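(* Let $s_1=\frac12(1+\log_q 2)$ (so $s_1\le 1$). As $g\to\infty$: (1) For every (arbitrarily small) $\varepsilon>0$ and every $s\in\bar X_\varepsilon$, $$\sum_{u\in\mathcal I_{g+1}}L(s,\chi_u)=2\alpha_g(s)q^{2g+1}+\begin{cases}O(g\,2^{g/2}q^{(2-s)g})&\text{if }\mathrm{Re}(s)<s_1,\\ O(g\,q^{3g/2})&\text{if }\mathrm{Re}(s)\ge s_1,\end{cases}$$ where $\alpha_g(\tfrac12)=\frac{\mathrm P(1)}{\zeta_A(2)}\big(g+1+\frac{2}{\log q}\frac{\mathrm P'}{\mathrm P}(1)\big)$, $\alpha_g(s)=\frac{\zeta_A(2s)}{\zeta_A(2)}\mathrm P(2s)$ for $\mathrm{Re}(s)\ge1$, and for $s\in X_\varepsilon$ $$\alpha_g(s)=\frac{\zeta_A(2s)}{\zeta_A(2)}\Big\{\mathrm P(2s)-q^{(1-2s)(g+1)}\mathrm P(2-2s)+\mathrm P(1)\big(q^{(1-2s)(g-[\frac{g-1}2])}-q^{(1-2s)([\frac g2]+1)}\big)\Big\}.$$ (2) For every (arbitrarily small) $\varepsilon>0$ and $\delta>0$, and every $s\in\bar X_\varepsilon$ with $|s-1|>\delta$ or $s=1$, $$\sum_{u\in\mathcal F_{g+1}}L(s,\chi_u)=\beta_g(s)q^{2g+2}+\begin{cases}O(2^{g/2}q^{(2-s)g})&\text{if }\mathrm{Re}(s)<s_1,\\ O(g\,q^{3g/2})&\text{if }\mathrm{Re}(s)\ge s_1,\end{cases}$$ where $\beta_g(\tfrac12)=\frac{\mathrm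 P(1)}{\zeta_A(2)}\big(g+1+\zeta_A(\tfrac12)+\frac{2}{\log q}\frac{\mathrm P'}{\mathrm P}(1)\big)$, $\beta_g(s)=\frac{\zeta_A(2s)}{\zeta_A(2)}\mathrm P(2s)$ for $\mathrm{Re}(s)\ge1$, and for $\mathrm{Re}(s)<1$, $s\neq\frac12$, $$\beta_g(s)=\frac{\zeta_A(2s)}{\zeta_A(2)}\Big\{\mathrm P(2s)-\mathrm P(1)q^{(1-2s)([\frac g2]+1)}+\tfrac{\zeta_A(2-s)}{\zeta_A(1+s)}q^{(1-2s)(g+1)}\big(\mathrm P(1)q^{(2s-1)([\frac{g-1}2]+1)}-\mathrm P(2-2s)\big)\Big\}-\mathrm P(1)q^{-gs}\Big(q^{[\frac g2]-s}+\tfrac{\zeta_A(2-s)}{\zeta_A(1+s)}q^{[\frac{g-1}2]}\Big).$$ (3) For every (arbitrarily small) $\varepsilon>0$ and every $s\in\bar X_\varepsilon$, $$\sum_{u\in\mathcal F'_{g+1}}L(s,\chi_u)=\gamma_g(s)q^{2g+2}+\begin{cases}O(2^{g/2}q^{(2-s)g})&\text{if }\mathrm{Re}(s)<s_1,\\ O(g\,q^{3g/2})&\text{if }\mathrm{Re}(s)\ge s_1,\end{cases}$$ where $\gamma_g(\tfrac12)=\frac{\mathrm P(1)}{\zeta_A(2)}\big(g+1+\frac{\zeta_A(0)}{\zeta_A(\frac12)}+\frac{2}{\log q}\frac{\mathrm P'}{\mathrm P}(1)\big)$, $\gamma_g(s)=\frac{\zeta_A(2s)}{\zeta_A(2)}\mathrm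 P(2s)$ for $\mathrm{Re}(s)\ge1$, and for $s\in X_\varepsilon$, with $\nu(s)=\frac{1+q^{-s}}{1+q^{s-1}}$, $$\gamma_g(s)=\frac{\zeta_A(2s)}{\zeta_A(2)}\Big\{\mathrm P(2s)-\mathrm P(1)q^{(1-2s)([\frac g2]+1)}+\nu(s)q^{(1-2s)(g+1)}\big(\mathrm P(1)q^{(2s-1)([\frac{g-1}2]+1)}-\mathrm P(2-2s)\big)\Big\}+(-1)^g\mathrm P(1)q^{-gs}\Big(q^{[\frac g2]-s}-\nu(s)q^{[\frac{g-1}2]}\Big).$$
   Context: Let $q$ be a power of $2$, $A=\mathbb F_q[T]$, $k=\mathbb F_q(T)$. $A^+$ is the set of monic polynomials, $A^+_n$ those of degree $n$; a ''prime'' $P$ is a monic irreducible polynomial; $|f|=q^{\deg f}$ for $f\ne0$. $\zeta_A(s)=\sum_{f\in A^+}|f|^{-s}=(1-q^{1-s})^{-1}$ (extended meromorphically). Fix $\xi\in\mathbb F_q$ not of the form $x^2+x$ with $x\in\mathbb F_q$. For a prime $P$, $\nu_P$ is the $P$-adic valuation. Let $\mathcal B$ be the set of monic $M\in A$ with $\nu_P(M)$ equal to $0$ or odd for every prime $P$; for $M\in\mathcal B$ and $P\mid M$ put $\ell_P=(\nu_P(M)+1)/2$, $\tilde M=\prod_{P\mid M}P^{\ell_P}$, and $\mathcal B_n=\{M\in\mathcal B:\deg\tilde M=n\}$. For $n\ge1$, $\mathcal F_n$ is the set of rational functions $u=\sum_{P\mid M}\sum_{i=1}^{\ell_P}A_{P,i}/P^{2i-1}$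 with $M\in\mathcal B_n$, $A_{P,i}\in A$, $\deg A_{P,i}<\deg P$, and $A_{P,\ell_P}\ne0$ for all $P\mid M$; $\mathcal F_0=\{0\}$; $\mathcal F'_n=\{u+\xi:u\in\mathcal F_n\}$. For $s\ge1$, $\mathcal G_s$ is the set of polynomials $\alpha+\sum_{i=1}^s\alpha_iT^{2i-1}$ with $\alpha\in\{0,\xi\}$, $\alpha_i\in\mathbb F_q$, $\alpha_s\ne0$. For $r\ge0,s\ge1$, $\mathcal I_{(r,s)}=\{u+F:u\in\mathcal F_r,F\in\mathcal G_s\}$ and $\mathcal I_n=\bigcup_{s=1}^n\mathcal I_{(n-s,s)}$. (Via $u\mapsto k(x_u)$, $x_u^2+x_u=u$, the sets $\mathcal I_{g+1},\mathcal F_{g+1},\mathcal F'_{g+1}$ parametrize the ramified imaginary, real, inert imaginary separable quadratic extensions of $k$ of genus $g$.) Quadratic symbol: for a prime $P$ and $u\in k$ whose (reduced) denominator is prime to $P$, $[u,P)=0$ if $X^2+X\equiv u\pmod P$ is solvable in $A$ and $1$ otherwise; for nonzero $N=c\prod P_i^{e_i}$ prime to the denominator of $u$, $[u,N)=\sum e_i[u,P_i)$. Set $\{\frac uN\}=(-1)^{[u,N)}$ if $N$ is prime to the denominator of $u$, and $0$ otherwise. $\chi_u(f)=\{\frac uf\}$ and $L(s,\chi_u)=\sum_{f\in A^+}\chi_u(f)|f|^{-s}$, a polynomial in $q^{-s}$. $\mathrm P(s)=\prod_P\big(1-\frac{1}{|P|^s(|P|+1)}\big)$ for $\mathrm{Re}(s)>0$,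 $\mathrm P'$ its derivative. For $\varepsilon>0$, $X_\varepsilon=\{s\in\mathbb C:\frac12\le\mathrm{Re}(s)<1,\ |s-\frac12|>\varepsilon\}$ and $\bar X_\varepsilon=\{\frac12\}\cup X_\varepsilon\cup\{s:\mathrm{Re}(s)\ge1\}$. $[x]$ is the integer part. *)

(* Defs.v *)
From HB Require Import structures.
From mathcomp Require Export all_boot all_order all_algebra.
From mathcomp Require Export all_classical all_reals all_analysis.
From mathcomp Require complex.

Set Implicit Arguments.
Unset Strict Implicit.
Unset Printing Implicit Defensive.

Export Order.TTheory GRing.Theory Num.Theory.
Export numFieldNormedType.Exports.
(* exported last, so that Re and Im are the real-valued projections of R[i] *)
Export complex.

Global Open Scope classical_set_scope.
Global Open Scope ring_scope.
Global Open Scope complex_scope.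

Notation ratfun F := {fraction {poly F}}.
Notation "p %:K" := (FracField.tofrac p) (at level 2, format "p %:K") : ring_scope.

Section FunctionField.
Variable F : finFieldType.
Implicit Types (P N M f : {poly F}) (u : ratfun F).

Definition monic_deg (n : nat) : set {poly F} :=
  [set f | f \is monic /\ size f = n.+1].

Definition primeA : set {poly F} :=
  [set P | P \is monic /\ irreducible_poly P].

Definition prime_divisors N : set {poly F} := [set P | primeA P /\ P %| N].

(* |f| = q ^ deg f, for f != 0 *)
Definition absA f : nat := (#|F| ^ (size f).-1)%N.

(* P-adic valuation of N, for P prime and N != 0: then P ^+ e %| N forces
   e <= deg N < size N *)
Definition valA P N : nat := \max_(e < size N | P ^+ e %| N) e.

Definition Bset : set {poly F} :=
  [set M | M \is monic /\
           forall P, primeA P -> valA P M = 0%N \/ odd (valA P M)].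

Definition ellA M P : nat := ((valA P M).+1)./2.

Definition tildeA M : {poly F} :=
  \big[*%R/1]_(P \in prime_divisors M) (P ^+ ellA M P).

Definition Bset_deg (n : nat) : set {poly F} :=
  [set M | Bset M /\ size (tildeA M) = n.+1].

Definition Fset (n : nat) : set (ratfun F) :=
  if n is 0 then [set 0] else
  [set u | exists M (a : {poly F} -> nat -> {poly F}),
    [/\ Bset_deg n M,
        forall P i, prime_divisors M P -> (1 <= i <= ellA M P)%N ->
          (size (a P i) < size P)%N,
        forall P, prime_divisors M P -> a P (ellA M P) != 0 &
        u = \sum_(P \in prime_divisors M)
              \sum_(1 <= i < (ellA M P).+1)
                 (a P i)%:K / (P ^+ (2 * i - 1))%:K]].

Definition Fset' (xi : F) (n : nat) : set (ratfun F) :=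
  [set u + (xi%:P)%:K | u in Fset n].

Definition Gset (xi : F) (s : nat) : set {poly F} :=
  [set f | exists (alpha : F) (a : nat -> F),
    [/\ alpha = 0 \/ alpha = xi, a s != 0 &
        f = alpha%:P + \sum_(1 <= i < s.+1) (a i)%:P * 'X^(2 * i - 1)]].

Definition Irs_set (xi : F) (r s : nat) : set (ratfun F) :=
  [set u | exists v f, [/\ Fset r v, Gset xi s f & u = v + f%:K]].

Definition Iset (xi : F) (n : nat) : set (ratfun F) :=
  \bigcup_(s in [set s | (1 <= s <= n)%N]) Irs_set xi (n - s) s.

Definition den_prime_to u N : Prop :=
  exists a b, [/\ b != 0, coprimep a b, u = a%:K / b%:K & coprimep b N].

(* x = 0 mod P in the localization of A at P *)
Definition eq0_mod P (x : ratfun F) : Prop :=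
  exists a b, ~~ (P %| b) /\ x = (P * a)%:K / b%:K.

Definition symbP u P : nat :=
  if `[< exists X : {poly F}, eq0_mod P ((X ^+ 2 + X)%:K - u) >] then 0%N
  else 1%N.

Definition symb u N : nat :=
  \big[addn/0%N]_(P \in prime_divisors N) (valA P N * symbP u P)%N.

Definition chi (C : pzRingType) u N : C :=
  if `[< den_prime_to u N >] then (-1) ^+ symb u N else 0.

End FunctionField.

Arguments monic_deg F n : clear implicits.
Arguments Fset F n : clear implicits.

Section Analytic.
Variables (R : realType) (F : finFieldType).
Implicit Types (s z : R[i]) (g n : nat).

(* R[i] has its norm topology under the alias R[i]^o *)

Definition cexp z : R[i] :=
  (expR (Re z) * cos (Im z)) +i* (expR (Re z) * sin (Im z)).

(* n ^ z = exp (z log n), for n > 0 *)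
Definition npow n z : R[i] := cexp (z * (ln n%:R)%:C).

Definition qpow z : R[i] := npow #|F| z.

Definition zetaA s : R[i] := (1 - qpow (1 - s))^-1.

(* Summed by increasing degree: for Re s <= 1 the series over f only converges
   when its terms are grouped by degree, the groups being eventually zero. *)
Definition Lfun s (u : ratfun F) : R[i] :=
  limn (series (fun n =>
    \sum_(f \in monic_deg F n) (chi R[i] u f * npow (absA f) (- s))
      : R[i]^o)).

Definition eulerP s : R[i] :=
  limn (fun n =>
    \big[*%R/1]_(P \in [set P : {poly F} | primeA P /\ (size P <= n)%N])
      (1 - (npow (absA P) s * ((absA P)%:R + 1))^-1) : R[i]^o).

Definition dlog_eulerP1 : R[i] := derive1 (eulerP : R[i]^o -> R[i]^o) 1 / eulerP 1.

Definition half : R[i] := 2^-1.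

Definition logq : R[i] := (ln (#|F|%:R : R))%:C.

Definition s1 : R := (1 + ln 2 / ln #|F|%:R) / 2.

Definition Xset (eps : R) : set R[i] :=
  [set s | 2^-1 <= Re s < 1 /\ eps%:C < `|s - half|].

Definition Xbar (eps : R) : set R[i] :=
  [set half] `|` Xset eps `|` [set s | 1 <= Re s].

(* The formulas below contain the factor zetaA (2 * s), whose poles
   s = 1/2 + pi i m / log q are removable singularities of the whole
   expression; there the value of the expression is its limit. *)
Definition meroval (f : R[i] -> R[i]) s : R[i] :=
  if qpow (1 - 2 * s) == 1 then lim ((f z : R[i]^o) @[z --> (s : R[i]^o)^']) else f s.

(* [g/2] is g./2 and, for g >= 1, [(g-1)/2] is g.-1./2. *)

Definition alpha_X g s : R[i] :=
  zetaA (2 * s) / zetaA 2 *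
  (eulerP (2 * s) - qpow ((1 - 2 * s) * g.+1%:R) * eulerP (2 - 2 * s)
   + eulerP 1 * (qpow ((1 - 2 * s) * (g%:R - g.-1./2%:R))
                 - qpow ((1 - 2 * s) * g./2.+1%:R))).

Definition alphag g s : R[i] :=
  if s == half then
    eulerP 1 / zetaA 2 * (g.+1%:R + 2 / logq * dlog_eulerP1)
  else if 1 <= Re s then zetaA (2 * s) / zetaA 2 * eulerP (2 * s)
  else meroval (alpha_X g) s.

Definition beta_X g s : R[i] :=
  let eta := zetaA (2 - s) / zetaA (1 + s) in
  zetaA (2 * s) / zetaA 2 *
  (eulerP (2 * s) - eulerP 1 * qpow ((1 - 2 * s) * g./2.+1%:R)
   + eta * qpow ((1 - 2 * s) * g.+1%:R)
     * (eulerP 1 * qpow ((2 * s - 1) * g.-1./2.+1%:R) - eulerP (2 - 2 * s)))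
  - eulerP 1 * qpow (- (g%:R * s))
    * (qpow (g./2%:R - s) + eta * qpow g.-1./2%:R).

Definition betag g s : R[i] :=
  if s == half then
    eulerP 1 / zetaA 2 * (g.+1%:R + zetaA half + 2 / logq * dlog_eulerP1)
  else if 1 <= Re s then zetaA (2 * s) / zetaA 2 * eulerP (2 * s)
  else meroval (beta_X g) s.

Definition nu s : R[i] := (1 + qpow (- s)) / (1 + qpow (s - 1)).

Definition gamma_X g s : R[i] :=
  zetaA (2 * s) / zetaA 2 *
  (eulerP (2 * s) - eulerP 1 * qpow ((1 - 2 * s) * g./2.+1%:R)
   + nu s * qpow ((1 - 2 * s) * g.+1%:R)
     * (eulerP 1 * qpow ((2 * s - 1) * g.-1./2.+1%:R) - eulerP (2 - 2 * s)))
  + (-1) ^+ g * eulerP 1 * qpow (- (g%:R * s))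
    * (qpow (g./2%:R - s) - nu s * qpow g.-1./2%:R).

Definition gammag g s : R[i] :=
  if s == half then
    eulerP 1 / zetaA 2
    * (g.+1%:R + zetaA 0 / zetaA half + 2 / logq * dlog_eulerP1)
  else if 1 <= Re s then zetaA (2 * s) / zetaA 2 * eulerP (2 * s)
  else meroval (gamma_X g) s.

End Analytic.

(* Main.v *)
Require Import Defs.
From mathcomp Require Import zify ring lra.

Set Implicit Arguments.
Unset Strict Implicit.
Unset Printing Implicit Defensive.

(** Let [psi] be the additive character of [F] trivial exactly on
    [{x^2 + x}]. For monic [f] prime to the denominator of [u], with [U = u]
    modulo [f], one has [chi_u(f) = psi(res(U f'/f))], where [res] is the
    coefficient of [1/T]. When [u = B/D^2] is proper, the sum of the residues of
    [u f'/f] vanishes and this becomes a character of [f] modulo [D^2]. Its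
    Gauss sum is [|D|], which gives the functional equation of [L(s, chi_u)];
    a polynomial part of [u] is handled in the same way at infinity, by
    reversing coefficients. So only the coefficients of degree [m <= g] matter.

    Averaging [chi_u(f)] over the digits of [u] factors over the primes. In
    characteristic 2 the derivative [f'] is a square [b^2]. If [b != 0], i.e.
    [f] is not a square, the average over [deg D = n] is at most
    [2^(deg b) q^n]; summing over [f] gives the error terms. If [f = l^2], the
    average is a sum of the totient [phi(D)] over [D] prime to [l]; summing over
    [deg l = k] gives [q^(2n) (1 - 1/q) c_k] up to [O((k+1) q^(n+k))], where
    [c_k = sum_(b <= k) p_b q^(k-b)] and [p_b] are the coefficients of the Euler
    product: [P(s) = Q(q^(1-s))] with [Q(x) = sum_b (p_b/q^b) x^b].

    The partial sums of the [p_b] are averages of [prod_(P | e) 1/(|P|+1)] over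
    [deg e = b], hence [O(q^(-b/2))]; so [Q] has radius of convergence larger
    than [q], and [Q(q) = 0]. Put [y = q^(1-2s)]. The truncated sums of the main
    terms are expressed by [Q(1) (1 + y + ... + y^(N-1)) - W(y)], where
    [W(x) = (Q(1) - Q(x))/(1 - x)] is again a convergent power series. These
    expressions have no pole at [y = 1], so all bounds are uniform in [s] and
    the values at [s = 1/2] are obtained by continuity. *)

(** Characteristic 2 helps because squares have derivative 0 and, over a squared denominator,
    residue 0. So derivation passes to the quotient modulo [D^2]; and as the odd pole orders leave
    exactly one factor [P] in [B] for each [P | D], the character becomes additive on [1 + D A],
    which gives the Gauss sum its exact value. The families differ at infinity. A pole there makes
    the functional equation hold coefficient by coefficient. Without one, the character is even and
    the equation only relates partial sums of coefficients; the upper half of the L-polynomial is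
    recovered by Abel summation, which produces the extra factors and boundary terms of beta and
    gamma. Adding [xi] amounts to [z -> -z], so beta and gamma are one computation. The reflected
    sums are power series in [1/y], controlled for [|1/y| <= q], that is [Re s <= 1]; beyond that
    line they are as small as the error, whence the separate formula there. In the errors [2^(m/2)]
    enters as [d^m] with [d^2 = 2], and [s1] is where [q d |z|] passes [q^(1/2)]. *)

Lemma big_seq_reindex (R : Type) (idx : R) (op : Monoid.com_law idx)
    (T T' : eqType) (r : seq T) (r' : seq T') (h : T -> T') (h' : T' -> T)
    (G : T' -> R) :
  uniq r -> uniq r' ->
  (forall x, x \in r -> h x \in r' /\ h' (h x) = x) ->
  (forall y, y \in r' -> h' y \in r /\ h (h' y) = y) ->
  \big[op/idx]_(y <- r') G y = \big[op/idx]_(x <- r) G (h x).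
Proof.
move=> ur ur' hr hr'; rewrite -(big_map h xpredT G).
apply: perm_big; apply: uniq_perm => //.
  rewrite map_inj_in_uniq // => x y xr yr e.
  by rewrite -(hr x xr).2 -(hr y yr).2 e.
move=> y; apply/idP/mapP => [yr|[x xr ->]]; last exact: (hr x xr).1.
by exists (h' y); [exact: (hr' y yr).1|rewrite (hr' y yr).2].
Qed.

(** * Monic polynomials, primes and valuations *)

Section Enum.
Variable F : finFieldType.
Implicit Types (P Q D E N M G f p a b : {poly F}) (n k : nat).

(** Coefficient vectors give a list without repetition of the polynomials of degree below [n], zero
    included: a vector space, to which orthogonality of characters applies. *)
Definition polys n : seq {poly F} := [seq rVpoly v | v <- enum 'rV[F]_n].

Lemma mem_polys n p : (p \in polys n) = (size p <= n)%N.
Proof.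
apply/mapP/idP => [[v _ ->]|hp]; first exact: size_poly.
by exists (poly_rV p); rewrite ?mem_enum // poly_rV_K.
Qed.

Lemma polys_uniq n : uniq (polys n).
Proof. by rewrite map_inj_uniq ?enum_uniq //; exact: can_inj rVpolyK. Qed.

Lemma size_polys n : size (polys n) = (#|F| ^ n)%N.
Proof. by rewrite size_map -cardE card_mx mul1n. Qed.

Definition monics n : seq {poly F} := [seq 'X^n + p | p <- polys n].

Lemma mem_monics n p : (p \in monics n) = (p \is monic) && (size p == n.+1).
Proof.
apply/mapP/andP => [[r]|[pm /eqP sp]].
  rewrite mem_polys => hr ->.
  have h : (size r < size ('X^n : {poly F}))%N by rewrite size_polyXn ltnS.
  by rewrite monicE lead_coefDl // lead_coefXn size_polyDl // size_polyXn.
exists (p - 'X^n); last by ring.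
rewrite mem_polys; apply/leq_sizeP => j; rewrite leq_eqVlt => /orP[/eqP<-|nj].
  by rewrite coefB coefXn eqxx -(monicP pm) /lead_coef sp subrr.
by rewrite coefB coefXn gtn_eqF // nth_default ?sp // subr0.
Qed.

Lemma monics_uniq n : uniq (monics n).
Proof. by rewrite map_inj_uniq ?polys_uniq //; exact: addrI. Qed.

Lemma size_monics n : size (monics n) = (#|F| ^ n)%N.
Proof. by rewrite size_map size_polys. Qed.

Lemma monicsP n p : reflect (monic_deg F n p) (p \in monics n).
Proof.
rewrite mem_monics; apply: (iffP andP) => [[? /eqP]|[? ?]]; split=> //.
exact/eqP.
Qed.

Lemma fsbig_monics (R : Type) (idx : R) (op : Monoid.com_law idx) n
    (G : {poly F} -> R) :
  \big[op/idx]_(f \in monic_deg F n) G f = \big[op/idx]_(f <- monics n) G f.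
Proof.
have -> : monic_deg F n = [set` monics n].
  by apply/seteqP; split=> f /= /monicsP.
by rewrite -fsbig_seq // monics_uniq.
Qed.

Lemma monics_monic n p : p \in monics n -> p \is monic.
Proof. by rewrite mem_monics => /andP[]. Qed.

Lemma monics_size n p : p \in monics n -> size p = n.+1.
Proof. by rewrite mem_monics => /andP[_ /eqP]. Qed.

Lemma monics_deg n p : p \in monics n -> (size p).-1 = n.
Proof. by move/monics_size->. Qed.

Lemma mem_monics_deg p : p \is monic -> p \in monics (size p).-1.
Proof.
move=> pm; have s0 : (0 < size p)%N by rewrite size_poly_gt0 monic_neq0.
by rewrite mem_monics pm prednK /=.
Qed.

Lemma monics0 : monics 0 = [:: 1].
Proof.
have := size_monics 0; have := @mem_monics 0.
case: (monics 0) => [|x [|]] //= h _.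
by have := h 1; rewrite monic1 size_poly1 inE => /eqP->.
Qed.

Lemma primeA_neq0 P : primeA P -> P != 0.
Proof. by case=> /monic_neq0. Qed.

Lemma primeA_size P : primeA P -> (1 < size P)%N.
Proof. by case=> _ []. Qed.

Lemma primeA_coprime P N : primeA P -> coprimep P N = ~~ (P %| N).
Proof.
move=> Pp; apply/idP/idP => [cP|].
  apply: contraL cP => dP; apply: contraL (primeA_size Pp) => /(coprimep_dvdl dP).
  by rewrite coprimepp => /eqP->.
apply: contraR; rewrite /coprimep => h.
have [_ /(_ _ h (dvdp_gcdl P N)) e] := Pp.2.
by rewrite -(eqp_dvdl _ e) dvdp_gcdr.
Qed.

Lemma primeA_dvdM P a b : primeA P -> (P %| a * b) = (P %| a) || (P %| b).
Proof.
move=> Pp; apply/idP/orP => [h|[h|h]]; last 2 first.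
- exact: dvdp_mulr.
- exact: dvdp_mull.
have [?|na] := boolP (P %| a); [by left|right].
by rewrite -primeA_coprime // in na; rewrite -(Gauss_dvdpr _ na).
Qed.

Lemma eqp_monic_eq P Q : P \is monic -> Q \is monic -> P %= Q -> P = Q.
Proof. by move=> Pm Qm; rewrite eqp_monic // => /eqP. Qed.

Lemma primeA_dvd P Q : primeA P -> primeA Q -> P %| Q -> P = Q.
Proof.
move=> Pp Qp dPQ; apply: eqp_monic_eq; [exact: Pp.1|exact: Qp.1|].
by apply: Qp.2.2 => //; rewrite gtn_eqF // primeA_size.
Qed.

Lemma primeA_dvdX P a e : primeA P -> P %| a ^+ e -> P %| a.
Proof.
move=> Pp; elim: e => [|e IH]; last by rewrite exprS primeA_dvdM // => /orP[].
rewrite expr0 => /dvdp_leq; rewrite oner_eq0 size_poly1 leqNgt primeA_size //.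
by move=> /(_ isT).
Qed.

Lemma primeA_not_dvd1 P : primeA P -> (P %| 1) = false.
Proof. by move=> Pp; rewrite dvdp1; apply/negbTE; rewrite gtn_eqF ?primeA_size. Qed.

Lemma prime_divisor_exists D : (1 < size D)%N -> exists2 P : {poly F}, primeA P & P %| D.
Proof.
have [m] := ubnP (size D); elim: m D => // m IH D; rewrite ltnS => sm s1.
have D0 : D != 0 by rewrite -size_poly_gt0; lia.
have l0 : (lead_coef D)^-1 != 0 by rewrite invr_eq0 lead_coef_eq0.
have [irr|nirr] := pselect (irreducible_poly D).
  exists ((lead_coef D)^-1 *: D).
    split; first by rewrite monicE lead_coefZ mulVf // lead_coef_eq0.
    split; first by rewrite size_scale.
    move=> p sp; rewrite dvdpZr // => /(irr.2 _ sp) /eqp_trans; apply.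
    by rewrite eqp_sym eqp_scale.
  by rewrite dvdpZl.
have [E [sE dE nE]] : exists E, [/\ size E != 1%N, E %| D & ~~ (E %= D)].
  apply: contrapT => h; apply: nirr; split=> // p sp dp.
  by apply: contrapT => /negP ne; apply: h; exists p.
have E0 : E != 0 by apply: contraNneq D0 => E0; move: dE; rewrite E0 dvd0p.
have lE : (size E < size D)%N.
  rewrite ltn_neqAle (dvdp_leq D0 dE) andbT.
  by apply: contra nE; rewrite dvdp_size_eqp.
have sE1 : (1 < size E)%N.
  by move: (E0) sE; rewrite -size_poly_gt0; case: (size E) => [|[]].
have [P Pp dP] := IH E (leq_trans lE sm) sE1.
by exists P => //; exact: dvdp_trans dE.
Qed.

Lemma monic_size1 D : D \is monic -> size D = 1%N -> D = 1.
Proof.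
move=> Dm /eqP /size_poly1P [c c0 e]; move: Dm; rewrite e monicE lead_coefC.
by move/eqP->.
Qed.

Lemma monic_divisor D E : D \is monic -> E \is monic -> E %| D ->
  exists2 G : {poly F}, G \is monic & D = E * G.
Proof.
move=> Dm Em /dvdpP [G e]; exists G; last by rewrite mulrC.
by move: Dm; rewrite e monicMr.
Qed.

Lemma size_monicM D E : D \is monic -> E \is monic ->
  (size (D * E)).-1 = ((size D).-1 + (size E).-1)%N.
Proof.
move=> Dm Em; rewrite size_Mmonic ?monic_neq0 //.
have := monic_neq0 Dm; have := monic_neq0 Em; rewrite -!size_poly_gt0; lia.
Qed.

(** Peels off one prime factor at a time; this is the induction used for the symbol and for counting
    divisors. *)
Lemma monic_ind (X : {poly F} -> Prop) : X 1 ->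
  (forall P D, primeA P -> D \is monic -> X D -> X (P * D)) ->
  forall D, D \is monic -> X D.
Proof.
move=> X1 XM D; have [m] := ubnP (size D); elim: m D => // m IH D.
rewrite ltnS => sm Dm.
have : (0 < size D)%N by rewrite size_poly_gt0 monic_neq0.
rewrite leq_eqVlt => /orP[/eqP e|s1]; first by rewrite (monic_size1 Dm (esym e)).
have [P Pp dP] := prime_divisor_exists s1.
have [G Gm e] := monic_divisor Dm Pp.1 dP.
rewrite e; apply: XM => //; apply: IH => //; apply: leq_trans sm.
have := size_monicM Pp.1 Gm; rewrite -e; have := primeA_size Pp; lia.
Qed.

Lemma valP P N e : primeA P -> N != 0 -> (P ^+ e %| N) = (e <= valA P N)%N.
Proof.
move=> Pp N0.
(* Ensures that the range [e < size N] in [valA] misses no exponent. *)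
have bnd k : P ^+ k %| N -> (k < size N)%N.
  move=> /(dvdp_leq N0) => h.
  have s0 : (0 < size (P ^+ k))%N by rewrite size_poly_gt0 expf_neq0 // primeA_neq0.
  apply: leq_trans h; rewrite -(prednK s0) size_exp ltnS leq_pmull //.
  by have := primeA_size Pp; case: (size P) => [|[]].
apply/idP/idP => [d|].
  have := @leq_bigmax_cond _ (fun e : 'I_(size N) => P ^+ e %| N)
    (fun e => nat_of_ord e) (Ordinal (bnd _ d)).
  exact.
have [e0|ep] := posnP e; first by rewrite e0 expr0 dvd1p.
have H : P ^+ valA P N %| N.
  rewrite /valA; apply: (big_ind (fun m => P ^+ m %| N)) => //.
    by rewrite expr0 dvd1p.
  by move=> x y hx hy; rewrite /maxn; case: ifP.
by move=> le; apply: dvdp_trans H; exact: dvdp_exp2l.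
Qed.

Lemma val_dvd P N : primeA P -> N != 0 -> (P %| N) = (0 < valA P N)%N.
Proof. by move=> Pp N0; rewrite -valP // expr1. Qed.

Lemma valE P N e : primeA P -> N != 0 -> P ^+ e %| N -> ~~ (P ^+ e.+1 %| N) ->
  valA P N = e.
Proof. by move=> Pp N0; rewrite !valP //; lia. Qed.

Lemma val_decomp P N : primeA P -> N != 0 ->
  exists2 N1 : {poly F}, N = P ^+ valA P N * N1 & ~~ (P %| N1).
Proof.
move=> Pp N0; have : P ^+ valA P N %| N by rewrite valP.
move=> /dvdpP [N1 e]; exists N1; first by rewrite mulrC.
apply/negP => /dvdpP [N2 e2]; have : P ^+ (valA P N).+1 %| N.
  by rewrite {2}e e2 -mulrA -exprS dvdp_mull.
by rewrite valP // ltnn.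
Qed.

Lemma valM P N M : primeA P -> N != 0 -> M != 0 ->
  valA P (N * M) = (valA P N + valA P M)%N.
Proof.
move=> Pp N0 M0; have [N1 eN dN] := val_decomp Pp N0.
have [M1 eM dM] := val_decomp Pp M0.
have e : N * M = P ^+ (valA P N + valA P M) * (N1 * M1).
  by rewrite {1}eN {1}eM exprD; ring.
apply: valE => //; first by rewrite mulf_neq0.
  by rewrite e dvdp_mulr.
have P0 : P ^+ (valA P N + valA P M) != 0 by rewrite expf_neq0 // primeA_neq0.
rewrite e exprSr (dvdp_mul2l _ _ P0) primeA_dvdM //.
by rewrite negb_or dN.
Qed.

Lemma val1 P : primeA P -> valA P 1 = 0%N.
Proof.
move=> Pp; apply/eqP; rewrite -leqn0 leqNgt -val_dvd ?oner_neq0 //.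
by rewrite primeA_not_dvd1.
Qed.

Lemma val_ndvd P N : primeA P -> N != 0 -> ~~ (P %| N) -> valA P N = 0%N.
Proof. by move=> Pp N0; rewrite val_dvd //; lia. Qed.

Lemma valX P N e : primeA P -> N != 0 -> valA P (N ^+ e) = (e * valA P N)%N.
Proof.
move=> Pp N0; elim: e => [|e IH]; first by rewrite expr0 val1.
by rewrite exprS valM ?expf_neq0 // IH mulSn.
Qed.

Lemma val_self P : primeA P -> valA P P = 1%N.
Proof.
move=> Pp; have P0 := primeA_neq0 Pp; apply: valE => //.
rewrite expr2 -{3}[P]mulr1 dvdp_mul2l // primeA_not_dvd1 //.
Qed.

Lemma val_prime P Q : primeA P -> primeA Q -> valA P Q = (P == Q).
Proof.
move=> Pp Qp; case: eqP => [<-|ne]; first exact: val_self.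
by apply: val_ndvd => //; [exact: primeA_neq0|apply/negP => /(primeA_dvd Pp Qp)].
Qed.

Lemma dvd_val D N : D \is monic -> N != 0 ->
  (forall P, primeA P -> (valA P D <= valA P N)%N) -> D %| N.
Proof.
move=> Dm; elim/monic_ind: Dm N => [|P D' Pp Dm IH] N N0 h; first exact: dvd1p.
have D0 := monic_neq0 Dm; have P0 := primeA_neq0 Pp.
have : P %| N by rewrite val_dvd //; have := h P Pp; rewrite valM // val_self //; lia.
move=> /dvdpP [N1 e]; rewrite e mulrC dvdp_mul2r //.
have N10 : N1 != 0 by apply: contraNneq N0 => N10; rewrite e N10 mul0r.
apply: IH => // Q Qp; have := h Q Qp; rewrite e !valM // ; lia.
Qed.

Lemma eq_val D E : D \is monic -> E \is monic ->
  (forall P, primeA P -> valA P D = valA P E) -> D = E.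
Proof.
move=> Dm Em h; apply: eqp_monic_eq => //; rewrite /eqp.
by rewrite !dvd_val ?monic_neq0 // => P Pp; rewrite h.
Qed.

Lemma val_prod P (r : seq {poly F}) (G : {poly F} -> {poly F}) :
  primeA P -> (forall Q, Q \in r -> G Q != 0) ->
  valA P (\prod_(Q <- r) G Q) = \sum_(Q <- r) valA P (G Q) :> nat.
Proof.
move=> Pp; elim: r => [|Q r IH] h; first by rewrite !big_nil val1.
rewrite !big_cons valM ?IH //.
- by move=> X Xr; apply: h; rewrite inE Xr orbT.
- by apply: h; rewrite mem_head.
- rewrite prodf_seq_neq0; apply/allP => X Xr /=; apply: h.
  by rewrite inE Xr orbT.
Qed.

(** One finite list containing every prime divisor of every polynomial of degree at most [n].
    Products over varying sets of divisors are all taken over it, the other primes contributing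
    trivially. *)
Definition prs n : seq {poly F} :=
  [seq P <- flatten [seq monics i | i <- iota 0%N n.+1] | `[< primeA P >]].

Lemma mem_flatten_monics (r : seq nat) p :
  (p \in flatten [seq monics i | i <- r]) = (p \is monic) && ((size p).-1 \in r).
Proof.
elim: r => [|i r IH]; first by rewrite andbF.
rewrite /= mem_cat IH inE mem_monics -andb_orr; have [pm|//] := boolP (p \is monic).
have s0 : (0 < size p)%N by rewrite size_poly_gt0 monic_neq0.
by rewrite -{1}(prednK s0) eqSS.
Qed.

Lemma mem_prs n P : P \in prs n <-> primeA P /\ (size P <= n.+1)%N.
Proof.
rewrite mem_filter mem_flatten_monics mem_iota add0n ltnS; split.
  move=> /and3P[/asboolP Pp _ h]; split=> //; have := primeA_size Pp.
  by case: (size P) h.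
move=> [Pp sP]; apply/and3P; split; [exact/asboolP|exact: Pp.1|].
by have := primeA_size Pp; case: (size P) sP.
Qed.

Lemma uniq_flatten_monics (r : seq nat) : uniq r ->
  uniq (flatten [seq monics i | i <- r]).
Proof.
elim: r => //= i r IH /andP[ir ur]; rewrite cat_uniq monics_uniq IH // andbT /=.
apply/hasPn => p; rewrite mem_flatten_monics => /andP[_ jr].
by apply: contra ir => /= /monics_deg <-.
Qed.

Lemma prs_uniq n : uniq (prs n).
Proof. by rewrite filter_uniq // uniq_flatten_monics // iota_uniq. Qed.

Lemma prs_prime n P : P \in prs n -> primeA P.
Proof. by move/mem_prs => []. Qed.

Lemma prs_dvd n P D : primeA P -> D != 0 -> (size D <= n.+1)%N -> P %| D ->
  P \in prs n.
Proof.
move=> Pp D0 sD dP; apply/mem_prs; split=> //.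
by apply: leq_trans sD; exact: dvdp_leq.
Qed.

Lemma val_prodX (r : seq {poly F}) P (e : {poly F} -> nat) : primeA P ->
  uniq r -> (forall Q, Q \in r -> primeA Q) ->
  valA P (\prod_(Q <- r) Q ^+ e Q) = if P \in r then e P else 0%N.
Proof.
move=> Pp ur pr; rewrite val_prod //; last first.
  by move=> Q /pr Qp; rewrite expf_neq0 // primeA_neq0.
rewrite big_seq (eq_bigr (fun Q => (P == Q) * e Q)%N); last first.
  move=> Q Qr; rewrite valX ?val_prime ?primeA_neq0 //; try exact: pr.
  by rewrite mulnC.
rewrite -big_seq; case: ifPn => Pr; last first.
  rewrite big_seq big1 // => Q Qr; case: eqP => // e0.
  by move: Pr; rewrite e0 Qr.
rewrite (bigD1_seq P) //= eqxx mul1n big1 ?addr0 // => Q.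
by rewrite eq_sym => /negbTE->.
Qed.

Lemma prime_prod_monic (r : seq {poly F}) (e : {poly F} -> nat) :
  (forall Q, Q \in r -> primeA Q) -> \prod_(Q <- r) Q ^+ e Q \is monic.
Proof.
move=> pr; rewrite big_seq; apply: monic_prod => Q /pr [Qm _].
exact: monic_exp.
Qed.

Lemma factorization n D : D \is monic -> (size D <= n.+1)%N ->
  D = \prod_(P <- prs n) P ^+ valA P D.
Proof.
move=> Dm sD; apply: eq_val => //.
  by apply: prime_prod_monic => Q; exact: prs_prime.
move=> P Pp; rewrite val_prodX ?prs_uniq //; last by move=> Q; exact: prs_prime.
case: ifPn => // Pn; apply: val_ndvd => //; first exact: monic_neq0.
apply/negP => d; move/negP: Pn; apply; apply: prs_dvd d => //.
exact: monic_neq0.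
Qed.

End Enum.

(** A kernel of at most two elements gives [#|T| <= 2 * #|H|] for the image [H]. If [x], [y] and
    [x - y] all missed [H], the cosets [H], [x + H], [y + H] would be disjoint, which is too many
    elements. It is applied to the Artin-Schreier map on [F] and on [A/Q]. *)
Lemma additive_image_index2 (T : finZmodType) (phi : T -> T) (k : T) :
  {morph phi : x y / x - y} -> (forall x, phi x = 0 -> x = 0 \/ x = k) ->
  forall x y, (forall z, phi z <> x) -> (forall z, phi z <> y) ->
  exists z, phi z = x - y.
Proof.
move=> phiB ker x y hx hy; apply: contrapT => hxy.
have phi0 : phi 0 = 0 by rewrite -[X in phi X](subrr 0) phiB subrr.
have phiN z : phi (- z) = - phi z by rewrite -sub0r phiB phi0 sub0r.
have phiD z t : phi (z + t) = phi z + phi t by rewrite -[t]opprK phiB !phiN opprK.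
pose H := (phi @: [set: T])%SET.
have HP z : reflect (exists t, phi t = z) (z \in H).
  by apply: (iffP imsetP) => [[t _ ->]|[t <-]]; exists t.
have cT : (#|T| <= 2 * #|H|)%N.
  have -> : #|T| = (\sum_(z : T) 1)%N by rewrite sum1_card.
  rewrite (partition_big phi (mem H)) /=; last by move=> z _; apply/HP; exists z.
  rewrite [leqRHS]mulnC -sum_nat_const; apply: leq_sum => h /HP [z0 <-].
  rewrite sum1dep_card; apply: (@leq_trans #|[set z0; z0 + k]%SET|).
    apply/subset_leq_card/fintype.subsetP => z; rewrite !inE => /eqP e.
    have [|e0|ek] := ker (z - z0); first by rewrite phiB e subrr.
    - by rewrite -(subrK z0 z) e0 add0r eqxx.
    - by rewrite -(subrK z0 z) ek addrC eqxx orbT.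
  by rewrite cards2; case: (_ == _).
have H0 : (0 < #|H|)%N by apply/card_gt0P; exists 0; apply/HP; exists 0.
pose Hx : {set T} := [set x + h | h in H]%SET.
pose Hy : {set T} := [set y + h | h in H]%SET.
have cx : #|Hx| = #|H| by apply: card_imset; exact: addrI.
have cy : #|Hy| = #|H| by apply: card_imset; exact: addrI.
have d1 : (H :&: Hx)%SET = finset.set0.
  apply/finset.setP => z; rewrite finset.in_setI finset.in_set0; apply/negP.
  move=> /andP[/HP [t et] /imsetP [h /HP [s <-] e]].
  by apply: (hx (t - s)); rewrite phiB et e addrK.
have d2 : (H :&: Hy)%SET = finset.set0.
  apply/finset.setP => z; rewrite finset.in_setI finset.in_set0; apply/negP.
  move=> /andP[/HP [t et] /imsetP [h /HP [s <-] e]].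
  by apply: (hy (t - s)); rewrite phiB et e addrK.
have d3 : (Hx :&: Hy)%SET = finset.set0.
  apply/finset.setP => z; rewrite finset.in_setI finset.in_set0; apply/negP.
  move=> /andP[/imsetP [h' /HP [t <-] ->] /imsetP [h /HP [s <-] e]].
  apply: hxy; exists (s - t); rewrite phiB.
  by rewrite -(addrK (phi t) x) e addrAC [y + _]addrC addrK.
have := max_card (mem (H :|: Hx :|: Hy)%SET); rewrite leqNgt => /negP; apply.
apply: leq_ltn_trans cT _.
have -> : #|(H :|: Hx :|: Hy)%SET| = (3 * #|H|)%N.
  rewrite !cardsU finset.setIUl d2 d3 d1 finset.setU0 finset.cards0 cx cy.
  by move: #|H| => m; lia.
by rewrite ltn_pmul2r.
Qed.

(** * Residues and the quadratic symbol *)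

Section Residue.
Variable F : finFieldType.
Implicit Types (a b c f p r P Q U : {poly F}).

(* For monic [b], the coefficient of [1/T] in the expansion of [a/b] at infinity. *)
Definition res a b : F := (a %% b)`_(size b).-2.

Lemma resD a a' b : res (a + a') b = res a b + res a' b.
Proof. by rewrite /res modpD coefD. Qed.

Lemma resZ (x : F) a b : res (x *: a) b = x * res a b.
Proof. by rewrite /res modpZl coefZ. Qed.

Lemma res_mod a b : res (a %% b) b = res a b.
Proof. by rewrite {2}(divp_eq a b) /res modpD modp_mull add0r. Qed.

Lemma res_dvd a b : b %| a -> res a b = 0.
Proof. by rewrite /res /dvdp => /eqP ->; rewrite coef0. Qed.

Lemma res0 b : res 0 b = 0.
Proof. by rewrite res_dvd // dvdp0. Qed.

Lemma res_eqmod a a' b : b %| a - a' -> res a b = res a' b.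
Proof.
by move=> h; rewrite -[a](subrK a') resD (res_dvd h) add0r.
Qed.

Lemma res1 a : res a 1 = 0.
Proof. by rewrite res_dvd // dvd1p. Qed.

(** A fraction of degree at most -2 has no term in [1/T]; every vanishing of a sum of residues comes
    down to this. *)
Lemma res_small a b : ((size a).+1 < size b)%N -> res a b = 0.
Proof.
move=> h; rewrite /res modp_small; last exact: ltnW.
by rewrite nth_default //; case: (size b) h => [|[]].
Qed.

Lemma coef_top_monicM r c d : c \is monic -> (size r <= d.+1)%N ->
  (r * c)`_(d + (size c).-1) = r`_d.
Proof.
move=> cm sr; rewrite coefM.
have lt : (d < (d + (size c).-1).+1)%N by rewrite ltnS leq_addr.
rewrite (bigD1 (Ordinal lt)) //= addKn.
rewrite -/(lead_coef c) (monicP cm) mulr1 big1 ?addr0 // => i /negP ne.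
have [le|lt'] := leqP d.+1 i; first by rewrite nth_default ?mul0r // (leq_trans sr).
rewrite [c`_ _]nth_default ?mulr0 //.
have : (i != d :> nat) by apply/negP => /eqP e; apply: ne; apply/eqP/val_inj.
have c0 : (0 < size c)%N by rewrite size_poly_gt0 monic_neq0.
move: lt' c0; move: (size c) (nat_of_ord i) => m j; lia.
Qed.

(** The residue depends only on the fraction: the remainder is multiplied by the monic [c], and its
    relevant coefficient moves up by the degree of [c] unchanged. *)
Lemma resM a b c : b \is monic -> c \is monic -> res (a * c) (b * c) = res a b.
Proof.
move=> bm cm; have b0 := monic_neq0 bm; have c0 := monic_neq0 cm.
rewrite /res; set r := a %% b.
have sr : (size r < size b)%N by rewrite ltn_modp.
have -> : (a * c) %% (b * c) = r * c.
  rewrite {1}(divp_eq a b) mulrDl -mulrA modp_addl_mul_small //.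
  rewrite -/r; have [->|r0] := eqVneq r 0.
    by rewrite mul0r size_poly0 size_poly_gt0 mulf_neq0.
  rewrite !size_mul //; move: c0; rewrite -size_poly_gt0; move: sr.
  by move: (size r) (size b) (size c) => i j k; lia.
have [b1|b1] := leqP (size b) 1.
  have r0 : r = 0 by apply/eqP; rewrite -size_poly_leq0; rewrite -ltnS (leq_trans sr).
  by rewrite r0 mul0r !coef0.
have -> : (size (b * c)).-2 = ((size b).-2 + (size c).-1)%N.
  rewrite size_mul //; move: b1 c0; rewrite -size_poly_gt0.
  by move: (size b) (size c) => j k; lia.
by rewrite coef_top_monicM // prednK ?ltn_predRL //; move: sr b1; case: (size b) => [|[|]].
Qed.

Lemma res_addfrac a b a' b' : b \is monic -> b' \is monic ->
  res (a * b' + a' * b) (b * b') = res a b + res a' b'.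
Proof. by move=> bm bm'; rewrite resD resM // [b * b']mulrC resM. Qed.

Lemma res_nondeg a b : b \is monic -> (forall c, res (a * c) b = 0) -> b %| a.
Proof.
move=> bm h; rewrite /dvdp; apply/eqP; set r := a %% b.
have b0 := monic_neq0 bm.
have sr : (size r < size b)%N by rewrite ltn_modp.
apply/eqP; apply: contraT => r0; have s0 : (0 < size r)%N by rewrite size_poly_gt0.
(* Multiplying the nonzero remainder by ['X^k] raises its degree to [deg b - 1], so that its leading
   coefficient becomes the residue. *)
pose k := ((size b).-1 - size r)%N.
have := h 'X^k; rewrite -res_mod mulrC -modp_mul res_mod -/r /res.
have sk : size ('X^k * r) = (size b).-1.
  rewrite mulrC size_mulXn // /k.
  by move: sr s0; move: (size b) (size r) => i j; lia.
rewrite modp_small; last by rewrite sk; move: sr; case: (size b).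
have -> : (size b).-2 = (size ('X^k * r)).-1 by rewrite sk.
rewrite -/(lead_coef _) => /eqP; rewrite lead_coef_eq0 mulf_eq0 (negbTE r0) orbF.
by rewrite (negbTE (monic_neq0 (monicXn _ _))).
Qed.

Lemma coprime_inv a b : coprimep a b -> exists c, b %| a * c - 1.
Proof.
move=> /Bezout_eq1_coprimepP [[c d] /= e]; exists c.
by rewrite -e mulrC opprD addNKr; apply/dvdpP; exists (- d); rewrite mulNr.
Qed.

Section Char2.
Hypothesis char2 : 2%N \in [pchar F].

Lemma pchar2_poly : 2%N \in [pchar {poly F}].
Proof. by rewrite pchar_poly. Qed.

Let ch2 := pchar2_poly.

Lemma addpp2 p : p + p = 0.
Proof. exact: addrr_pchar2. Qed.

Lemma oppp2 p : - p = p.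
Proof. exact: oppr_pchar2. Qed.

Lemma sqrD2 p r : (p + r) ^+ 2 = p ^+ 2 + r ^+ 2.
Proof. by rewrite sqrrD -mulr_natr mulrC (pcharf0 ch2) mul0r addr0. Qed.

Lemma sqrFD (x y : F) : (x + y) ^+ 2 = x ^+ 2 + y ^+ 2.
Proof. by rewrite sqrrD -mulr_natr mulrC (pcharf0 char2) mul0r addr0. Qed.

Lemma coef_sqr2 p i : (p ^+ 2)`_i.*2 = p`_i ^+ 2 /\ (p ^+ 2)`_i.*2.+1 = 0.
Proof.
elim/poly_ind: p i => [|p c IH] i; first by rewrite expr0n /= !coef0 expr0n.
rewrite sqrD2 exprMn -polyC_exp !coefD !coefMXn !coefMX !coefC.
case: i => [|i] /=; first by rewrite !add0r.
rewrite !addr0 doubleS !subSS subn0 //=; exact: IH.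
Qed.

(* The square root in [F]; the default value is never used in characteristic 2. *)
Definition rtF (x : F) : F := odflt 0 [pick y | y ^+ 2 == x].

Lemma rtFK x : rtF x ^+ 2 = x.
Proof.
rewrite /rtF; case: pickP => [y /eqP //|h].
have inj : injective (fun y : F => y ^+ 2).
  move=> y z /eqP; rewrite -subr_eq0 subr_sqr mulf_eq0 subr_eq0 addr_eq0.
  by rewrite (oppr_pchar2 char2) orbb => /eqP.
by have := h (invF inj x); rewrite (f_invF inj) eqxx.
Qed.

(** Every coefficient is a square, so [p = ev2 p ^+ 2 + 'X * od2 p ^+ 2]. Thus [od2 p] is the square
    root of the derivative, and it vanishes exactly when [p] is a square. *)
Definition ev2 p : {poly F} := \poly_(i < size p) rtF p`_i.*2.
Definition od2 p : {poly F} := \poly_(i < size p) rtF p`_i.*2.+1.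

Lemma ev_od2 p : p = ev2 p ^+ 2 + 'X * od2 p ^+ 2.
Proof.
have rt0 : rtF 0 = 0 by apply/eqP; rewrite -sqrf_eq0 rtFK.
have e i : (ev2 p)`_i = rtF p`_i.*2.
  rewrite coef_poly; case: ltnP => // h; rewrite nth_default ?rt0 //.
  by move: h; move: (size p) => n; lia.
have o i : (od2 p)`_i = rtF p`_i.*2.+1.
  rewrite coef_poly; case: ltnP => // h; rewrite nth_default ?rt0 //.
  by move: h; move: (size p) => n; lia.
apply/polyP => i; rewrite coefD mulrC coefMX -(odd_double_half i).
case: (odd i) => /=; rewrite ?add0n ?add1n /=.
  by rewrite (coef_sqr2 _ _).2 (coef_sqr2 _ _).1 add0r o rtFK.
rewrite (coef_sqr2 _ _).1 e rtFK; case: (i./2) => [|j] /=; first by rewrite addr0.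
by rewrite doubleS /= (coef_sqr2 _ _).2 addr0.
Qed.

Lemma deriv_sqr2 p : (p ^+ 2)^`() = 0.
Proof. by rewrite expr2 derivM mulrC addpp2. Qed.

Lemma deriv_od2 p : p^`() = od2 p ^+ 2.
Proof.
by rewrite {1}(ev_od2 p) derivD deriv_sqr2 add0r derivM derivX deriv_sqr2 mulr0 addr0 mul1r.
Qed.

Lemma size_od2 p : (size (od2 p) <= (size p)./2)%N.
Proof.
apply/leq_sizeP => j hj; rewrite coef_poly; case: ifP => // _.
rewrite nth_default; first by apply/eqP; rewrite -sqrf_eq0 rtFK.
by move: hj; move: (size p) => n; lia.
Qed.

(** Over [b ^+ 2] the residue is a coefficient of odd index. Squares have even powers only, and ['X]
    shifts them onto that index, in the manner of the Cartier operator. *)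
Lemma res_sqr2 a b : b \is monic ->
  res (a ^+ 2) (b ^+ 2) = 0 /\ res ('X * a ^+ 2) (b ^+ 2) = res a b ^+ 2.
Proof.
move=> bm; have b0 := monic_neq0 bm.
have [b1|b1] := leqP (size b) 1.
  have -> : b = 1.
    by apply: monic_size1 => //; apply/eqP; rewrite eqn_leq b1 size_poly_gt0.
  by rewrite expr1n !res1 expr0n.
set r := (a %% b)%R.
have sr : (size r < size b)%N by rewrite ltn_modp.
have sb : size (b ^+ 2) = ((size b).-2).*2.+3.
  rewrite -(prednK (n := size _)) ?size_poly_gt0 ?expf_neq0 // size_exp muln2.
  by move: b1; case: (size b) => [|[]].
have sa : (size ('X * r ^+ 2)%R <= ((size b).-2).*2.+2)%N.
  have [->|r0] := eqVneq r 0; first by rewrite expr0n mulr0 size_poly0.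
  rewrite mulrC size_mulX ?expf_neq0 //.
  rewrite -(prednK (n := size (r ^+ 2))) ?size_poly_gt0 ?expf_neq0 // size_exp.
  move: sr b1 r0; rewrite -size_poly_gt0; move: (size r) (size b) => i j; lia.
have sa' : (size (r ^+ 2)%R <= ((size b).-2).*2.+2)%N.
  apply: leq_trans sa; have [->|r0] := eqVneq r 0; first by rewrite expr0n size_poly0.
  by rewrite mulrC size_mulX ?expf_neq0.
have e : a ^+ 2 = (a %/ b) ^+ 2 * b ^+ 2 + r ^+ 2.
  by rewrite {1}(divp_eq a b) sqrD2 exprMn.
split.
  rewrite e /res modp_addl_mul_small ?sb ?ltnS //=.
  by rewrite (coef_sqr2 _ _).2.
rewrite e mulrDr mulrA /res modp_addl_mul_small ?sb ?ltnS //=.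
by rewrite mulrC coefMX /= (coef_sqr2 _ _).1.
Qed.

(** Write [a^2 f'/f] as [a^2 f' f/f^2]. With [f = ev2 f ^+ 2 + 'X * od2 f ^+ 2] and
    [f' = od2 f ^+ 2] the numerator is a square plus ['X (a f')^2]. *)
Lemma res_deriv a f : f \is monic ->
  res (a ^+ 2 * f^`()) f = res (a * f^`()) f ^+ 2.
Proof.
move=> fm; rewrite -(resM _ fm fm) -expr2 -(res_sqr2 _ fm).2.
have -> : a ^+ 2 * f^`() * f =
  (a * od2 f * ev2 f) ^+ 2 + 'X * (a * f^`()) ^+ 2.
  by rewrite {2}(ev_od2 f) deriv_od2; ring.
by rewrite resD (res_sqr2 _ fm).1 add0r.
Qed.

(** The image of the Artin-Schreier map. *)
Definition inH (x : F) : bool := [exists y, x == y ^+ 2 + y].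

Lemma inHP x : reflect (exists y, x = y ^+ 2 + y) (inH x).
Proof. by apply: (iffP existsP) => -[y /eqP]; exists y => //; apply/eqP. Qed.

(** Contains the index statement that makes [psi] multiplicative: the sum of two elements outside
    the image lies in it. *)
Lemma inHD x y : inH (x + y) = (inH x == inH y).
Proof.
have HD u v : inH u -> inH v -> inH (u + v).
  move=> /inHP [s ->] /inHP [t ->]; apply/inHP; exists (s + t).
  by rewrite sqrFD; ring.
have vv (v : F) : v + v = 0 by exact: addrr_pchar2.
have cancel u v : inH (u + v) -> inH v -> inH u.
  by move=> h1 h2; have := HD _ _ h1 h2; rewrite -addrA vv addr0.
have [hx|hx] := boolP (inH x); have [hy|hy] := boolP (inH y) => /=.
- exact: HD.
- apply/negbTE/negP => h; move/negP: hy; apply; apply: (cancel y x) hx.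
  by rewrite addrC.
- by apply/negbTE/negP => h; move/negP: hx; apply; exact: (cancel x y h).
apply/inHP.
have [||z|z|z hz] := @additive_image_index2 F (fun z => z ^+ 2 + z) 1 _ _ x y.
- by move=> u v; rewrite (oppr_pchar2 char2 v) (oppr_pchar2 char2) sqrFD; ring.
- move=> u; rewrite -{2}[u]mul1r expr2 -mulrDl => /eqP; rewrite mulf_eq0 addr_eq0.
  by rewrite (oppr_pchar2 char2) => /orP[] /eqP; [right|left].
- by move=> e; move/inHP: hx; apply; exists z.
- by move=> e; move/inHP: hy; apply; exists z.
by exists z; rewrite hz (oppr_pchar2 char2).
Qed.

Lemma inH0 : inH 0.
Proof. by apply/inHP; exists 0; rewrite expr0n addr0. Qed.

Lemma inH_sqr x : inH (x ^+ 2) = inH x.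
Proof.
have h : inH (x ^+ 2 + x) by apply/inHP; exists x.
by move: h; rewrite inHD => /eqP.
Qed.

(** For degree reasons [Q | Q'] forces [Q' = 0], and then [Q = ev2 Q ^+ 2] is a square, hence not
    irreducible. *)
Lemma prime_deriv_neq0 Q : primeA Q -> ~~ (Q %| Q^`()).
Proof.
move=> Qp; apply/negP => dQ; have Q0 := primeA_neq0 Qp.
have d0 : Q^`() = 0.
  apply/eqP; apply: contraT => d0; have := dvdp_leq d0 dQ.
  by rewrite leqNgt lt_size_deriv.
have od0 : od2 Q = 0 by apply/eqP; rewrite -sqrf_eq0 -deriv_od2 d0.
have e : Q = ev2 Q ^+ 2 by rewrite {1}(ev_od2 Q) od0 expr0n mulr0 addr0.
have dv : Q %| ev2 Q by apply: (@primeA_dvdX _ Q _ 2 Qp); rewrite -e.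
have e0 : ev2 Q != 0 by apply: contraNneq Q0 => h; rewrite e h expr0n.
have := dvdp_leq e0 dv; have := primeA_size Qp.
have s2 : (size Q).-1 = ((size (ev2 Q)).-1 * 2)%N by rewrite {1}e size_exp.
by move: e0 s2; rewrite -size_poly_gt0; move: (size Q) (size _) => i j; lia.
Qed.

(* [U |-> res (U Q'/Q)] commutes with squaring, so it maps [{X^2 + X}] modulo [Q]
   into [{x^2 + x}]; both are subgroups of index 2. *)
Lemma quadratic_symbol_residue (xi : F) Q U : ~~ inH xi -> primeA Q ->
  (exists X : {poly F}, Q %| X ^+ 2 + X - U) <-> inH (res (U * Q^`()) Q).
Proof.
move=> nxi Qp; have Qm := Qp.1; have Q0 := primeA_neq0 Qp.
have imp (V : {poly F}) : (exists X : {poly F}, Q %| X ^+ 2 + X - V) -> inH (res (V * Q^`()) Q).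
  move=> [X dX]; apply/inHP; exists (res (X * Q^`()) Q).
  rewrite -res_deriv // -resD -mulrDl; apply: res_eqmod.
  by rewrite -mulrBl -opprB mulNr dvdpNr dvdp_mulr.
split=> [|hU]; first exact: imp.
(* A class whose residue is [xi]: [c] inverts [Q'] modulo [Q], and [T^(deg Q - 1)/Q] has residue
   1. *)
have [V hV] : exists V : {poly F}, ~~ inH (res (V * Q^`()) Q).
  have cd : coprimep Q^`() Q by rewrite coprimep_sym primeA_coprime // prime_deriv_neq0.
  have [c hc] := coprime_inv cd.
  exists (xi *: (c * 'X^((size Q).-2))).
  rewrite -scalerAl resZ (res_eqmod (a' := 'X^((size Q).-2))); last first.
    have -> : c * 'X^((size Q).-2) * Q^`() - 'X^((size Q).-2) =
      (Q^`() * c - 1) * 'X^((size Q).-2) by ring.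
    exact: dvdp_mulr.
  rewrite /res modp_small; last first.
    by rewrite size_polyXn; have := primeA_size Qp; case: (size Q) => [|[]].
  by rewrite coefXn eqxx mulr1.
apply: contrapT => hn.
have hn' : ~ exists X : {poly F}, Q %| X ^+ 2 + X - V by move=> /imp; apply/negP.
(* [phi] is [X^2 + X] on [A/Q], with kernel 0 and 1. If [U] and [V] both missed its image, [U - V]
   would lie in it, although its residue is outside [{x^2 + x}]. *)
pose d := (size Q).-1; pose phi (v : 'rV[F]_d) : 'rV[F]_d :=
  poly_rV ((rVpoly v ^+ 2 + rVpoly v) %% Q).
have dQ (p : {poly F}) : (size (p %% Q)%R <= d)%N.
  by rewrite /d; have : (size (p %% Q)%R < size Q)%N;
     [rewrite ltn_modp|case: (size Q)].
have phiE v p : phi v = poly_rV (p %% Q) -> Q %| rVpoly v ^+ 2 + rVpoly v - p.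
  move=> /(congr1 rVpoly); rewrite /phi !poly_rV_K // => e.
  by rewrite /dvdp modpD modpN e subrr.
have rV1 : (0 < d)%N by rewrite /d; have := primeA_size Qp; case: (size Q) => [|[]].
have [||z|z|z hz] := @additive_image_index2 'rV[F]_d phi (poly_rV 1) _ _
   (poly_rV (U %% Q)) (poly_rV (V %% Q)).
- move=> u v; rewrite /phi -linearB -modpN -modpD; congr (poly_rV (_ %% _)).
  by rewrite linearB /= !(oppp2 (rVpoly v)) (oppp2 (_ + _)) sqrD2; ring.
- move=> u h; have /phiE : phi u = poly_rV (0 %% Q) by rewrite mod0p linear0.
  rewrite subr0 -{2}[rVpoly u]mul1r expr2 -mulrDl primeA_dvdM //.
  have sm (p : {poly F}) : (size p <= d)%N -> Q %| p -> p = 0.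
    move=> sp dp; apply/eqP; apply: contraT => p0; have := dvdp_leq p0 dp.
    rewrite leqNgt; have := primeA_size Qp; move: sp; rewrite /d.
    by case: (size Q) => // n sp _; rewrite ltnS sp.
  move=> /orP[] {}h; [right|left].
    have := sm _ _ h; rewrite (leq_trans (size_polyD _ _)) //; last first.
      by rewrite geq_max size_poly size_poly1.
    move=> /(_ isT) /eqP; rewrite addr_eq0 oppp2 => /eqP e.
    by rewrite -e rVpolyK.
  by rewrite -[u]rVpolyK (sm _ _ h) ?size_poly // linear0.
- by move=> /phiE h; apply: hn; exists (rVpoly z).
- by move=> /phiE h; apply: hn'; exists (rVpoly z).
move: hz; rewrite -linearB -modpN -modpD => /phiE h.
have : inH (res ((U - V) * Q^`()) Q) by apply: imp; exists (rVpoly z).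
by rewrite oppp2 mulrDl resD inHD hU eq_sym (negbTE hV).
Qed.

End Char2.
End Residue.

(** * Rational functions and congruences at a prime *)

Section Frac.
Variable F : finFieldType.
Implicit Types (a b B N P f U X : {poly F}) (u v : ratfun F).

Lemma tofrac_neq0 b : b != 0 -> b%:K != 0 :> ratfun F.
Proof. by move=> b0; rewrite tofrac_eq0. Qed.

Lemma frac_eq a b a' b' : b != 0 -> b' != 0 ->
  (a%:K / b%:K = a'%:K / b'%:K :> ratfun F) <-> a * b' = a' * b.
Proof.
move=> b0 b0'; split=> [|e].
  move=> /(congr1 (fun x => x * (b%:K * b'%:K))).
  rewrite mulrA divfK ?tofrac_neq0 // mulrCA divfK ?tofrac_neq0 //.
  by rewrite -!tofracM => /eqP; rewrite tofrac_eq => /eqP ->; rewrite mulrC.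
apply/eqP; rewrite eqr_div ?tofrac_neq0 // -!tofracM e mulrC //.
Qed.

Lemma frac_add a b a' b' : b != 0 -> b' != 0 ->
  a%:K / b%:K + a'%:K / b'%:K = (a * b' + a' * b)%:K / (b * b')%:K :> ratfun F.
Proof.
move=> b0 b0'; rewrite addf_div ?tofrac_neq0 //.
by rewrite -!tofracM -tofracD.
Qed.

Lemma fsbig_prime_divisors (T : eqType) (idx : T) (op : Monoid.com_law idx) n f
    (G : {poly F} -> T) : f != 0 -> (size f <= n.+1)%N ->
  (forall P, primeA P -> ~~ (P %| f) -> G P = idx) ->
  \big[op/idx]_(P \in prime_divisors f) G P = \big[op/idx]_(P <- prs F n) G P.
Proof.
move=> f0 sf hG; apply: fsbig_fwiden.
- by move=> P [Pp dP] /=; exact: prs_dvd dP.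
- exact: prs_uniq.
- move=> P [/= /prs_prime Pp h]; apply: hG => //.
  by apply/negP => dP; apply: h.
Qed.

Lemma symbE n u f : f != 0 -> (size f <= n.+1)%N ->
  symb u f = (\sum_(P <- prs F n) valA P f * symbP u P)%N.
Proof.
move=> f0 sf; apply: fsbig_prime_divisors => // P Pp nd.
by rewrite val_ndvd.
Qed.

Lemma symbM u f g : f != 0 -> g != 0 -> symb u (f * g) = (symb u f + symb u g)%N.
Proof.
move=> f0 g0; pose n := size (f * g).
have sM : size (f * g) = (size f + size g).-1 by rewrite size_mul.
move: (f0) (g0); rewrite -!size_poly_gt0 => sf sg.
rewrite !(@symbE n) ?mulf_neq0 //; try (rewrite /n sM; move: sf sg; move: (size f) (size g) => i j; lia).
rewrite -big_split /= !big_seq; apply: eq_bigr => P /prs_prime Pp.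
by rewrite valM // mulnDl.
Qed.

Lemma symb1 u : symb u (1 : {poly F}) = 0%N.
Proof.
rewrite (@symbE 0) ?oner_neq0 ?size_poly1 // big_seq big1 // => P /prs_prime Pp.
by rewrite val1.
Qed.

Lemma symb_prime u P : primeA P -> symb u P = symbP u P.
Proof.
move=> Pp; have P0 := primeA_neq0 Pp; rewrite (@symbE (size P)) //.
rewrite (bigD1_seq P) ?prs_uniq //=; last by apply/mem_prs.
rewrite val_self // mul1n big_seq_cond big1 ?addn0 // => Q /andP[/prs_prime Qp ne].
by rewrite val_prime // (negbTE ne).
Qed.

Lemma den_prime_toP u N f : N != 0 -> coprimep N f ->
  (exists B, u = B%:K / N%:K) -> den_prime_to u f.
Proof.
move=> N0 cN [B ->]; exists (B %/ gcdp B N), (N %/ gcdp B N).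
have g0 : gcdp B N != 0 by rewrite gcdp_eq0 negb_and N0 orbT.
have dN : gcdp B N %| N by rewrite dvdp_gcdr.
have dB : gcdp B N %| B by rewrite dvdp_gcdl.
have n0 : N %/ gcdp B N != 0 by rewrite dvdp_div_eq0.
split=> //.
- by rewrite coprimep_div_gcd // N0 orbT.
- apply/frac_eq => //; set g := gcdp B N in dN dB *.
  transitivity (B %/ g * g * (N %/ g)); first by rewrite (divpK dB).
  by rewrite -mulrA [g * _]mulrC (divpK dN).
- by apply: (coprimep_dvdr _ cN); apply/dvdpP; exists (gcdp B N); rewrite mulrC divpK.
Qed.

(** Multiplying by [N], a unit at [P], replaces the congruence in the local ring by one between
    polynomials, with [U] standing for [u] modulo [P]. *)
Lemma symbP_mod u B N U P : primeA P -> ~~ (P %| N) -> u = B%:K / N%:K ->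
  P %| U * N - B ->
  (exists X, eq0_mod P ((X ^+ 2 + X)%:K - u)) <-> (exists X, P %| X ^+ 2 + X - U).
Proof.
move=> Pp nd eu dU; have P0 := primeA_neq0 Pp.
have N0 : N != 0 by apply: contraNneq nd => ->; rewrite dvdp0.
have e X : (X ^+ 2 + X) * N - B = (X ^+ 2 + X - U) * N + (U * N - B) by ring.
have eX X : (X ^+ 2 + X)%:K - u = ((X ^+ 2 + X) * N - B)%:K / N%:K.
  by rewrite eu tofracB tofracM mulrBl mulfK ?tofrac_neq0.
split=> -[X].
  move=> [a [b [nb]]]; have b0 : b != 0 by apply: contraNneq nb => ->; rewrite dvdp0.
  rewrite eX => /(frac_eq _ _ N0 b0) h; exists X.
  have : P %| ((X ^+ 2 + X) * N - B) * b by rewrite h -mulrA dvdp_mulr.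
  rewrite primeA_dvdM // (negbTE nb) orbF e dvdp_addl // primeA_dvdM //.
  by rewrite (negbTE nd) orbF.
move=> dX; exists X; rewrite /eq0_mod eX.
have /dvdpP [a ea] : P %| (X ^+ 2 + X) * N - B by rewrite e dvdp_add // dvdp_mulr.
by exists a, N; split=> //; rewrite ea (mulrC a).
Qed.

End Frac.

(** * The symbol as a residue, and reciprocity *)

Section Chi.
Variables (R : realType) (F : finFieldType) (xi : F).
Hypothesis char2 : 2%N \in [pchar F].
Hypothesis nxi : ~~ inH xi.
Implicit Types (a b B N P f U X : {poly F}) (u v : ratfun F).

Definition psi (x : F) : R := (-1) ^+ (~~ inH x).

Lemma psiD x y : psi (x + y) = psi x * psi y.
Proof.
by rewrite /psi inHD // -signr_addb; congr (_ ^+ _); case: inH; case: inH.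
Qed.

Lemma psi0 : psi 0 = 1.
Proof. by rewrite /psi inH0. Qed.

Lemma psi_sqr x : psi (x ^+ 2) = psi x.
Proof. by rewrite /psi inH_sqr. Qed.

Lemma psi_sq x : psi x * psi x = 1.
Proof. by rewrite -psiD addrr_pchar2 // psi0. Qed.

Lemma psi_xi : psi xi = -1.
Proof. by rewrite /psi nxi expr1. Qed.

Lemma normr_psi x : `|psi x| = 1.
Proof. by rewrite /psi normrX normrN1 expr1n. Qed.

Lemma symbP_res u B N U P : primeA P -> ~~ (P %| N) -> u = B%:K / N%:K ->
  P %| U * N - B -> (-1) ^+ symbP u P = psi (res (U * P^`()) P).
Proof.
move=> Pp nd eu dU; rewrite /symbP /psi; congr (_ ^+ _).
have h := symbP_mod Pp nd eu dU.
have h' := quadratic_symbol_residue char2 U nxi Pp.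
case: asboolP => [hx|hx].
  by have -> // : inH (res (U * P^`()) P) by apply/h'/h.
have -> // : inH (res (U * P^`()) P) = false.
by apply/negbTE/negP => hi; apply: hx; apply/h; apply/h'.
Qed.

(** Both sides are additive over the prime factors of [f]: the logarithmic derivative of a product
    is a sum of fractions, whose residues add. *)
Lemma symb_res u B N U f : N != 0 -> u = B%:K / N%:K -> f \is monic ->
  coprimep N f -> f %| U * N - B -> (-1) ^+ symb u f = psi (res (U * f^`()) f).
Proof.
move=> N0 eu fm; elim/monic_ind: fm => [|P f' Pp fm IH].
  by rewrite symb1 res1 psi0.
rewrite coprimepMr => /andP[cP cf] d.
have nd : ~~ (P %| N) by rewrite -primeA_coprime // coprimep_sym.
have dP : P %| U * N - B by apply: dvdp_trans d; exact: dvdp_mulr.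
have df : f' %| U * N - B by apply: dvdp_trans d; exact: dvdp_mull.
rewrite symbM ?monic_neq0 //; last exact: Pp.1.
rewrite exprD IH // symb_prime // (symbP_res Pp nd eu dP) -psiD; congr psi.
rewrite derivM -(res_addfrac _ _ Pp.1 fm); congr (res _ _); ring.
Qed.

Lemma chi_res u B N U f : N != 0 -> u = B%:K / N%:K -> f \is monic ->
  coprimep N f -> f %| U * N - B -> chi R u f = psi (res (U * f^`()) f).
Proof.
move=> N0 eu fm cN d; rewrite /chi; case: asboolP => [_|nd].
  exact: symb_res d.
by case: nd; apply: den_prime_toP cN _ => //; exists B.
Qed.

Lemma solve_mod B N f : coprimep N f -> exists U, f %| U * N - B.
Proof.
move=> cN; have [c hc] := coprime_inv cN; exists (B * c).
have -> : B * c * N - B = B * (N * c - 1) by ring.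
exact: dvdp_mull.
Qed.

(** [U] represents [B/N] modulo [f], and [V] represents [B/f] modulo [N]. Modulo polynomials,
    [U f'/f + V f'/N] equals [B f'/(f N)], which has degree at most -2 because [B/N] is proper;
    hence the two residues coincide in characteristic 2. *)
Lemma reciprocity B N V f : N \is monic -> f \is monic -> coprimep N f ->
  (size B < size N)%N -> N %| f * V - B ->
  chi R (B%:K / N%:K) f = psi (res (V * f^`()) N).
Proof.
move=> Nm fm cN sB dV; have N0 := monic_neq0 Nm; have f0 := monic_neq0 fm.
have [U dU] := solve_mod B cN.
rewrite (chi_res N0 _ fm cN dU) //; congr psi.
apply/eqP; rewrite -subr_eq0 (oppr_pchar2 char2) -(res_addfrac _ _ fm Nm); apply/eqP.
have dd : f * N %| U * N + V * f - B.
  rewrite Gauss_dvdp; last by rewrite coprimep_sym.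
  apply/andP; split.
    by rewrite addrAC dvdp_addl // dvdp_mull.
  by rewrite -addrA [V * f]mulrC dvdp_addr // dvdp_mull.
rewrite (res_eqmod (a' := B * f^`())); last first.
  have -> : U * f^`() * N + V * f^`() * f - B * f^`() = (U * N + V * f - B) * f^`().
    ring.
  exact: dvdp_mulr.
have [->|B0] := eqVneq B 0; first by rewrite mul0r res0.
have [->|d0] := eqVneq f^`() 0; first by rewrite mulr0 res0.
apply: res_small; rewrite !size_mul //.
have := lt_size_deriv f0; move: sB B0 d0; rewrite -!size_poly_gt0.
move: (size B) (size N) (size f^`()) (size f) => i j k l; lia.
Qed.

End Chi.

Lemma leq_of_double_pred (i j : nat) : (0 < i -> i + i.-1 <= 2 * j -> i <= j)%N.
Proof. by lia. Qed.

(** * Gauss sums and the functional equation *)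

Section Theta.
Variables (R : realType) (F : finFieldType) (xi : F).
Hypothesis char2 : 2%N \in [pchar F].
Hypothesis nxi : ~~ inH xi.
Implicit Types (a b c f g p v x y D B P Q V : {poly F}) (n m d : nat).
Local Notation psi := (@psi R F).
Local Notation q := (#|F|%:R : R).
Local Notation psiD := (@psiD R F char2).

Lemma addr2 p : p + p = 0. Proof. exact: addpp2. Qed.
Lemma opp2 p : - p = p. Proof. exact: oppp2. Qed.

Lemma dvdp_modB p b : b %| p - p %% b.
Proof. by rewrite {1}(divp_eq p b) addrK dvdp_mull. Qed.

Lemma polysD n (G : {poly F} -> R) f0 : (size f0 <= n)%N ->
  \sum_(f <- polys F n) G f = \sum_(f <- polys F n) G (f + f0).
Proof.
move=> s0; apply: (@big_seq_reindex _ _ _ _ _ _ _ _ (fun f => f + f0)); rewrite ?polys_uniq //.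
  move=> f; rewrite !mem_polys -addrA addr2 addr0 => sf; split=> //.
  by rewrite (leq_trans (size_polyD _ _)) // geq_max sf.
move=> f; rewrite !mem_polys -addrA addr2 addr0 => sf; split=> //.
by rewrite (leq_trans (size_polyD _ _)) // geq_max sf.
Qed.

(** Translation by the multiple [f1] of [f0] with [l f1 = xi] changes the sign of every term, since
    [psi xi = -1]. *)
Lemma sum_psi_eq0 n (l : {poly F} -> F) f0 :
  {morph l : p r / p + r} -> (forall (c : F) p, l (c *: p) = c * l p) ->
  (size f0 <= n)%N -> l f0 != 0 -> \sum_(f <- polys F n) psi (l f) = 0.
Proof.
move=> lD lZ s0 l0; pose f1 := (xi / l f0) *: f0.
have s1 : (size f1 <= n)%N by rewrite (leq_trans (size_scale_leq _ _)).
have := polysD (psi \o l) s1; rewrite /=.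
rewrite [in RHS](eq_bigr (fun f => - psi (l f))); last first.
  by move=> f _; rewrite lD psiD lZ divfK // (psi_xi R nxi) mulrN1.
by rewrite sumrN; move: (\sum_(_ <- _) _) => S ?; lra.
Qed.

Lemma sum_const_polys n (c : R) : \sum_(f <- polys F n) c = q ^+ n * c.
Proof.
by rewrite big_const_seq count_predT iter_addr_0 size_polys -(mulr_natl c) natrX.
Qed.

Lemma sum_psi_triv n (l : {poly F} -> F) :
  (forall f, (size f <= n)%N -> l f = 0) ->
  \sum_(f <- polys F n) psi (l f) = q ^+ n.
Proof.
move=> h; rewrite big_seq (eq_bigr (fun=> 1)) -?big_seq; last first.
  by move=> f; rewrite mem_polys => /h ->; rewrite psi0.
by rewrite sum_const_polys mulr1.
Qed.

(** The default value 0 is harmless: [theta] consults [invm] only for [f] prime to [D]. *)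
Definition invm N f : {poly F} :=
  match pselect (exists c, N %| f * c - 1) with
  | left h => projT1 (cid h) | right _ => 0 end.

Lemma invmP N f : coprimep f N -> N %| f * invm N f - 1.
Proof.
move=> cf; rewrite /invm; case: pselect => [h|]; first by case: (cid h).
by case; exact: coprime_inv.
Qed.

(* [chi_u] for [u = B/D^2], after reciprocity. *)
Definition theta D B f : R :=
  if coprimep f D then psi (res (B * invm (D ^+ 2) f * f^`()) (D ^+ 2)) else 0.

Section Modulus.
Variables (D B : {poly F}).
Hypothesis Dm : D \is monic.
Local Notation theta := (theta D B).
Local Notation d := (size D).-1.

Let D0 : D != 0. Proof. exact: monic_neq0. Qed.
Let D2m : D ^+ 2 \is monic. Proof. exact: monic_exp. Qed.
Let D20 : D ^+ 2 != 0. Proof. exact: monic_neq0. Qed.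

Lemma size_D2 : size (D ^+ 2) = (2 * d).+1.
Proof.
by rewrite -(prednK (n := size _)) ?size_poly_gt0 // size_exp mulnC.
Qed.

Lemma coprime_D2 f : coprimep f (D ^+ 2) = coprimep f D.
Proof. by rewrite coprimep_pexpr. Qed.

Lemma thetaE f V : coprimep f D -> D ^+ 2 %| f * V - B ->
  theta f = psi (res (V * f^`()) (D ^+ 2)).
Proof.
move=> cf dV; rewrite /theta cf; congr psi; apply: res_eqmod.
rewrite -mulrBl dvdp_mulr //.
have cf2 : coprimep (D ^+ 2) f by rewrite coprimep_sym coprime_D2.
rewrite -(Gauss_dvdpr _ cf2).
have -> : f * (B * invm (D ^+ 2) f - V) =
  B * (f * invm (D ^+ 2) f - 1) - (f * V - B) by ring.
by rewrite dvdp_sub // dvdp_mull // invmP // coprime_D2.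
Qed.

Lemma theta_solve f : coprimep f D -> exists V, D ^+ 2 %| f * V - B.
Proof.
rewrite -coprime_D2 => cf; have [V hV] := solve_mod B cf.
by exists V; rewrite mulrC.
Qed.

Lemma theta0 f : ~~ coprimep f D -> theta f = 0.
Proof. by rewrite /theta => /negbTE ->. Qed.

(** Since [(D^2)' = 0], derivation is well defined modulo [D^2]; this is what makes [theta] periodic
    with that modulus. *)
Lemma dvd_D2_deriv p : D ^+ 2 %| p -> D ^+ 2 %| p^`().
Proof.
move=> /dvdpP [y ->]; rewrite derivM deriv_sqr2 // mulr0 addr0.
exact: dvdp_mull.
Qed.

Lemma theta_mod f g : D ^+ 2 %| f - g -> theta f = theta g.
Proof.
move=> dfg; have dfg1 : D %| f - g by apply: dvdp_trans dfg; rewrite dvdp_mulr.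
have cfg : coprimep f D = coprimep g D.
  by rewrite -(subrK g f); case/dvdpP: dfg1 => y ->;
     rewrite coprimep_sym coprimep_addl_mul coprimep_sym.
have [cf|cf] := boolP (coprimep f D); last by rewrite !theta0 -?cfg.
have [V hV] := theta_solve cf; have cg : coprimep g D by rewrite -cfg.
have hVg : D ^+ 2 %| g * V - B.
  have -> : g * V - B = (f * V - B) - (f - g) * V by ring.
  by rewrite dvdp_sub // dvdp_mulr.
rewrite (thetaE cf hV) (thetaE cg hVg); congr psi; apply: res_eqmod.
by rewrite -mulrBr -derivB dvdp_mull // dvd_D2_deriv.
Qed.

(** If [V] represents [B/(f g)], then [g V] and [f V] represent [B/f] and [B/g], and the Leibniz
    rule splits the residue. *)
Lemma thetaM f g : theta (f * g) = theta f * theta g.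
Proof.
have [cf|cf] := boolP (coprimep f D); last first.
  by rewrite (theta0 cf) mul0r theta0 // coprimepMl (negbTE cf).
have [cg|cg] := boolP (coprimep g D); last first.
  by rewrite (theta0 cg) mulr0 theta0 // coprimepMl (negbTE cg) andbF.
have cfg : coprimep (f * g) D by rewrite coprimepMl cf.
have [V hV] := theta_solve cfg.
have hf : D ^+ 2 %| f * (g * V) - B by rewrite mulrA.
have hg : D ^+ 2 %| g * (f * V) - B by rewrite mulrCA mulrA.
rewrite (thetaE cfg hV) (thetaE cf hf) (thetaE cg hg) -psiD -resD.
by rewrite derivM; congr (psi (res _ _)); ring.
Qed.

Lemma theta_sqr f : coprimep f D -> theta (f ^+ 2) = 1.
Proof.
move=> cf; have cf2 : coprimep (f ^+ 2) D by rewrite coprimep_expl.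
have [V hV] := theta_solve cf2.
by rewrite (thetaE cf2 hV) deriv_sqr2 // mulr0 res0 psi0.
Qed.

Lemma theta_sq f : coprimep f D -> theta f * theta f = 1.
Proof. by move=> cf; rewrite -thetaM -expr2 theta_sqr. Qed.

Lemma thetaZ (c : F) f : c != 0 -> theta (c *: f) = theta f.
Proof.
move=> c0; have [cf|cf] := boolP (coprimep f D); last first.
  by rewrite !theta0 // coprimepZl.
have cf' : coprimep (c *: f) D by rewrite coprimepZl.
have [V hV] := theta_solve cf'.
have hf : D ^+ 2 %| f * (c *: V) - B by rewrite -scalerAr scalerAl.
by rewrite (thetaE cf' hV) (thetaE cf hf) derivZ -scalerAr scalerAl.
Qed.

Hypothesis BD : forall P, primeA P -> P %| D -> P %| B /\ ~~ (P ^+ 2 %| B).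

Lemma coprime_1D y : coprimep (1 + D * y) D.
Proof.
by rewrite coprimep_sym addrC mulrC coprimep_addl_mul coprimep1.
Qed.

Lemma dvd_deriv P e p : P ^+ e.+1 %| p -> P ^+ e %| p^`().
Proof.
elim: e p => [|e IH] p; first by rewrite expr0 dvd1p.
move=> /dvdpP [y ->].
have -> : y * P ^+ e.+2 = P * (y * P ^+ e.+1) by rewrite exprS mulrCA.
rewrite derivM dvdp_add //; first by rewrite dvdp_mull // dvdp_mull.
by rewrite [X in X %| _]exprS dvdp_mul // IH // dvdp_mull.
Qed.

(** This is the part of [theta (1 + D * y)] quadratic in [y]. The numerator is a square plus
    ['X (s1 t)^2], so [D | s1 t] suffices. If [P] has exponent [l] in [D], the extra factor [P] of
    [B] gives [P^l | s1^2], while [P^(l-1) | t^2]; so [(s1 t)^2] has exponent at least [2l - 1], and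
    [s1 t] at least [l]. *)
Lemma second_order_term y :
  psi (res (B * (D * y) * (D * y)^`()) (D ^+ 2)) = 1.
Proof.
set s1 := od2 (B * (D * y)); set t := od2 (D * y).
have dst : D %| s1 * t.
  have [->|st0] := eqVneq (s1 * t) 0; first by rewrite dvdp0.
  apply: dvd_val => // P Pp; have [->//|lp] := posnP (valA P D).
  have dP : P %| D by rewrite val_dvd.
  have dB := (BD Pp dP).1.
  have h1 : P ^+ valA P D %| D by rewrite valP.
  have hs : P ^+ valA P D %| s1 ^+ 2.
    by rewrite -deriv_od2 //; apply: dvd_deriv; rewrite exprS dvdp_mul // dvdp_mulr.
  have ht : P ^+ (valA P D).-1 %| t ^+ 2.
    by rewrite -deriv_od2 //; apply: dvd_deriv; rewrite prednK // dvdp_mulr.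
  have : P ^+ (valA P D + (valA P D).-1) %| (s1 * t) ^+ 2.
    by rewrite exprMn exprD dvdp_mul.
  rewrite valP ?expf_neq0 // valX //.
  exact: leq_of_double_pred.
have -> : B * (D * y) * (D * y)^`() =
   (ev2 (B * (D * y)) * t) ^+ 2 + 'X * (s1 * t) ^+ 2.
  by rewrite {1}(ev_od2 char2 (B * (D * y))) (deriv_od2 char2 (D * y)) -/s1 -/t; ring.
rewrite resD (res_sqr2 char2 _ Dm).1 (res_sqr2 char2 _ Dm).2 add0r psi_sqr //.
by rewrite res_dvd // psi0.
Qed.

(** Modulo [D^2] the element [1 + D y] is its own inverse, so [B (1 + D y)] represents the quotient.
    Of the resulting terms, [(B D y)'] is a square and has no residue, and the quadratic one is
    trivial; only [D B' y] remains. *)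
Lemma theta_1D y : theta (1 + D * y) = psi (res (B^`() * y) D).
Proof.
have hV : D ^+ 2 %| (1 + D * y) * (B * (1 + D * y)) - B.
  have -> : (1 + D * y) * (B * (1 + D * y)) - B = B * ((1 + D * y) ^+ 2 - 1) by ring.
  by rewrite sqrD2 // expr1n [1 + _]addrC addrK exprMn dvdp_mull // dvdp_mulr.
rewrite (thetaE (coprime_1D y) hV) derivD derivC add0r.
have -> : B * (1 + D * y) * (D * y)^`() =
   (B * (D * y))^`() + D * (B^`() * y) + B * (D * y) * (D * y)^`().
  have e : (B * (D * y))^`() = B^`() * (D * y) + B * (D * y)^`() by rewrite derivM.
  rewrite e.
  have -> : B^`() * (D * y) = D * (B^`() * y) by ring.
  rewrite [_ + B * _]addrC -addrA -addrA.
  transitivity (B * (D * y)^`() + (D * (B^`() * y) + D * (B^`() * y)) +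
     B * (D * y) * (D * y)^`()); first by rewrite addr2; ring.
  ring.
rewrite !resD !psiD second_order_term mulr1 deriv_od2 // (res_sqr2 char2 _ Dm).1.
by rewrite psi0 mul1r [D * _]mulrC expr2 resM.
Qed.

(** At a prime [P] of [D] write [B = C P] with [C] prime to [P]: modulo [P] the derivative is
    [C P'], a unit. *)
Lemma coprime_derivB : coprimep B^`() D.
Proof.
apply: contraT => /negP nc; 
have [P Pp /andP[dB dD]] : exists2 P, primeA P & (P %| B^`()) && (P %| D).
  have s1 : (1 < size (gcdp B^`() D))%N.
    rewrite ltn_neqAle size_poly_gt0 gcdp_eq0 negb_and D0 orbT andbT eq_sym.
    exact/negP.
  by have [P Pp dP] := prime_divisor_exists s1; exists P => //; rewrite -dvdp_gcd.
have [/dvdpP [C eB] /negP []] := BD Pp dD.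
move: dB; rewrite eB derivM dvdp_addr; last exact: dvdp_mull.
rewrite primeA_dvdM //.
rewrite (negbTE (prime_deriv_neq0 char2 Pp)) orbF => dC.
by rewrite expr2 mulrC dvdp_mul.
Qed.

Lemma theta_derivB : theta B^`() = 1.
Proof.
have := coprime_derivB; rewrite deriv_od2 // => c; apply: theta_sqr.
by move: c; rewrite coprimep_pexpl.
Qed.

(** Write [a f = B' + D x]. Then [theta (a f)] is [theta B' = 1] times the value of [theta] at
    [1 + D x/B'], that is [psi (res x D)]. The additive factor has the same value, [B'] being a
    square, and the two cancel. *)
Lemma gauss_term a f : coprimep f D -> D %| a * f - B^`() ->
  theta a * psi (res (a * f) (D ^+ 2)) = theta f.
Proof.
move=> cf /dvdpP [x ex].
have eaf : a * f = B^`() + D * x by rewrite [D * x]mulrC -ex addrCA subrr addr0.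
have [c hc] := coprime_inv coprime_derivB.
have th : theta (a * f) = psi (res x D).
  have -> : theta (a * f) = theta (B^`() * (1 + D * (c * x))).
    apply: theta_mod; rewrite eaf.
    have -> : B^`() + D * x - B^`() * (1 + D * (c * x)) =
      - (D * x * (B^`() * c - 1)) by ring.
    by rewrite dvdpNr -mulrA expr2 dvdp_mul // dvdp_mull.
  rewrite thetaM theta_derivB mul1r theta_1D; congr psi; apply: res_eqmod.
  have -> : B^`() * (c * x) - x = (B^`() * c - 1) * x by ring.
  exact: dvdp_mulr.
have ps : psi (res (a * f) (D ^+ 2)) = psi (res x D).
  rewrite eaf resD deriv_od2 // (res_sqr2 char2 _ Dm).1 add0r.
  by rewrite [D * x]mulrC expr2 resM.
have : theta a * theta f * theta f = psi (res x D) * theta f by rewrite -thetaM th.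
rewrite -mulrA theta_sq // mulr1 => ->.
by rewrite ps mulrAC psi_sq // mul1r.
Qed.

(** Multiplication by [1 + D y] is an involution of [A/D^2], because [(1 + D y)^2 = 1] there. *)
Lemma theta_shift y (G : {poly F} -> R) :
  (forall a b, D ^+ 2 %| a - b -> G a = G b) ->
  \sum_(a <- polys F (2 * d)) G a =
  \sum_(a <- polys F (2 * d)) G (a * (1 + D * y)).
Proof.
move=> hG; pose h a := (a * (1 + D * y)) %% D ^+ 2.
have hh a : (size a <= 2 * d)%N -> h (h a) = a.
  move=> sa; rewrite /h [X in (X %% _)]mulrC modp_mul mulrC -mulrA -expr2 sqrD2 //.
  rewrite expr1n exprMn mulrDr mulr1 mulrCA modpD modp_mulr addr0 modp_small //.
  by rewrite size_D2 ltnS.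
have sh a : (size (h a) <= 2 * d)%N by rewrite -ltnS -size_D2 ltn_modp.
rewrite (@big_seq_reindex _ _ _ _ _ (polys F (2 * d)) _ h h) ?polys_uniq //.
- by apply: eq_bigr => a _; apply: hG; rewrite -opprB dvdpNr dvdp_modB.
- by move=> a; rewrite !mem_polys => /hh.
- by move=> a; rewrite !mem_polys => /hh.
Qed.

Lemma sum_psi_D c : \sum_(y <- polys F d) psi (res (c * y) D) =
  if D %| c then q ^+ d else 0.
Proof.
case: ifPn => [dc|nc].
  by apply: sum_psi_triv => f _; rewrite res_dvd // dvdp_mulr.
have [y hy] : exists y, res (c * y) D != 0.
  apply: contrapT => h; move/negP: nc; apply; apply: res_nondeg => // y.
  by apply/eqP; apply: contraT => hy; case: h; exists y.
apply: (sum_psi_eq0 (f0 := y %% D)).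
- by move=> p r; rewrite mulrDr resD.
- by move=> x p; rewrite -scalerAr resZ.
- by have : (size (y %% D)%R < size D)%N; [rewrite ltn_modp|case: (size D)].
- by rewrite -res_mod modp_mul res_mod.
Qed.

(** The sum is invariant under [a -> a (1 + D y)]; summing over [y] modulo [D] leaves only the [a]
    with [a f = B'] modulo [D]. For [f] prime to [D] these form one class modulo [D], with [q^d]
    members, all contributing [theta f]. For other [f] there are none, since [B'] is prime to
    [D]. *)
Lemma gauss f :
  \sum_(a <- polys F (2 * d)) theta a * psi (res (a * f) (D ^+ 2)) =
  q ^+ d * theta f.
Proof.
have q0 : q ^+ d != 0 by rewrite expf_neq0 // pnatr_eq0 -lt0n; apply/card_gt0P; exists 0.
apply: (mulfI q0).
pose G a := theta a * psi (res (a * f) (D ^+ 2)).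
have GE y a : G (a * (1 + D * y)) = G a * psi (res ((B^`() + a * f) * y) D).
  rewrite /G thetaM theta_1D [(B^`() + _) * y]mulrDl resD psiD.
  have -> : a * (1 + D * y) * f = a * f + a * f * y * D by ring.
  rewrite resD psiD expr2 resM //; ring.
have hG a b : D ^+ 2 %| a - b -> G a = G b.
  move=> dab; rewrite /G (theta_mod dab); congr (_ * psi _); apply: res_eqmod.
  by rewrite -mulrBl dvdp_mulr.
have e1 : q ^+ d * (\sum_(a <- polys F (2 * d)) G a) =
  \sum_(a <- polys F (2 * d)) G a * \sum_(y <- polys F d) psi (res ((B^`() + a * f) * y) D).
  have -> : q ^+ d = \sum_(y <- polys F d) 1.
    by rewrite sum_const_polys mulr1.
  rewrite mulr_suml; under eq_bigr => y _ do rewrite mul1r (theta_shift y hG).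
  rewrite exchange_big; apply: eq_bigr => a _.
  by rewrite mulr_sumr; apply: eq_bigr => y _; rewrite GE.
rewrite e1; under eq_bigr do rewrite sum_psi_D.
have [cf|cf] := boolP (coprimep f D); last first.
  rewrite (theta0 cf) !mulr0 big1 // => a _; case: ifPn => [dd|]; last by rewrite mulr0.
  case/negP: cf; rewrite /coprimep.
  have : coprimep (gcdp f D) B^`().
    apply: coprimep_dvdr (_ : coprimep D B^`()); first by rewrite dvdp_gcdr.
    by rewrite coprimep_sym coprime_derivB.
  have /dvdp_trans/(_ dd) : gcdp f D %| D by rewrite dvdp_gcdr.
  rewrite dvdp_addl; last by rewrite dvdp_mull // dvdp_gcdl.
  by move=> h /(coprimep_dvdl h); rewrite coprimepp.
have [c hc] := coprime_inv cf.
pose a0 := (B^`() * c) %% D.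
have da a : (D %| B^`() + a * f) = (D %| a - a0).
  have cf' : coprimep D f by rewrite coprimep_sym.
  rewrite -(Gauss_dvdpr (a - a0) cf').
  have -> : B^`() + a * f = f * (a - a0) + (- f * (B^`() * c - a0) + B^`() * (f * c - 1)) + (B^`() + B^`()).
    ring.
  rewrite addr2 addr0 dvdp_addl // dvdp_add //; last exact: dvdp_mull.
  by rewrite dvdp_mull // dvdp_modB.
have sd : (0 < size D)%N by rewrite size_poly_gt0.
rewrite (bigID (fun a => D %| a - a0)) /= [X in _ + X]big1 ?addr0; last first.
  by move=> a; rewrite da => /negbTE ->; rewrite mulr0.
rewrite (eq_bigr (fun=> theta f * q ^+ d)); last first.
  move=> a ha; rewrite da ha /G gauss_term //.
  by rewrite opp2 addrC da.
rewrite -big_filter (@big_seq_reindex _ _ _ _ _ (polys F d) _ (fun y => D * y + a0)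
   (fun a => (a - a0) %/ D)).
- by rewrite sum_const_polys; ring.
- exact: polys_uniq.
- by rewrite filter_uniq // polys_uniq.
- move=> y; rewrite mem_polys => sy; rewrite mem_filter mem_polys addrK.
  split; last by rewrite mulKp.
  rewrite dvdp_mulr //= (leq_trans (size_polyD _ _)) // geq_max; apply/andP; split.
    have [->|y0] := eqVneq y 0; first by rewrite mulr0 size_poly0.
    rewrite size_mul //; move: sy sd; move: (size y) (size D) => i j; lia.
  have : (size a0 < size D)%N by rewrite ltn_modp.
  by move: sd; move: (size a0) (size D) => i j; lia.
- move=> a; rewrite mem_filter !mem_polys => /andP[dd sa]; split; last first.
    by rewrite mulrC divpK // subrK.
  have [->|aa0] := eqVneq (a - a0) 0; first by rewrite div0p size_poly0.
  rewrite size_divp // leq_subLR opp2 (leq_trans (size_polyD _ _)) // geq_max.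
  rewrite addnn -mul2n sa /=; apply: (@leq_trans d); last by rewrite mul2n -addnn leq_addr.
  by rewrite -ltnS (prednK sd) ltn_modp.
Qed.

(** Poisson summation: for the residue pairing modulo [D^2], the annihilator of the polynomials of
    degree below [m] consists of those of degree below [2d - m]. The Gauss sum turns [theta] into
    its own Fourier transform. *)
Lemma functional_equation m :
  q ^+ d * \sum_(f <- polys F m) theta f =
  q ^+ m * \sum_(f <- polys F (2 * d - m)) theta f.
Proof.
rewrite mulr_sumr; under eq_bigr do rewrite -gauss.
rewrite exchange_big /=; under eq_bigr do rewrite -mulr_sumr.
have inner a : (size a <= 2 * d)%N ->
   \sum_(f <- polys F m) psi (res (a * f) (D ^+ 2)) =
   if (size a <= 2 * d - m)%N then q ^+ m else 0.
  move=> sa; case: leqP => h.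
    apply: sum_psi_triv => f sf; have [->|f0] := eqVneq f 0; first by rewrite mulr0 res0.
    have [->|a0] := eqVneq a 0; first by rewrite mul0r res0.
    apply: res_small; rewrite size_D2 size_mul //.
    move: h sf f0 a0; rewrite -!size_poly_gt0; move: (size a) (size f) => i j; lia.
  have a0 : a != 0 by rewrite -size_poly_gt0; apply: leq_trans h.
  pose k := (2 * d - size a)%N.
  have sk : size (a * 'X^k) = (2 * d)%N by rewrite size_mulXn // /k subnK.
  apply: (sum_psi_eq0 (f0 := 'X^k)).
  - by move=> p r; rewrite mulrDr resD.
  - by move=> x p; rewrite -scalerAr resZ.
  - rewrite size_polyXn /k; move: h sa a0; rewrite -size_poly_gt0.
    by move: (size a) => i; lia.
  - rewrite /res modp_small ?sk ?size_D2 //= -sk -/(lead_coef _) lead_coef_eq0.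
    by rewrite mulf_neq0 // monic_neq0 // monicXn.
rewrite big_seq (eq_bigr (fun a => if (size a <= 2 * d - m)%N then theta a * q ^+ m else 0)); last first.
  by move=> a; rewrite mem_polys => sa; rewrite inner //; case: ifP; rewrite ?mulr0.
rewrite -big_seq -big_mkcond /= -big_filter mulr_sumr.
rewrite (perm_big (polys F (2 * d - m))) /=.
  by apply: eq_bigr => a _; rewrite mulrC.
apply: uniq_perm; rewrite ?filter_uniq ?polys_uniq // => a.
rewrite mem_filter !mem_polys andb_idr // => h; apply: leq_trans h _.
exact: leq_subr.
Qed.

End Modulus.
End Theta.

Lemma leq_shift_bound (r s m i : nat) :
  (0 < i -> i <= 2 * r + 2 * s - 1 - m -> m.+1 + i <= 2 * r + 2 * s)%N.
Proof. by lia. Qed.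

(** * Reversal of coefficients and expansion at infinity *)

Section Rev.
Variable F : finFieldType.
Implicit Types (a b c f g p v x y V : {poly F}) (n m d i j : nat).

(** [T^m f(1/T)] for [f] of degree at most [m]. The length is a parameter, since padding [f] with
    zeros multiplies the reversal by a power of ['X]. *)
Definition revp m f : {poly F} := \poly_(i < m.+1) f`_(m - i).

Lemma coef_revp m f i : (revp m f)`_i = if (i <= m)%N then f`_(m - i) else 0.
Proof. by rewrite coef_poly ltnS. Qed.

Lemma size_revp m f : (size (revp m f) <= m.+1)%N.
Proof. exact: size_poly. Qed.

Lemma revpD m f g : revp m (f + g) = revp m f + revp m g.
Proof. by apply/polyP => i; rewrite coefD !coef_revp coefD; case: ifP; rewrite ?addr0. Qed.

Lemma revpZ m (x : F) f : revp m (x *: f) = x *: revp m f.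
Proof. by apply/polyP => i; rewrite coefZ !coef_revp coefZ; case: ifP; rewrite ?mulr0. Qed.

Lemma revp_sum m (I : Type) (r : seq I) (G : I -> {poly F}) :
  revp m (\sum_(i <- r) G i) = \sum_(i <- r) revp m (G i).
Proof.
elim: r => [|i r IH]; last by rewrite !big_cons revpD IH.
by rewrite !big_nil; apply/polyP => i; rewrite coef_revp !coef0 if_same.
Qed.

Lemma revpXn m i : (i <= m)%N -> revp m 'X^i = 'X^(m - i).
Proof.
move=> im; apply/polyP => j; rewrite coef_revp !coefXn.
case: leqP => jm; last by case: eqP => // e; move: jm im e; lia.
by congr (_%:R); apply/eqP/eqP; lia.
Qed.

Lemma revpK m f : (size f <= m.+1)%N -> revp m (revp m f) = f.
Proof.
move=> sf; apply/polyP => i; rewrite !coef_revp; case: leqP => im.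
  by rewrite leq_subr subKn.
by rewrite nth_default // (leq_trans sf).
Qed.

Lemma revpM m n f g : (size f <= m.+1)%N -> (size g <= n.+1)%N ->
  revp (m + n) (f * g) = revp m f * revp n g.
Proof.
have ex k (h : {poly F}) : (size h <= k.+1)%N -> h = \sum_(i < k.+1) h`_i *: 'X^i.
  move=> sh; rewrite -poly_def; apply/polyP => i; rewrite coef_poly.
  by case: ltnP => // ki; rewrite nth_default // (leq_trans sh).
move=> sf sg; rewrite (ex m f sf) (ex n g sg) big_distrlr /= !revp_sum big_distrlr /=.
apply: eq_bigr => i _; rewrite revp_sum; apply: eq_bigr => j _.
have im := ltn_ord i; have jn := ltn_ord j; rewrite !ltnS in im jn.
rewrite -scalerAl -scalerAr scalerA -exprD !revpZ !revpXn ?leq_add //.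
rewrite -scalerAl -scalerAr scalerA -exprD; congr (_ *: 'X^_); lia.
Qed.

Lemma revp_small m k f : (size f <= m.+1)%N -> revp (m + k) f = revp m f * 'X^k.
Proof.
move=> sf; rewrite -[f in LHS]mulr1 revpM ?size_poly1 //.
by have := @revpXn k 0 isT; rewrite expr0 subn0 => ->.
Qed.

Lemma revp_mulXn m k f : (size f <= m.+1)%N -> revp (m + k) (f * 'X^k) = revp m f.
Proof. by move=> sf; rewrite revpM ?size_polyXn // revpXn // subnn expr0 mulr1. Qed.

Lemma coef_modXn n p i : (i < n)%N -> (p %% 'X^n)`_i = p`_i.
Proof.
by move=> ni; rewrite {2}(divp_eq p 'X^n) coefD coefMXn ni add0r.
Qed.

Lemma res_Xn n p : (0 < n)%N -> res p 'X^n = p`_n.-1.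
Proof. by move=> n0; rewrite /res size_polyXn /= coef_modXn // prednK. Qed.

Lemma dvdXn_coef n p i : 'X^n %| p -> (i < n)%N -> p`_i = 0.
Proof. by move=> /dvdpP [y ->] ni; rewrite coefMXn ni. Qed.

(** In the coordinate [1/T], [a/b] is [T^(A - d)] times the quotient of the reversals, where
    [d = deg b]. The coefficient of [1/T] is therefore the one of index [A - d + 1] in any quotient
    [V] correct up to that index. *)
Lemma res_revp a b V A : b \is monic -> (size a <= A.+1)%N ->
  'X^((A - (size b).-1).+2) %| V * revp (size b).-1 b - revp A a ->
  ((size b).-1 <= A)%N ->
  res a b = V`_((A - (size b).-1).+1).
Proof.
move=> bm sa dV dA; have b0 := monic_neq0 bm.
set d := (size b).-1 in dV dA *; set e := (A - d)%N in dV *.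
have sb : size b = d.+1 by rewrite /d prednK // size_poly_gt0.
set Q := a %/ b; set rho := a %% b.
have srho : (size rho <= d)%N by rewrite -ltnS -sb ltn_modp.
have sQ : (size Q <= e.+1)%N.
  rewrite /Q size_divp // -/d; move: sa; rewrite /e; move: (size a) dA => i; lia.
have rb0 : (revp d b)`_0 = 1 by rewrite coef_revp leq0n subn0 -(monicP bm) /lead_coef.
have [d0|dp] := posnP d.
  have b1 : b = 1 by apply: monic_size1 => //; rewrite sb d0.
  rewrite b1 res1.
  move: dV; rewrite b1 d0 => dV.
  have r1 : revp 0 (1 : {poly F}) = 1.
    by apply/polyP => i; rewrite coef_revp coef1; case: i => [|i] //=; rewrite coef1.
  move: dV; rewrite r1 mulr1 => /dvdXn_coef /(_ (ltnSn e.+1)).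
  rewrite coefB coef_revp /e d0 subn0 ltnn subr0 => ->; by [].
have e1 : revp A a = revp e Q * revp d b + 'X^(e.+1) * revp d.-1 rho.
  rewrite {1}(divp_eq a b) -/Q -/rho revpD; congr (_ + _).
    have -> : A = (e + d)%N by rewrite /e subnK.
    by rewrite revpM // sb.
  have -> : A = (d.-1 + e.+1)%N by rewrite /e; move: dA dp; lia.
  by rewrite revp_small ?prednK // mulrC.
have dW : 'X^(e.+2) %| (V - revp e Q) * revp d b - 'X^(e.+1) * revp d.-1 rho.
  by move: dV; rewrite e1; congr (_ %| _); ring.
have cop : coprimep 'X^(e.+2) (revp d b).
  by rewrite coprimep_expl // coprimep_sym coprimepX /root horner_coef0 rb0 oner_neq0.
have dX : 'X^(e.+1) %| V - revp e Q.
  have cop' : coprimep 'X^(e.+1) (revp d b).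
    by rewrite coprimep_expl // coprimep_sym coprimepX /root horner_coef0 rb0 oner_neq0.
  rewrite -(Gauss_dvdpl _ cop') -(dvdp_subl _ (n := 'X^(e.+1) * revp d.-1 rho)) ?dvdp_mulr //.
  by apply: dvdp_trans dW; rewrite dvdp_exp2l.
have [W eW] := dvdpP _ _ dX.
have VE : V`_e.+1 = W`_0.
  rewrite -(subrK (revp e Q) V) eW coefD coefMXn ltnn subnn.
  by rewrite coef_revp ltnn addr0.
have : 'X %| W * revp d b - revp d.-1 rho.
  have x0 : 'X^(e.+1) != 0 :> {poly F} by rewrite monic_neq0 // monicXn.
  rewrite -(dvdp_mul2l _ _ x0) -exprSr; move: dW; rewrite eW; congr (_ %| _); ring.
rewrite -['X]expr1 => /dvdXn_coef /(_ (ltnSn 0)); rewrite coefB coef0M rb0 mulr1.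
rewrite coef_revp leq0n subn0 -VE => /eqP; rewrite subr_eq0 => /eqP ->.
by rewrite /res sb.
Qed.

End Rev.

(** * The functional equation with a pole at infinity *)

Section Infinity.
Variables (R : realType) (F : finFieldType) (xi : F).
Hypothesis char2 : 2%N \in [pchar F].
Hypothesis nxi : ~~ inH xi.
Variables (s : nat) (Fp : {poly F}).
Hypothesis s0 : (0 < s)%N.
Hypothesis sFp : size Fp = (2 * s)%N.
Hypothesis Fp0 : Fp`_0 = 0.
Implicit Types (a b c f g p v x y D B P Q V : {poly F}) (n m d : nat).
Local Notation psi := (@psi R F).
Local Notation q := (#|F|%:R : R).

(* In the coordinate [1/T], [Fp] has the form [Binf/(T^s)^2]. *)
Definition Binf : {poly F} := revp (2 * s) Fp.
Local Notation thinf := (theta R 'X^s Binf).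

Let Xs2 : ('X^s : {poly F}) ^+ 2 = 'X^(2 * s).
Proof. by rewrite -exprM mulnC. Qed.

Lemma primeA_X : primeA ('X : {poly F}).
Proof.
by split; [exact: monicX|have := @irredp_XsubC F 0; rewrite subr0].
Qed.

(** The odd degree [2s - 1] of [Fp] gives its reversal to length [2s] a simple zero at 0, so the
    pole at infinity satisfies the condition required of finite poles and [gauss] applies to
    ['X^s]. *)
Lemma Binf_cond P : primeA P -> P %| 'X^s -> P %| Binf /\ ~~ (P ^+ 2 %| Binf).
Proof.
move=> Pp /(primeA_dvdX Pp) /(primeA_dvd Pp primeA_X) ->; split.
  apply/dvdpP.
  have : root Binf 0.
    by rewrite /root horner_coef0 coef_revp leq0n subn0 nth_default // sFp.
  by move=> /factor_theorem [y]; rewrite subr0 => ->; exists y.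
apply/negP => /dvdXn_coef /(_ (ltnSn 1)); rewrite coef_revp muln_gt0 s0 /= => e.
have : lead_coef Fp = 0 by rewrite /lead_coef sFp -subn1 e.
by move/eqP; rewrite lead_coef_eq0 -size_poly_eq0 sFp; move: s0; lia.
Qed.

Lemma revp_coprimeX m f k : f`_m != 0 -> coprimep (revp m f) 'X^k.
Proof.
move=> fm; rewrite coprimep_expr // coprimepX /root horner_coef0 coef_revp.
by rewrite leq0n subn0.
Qed.

(** The chain rule for [T -> 1/T]; its minus sign disappears in characteristic 2. *)
Lemma revp_deriv m f : (0 < m)%N -> (size f <= m.+1)%N ->
  revp m.-1 f^`() = revp m f *+ m + 'X * (revp m f)^`().
Proof.
move=> m0 sf; apply/polyP => j; rewrite coefD coefMn mulrC coefMX coef_revp coef_deriv.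
rewrite coef_deriv !coef_revp.
have mm (x : F) : x *+ m + x *+ m = 0 by rewrite addrr_pchar2.
have [jm|jm] := leqP j m; last first.
  rewrite ifF; last by move: jm m0; lia.
  case: j jm => [//|j] jm /=; rewrite ifF; last by move: jm; lia.
  by rewrite !mul0rn addr0.
have -> : (if j == 0 then 0 else (if (j.-1 < m)%N then f`_(m - j.-1.+1) else 0) *+ j.-1.+1)
  = f`_(m - j) *+ j.
  by case: j jm => [|j] jm /=; rewrite ?mulr0n // jm.
case: leqP => jm1.
  have -> : (m.-1 - j).+1 = (m - j)%N by move: jm1 jm m0; lia.
  move: (f`_(m - j)) => x; rewrite -{2}(subnK jm).
  by rewrite mulrnDr -addrA addrr_pchar2 // addr0.
by have -> : j = m; [move: jm jm1; lia|rewrite mm].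
Qed.

Lemma chi_infinity f : f \is monic ->
  psi (res (Fp * f^`()) f) = thinf (revp (size f).-1 f).
Proof.
move=> fm; set m := (size f).-1.
have sf : size f = m.+1 by rewrite /m prednK // size_poly_gt0 monic_neq0.
have Xm : ('X^s : {poly F}) \is monic by exact: monicXn.
have fm1 : f`_m = 1 by rewrite /m -/(lead_coef f) (monicP fm).
have cw : coprimep (revp m f) 'X^s by apply: revp_coprimeX; rewrite fm1 oner_neq0.
have [V hV] := theta_solve Binf cw.
rewrite (thetaE R cw hV) Xs2; rewrite Xs2 in hV.
have s20 : (0 < 2 * s)%N by rewrite muln_gt0 s0.
rewrite (res_Xn _ s20); congr psi.
have [m0|mp] := posnP m.
  have f1 : f = 1 by apply: monic_size1 => //; rewrite sf m0.
  have -> : revp m f = 1.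
    by rewrite m0 f1; have := @revpXn F 0 0 isT; rewrite expr0.
  by rewrite f1 derivC mulr0 res0 mulr0 coef0.
(* One more than a bound for the degree of [Fp f'], because [Binf] reverses [Fp] to length [2 s]
   although its degree is [2 s - 1]. *)
pose A := (2 * s + m.-1)%N.
have Am : (A - m).+1 = (2 * s)%N by rewrite /A; move: mp s0; lia.
have mA : (m <= A)%N by rewrite /A; move: mp s0; lia.
have sd : (size f^`() <= m)%N by rewrite -ltnS -sf lt_size_deriv // monic_neq0.
(* By [revp_deriv] this is a truncated quotient for [Fp f'/f]. Its first summand contributes a
   multiple of the constant coefficient of [Fp], which is zero. *)
rewrite (@res_revp F _ _ (Binf *+ m + 'X * (V * (revp m f)^`())) A) //.
- rewrite -/m Am coefD coefMn coef_revp leqnn subnn Fp0 mul0rn add0r.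
  by rewrite mulrC coefMX ifF //; move: s0; lia.
- have [->|Fz] := eqVneq Fp 0; first by rewrite mul0r size_poly0.
  have [->|fz] := eqVneq f^`() 0; first by rewrite mulr0 size_poly0.
  rewrite size_mul // sFp /A; move: sd fz; rewrite -size_poly_gt0.
  by move: (size _) mp => i; lia.
- rewrite -/m Am /A revpM ?sFp ?prednK // revp_deriv ?sf // -/Binf.
  have -> : (Binf *+ m + 'X * (V * (revp m f)^`())) * revp m f -
      Binf * (revp m f *+ m + 'X * (revp m f)^`()) =
      'X * (revp m f)^`() * (revp m f * V - Binf).
    rewrite mulrDl mulrDr [Binf *+ m * _]mulrnAl [Binf * (_ *+ m)]mulrnAr.
    by move: (Binf * revp m f *+ m) (revp m f) ((revp m f)^`()) => t w w'; ring.
  by rewrite exprS dvdp_mul // dvdp_mulr.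
Qed.

Variables (D B : {poly F}).
Hypothesis Dm : D \is monic.
Hypothesis BD : forall P, primeA P -> P %| D -> P %| B /\ ~~ (P ^+ 2 %| B).
Local Notation r := (size D).-1.
Local Notation thD := (theta R D B).

Let D0 : D != 0. Proof. exact: monic_neq0. Qed.
Let D2m : D ^+ 2 \is monic. Proof. exact: monic_exp. Qed.
Let D20 : D ^+ 2 != 0. Proof. exact: monic_neq0. Qed.
Let sD2 : size (D ^+ 2) = (2 * r).+1. Proof. exact: size_D2. Qed.
Let Xn0 n : 'X^n != 0 :> {poly F}. Proof. by rewrite monic_neq0 // monicXn. Qed.

Lemma size_quot m a : (size a <= 2 * r)%N ->
  (size ((a * 'X^(m.+1)) %/ D ^+ 2)%R <= m.+1)%N.
Proof.
move=> sa; have [->|a0] := eqVneq a 0; first by rewrite mul0r div0p size_poly0.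
by rewrite size_divp // sD2 size_mulXn //= leq_subLR addnC leq_add2r.
Qed.

(** Orthogonality at the finite and the infinite modulus together: the coefficient of [Q f] is the
    residue of [Q f/T^(m+1)]. Over the common denominator the numerator is [((c + Q0) D^2 + rho) f];
    it has no residue for all small [f] if [Q0 = c], and otherwise a power of ['X] detects its
    leading coefficient. *)
Lemma sum_psi_pair m a Q : (size a <= 2 * r)%N ->
  \sum_(f <- polys F m.+1) psi (res (a * f) (D ^+ 2) + (Q * f)`_m) =
  if Q %% 'X^(m.+1) == (a * 'X^(m.+1)) %/ D ^+ 2 then q ^+ m.+1 else 0.
Proof.
move=> sa; set Q0 := Q %% _; set c := _ %/ _; set rho := (a * 'X^(m.+1)) %% D ^+ 2.
have ea : a * 'X^(m.+1) = c * D ^+ 2 + rho by rewrite -divp_eq.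
have srho : (size rho <= 2 * r)%N by rewrite -ltnS -sD2 ltn_modp.
have XM : ('X^(m.+1) : {poly F}) \is monic by exact: monicXn.
have lE f : res (a * f) (D ^+ 2) + (Q * f)`_m =
  res (((c + Q0) * D ^+ 2 + rho) * f) (D ^+ 2 * 'X^(m.+1)).
  have -> : (Q * f)`_m = res (Q0 * f) 'X^(m.+1).
    rewrite (_ : (Q * f)`_m = res (Q * f) 'X^(m.+1)); last by rewrite res_Xn.
    by rewrite -res_mod mulrC -modp_mul res_mod mulrC.
  rewrite -(resM _ D2m XM) -(resM (Q0 * f) XM D2m) ['X^(m.+1) * _]mulrC -resD.
  congr (res _ _); rewrite mulrAC ea; ring.
under eq_bigr do rewrite lE.
have [e|ne] := eqVneq Q0 c.
  apply: sum_psi_triv => f sf; rewrite e addpp2 // mul0r add0r.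
  have [->|r0] := eqVneq rho 0; first by rewrite mul0r res0.
  have [->|f0] := eqVneq f 0; first by rewrite mulr0 res0.
  apply: res_small; rewrite size_mulXn // size_mul // sD2.
  move: srho sf r0 f0; rewrite -!size_poly_gt0; move: (size rho) (size f) => i j; lia.
set e := c + Q0; have e0 : e != 0.
  by apply: contraNneq ne => h; rewrite -subr_eq0 oppp2 // addrC -/e h.
have se : (size e <= m.+1)%N.
  rewrite (leq_trans (size_polyD _ _)) // geq_max size_quot //=.
  by rewrite -ltnS -[X in (_ < X)%N](size_polyXn F) ltn_modp.
pose k := (m.+1 - size e)%N.
have s1 : size (e * D ^+ 2 * 'X^k) = (2 * r + m.+1)%N.
  rewrite size_mulXn ?mulf_neq0 // size_mul // sD2 /k; move: se e0.
  by rewrite -size_poly_gt0; move: (size e) => i; lia.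
have s2 : (size (rho * 'X^k)%R < 2 * r + m.+1)%N.
  have [->|r0] := eqVneq rho 0; first by rewrite mul0r size_poly0; lia.
  rewrite size_mulXn // /k; move: se e0 srho; rewrite -size_poly_gt0.
  by move: (size e) (size rho) => i j; lia.
apply: (sum_psi_eq0 R char2 nxi (f0 := 'X^k)).
- by move=> p x; rewrite mulrDr resD.
- by move=> x p; rewrite -scalerAr resZ.
- by rewrite size_polyXn /k; move: se e0; rewrite -size_poly_gt0; move: (size e) => i; lia.
- have sN : size (D ^+ 2 * 'X^(m.+1)) = (2 * r + m.+1).+1.
    by rewrite size_mulXn // sD2 addnC addSn.
  rewrite mulrDl /res modp_small; last first.
    by rewrite size_polyDl s1 // sN.
  rewrite coefD [X in _ + X]nth_default; last first.
    by move: s2; rewrite sN /=; move: (size _) => i; lia.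
  rewrite addr0 sN -s1 -/(lead_coef _) lead_coef_eq0.
  by rewrite !mulf_neq0.
Qed.

Lemma pair_bij_quot m a Q : (size a <= 2 * r)%N ->
  Q %% 'X^(m.+1) = (a * 'X^(m.+1)) %/ D ^+ 2 ->
  (Q %/ 'X^(m.+1) * D ^+ 2 + a) * 'X^(m.+1) =
  Q * D ^+ 2 + (a * 'X^(m.+1)) %% D ^+ 2.
Proof.
move=> sa e; rewrite {2}(divp_eq Q 'X^(m.+1)) e mulrDl mulrAC mulrDl.
by rewrite [Q %/ _ * _ * _]mulrAC -addrA -divp_eq.
Qed.

(** Reversed modulo ['X^(2s)], the division [a T^(m+1) = Q D^2 + rho] loses [rho] and says that the
    reversal of [a] is that of [Q] times a square, on which [theta] is 1. *)
Lemma thinf_quot m a Q (rho : {poly F}) : a != 0 -> (size a <= 2 * r + 2 * s - 1 - m)%N ->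
  (size Q <= 2 * s)%N -> (size rho <= 2 * r)%N ->
  a * 'X^(m.+1) = Q * D ^+ 2 + rho ->
  thinf (revp (2 * s).-1 Q) = thinf (revp (2 * r + 2 * s - 2 - m) a).
Proof.
move=> a0 sa sQ srho e.
have Nm : (2 * r + 2 * s - 2 - m + m.+1 = (2 * s).-1 + 2 * r)%N.
  by move: sa a0 s0; rewrite -size_poly_gt0; move: (size a) => i; lia.
have sa' : (size a <= (2 * r + 2 * s - 2 - m).+1)%N.
  by move: sa a0 s0; rewrite -size_poly_gt0; move: (size a) => i; lia.
have Xm : ('X^s : {poly F}) \is monic by exact: monicXn.
have s20 : (0 < 2 * s)%N by rewrite muln_gt0 s0.
have sD : size D = r.+1 by rewrite prednK // size_poly_gt0.
have cD : coprimep (revp r D) 'X^s.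
  by apply: revp_coprimeX; rewrite -/(lead_coef D) (monicP Dm) oner_neq0.
have -> : thinf (revp (2 * r + 2 * s - 2 - m) a) =
   thinf (revp (2 * s).-1 Q * revp r D ^+ 2).
  apply: theta_mod => //; rewrite Xs2 -(revp_mulXn m.+1 sa') Nm e revpD.
  have -> : revp ((2 * s).-1 + 2 * r) (Q * D ^+ 2) = revp (2 * s).-1 Q * revp r D ^+ 2.
    rewrite revpM ?prednK ?sD2 //; congr (_ * _).
    by rewrite [D ^+ 2]expr2 [(2 * r)%N]mul2n -addnn revpM -?sD // expr2.
  rewrite addrAC subrr add0r.
  have [r0|rp] := posnP r.
    have -> : rho = 0 by apply/eqP; rewrite -size_poly_leq0; move: srho; rewrite r0.
    by rewrite -[0](scale0r (0 : {poly F})) revpZ scale0r dvdp0.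
  have -> : ((2 * s).-1 + 2 * r = (2 * r).-1 + 2 * s)%N by move: rp s20; lia.
  rewrite revp_small ?dvdp_mull // prednK //; by rewrite muln_gt0 rp.
by rewrite thetaM // theta_sqr // mulr1.
Qed.

(** Both characters are expanded by their Gauss sums and the sum over [f] is done first. It selects
    pairs of a class [a] modulo [D^2] and a polynomial [Q] at infinity, and these pairs correspond
    to single polynomials of bounded degree. *)
Lemma functional_equation_infinity m :
  q ^+ (r + s) * \sum_(f <- polys F m.+1) thD f * thinf (revp m f) =
  q ^+ m.+1 * \sum_(a <- polys F (2 * r + 2 * s - 1 - m))
     thD a * thinf (revp (2 * r + 2 * s - 2 - m) a).
Proof.
have Xm : ('X^s : {poly F}) \is monic by exact: monicXn.
have s20 : (0 < 2 * s)%N by rewrite muln_gt0 s0.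
have gt f : (size f <= m.+1)%N -> q ^+ s * thinf (revp m f) =
  \sum_(Q <- polys F (2 * s)) thinf (revp (2 * s).-1 Q) * psi ((Q * f)`_m).
  move=> sf; have := gauss R char2 nxi Xm Binf_cond (revp m f).
  rewrite size_polyXn /= => <-.
  rewrite (@big_seq_reindex _ _ _ _ _ (polys F (2 * s)) _ (revp (2 * s).-1)
     (revp (2 * s).-1)) ?polys_uniq //.
  - rewrite !big_seq; apply: eq_bigr => Q; rewrite mem_polys => sQ; congr (_ * psi _).
    rewrite Xs2 -revpM ?prednK // res_Xn // coef_revp leq_addr.
    by congr (_`_ _); rewrite addKn.
  - move=> Q; rewrite !mem_polys => sQ; rewrite revpK ?prednK //; split=> //.
    by rewrite (leq_trans (size_revp _ _)) // prednK.
  - move=> Q; rewrite !mem_polys => sQ; rewrite revpK ?prednK //; split=> //.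
    by rewrite (leq_trans (size_revp _ _)) // prednK.
have gD f : q ^+ r * thD f =
  \sum_(a <- polys F (2 * r)) thD a * psi (res (a * f) (D ^+ 2)).
  by rewrite -(gauss R char2 nxi Dm BD).
pose T a Q := thD a * thinf (revp (2 * s).-1 Q).
pose cond a Q := Q %% 'X^(m.+1) == (a * 'X^(m.+1)) %/ D ^+ 2.
have -> : q ^+ (r + s) * \sum_(f <- polys F m.+1) thD f * thinf (revp m f) =
   \sum_(a <- polys F (2 * r)) \sum_(Q <- polys F (2 * s))
      (if cond a Q then q ^+ m.+1 * T a Q else 0).
  transitivity (\sum_(f <- polys F m.+1) \sum_(a <- polys F (2 * r))
     \sum_(Q <- polys F (2 * s)) T a Q * psi (res (a * f) (D ^+ 2) + (Q * f)`_m)).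
    rewrite mulr_sumr !big_seq; apply: eq_bigr => f; rewrite mem_polys => sf.
    rewrite exprD mulrACA gD gt // big_distrlr /=; apply: eq_bigr => a _.
    by apply: eq_bigr => Q _; rewrite psiD // /T; ring.
  rewrite exchange_big /= !big_seq; apply: eq_bigr => a; rewrite mem_polys => sa.
  rewrite exchange_big /=; apply: eq_bigr => Q _.
  rewrite -mulr_sumr sum_psi_pair // /cond; case: ifP => _; last by rewrite mulr0.
  by rewrite mulrC.
pose pr := [seq x <- [seq (a, Q) | a <- polys F (2 * r), Q <- polys F (2 * s)]
             | cond x.1 x.2].
transitivity (\sum_(x <- pr) q ^+ m.+1 * T x.1 x.2).
  by rewrite [RHS]big_filter [RHS]big_mkcond [RHS]big_allpairs_dep.
have prP a Q : reflect [/\ cond a Q, (size a <= 2 * r)%N & (size Q <= 2 * s)%N]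
   ((a, Q) \in pr).
  rewrite mem_filter; apply: (iffP andP) => /=.
    by move=> [c /allpairsP [[a' Q'] /= []]]; rewrite !mem_polys => ? ? [ea eQ]; subst a' Q'.
  by move=> [c sa sQ]; split=> //; apply: (allpairs_f pair); rewrite mem_polys.
have upr : uniq pr.
  apply: filter_uniq; apply: allpairs_uniq; rewrite ?polys_uniq //.
  by move=> [? ?] [? ?].
(* A polynomial of degree below [N] yields its class modulo [D^2] and the quotient of its product
   with [T^(m+1)] by [D^2]; the high part of that quotient restores the multiple of [D^2] lost in
   the class. *)
pose h a : {poly F} * {poly F} := (a %% D ^+ 2, (a * 'X^(m.+1)) %/ D ^+ 2).
pose h' (x : {poly F} * {poly F}) := x.2 %/ 'X^(m.+1) * D ^+ 2 + x.1.
pose N := (2 * r + 2 * s - 1 - m)%N.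
have srho p : (size (p %% D ^+ 2)%R <= 2 * r)%N by rewrite -ltnS -sD2 ltn_modp.
have hP a : a \in polys F N -> h a \in pr /\ h' (h a) = a.
  rewrite mem_polys => sa; set a1 := a %% D ^+ 2; set Q := (a * 'X^(m.+1)) %/ D ^+ 2.
  pose p := a %/ D ^+ 2; pose c := (a1 * 'X^(m.+1)) %/ D ^+ 2.
  have sc : (size c < size ('X^(m.+1) : {poly F}))%N.
    by rewrite size_polyXn ltnS; apply: size_quot; exact: srho.
  have eQ : Q = p * 'X^(m.+1) + c.
    rewrite /Q {1}(divp_eq a (D ^+ 2)) -/p -/a1 mulrDl mulrAC.
    by rewrite divp_addl_mul.
  have Qm : Q %% 'X^(m.+1) = c by rewrite eQ modp_addl_mul_small.
  have Qd : Q %/ 'X^(m.+1) = p by rewrite eQ divp_addl_mul // (divp_small sc) addr0.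
  split; last by rewrite /h /h' /= -/Q Qd -/a1 /p /a1 -divp_eq.
  apply/prP; split; [by rewrite /cond Qm | exact: srho |].
  have [a0|a0] := eqVneq a 0; first by rewrite /Q a0 mul0r div0p size_poly0.
  rewrite /Q size_divp // sD2 size_mulXn //= leq_subLR.
  by apply: leq_shift_bound sa; rewrite size_poly_gt0.
have h'P (x : {poly F} * {poly F}) : x \in pr -> h' x \in polys F N /\ h (h' x) = x.
  case: x => a Q /prP [/eqP c sa sQ]; rewrite /h' /=.
  have e := pair_bij_quot sa c; set at_ := _ + a in e *.
  split; last first.
    rewrite /h; congr (_, _).
      by rewrite /at_ modp_addl_mul_small // sD2 ltnS.
    by rewrite e divp_addl_mul // (divp_small (p := _ %% _)) ?addr0 // ltn_modp.
  rewrite mem_polys; have [->|t0] := eqVneq at_ 0; first by rewrite size_poly0.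
  have : size (at_ * 'X^(m.+1)) = (m.+1 + size at_)%N by rewrite size_mulXn.
  rewrite e; set S := (size _).
  have : (S <= 2 * r + 2 * s)%N.
    rewrite /S (leq_trans (size_polyD _ _)) // geq_max (leq_trans (srho _)) ?leq_addr //.
    rewrite andbT; have [->|Q0] := eqVneq Q 0; first by rewrite mul0r size_poly0.
    rewrite size_mul // sD2; move: sQ Q0; rewrite -size_poly_gt0.
    by move: (size Q) => i; lia.
  by move: S => S; rewrite /N; move: (size at_) => i; lia.
rewrite (@big_seq_reindex _ _ _ _ _ (polys F N) pr h h') ?polys_uniq //.
rewrite mulr_sumr !big_seq; apply: eq_bigr => a aN; congr (_ * _).
rewrite /T /h /=; congr (_ * _).
  by apply: theta_mod => //; rewrite -opprB dvdpNr dvdp_modB.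
have [->|a0] := eqVneq a 0.
  by rewrite mul0r div0p -[0](scale0r (0 : {poly F})) !revpZ !scale0r.
have [/prP [_ _ sQ] _] := hP a aN.
apply: (thinf_quot a0 _ sQ (srho (a * 'X^(m.+1)))); last exact: divp_eq.
by move: aN; rewrite mem_polys.
Qed.

End Infinity.

Lemma val_balance (b c d e : nat) : ((0 < d -> b = 1) -> (0 < e -> c = 1) ->
  b + 2 * e = c + 2 * d -> d = e)%N.
Proof.
case: d => [|d]; case: e => [|e] // hb hc; try (have := hb isT); try (have := hc isT); lia.
Qed.

(** * Enumeration of the family F_n *)

Section Digits.
Variable F : finFieldType.
Implicit Types (P Q D B C E N M A f a b c d : {poly F}) (u w x y : ratfun F) (r : seq {poly F}) (v n i : nat).

Definition digs P : seq {poly F} := polys F (size P).-1.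

(** Digits are numbered from 0: pole order [2 i + 1] here is index [i + 1] in the definition of the
    family. *)
Definition dig_frac P i A : ratfun F := A%:K / (P ^+ (2 * i + 1))%:K.

Fixpoint allD P v : seq (ratfun F) :=
  if v is v'.+1 then [seq x + dig_frac P v' A | x <- allD P v', A <- digs P]
  else [:: 0].

(** Only the leading digit must be nonzero, hence the separation of the arbitrary lower digits
    [allD] from the last one. *)
Definition locP P v : seq (ratfun F) :=
  if v is v'.+1 then
    [seq x + dig_frac P v' A | x <- allD P v', A <- [seq A <- digs P | A != 0]]
  else [:: 0].

Fixpoint Vseq r D : seq (ratfun F) :=
  if r is P :: r' then [seq x + y | x <- locP P (valA P D), y <- Vseq r' D]
  else [:: 0].

Lemma mem_digs P A : primeA P -> (A \in digs P) = (size A < size P)%N.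
Proof.
by move=> Pp; rewrite mem_polys; have := primeA_size Pp; case: (size P).
Qed.

Lemma digs_dvd P A : primeA P -> (size A < size P)%N -> P %| A -> A = 0.
Proof.
move=> Pp sA dA; apply/eqP; apply: contraT => A0.
by have := dvdp_leq A0 dA; rewrite leqNgt sA.
Qed.

Lemma pow_odd_step P v : P ^+ (2 * v + 1) = P ^+ (2 * v) * P.
Proof. by rewrite exprD expr1. Qed.

Lemma pow_even_step P v : P ^+ (2 * v.+1) = P ^+ (2 * v) * P ^+ 2.
Proof. by rewrite mulnSr exprD. Qed.

Definition proper N u := exists2 B : {poly F}, (size B < size N)%N & u = B%:K / N%:K.

Lemma proper0 N : N != 0 -> proper N 0.
Proof. by exists 0; rewrite ?size_poly0 ?size_poly_gt0 // tofrac0 mul0r. Qed.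

Lemma size_mul_lt a b c d : (size a < size b)%N ->
  (size c <= size d)%N -> d != 0 ->
  (size (a * c)%R < size (b * d)%R)%N.
Proof.
move=> ab cd d0.
have b0 : b != 0 by rewrite -size_poly_gt0; apply: leq_trans ab.
have [->|a0] := eqVneq a 0; first by rewrite mul0r size_poly0 size_poly_gt0 mulf_neq0.
have [->|c0] := eqVneq c 0; first by rewrite mulr0 size_poly0 size_poly_gt0 mulf_neq0.
rewrite !size_mul //; move: ab cd c0 a0; rewrite -!size_poly_gt0.
move: (size a) (size b) (size c) (size d) => i j k l; lia.
Qed.

Lemma properD N M u w : N != 0 -> M != 0 -> proper N u -> proper M w ->
  proper (N * M) (u + w).
Proof.
move=> N0 M0 [B sB ->] [C sC ->]; rewrite frac_add //.
exists (B * M + C * N) => //; rewrite (leq_ltn_trans (size_polyD _ _)) // gtn_max.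
by rewrite size_mul_lt //= [N * M]mulrC size_mul_lt.
Qed.

Lemma dig_frac_proper P i A : primeA P -> (size A < size P)%N ->
  proper (P ^+ (2 * i + 1)) (dig_frac P i A).
Proof.
move=> Pp sA; exists A => //; apply: (leq_trans sA); rewrite addn1 exprS.
rewrite size_mul ?expf_neq0 ?primeA_neq0 //.
have : (0 < size (P ^+ (2 * i))%R)%N by rewrite size_poly_gt0 expf_neq0 // primeA_neq0.
by move: (size P) (size _) => k l; lia.
Qed.

Lemma allD_proper P v u : primeA P -> u \in allD P v -> proper (P ^+ (2 * v)) u.
Proof.
move=> Pp; have P0 := primeA_neq0 Pp; elim: v u => [|v IH] u.
  by rewrite inE => /eqP ->; apply: proper0; rewrite expr0 oner_neq0.
move=> /allpairsP [[x A] /= [/IH [C sC ->]]]; rewrite mem_digs // => sA ->.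
rewrite /dig_frac frac_add ?expf_neq0 //.
exists (C * P ^+ 2 + A * P); last first.
  apply/frac_eq; rewrite ?mulf_neq0 ?expf_neq0 // pow_odd_step pow_even_step.
  by move: (P ^+ (2 * v)) => N; ring.
have e : P ^+ (2 * v.+1) = P ^+ (2 * v) * P ^+ 2 by rewrite mulnSr exprD.
rewrite e (leq_ltn_trans (size_polyD _ _)) // gtn_max; apply/andP; split.
  by rewrite size_mul_lt // expf_neq0.
have lt : (size (A * P)%R < size (P ^+ 2)%R)%N by rewrite expr2 size_mul_lt.
apply: (leq_trans lt); apply: dvdp_leq; rewrite ?mulf_neq0 ?expf_neq0 //.
exact: dvdp_mull.
Qed.

Lemma locP_spec P v u : primeA P -> u \in locP P v ->
  exists B, [/\ u = B%:K / (P ^+ (2 * v))%:K, (size B < size (P ^+ (2 * v)))%N &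
    (0 < v)%N -> P %| B /\ ~~ (P ^+ 2 %| B)].
Proof.
move=> Pp; have P0 := primeA_neq0 Pp; case: v => [|v].
  rewrite inE => /eqP ->; exists 0; rewrite tofrac0 mul0r size_poly0.
  by rewrite size_poly_gt0 expf_neq0.
move=> /allpairsP [[x A] /= [/(allD_proper Pp) [C sC ->]]].
rewrite mem_filter mem_digs // => /andP[A0 sA] ->.
exists (C * P ^+ 2 + A * P); split.
- rewrite /dig_frac frac_add ?expf_neq0 //.
  apply/frac_eq; rewrite ?mulf_neq0 ?expf_neq0 // pow_odd_step pow_even_step.
  by move: (P ^+ (2 * v)) => N; ring.
- have e : P ^+ (2 * v.+1) = P ^+ (2 * v) * P ^+ 2 by rewrite mulnSr exprD.
  rewrite e (leq_ltn_trans (size_polyD _ _)) // gtn_max; apply/andP; split.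
    by rewrite size_mul_lt // expf_neq0.
  have lt : (size (A * P)%R < size (P ^+ 2)%R)%N by rewrite expr2 size_mul_lt.
  apply: (leq_trans lt); apply: dvdp_leq; rewrite ?mulf_neq0 ?expf_neq0 //.
  exact: dvdp_mull.
- move=> _; split; first by rewrite dvdp_add // ?dvdp_mull // expr2 dvdp_mulr.
  rewrite dvdp_addr; last exact: dvdp_mull.
  rewrite expr2 dvdp_mul2r //; by apply: contra A0 => dA; apply/eqP; exact: digs_dvd dA.
Qed.

Definition Dr r D : {poly F} := \prod_(P <- r) P ^+ valA P D.

(* Since the pole of [u] at [P] has odd order [2 v - 1], writing [u = B/D^2] with
   [v = valA P D] leaves exactly one factor [P] in [B]. *)
Definition simple_poles D B :=
  forall P, primeA P -> P %| D -> P %| B /\ ~~ (P ^+ 2 %| B).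

Lemma Vseq_spec r D u : uniq r -> (forall P, P \in r -> primeA P) ->
  u \in Vseq r D -> exists B, [/\ u = B%:K / (Dr r D ^+ 2)%:K,
    (size B < size (Dr r D ^+ 2))%N & simple_poles (Dr r D) B].
Proof.
elim: r u => [|P r IH] u.
  move=> _ _; rewrite inE => /eqP ->; exists 0; rewrite tofrac0 mul0r size_poly0 /Dr big_nil.
  rewrite size_poly_gt0 expr1n oner_neq0; split=> // P Pp.
  by rewrite primeA_not_dvd1.
move=> /= /andP[Pr ur] pr /allpairsP [[x y] /= [hx hy ->]].
have Pp : primeA P by apply: pr; rewrite mem_head.
have pr' Q : Q \in r -> primeA Q by move=> h; apply: pr; rewrite inE h orbT.
have P0 := primeA_neq0 Pp.
have [B1 [-> s1 h1]] := locP_spec Pp hx.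
have [B2 [-> s2 h2]] := IH y ur pr' hy.
set v := valA P D in s1 h1 *; set E := Dr r D in s2 h2 *.
have Em : E \is monic by exact: prime_prod_monic.
have E0 := monic_neq0 Em.
have DE : Dr (P :: r) D = P ^+ v * E by rewrite /Dr big_cons.
have DE2 : Dr (P :: r) D ^+ 2 = P ^+ (2 * v) * E ^+ 2.
  by rewrite DE exprMn -exprM mulnC.
have nPE : ~~ (P %| E).
  rewrite val_dvd // /E /Dr val_prodX //.
  by rewrite (negbTE Pr).
have nP2 k : P ^+ k != 0 by rewrite expf_neq0.
exists (B1 * E ^+ 2 + B2 * P ^+ (2 * v)); split.
- by rewrite frac_add ?expf_neq0 // DE2.
- rewrite DE2 (leq_ltn_trans (size_polyD _ _)) // gtn_max.
  rewrite size_mul_lt ?expf_neq0 //= [P ^+ _ * _]mulrC size_mul_lt //.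
- move=> Q Qp; rewrite DE primeA_dvdM // => dQ.
  have [eQ|neQ] := eqVneq Q P.
    subst Q.
    have vp : (0 < v)%N.
      move: dQ; rewrite (negbTE nPE) orbF lt0n; apply: contraTneq => ->.
      by rewrite expr0 primeA_not_dvd1.
    have [d1 n1] := h1 vp.
    have d2 : P ^+ 2 %| B2 * P ^+ (2 * v).
      by rewrite dvdp_mull // dvdp_exp2l // leq_pmulr.
    split.
      rewrite dvdp_add ?(dvdp_mulr _ d1) // (dvdp_trans _ d2) //.
      by rewrite expr2 dvdp_mulr.
    rewrite dvdp_addl // Gauss_dvdpl // coprimep_expl // coprimep_expr //.
    by rewrite primeA_coprime.
  have nQP : ~~ (Q %| P ^+ v).
    by apply/negP => /(primeA_dvdX Qp) /(primeA_dvd Qp Pp) /eqP; rewrite (negbTE neQ).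
  have dE : Q %| E by move: dQ; rewrite (negbTE nQP).
  have [d1 n1] := h2 Q Qp dE.
  have d2 : Q ^+ 2 %| B1 * E ^+ 2 by rewrite dvdp_mull // dvdp_exp2r.
  have cQ : coprimep (Q ^+ 2) (P ^+ (2 * v)).
    rewrite coprimep_expl // coprimep_expr // primeA_coprime //.
    by apply/negP => /(primeA_dvd Qp Pp) /eqP; rewrite (negbTE neQ).
  split.
    rewrite dvdp_add ?(dvdp_mulr _ d1) // (dvdp_trans _ d2) //.
    by rewrite expr2 dvdp_mulr.
  by rewrite dvdp_addr // Gauss_dvdpl.
Qed.

(** Clearing denominators gives [(C - C') P = A' - A], and a multiple of [P] of smaller degree is
    zero. *)
Lemma dig_sum_inj P v x x' A A' : primeA P -> proper (P ^+ (2 * v)) x ->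
  proper (P ^+ (2 * v)) x' -> (size A < size P)%N -> (size A' < size P)%N ->
  x + dig_frac P v A = x' + dig_frac P v A' -> x = x' /\ A = A'.
Proof.
move=> Pp [C sC ->] [C' sC' ->] sA sA'; have P0 := primeA_neq0 Pp.
have nP k : P ^+ k != 0 by rewrite expf_neq0.
rewrite /dig_frac !frac_add // => /(frac_eq _ _ (mulf_neq0 (nP _) (nP _)) (mulf_neq0 (nP _) (nP _))).
move=> /(mulIf (mulf_neq0 (nP _) (nP _))); rewrite addn1 exprS.
move: (P ^+ (2 * v)) (nP (2 * v)%N) sC sC' => N N0 sC sC' e.
have e2 : (C - C') * P = A' - A.
  apply: (mulIf N0); move: e => /eqP; rewrite -subr_eq0 => /eqP e.
  apply/eqP; rewrite -subr_eq0; apply/eqP; rewrite -[RHS]e; ring.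
have eA : A' - A = 0.
  apply: (digs_dvd Pp); last by rewrite -e2 dvdp_mull.
  by rewrite (leq_ltn_trans (size_polyD _ _)) // size_polyN gtn_max sA sA'.
move: e2; rewrite eA => /eqP; rewrite mulf_eq0 (negbTE P0) orbF subr_eq0 => /eqP ->.
by split=> //; apply/eqP; rewrite eq_sym -subr_eq0 eA.
Qed.

Lemma allD_uniq P v : primeA P -> uniq (allD P v).
Proof.
move=> Pp; elim: v => //= v IH; apply: allpairs_uniq => //; first exact: polys_uniq.
move=> [x A] [x' A'] /allpairsP [[? ?] /= [hx hA [-> ->]]].
move=> /allpairsP [[? ?] /= [hx' hA' [-> ->]]] /=; rewrite !mem_digs // in hA hA' => e.
by have [-> ->] := dig_sum_inj Pp (allD_proper Pp hx) (allD_proper Pp hx') hA hA' e.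
Qed.

Lemma locP_uniq P v : primeA P -> uniq (locP P v).
Proof.
move=> Pp; case: v => //= v; apply: allpairs_uniq; rewrite ?allD_uniq //.
  by rewrite filter_uniq // polys_uniq.
move=> [x A] [x' A'] /allpairsP [[? ?] /= [hx hA [-> ->]]].
move=> /allpairsP [[? ?] /= [hx' hA' [-> ->]]] /=.
rewrite !mem_filter !mem_digs // in hA hA' => e.
case/andP: hA => _ hA; case/andP: hA' => _ hA'.
by have [-> ->] := dig_sum_inj Pp (allD_proper Pp hx) (allD_proper Pp hx') hA hA' e.
Qed.

Lemma proper_coprime_inj N M u u' w w' : N != 0 -> M != 0 -> coprimep N M ->
  proper N u -> proper N u' -> proper M w -> proper M w' ->
  u + w = u' + w' -> u = u' /\ w = w'.
Proof.
move=> N0 M0 cNM [B sB ->] [B' sB' ->] [C sC ->] [C' sC' ->].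
have NM0 := mulf_neq0 N0 M0.
rewrite !frac_add // => /(frac_eq _ _ NM0 NM0) /(mulIf NM0) e.
have e2 : (B - B') * M = (C' - C) * N.
  move: e => /eqP; rewrite -subr_eq0 => /eqP e.
  apply/eqP; rewrite -subr_eq0; apply/eqP; rewrite -[RHS]e; ring.
have eB : B - B' = 0.
  apply/eqP; apply: contraT => B0.
  have : N %| B - B' by rewrite -(Gauss_dvdpl _ cNM) e2 dvdp_mull.
  move=> /(dvdp_leq B0); rewrite leqNgt => /negP; case.
  by rewrite (leq_ltn_trans (size_polyD _ _)) // size_polyN gtn_max sB sB'.
move: e2; rewrite eB mul0r => /esym /eqP; rewrite mulf_eq0 (negbTE N0) orbF subr_eq0.
move=> /eqP ->; split=> //; congr (_%:K / _); apply/eqP; by rewrite -subr_eq0 eB.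
Qed.

Lemma Vseq_uniq r D : uniq r -> (forall P, P \in r -> primeA P) -> uniq (Vseq r D).
Proof.
elim: r => //= P r IH /andP[Pr ur] pr.
have Pp : primeA P by apply: pr; rewrite mem_head.
have pr' Q : Q \in r -> primeA Q by move=> h; apply: pr; rewrite inE h orbT.
have P0 := primeA_neq0 Pp.
apply: allpairs_uniq; [exact: locP_uniq|exact: IH|].
move=> [x y] [x' y'] /allpairsP [[? ?] /= [hx hy [-> ->]]].
move=> /allpairsP [[? ?] /= [hx' hy' [-> ->]]] /= e.
have [B1 [e1 s1 _]] := locP_spec Pp hx; have [B1' [e1' s1' _]] := locP_spec Pp hx'.
have [B2 [e2 s2 _]] := Vseq_spec ur pr' hy.
have [B2' [e2' s2' _]] := Vseq_spec ur pr' hy'.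
have Em : Dr r D \is monic by exact: prime_prod_monic.
have [|||||||-> ->] := @proper_coprime_inj (P ^+ (2 * valA P D)) (Dr r D ^+ 2) _ _ _ _ _ _ _ _ _ _ _ e => //.
- by rewrite expf_neq0.
- by rewrite expf_neq0 // monic_neq0.
- rewrite coprimep_expl // coprimep_expr // primeA_coprime //.
  rewrite val_dvd // ?monic_neq0 // /Dr val_prodX // (negbTE Pr) //.
- by exists B1.
- by exists B1'.
- by exists B2.
- by exists B2'.
Qed.

(** At a prime of [D] with exponent [v] the fraction has valuation [1 - 2v], so its pole orders
    determine [D]. The zero fraction is separate: it forces both denominators to have no prime
    factor. *)
Lemma simple_poles_inj D E B C : D \is monic -> E \is monic ->
  simple_poles D B -> simple_poles E C ->
  B%:K / (D ^+ 2)%:K = C%:K / (E ^+ 2)%:K :> ratfun F -> D = E.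
Proof.
move=> Dm Em hB hC; have D0 := monic_neq0 Dm; have E0 := monic_neq0 Em.
have D20 : D ^+ 2 != 0 by rewrite expf_neq0.
have E20 : E ^+ 2 != 0 by rewrite expf_neq0.
move=> /(frac_eq _ _ D20 E20) e; apply: eq_val => // P Pp.
have vB : (0 < valA P D)%N -> B != 0 -> valA P B = 1%N.
  by rewrite -val_dvd // => /(hB P Pp) [d n] B0; apply: valE => //; rewrite expr1.
have vC : (0 < valA P E)%N -> C != 0 -> valA P C = 1%N.
  by rewrite -val_dvd // => /(hC P Pp) [d n] C0; apply: valE => //; rewrite expr1.
have [B0|B0] := eqVneq B 0.
  have C0 : C = 0.
    by move: e => /esym /eqP; rewrite B0 mul0r mulf_eq0 (negbTE D20) orbF => /eqP.
  have -> : valA P D = 0%N.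
    apply/eqP; rewrite -leqn0 leqNgt -val_dvd //; apply/negP => /(hB P Pp) [_].
    by rewrite B0 dvdp0.
  apply/esym/eqP; rewrite -leqn0 leqNgt -val_dvd //; apply/negP => /(hC P Pp) [_].
  by rewrite C0 dvdp0.
have C0 : C != 0.
  by apply: contraNneq B0 => C0; move: e => /eqP; rewrite C0 mul0r mulf_eq0 (negbTE E20) orbF.
move: (congr1 (valA P) e).
rewrite (valM Pp B0 E20) (valM Pp C0 D20) (valX _ Pp E0) (valX _ Pp D0).
apply: val_balance => h; [exact: vB|exact: vC].
Qed.

Definition Fseq n : seq (ratfun F) := flatten [seq Vseq (prs F n) D | D <- monics F n].

Lemma Dr_monics n D : D \in monics F n -> Dr (prs F n) D = D.
Proof.
move=> hD; rewrite /Dr -factorization //; first exact: monics_monic hD.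
by rewrite (monics_size hD).
Qed.

Lemma Vseq_prs_spec n D u : D \in monics F n -> u \in Vseq (prs F n) D ->
  exists B, [/\ u = B%:K / (D ^+ 2)%:K, (size B < size (D ^+ 2))%N & simple_poles D B].
Proof.
move=> hD hu; have := Vseq_spec (prs_uniq F n) (@prs_prime F n) hu.
by rewrite Dr_monics.
Qed.

Lemma Fseq_uniq n : uniq (Fseq n).
Proof.
have H (s : seq {poly F}) : {subset s <= monics F n} -> uniq s ->
   uniq (flatten [seq Vseq (prs F n) D | D <- s]).
  elim: s => //= D s IH ss /andP[Ds us]; rewrite cat_uniq.
  rewrite Vseq_uniq ?prs_uniq //; last exact: prs_prime.
  rewrite IH // ?andbT /=; last by move=> E Es; apply: ss; rewrite inE Es orbT.
  apply/hasPn => u /flattenP [t /mapP [E Es ->]] hE /=; apply/negP => hD.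
  have Dn : D \in monics F n by apply: ss; rewrite mem_head.
  have En : E \in monics F n by apply: ss; rewrite inE Es orbT.
  have [B [eB _ pB]] := Vseq_prs_spec Dn hD.
  have [C [eC _ pC]] := Vseq_prs_spec En hE.
  move: Ds; suff -> : D = E by rewrite Es.
  apply: (simple_poles_inj _ _ pB pC); last by rewrite -eB.
    exact: monics_monic Dn.
  exact: monics_monic En.
by apply: H; rewrite ?monics_uniq.
Qed.

Definition dig_sum P v (a : nat -> {poly F}) : ratfun F :=
  \sum_(1 <= i < v.+1) (a i)%:K / (P ^+ (2 * i - 1))%:K.

Lemma dig_sumS P v (a : nat -> {poly F}) : dig_sum P v.+1 a = dig_sum P v a + dig_frac P v (a v.+1).
Proof.
rewrite /dig_sum big_nat_recr //=; congr (_ + _%:K / (_ ^+ _)%:K); lia.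
Qed.

Definition digits P v (a : nat -> {poly F}) :=
  forall i, (1 <= i <= v)%N -> (size (a i) < size P)%N.

Lemma eq_dig_sum P v (a b : nat -> {poly F}) :
  (forall i, (1 <= i <= v)%N -> a i = b i) -> dig_sum P v a = dig_sum P v b.
Proof.
by move=> h; apply: eq_big_nat => i; rewrite ltnS => /h ->.
Qed.

Lemma mem_allD P v u : primeA P ->
  u \in allD P v <-> exists2 a : nat -> {poly F}, digits P v a & u = dig_sum P v a.
Proof.
move=> Pp; elim: v u => [|v IH] u.
  rewrite inE; split=> [/eqP ->|[a _ ->]]; last by rewrite /dig_sum big_geq.
  by exists (fun=> 0) => [i|]; [case: i|rewrite /dig_sum big_geq].
split=> [/allpairsP [[x A] /= [/IH [a ha ->]]]|[a ha ->]].
  rewrite mem_digs // => sA ->.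
  exists (fun i => if i == v.+1 then A else a i) => [i hi|].
    case: eqP => // ne; apply: ha; move: hi ne; lia.
  rewrite dig_sumS eqxx; congr (_ + _); apply: eq_dig_sum => i hi.
  by case: eqP => // ne; move: hi ne; lia.
rewrite dig_sumS; apply: (allpairs_f (fun x A => x + dig_frac P v A)).
  by apply/IH; exists a => // i hi; apply: ha; move: hi; lia.
by rewrite mem_digs //; apply: ha; lia.
Qed.

Lemma mem_locP P v u : primeA P -> u \in locP P v <->
  exists a : nat -> {poly F}, [/\ digits P v a, (0 < v)%N -> a v != 0 & u = dig_sum P v a].
Proof.
move=> Pp; case: v => [|v].
  rewrite inE; split=> [/eqP ->|[a [_ _ ->]]]; last by rewrite /dig_sum big_geq.
  by exists (fun=> 0); split=> // [i|]; [case: i|rewrite /dig_sum big_geq].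
split=> [/allpairsP [[x A] /= [/mem_allD]]|[a [ha a0 ->]]].
  move=> /(_ Pp) [a ha ->]; rewrite mem_filter mem_digs // => /andP[A0 sA] ->.
  exists (fun i => if i == v.+1 then A else a i); split=> [i hi|_|].
  - case: eqP => // ne; apply: ha; move: hi ne; lia.
  - by rewrite eqxx.
  - rewrite dig_sumS eqxx; congr (_ + _); apply: eq_dig_sum => i hi.
    by case: eqP => // ne; move: hi ne; lia.
rewrite dig_sumS; apply: (allpairs_f (fun x A => x + dig_frac P v A)).
  by apply/mem_allD => //; exists a => // i hi; apply: ha; move: hi; lia.
by rewrite mem_filter a0 // mem_digs //; apply: ha; lia.
Qed.

Lemma mem_Vseq r D u : uniq r -> (forall P, P \in r -> primeA P) ->
  u \in Vseq r D <-> exists a : {poly F} -> nat -> {poly F},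
   [/\ forall P, P \in r -> digits P (valA P D) (a P),
       forall P, P \in r -> (0 < valA P D)%N -> a P (valA P D) != 0 &
       u = \sum_(P <- r) dig_sum P (valA P D) (a P)].
Proof.
elim: r u => [|P r IH] u.
  move=> _ _; rewrite inE; split=> [/eqP ->|[a [_ _ ->]]]; last by rewrite big_nil.
  by exists (fun _ _ => 0); split=> //; rewrite big_nil.
move=> /= /andP[Pr ur] pr.
have Pp : primeA P by apply: pr; rewrite mem_head.
have pr' Q : Q \in r -> primeA Q by move=> h; apply: pr; rewrite inE h orbT.
split=> [/allpairsP [[x y] /= [/mem_locP]]|[a [h1 h2 ->]]].
  move=> /(_ Pp) [a0 [d0 n0 ->]] /(IH _ ur pr') [a [d n ->]] ->.
  pose b Q := if Q == P then a0 else a Q.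
  have bP : b P = a0 by rewrite /b eqxx.
  have br Q : Q \in r -> b Q = a Q.
    by rewrite /b; case: eqP => // ->; rewrite (negbTE Pr).
  exists b; split=> [Q|Q|].
  - by rewrite inE => /orP[/eqP ->|Qr]; rewrite ?bP // br //; exact: d.
  - by rewrite inE => /orP[/eqP ->|Qr]; rewrite ?bP // br //; exact: n.
  - rewrite big_cons bP; congr (_ + _); rewrite !big_seq; apply: eq_bigr => Q Qr.
    by rewrite br.
rewrite big_cons; apply: (allpairs_f (fun x y => x + y)).
  apply/mem_locP => //; exists (a P); split=> //; [apply: h1|apply: h2]; exact: mem_head.
apply/IH => //; exists a; split=> // Q Qr; [apply: h1|apply: h2]; by rewrite inE Qr orbT.
Qed.

Lemma mem_Fseq n u :
  u \in Fseq n <-> exists2 D, D \in monics F n & u \in Vseq (prs F n) D.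
Proof.
split=> [/flattenP [t /mapP [D hD ->]] hu|[D hD hu]]; first by exists D.
by apply/flattenP; exists (Vseq (prs F n) D) => //; exact: map_f.
Qed.

Lemma ellA_ndvd M P : primeA P -> M != 0 -> ~~ (P %| M) -> ellA M P = 0%N.
Proof. by move=> Pp M0 nd; rewrite /ellA val_ndvd. Qed.

Lemma tildeA_prod n M : M \is monic ->
  (forall P, primeA P -> P %| M -> (size P <= n.+1)%N) ->
  tildeA M = \prod_(P <- prs F n) P ^+ ellA M P.
Proof.
move=> Mm h; have M0 := monic_neq0 Mm; apply: fsbig_fwiden.
- by move=> P [Pp dP]; apply/mem_prs; split=> //; exact: h.
- exact: prs_uniq.
- move=> P [/= /prs_prime Pp np]; change (P ^+ ellA M P = 1); rewrite ellA_ndvd //.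
  by apply/negP => dP; apply: np.
Qed.

Lemma val_tildeA M P : M \is monic -> primeA P -> valA P (tildeA M) = ellA M P.
Proof.
move=> Mm Pp; have M0 := monic_neq0 Mm.
have h Q : primeA Q -> Q %| M -> (size Q <= (size M).+1)%N.
  by move=> Qp dQ; apply: leqW; exact: dvdp_leq.
rewrite (tildeA_prod Mm h) val_prodX ?prs_uniq //; last exact: prs_prime.
case: ifPn => // /negP Pn; rewrite ellA_ndvd //; apply/negP => dP.
by apply: Pn; apply/mem_prs; split=> //; exact: h.
Qed.

Lemma tildeA_monic M : M \is monic -> tildeA M \is monic.
Proof.
move=> Mm; rewrite (@tildeA_prod (size M)) //; last first.
  by move=> Q Qp dQ; apply: leqW; apply: dvdp_leq; rewrite ?monic_neq0.
by apply: prime_prod_monic => Q; exact: prs_prime.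
Qed.

Lemma Fset_sum_prs n M (a : {poly F} -> nat -> {poly F}) : M \is monic ->
  (forall P, primeA P -> P %| M -> (size P <= n.+1)%N) ->
  \sum_(P \in prime_divisors M) dig_sum P (ellA M P) (a P) =
  \sum_(P <- prs F n) dig_sum P (ellA M P) (a P).
Proof.
move=> Mm h; have M0 := monic_neq0 Mm; apply: fsbig_fwiden.
- by move=> P [Pp dP]; apply/mem_prs; split=> //; exact: h.
- exact: prs_uniq.
- move=> P [/= /prs_prime Pp np]; change (dig_sum P (ellA M P) (a P) = 0).
  rewrite ellA_ndvd //.
    by rewrite /dig_sum big_geq.
  by apply/negP => dP; apply: np.
Qed.

Lemma ellA_gt0 M P : primeA P -> M != 0 -> P %| M -> (0 < ellA M P)%N.
Proof. by move=> Pp M0; rewrite val_dvd // /ellA; case: valA. Qed.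

(** The family is indexed by [M], the list by [D], which is [tildeA M]; the exponents correspond by
    [2v - 1] and [v]. *)
Lemma Fset_Fseq n u : Fset F n u <-> u \in Fseq n.
Proof.
case: n => [|n].
  rewrite /Fseq monics0 /= cats0.
  have -> : prs F 0 = [::].
    apply/eqP; rewrite -size_eq0 -leqn0 leqNgt; apply/negP.
    case e : (prs F 0) => [//|P t] _; have /mem_prs [Pp] : P \in prs F 0 by rewrite e mem_head.
    by rewrite leqNgt primeA_size.
  by rewrite inE; split=> [->//|/eqP].
rewrite mem_Fseq; split.
  move=> [M [a [[[Mm odd_M] sM] h1 h2 ->]]]; have M0 := monic_neq0 Mm.
  have Dm := tildeA_monic Mm; have hD : tildeA M \in monics F n.+1.
    by rewrite mem_monics Dm sM eqxx.
  have sP P : primeA P -> P %| M -> (size P <= n.+2)%N.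
    move=> Pp dP; rewrite -sM; apply: dvdp_leq; first exact: monic_neq0.
    by rewrite val_dvd ?monic_neq0 // val_tildeA // ellA_gt0.
  exists (tildeA M) => //.
  apply/(mem_Vseq _ _ (prs_uniq F _)); first exact: prs_prime.
  exists a; split.
  - move=> P /prs_prime Pp i; rewrite val_tildeA // => hi; apply: h1 => //; split=> //.
    by apply: contraT => nd; move: hi; rewrite ellA_ndvd //; lia.
  - move=> P /prs_prime Pp; rewrite val_tildeA // => hp; apply: h2; split=> //.
    by apply: contraT => nd; move: hp; rewrite ellA_ndvd.
  - rewrite (Fset_sum_prs a Mm sP) !big_seq; apply: eq_bigr => P /prs_prime Pp.
    by rewrite val_tildeA.
move=> [D hD hu]; have Dm := monics_monic hD; have D0 := monic_neq0 Dm.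
have sD := monics_size hD.
have /(mem_Vseq _ _ (prs_uniq F _) (@prs_prime F _)) [a [h1 h2 eu]] := hu.
(* The truncated predecessor sends [2 * 0] to 0, so primes not dividing [D] do not enter [M]. *)
pose M := \prod_(P <- prs F n.+1) P ^+ (2 * valA P D).-1.
have Mm : M \is monic by apply: prime_prod_monic => Q; exact: prs_prime.
have M0 := monic_neq0 Mm.
have vM P : primeA P -> valA P M = (2 * valA P D).-1.
  move=> Pp; rewrite /M val_prodX ?prs_uniq //; last exact: prs_prime.
  case: ifPn => // /negP nP; rewrite val_ndvd //; apply/negP => dP; apply: nP.
  by apply: prs_dvd dP => //; rewrite sD.
have eM P : primeA P -> ellA M P = valA P D.
  by move=> Pp; rewrite /ellA vM //; case: valA => // v; rewrite mul2n doubleS /= doubleK.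
have sP P : primeA P -> P %| M -> (size P <= n.+2)%N.
  move=> Pp; rewrite val_dvd // vM // => hv; rewrite -sD; apply: dvdp_leq => //.
  by rewrite val_dvd //; move: hv; case: valA.
have tM : tildeA M = D.
  rewrite (tildeA_prod Mm sP) [RHS](@factorization F n.+1) ?sD // !big_seq.
  by apply: eq_bigr => P /prs_prime Pp; rewrite eM.
have prsM P : prime_divisors M P -> P \in prs F n.+1.
  by move=> [Pp dP]; apply/mem_prs; split=> //; exact: sP.
exists M, a; split.
- split; last by rewrite tM sD.
  split=> // P Pp; rewrite vM //; case: valA => [|v]; [by left|right].
  by rewrite mul2n doubleS /= odd_double.
- by move=> P i hP; have [Pp _] := hP; rewrite eM // => hi; apply: h1 => //; exact: prsM.
- move=> P hP; have [Pp dP] := hP; rewrite eM //; apply: h2; first exact: prsM.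
  by rewrite -eM // ellA_gt0.
- rewrite -/(dig_sum _ _ _) (Fset_sum_prs a Mm sP) eu !big_seq.
  by apply: eq_bigr => P /prs_prime Pp; rewrite eM.
Qed.

Lemma fsbig_Fset (T : Type) (idx : T) (op : Monoid.com_law idx) n
    (G : ratfun F -> T) :
  \big[op/idx]_(u \in Fset F n) G u =
  \big[op/idx]_(D <- monics F n) \big[op/idx]_(u <- Vseq (prs F n) D) G u.
Proof.
have -> : Fset F n = [set` Fseq n] by apply/seteqP; split=> u /Fset_Fseq.
by rewrite -fsbig_seq ?Fseq_uniq // /Fseq big_flatten big_map.
Qed.

End Digits.

(** * Multiples and divisors of a polynomial *)

Section Divisors.
Variable F : finFieldType.
Implicit Types (P D E b : {poly F}) (n : nat).

Lemma big_monics_dvd (T : Type) (idx : T) (op : Monoid.com_law idx) n E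
    (G : {poly F} -> T) : E \is monic -> ((size E).-1 <= n)%N ->
  \big[op/idx]_(D <- monics F n | E %| D) G D =
  \big[op/idx]_(D <- monics F (n - (size E).-1)) G (E * D).
Proof.
move=> Em sE; have E0 := monic_neq0 Em; rewrite -big_filter.
apply: (@big_seq_reindex _ _ _ _ _ _ _ _ (fun D => D %/ E)).
- exact: monics_uniq.
- by rewrite filter_uniq // monics_uniq.
- move=> D hD; rewrite mulKp //; split=> //; rewrite mem_filter dvdp_mulr //=.
  have Dm := monics_monic hD.
  rewrite -[n in monics F n](subnKC sE) -(monics_deg hD) -size_monicM //.
  by apply: mem_monics_deg; rewrite monicMl.
- move=> D; rewrite mem_filter => /andP[dE hD]; have Dm := monics_monic hD.
  have [G' Gm eD] := monic_divisor Dm Em dE.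
  rewrite eD mulKp //; split=> //.
  have := size_monicM Em Gm; rewrite -eD (monics_deg hD) => ->.
  by rewrite addKn mem_monics_deg.
Qed.

Lemma big_monics_ndvd (T : Type) (idx : T) (op : Monoid.com_law idx) n E
    (G : {poly F} -> T) : (n < (size E).-1)%N ->
  \big[op/idx]_(D <- monics F n | E %| D) G D = idx.
Proof.
move=> nE; rewrite big_seq_cond big1 // => D /andP[hD dE].
have := dvdp_leq (monic_neq0 (monics_monic hD)) dE; rewrite (monics_size hD).
by move: nE; case: (size E) => // k; lia.
Qed.

Definition divs b : seq {poly F} :=
  [seq E <- flatten [seq monics F i | i <- iota 0%N (size b)] | E %| b].

Lemma mem_divs b E : b != 0 -> (E \in divs b) = (E \is monic) && (E %| b).
Proof.
move=> b0; rewrite mem_filter mem_flatten_monics mem_iota add0n.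
have [Em|] := boolP (E \is monic); last by rewrite andbF.
have [dE|//] := boolP (E %| b); rewrite /=.
have := dvdp_leq b0 dE; have : (0 < size E)%N by rewrite size_poly_gt0 monic_neq0.
by move: (size E) (size b) => i j; lia.
Qed.

Lemma divs_uniq b : uniq (divs b).
Proof. by rewrite filter_uniq // uniq_flatten_monics ?iota_uniq. Qed.

(** One more prime factor, of degree at least 1, at most doubles the set of divisors. *)
Lemma size_divs_monic b : b \is monic -> (size (divs b) <= 2 ^ (size b).-1)%N.
Proof.
move=> bm; elim/monic_ind: bm => [|P b' Pp bm IH].
  rewrite size_poly1 expn0 /divs size_poly1 /= size_filter.
  by rewrite monics0 cats0 (leq_trans (count_size _ _)).
have b0 := monic_neq0 bm; have P0 := primeA_neq0 Pp.
have Pb0 : P * b' != 0 by rewrite mulf_neq0.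
apply: (@leq_trans (size (divs b' ++ [seq P * E | E <- divs b']))).
  apply: uniq_leq_size; first exact: divs_uniq.
  move=> E; rewrite mem_divs // => /andP[Em dE]; rewrite mem_cat.
  have [dP|nP] := boolP (P %| E).
    have [G Gm eE] := monic_divisor Em Pp.1 dP.
    apply/orP; right; apply/mapP; exists G => //; rewrite mem_divs // Gm.
    by move: dE; rewrite eE dvdp_mul2l.
  apply/orP; left; rewrite mem_divs // Em /=.
  by move: dE; rewrite Gauss_dvdpr // coprimep_sym primeA_coprime.
rewrite size_cat size_map addnn -mul2n size_monicM //; last exact: Pp.1.
apply: leq_trans (leq_mul (leqnn 2) IH) _; rewrite -expnS leq_exp2l // -add1n leq_add2r.
by have := primeA_size Pp; case: (size P) => [|[]].
Qed.

Lemma size_divs b : b != 0 -> (size (divs b) <= 2 ^ (size b).-1)%N.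
Proof.
move=> b0; have l0 : lead_coef b != 0 by rewrite lead_coef_eq0.
pose b1 := (lead_coef b)^-1 *: b.
have b1m : b1 \is monic by rewrite monicE lead_coefZ mulVf.
have s1 : size b1 = size b by rewrite size_scale // invr_eq0.
rewrite -s1; apply: leq_trans (size_divs_monic b1m).
rewrite /divs s1; apply: uniq_leq_size; first exact: divs_uniq.
by move=> E; rewrite !mem_filter /b1 dvdpZr // invr_eq0.
Qed.

End Divisors.

(** * Averages of the characters over the family *)

Section CharSums.
Variables (R : realType) (F : finFieldType) (xi : F).
Hypothesis char2 : 2%N \in [pchar F].
Hypothesis nxi : ~~ inH xi.
Implicit Types (P Q D E B N A f U : {poly F}) (u w x y : ratfun F) (v n i : nat).
Local Notation psi := (@psi R F).
Local Notation q := (#|F|%:R : R).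
Local Notation chi := (@chi F R).

Definition absR N : R := q ^+ (size N).-1.

Lemma q_gt1 : 1 < q.
Proof. rewrite ltr1n; apply/card_gt1P; exists 0, 1; split=> //.
by rewrite eq_sym oner_neq0. Qed.

Lemma q_gt0 : 0 < q. Proof. exact: lt_trans ltr01 q_gt1. Qed.
Lemma q_ge1 : 1 <= q. Proof. exact: ltW q_gt1. Qed.
Lemma qX_gt0 n : 0 < q ^+ n. Proof. by rewrite exprn_gt0 // q_gt0. Qed.

Lemma absR_gt0 N : 0 < absR N. Proof. exact: qX_gt0. Qed.

Lemma absRM D E : D \is monic -> E \is monic -> absR (D * E) = absR D * absR E.
Proof. by move=> Dm Em; rewrite /absR size_monicM // exprD. Qed.

Lemma absR_prod (r : seq {poly F}) (e : {poly F} -> nat) :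
  (forall P, P \in r -> primeA P) ->
  absR (\prod_(P <- r) P ^+ e P) = \prod_(P <- r) absR P ^+ e P.
Proof.
elim: r => [|P r IH] pr; first by rewrite !big_nil /absR size_poly1 expr0.
have Pp : primeA P by apply: pr; rewrite mem_head.
have pr' Q : Q \in r -> primeA Q by move=> h; apply: pr; rewrite inE h orbT.
rewrite !big_cons absRM ?IH //; last 2 first.
- by apply: monic_exp; case: Pp.
- exact: prime_prod_monic.
by rewrite /absR size_exp exprM.
Qed.

Definition good f u := exists B N : {poly F}, [/\ N != 0, coprimep N f & u = B%:K / N%:K].

Lemma chiD f u w : f \is monic -> good f u -> good f w -> chi (u + w) f = chi u f * chi w f.
Proof.
move=> fm [B [N [N0 cN eu]]] [C [M [M0 cM ew]]].
have [U hU] := solve_mod B cN; have [W hW] := solve_mod C cM.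
have euw : u + w = (B * M + C * N)%:K / (N * M)%:K by rewrite eu ew frac_add.
have cNM : coprimep (N * M) f by rewrite coprimepMl cN.
have hUW : f %| (U + W) * (N * M) - (B * M + C * N).
  have -> : (U + W) * (N * M) - (B * M + C * N) = (U * N - B) * M + (W * M - C) * N by ring.
  by rewrite dvdp_add // dvdp_mulr.
rewrite (chi_res R char2 nxi N0 eu fm cN hU) (chi_res R char2 nxi M0 ew fm cM hW).
rewrite (chi_res R char2 nxi (mulf_neq0 N0 M0) euw fm cNM hUW).
by rewrite mulrDl resD psiD.
Qed.

Lemma chi0 f : f \is monic -> chi 0 f = 1.
Proof.
move=> fm; have e : 0 = (0 : {poly F})%:K / 1%:K :> ratfun F by rewrite tofrac0 mul0r.
rewrite (@chi_res R F xi char2 nxi 0 0 1 0 f) ?oner_neq0 ?coprime1p //.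
  by rewrite mul0r res0 psi0.
by rewrite mul0r subrr dvdp0.
Qed.

Lemma chi_pole D B f : D \is monic -> simple_poles D B -> f \is monic ->
  ~~ coprimep D f -> chi (B%:K / (D ^+ 2)%:K) f = 0.
Proof.
move=> Dm hB fm nc; rewrite /Defs.chi; case: asboolP => // -[a [b [b0 cab e cbf]]].
case/negP: nc; apply: contraT => nc; have D0 := monic_neq0 Dm.
have s1 : (1 < size (gcdp D f))%N.
  by rewrite ltn_neqAle size_poly_gt0 gcdp_eq0 negb_and D0 andbT eq_sym.
have [P Pp] := prime_divisor_exists s1; rewrite dvdp_gcd => /andP[dD df].
have [dB ndB] := hB P Pp dD.
have D20 : D ^+ 2 != 0 by rewrite expf_neq0.
have /(frac_eq _ _ D20 b0) e2 := e.
have nb : ~~ (P %| b).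
  apply/negP => db; have := coprimep_dvdl df (coprimep_dvdr db cbf).
  by rewrite coprimepp; have := primeA_size Pp; case: (size P) => [|[]].
case/negP: ndB; have d2 : P ^+ 2 %| B * b by rewrite e2 dvdp_mull // dvdp_exp2r.
by rewrite -(Gauss_dvdpl _ (_ : coprimep _ b)) // coprimep_expl // primeA_coprime.
Qed.

Lemma chi_theta D B f : D \is monic -> simple_poles D B -> (size B < size (D ^+ 2)%R)%N ->
  f \is monic -> chi (B%:K / (D ^+ 2)%:K) f = theta R D B f.
Proof.
move=> Dm hB sB fm; have [cD|cD] := boolP (coprimep D f); last first.
  by rewrite chi_pole // /theta coprimep_sym (negbTE cD).
have cf : coprimep f D by rewrite coprimep_sym.
have [V hV] := theta_solve B cf.
rewrite (thetaE R cf hV); 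
have c2 : coprimep (D ^+ 2) f by rewrite coprimep_expl.
exact: (reciprocity R char2 nxi (monic_exp 2 Dm) fm c2 sB hV).
Qed.

Definition sumA f P i : R := \sum_(A <- digs P) chi (dig_frac P i A) f.

Lemma sumA_linear f P i : f \is monic -> primeA P -> ~~ (P %| f) ->
  exists c, [/\ P ^+ (2 * i + 1) %| f * c - 1 &
   sumA f P i = \sum_(A <- digs P) psi (res (A * c * f^`()) (P ^+ (2 * i + 1)))].
Proof.
move=> fm Pp nd; have cP : coprimep (P ^+ (2 * i + 1)) f.
  by rewrite coprimep_expl // primeA_coprime.
have [c hc] : exists c, P ^+ (2 * i + 1) %| f * c - 1.
  by apply: coprime_inv; rewrite coprimep_sym.
exists c; split=> //; rewrite /sumA !big_seq; apply: eq_bigr => A; rewrite mem_digs // => sA.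
have [C sC eC] := dig_frac_proper i Pp sA.
have Pm : P ^+ (2 * i + 1) \is monic by apply: monic_exp; case: Pp.
apply: (reciprocity R char2 nxi Pm fm cP).
  apply: leq_trans sA _; rewrite pow_odd_step mulrC; apply: dvdp_leq; last exact: dvdp_mulr.
  by rewrite mulf_neq0 ?expf_neq0 // primeA_neq0.
have -> : f * (A * c) - A = A * (f * c - 1) by ring.
exact: dvdp_mull.
Qed.

Lemma sumA_triv f P i : f \is monic -> primeA P -> ~~ (P %| f) ->
  P ^+ (2 * i + 1) %| f^`() -> sumA f P i = absR P.
Proof.
move=> fm Pp nd d; have [c [_ ->]] := sumA_linear i fm Pp nd.
by apply: sum_psi_triv => A _; rewrite res_dvd // dvdp_mull.
Qed.

(** After cancelling [P^(2i)] the digit [A] runs through the additive character of [c h A/P] modulo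
    [P], which is nontrivial because [c] and [h] are units there. *)
Lemma sumA_zero f P i : f \is monic -> primeA P -> ~~ (P %| f) ->
  P ^+ (2 * i) %| f^`() -> ~~ (P ^+ (2 * i + 1) %| f^`()) -> sumA f P i = 0.
Proof.
move=> fm Pp nd d nd2; have [c [hc ->]] := sumA_linear i fm Pp nd.
have P0 := primeA_neq0 Pp; have Pm := Pp.1.
have /dvdpP [h eh] := d.
have nh : ~~ (P %| h).
  by apply: contra nd2 => dh; rewrite eh pow_odd_step mulrC dvdp_mul.
have nc : ~~ (P %| c).
  apply/negP => dc.
  have dP : P %| f * c - 1.
    by apply: dvdp_trans hc; rewrite pow_odd_step dvdp_mull.
  have : P %| 1 by rewrite -(dvdp_subr _ (dvdp_mull f dc)).
  by rewrite primeA_not_dvd1.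
have resE A : res (A * c * f^`()) (P ^+ (2 * i + 1)) = res (c * h * A) P.
  rewrite eh pow_odd_step [P ^+ _ * P]mulrC.
  have -> : A * c * (h * P ^+ (2 * i)) = c * h * A * P ^+ (2 * i).
    by move: (P ^+ (2 * i)) => N; ring.
  by rewrite resM // monic_exp.
under eq_bigr do rewrite resE.
rewrite (sum_psi_D R char2 nxi Pm); case: ifP => //.
by rewrite primeA_dvdM // (negbTE nc) (negbTE nh).
Qed.

Lemma allD_good f P v x : primeA P -> ~~ (P %| f) -> x \in allD P v -> good f x.
Proof.
move=> Pp nd /(allD_proper Pp) [B _ ->]; exists B, (P ^+ (2 * v)); split=> //.
  by rewrite expf_neq0 // primeA_neq0.
by rewrite coprimep_expl // primeA_coprime.
Qed.

Lemma dig_good f P i A : primeA P -> ~~ (P %| f) -> good f (dig_frac P i A).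
Proof.
move=> Pp nd; exists A, (P ^+ (2 * i + 1)); split=> //.
  by rewrite expf_neq0 // primeA_neq0.
by rewrite coprimep_expl // primeA_coprime.
Qed.

Lemma sum_allD f P v : f \is monic -> primeA P -> ~~ (P %| f) ->
  \sum_(x <- allD P v) chi x f = \prod_(i < v) sumA f P i.
Proof.
move=> fm Pp nd; elim: v => [|v IH]; first by rewrite big_ord0 big_seq1 chi0.
rewrite big_ord_recr /= -IH big_allpairs_dep /= big_distrl /= !big_seq.
apply: eq_bigr => x hx; rewrite big_distrr /=; apply: eq_bigr => A _.
by rewrite chiD //; [exact: allD_good hx|exact: dig_good].
Qed.

Definition wloc f P v : R := \sum_(x <- locP P v) chi x f.

Lemma wloc0 f P : f \is monic -> wloc f P 0 = 1.
Proof. by move=> fm; rewrite /wloc big_seq1 chi0. Qed.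

Lemma wlocS f P v : f \is monic -> primeA P -> ~~ (P %| f) ->
  wloc f P v.+1 = (\prod_(i < v) sumA f P i) * (sumA f P v - 1).
Proof.
move=> fm Pp nd; rewrite /wloc /= big_allpairs_dep /= -sum_allD // big_distrl /= !big_seq.
apply: eq_bigr => x hx; rewrite big_filter.
have hd : (0 : {poly F}) \in digs P by rewrite mem_digs // size_poly0; have := primeA_size Pp; lia.
rewrite /sumA (bigD1_seq 0) ?polys_uniq //= addrC.
have -> : dig_frac P v 0 = 0 by rewrite /dig_frac tofrac0 mul0r.
rewrite chi0 // addrK big_distrr /=; apply: eq_bigr => A _.
by rewrite chiD //; [exact: allD_good hx|exact: dig_good].
Qed.

Definition phiP P v : R := if v is v'.+1 then absR P ^+ v' * (absR P - 1) else 1.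

Lemma wloc_square f P v : f \is monic -> f^`() = 0 -> primeA P -> ~~ (P %| f) ->
  wloc f P v = phiP P v.
Proof.
move=> fm d0 Pp nd; have sA i : sumA f P i = absR P.
  by apply: sumA_triv; rewrite // d0 dvdp0.
case: v => [|v]; first exact: wloc0.
rewrite wlocS // sA; congr (_ * _).
by under eq_bigr do rewrite sA; rewrite prodr_const card_ord.
Qed.

(** As [f'] is a square, its valuation is [2e] with [e = valA P (od2 f)]. Digits of index below [e]
    sum to [|P|], the digit of index [e] sums to 0. So up to [e] digits count in full, [e + 1]
    digits leave [- |P|^e] from the excluded zero digit, and more digits give 0. *)
Lemma wloc_bound f P v : f \is monic -> od2 f != 0 -> primeA P -> ~~ (P %| f) ->
  `|wloc f P v| <= absR P ^+ minn v (valA P (od2 f)).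
Proof.
move=> fm b0 Pp nd; set e := valA P _.
have ap : 1 <= absR P by rewrite exprn_ege1 // q_ge1.
have dE k : (P ^+ k %| f^`()) = (k <= 2 * e)%N.
  by rewrite deriv_od2 // valP ?expf_neq0 // valX.
have sA i : (i < e)%N -> sumA f P i = absR P.
  by move=> ie; apply: sumA_triv => //; rewrite dE; move: ie; lia.
have sAe : sumA f P e = 0 by apply: sumA_zero => //; rewrite dE; lia.
case: v => [|v]; first by rewrite wloc0 // normr1 min0n expr0.
rewrite wlocS //.
have pr k : (k <= e)%N -> \prod_(i < k) sumA f P i = absR P ^+ k.
  move=> ke; rewrite (eq_bigr (fun=> absR P)) ?prodr_const ?card_ord // => i _.
  by apply: sA; apply: leq_trans ke.
have a0 : 0 <= absR P by exact: (le_trans ler01 ap).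
case: (ltngtP v e) => ve.
- rewrite pr 1?ltnW // sA // (minn_idPl ve) exprSr normrM [`|_ ^+ _|]ger0_norm ?exprn_ge0 //.
  by rewrite ler_wpM2l ?exprn_ge0 // ger0_norm; lra.
- by rewrite (bigD1 (Ordinal ve)) //= sAe mul0r mul0r normr0 exprn_ge0.
- rewrite ve pr // sAe sub0r mulrN1 normrN ger0_norm ?exprn_ge0 //.
  by rewrite (minn_idPr _).
Qed.

Lemma sum_Vseq f r D : f \is monic -> uniq r -> (forall P, P \in r -> primeA P) ->
  coprimep (Dr r D) f ->
  \sum_(u <- Vseq r D) chi u f = \prod_(P <- r) wloc f P (valA P D).
Proof.
move=> fm; elim: r => [|P r IH] /=; first by rewrite big_nil big_seq1 chi0.
move=> /andP[Pr ur] pr; rewrite /Dr big_cons -/(Dr r D) coprimepMl => /andP[cP cD].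
have Pp : primeA P by apply: pr; rewrite mem_head.
have pr' Q : Q \in r -> primeA Q by move=> h; apply: pr; rewrite inE h orbT.
rewrite big_allpairs_dep /= big_cons -IH // /wloc big_distrl /= !big_seq.
apply: eq_bigr => x hx; rewrite big_distrr /= !big_seq; apply: eq_bigr => y hy.
apply: chiD => //.
  have [B [-> _ _]] := locP_spec Pp hx; exists B, (P ^+ (2 * valA P D)); split=> //.
    by rewrite expf_neq0 // primeA_neq0.
  by rewrite mulnC exprM coprimep_expl.
have [B [-> _ _]] := Vseq_spec ur pr' hy; exists B, (Dr r D ^+ 2); split=> //.
  by rewrite expf_neq0 // monic_neq0 // prime_prod_monic.
by rewrite coprimep_expl.
Qed.

Lemma sum_Vseq_pole n f D : f \is monic -> D \in monics F n -> ~~ coprimep D f ->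
  \sum_(u <- Vseq (prs F n) D) chi u f = 0.
Proof.
move=> fm hD nc; rewrite big_seq big1 // => u hu.
have [B [-> _ hB]] := Vseq_prs_spec hD hu.
by apply: chi_pole => //; exact: monics_monic hD.
Qed.

Definition Ssum n f : R := \sum_(D <- monics F n) \sum_(u <- Vseq (prs F n) D) chi u f.

Definition phi D : R := \prod_(P <- prs F (size D).-1) phiP P (valA P D).

Lemma coprime_prime_ndvd P D f : primeA P -> coprimep D f -> P %| D -> ~~ (P %| f).
Proof.
move=> Pp cD dD; rewrite -primeA_coprime //; exact: coprimep_dvdr dD cD.
Qed.

Lemma Ssum_square n f : f \is monic -> f^`() = 0 ->
  Ssum n f = \sum_(D <- monics F n | coprimep D f) phi D.
Proof.
move=> fm d0; rewrite /Ssum [RHS]big_mkcond /= !big_seq; apply: eq_bigr => D hD.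
have Dm := monics_monic hD; have D0 := monic_neq0 Dm.
case: ifPn => cD; last exact: sum_Vseq_pole.
rewrite sum_Vseq ?prs_uniq ?Dr_monics //; last exact: prs_prime.
rewrite /phi (monics_deg hD) !big_seq; apply: eq_bigr => P /prs_prime Pp.
have [vD|vD] := posnP (valA P D); first by rewrite vD wloc0.
by rewrite wloc_square // (coprime_prime_ndvd Pp cD) // val_dvd.
Qed.

(** For fixed [D] the local bounds multiply to [|E|] with [E = gcd(D, b)]. This is majorized by the
    sum of [|E|] over all common divisors; each divisor [E] of [b] has [q^(n - deg E)] multiples
    [D], hence contributes at most [q^n], and there are at most [2^(deg b)] of them. *)
Lemma Ssum_nonsquare n f : f \is monic -> od2 f != 0 ->
  `|Ssum n f| <= q ^+ n * 2 ^+ (size (od2 f)).-1.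
Proof.
move=> fm b0; set b := od2 f.
have step D : D \in monics F n ->
   `|\sum_(u <- Vseq (prs F n) D) chi u f| <= \sum_(E <- divs b | E %| D) absR E.
  move=> hD; have Dm := monics_monic hD; have D0 := monic_neq0 Dm.
  have [cD|cD] := boolP (coprimep D f); last first.
    rewrite sum_Vseq_pole // normr0 sumr_ge0 // => E _; exact/ltW/absR_gt0.
  rewrite sum_Vseq ?prs_uniq ?Dr_monics //; last exact: prs_prime.
  pose E := \prod_(P <- prs F n) P ^+ minn (valA P D) (valA P b).
  have Em : E \is monic by apply: prime_prod_monic => P; exact: prs_prime.
  have vE P : primeA P -> valA P E = if P \in prs F n then minn (valA P D) (valA P b) else 0%N.
    by move=> Pp; rewrite val_prodX ?prs_uniq //; exact: prs_prime.
  have ED : E %| D by apply: dvd_val => // P Pp; rewrite vE //; case: ifP => // _; exact: geq_minl.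
  have Eb : E %| b by apply: dvd_val => // P Pp; rewrite vE //; case: ifP => // _; exact: geq_minr.
  rewrite normr_prod; apply: (@le_trans _ _ (absR E)).
    rewrite absR_prod; last exact: prs_prime.
    rewrite !big_seq; apply: ler_prod => P /prs_prime Pp; rewrite normr_ge0 /=.
    have [vD|vD] := posnP (valA P D); first by rewrite vD wloc0 // normr1 min0n expr0.
    by apply: wloc_bound => //; rewrite (coprime_prime_ndvd Pp cD) // val_dvd.
  have hE : E \in [seq i <- divs b | i %| D] by rewrite mem_filter ED mem_divs // Em Eb.
  rewrite -big_filter (bigD1_seq E hE) /=; last by apply: filter_uniq; exact: divs_uniq.
  rewrite lerDl sumr_ge0 // => G _; exact/ltW/absR_gt0.
apply: le_trans (ler_norm_sum _ _ _) _.
apply: (@le_trans _ _ (\sum_(D <- monics F n) \sum_(E <- divs b | E %| D) absR E)).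
  by rewrite !big_seq; apply: ler_sum => D; exact: step.
under eq_bigr do rewrite big_mkcond; rewrite exchange_big /=.
apply: (@le_trans _ _ (\sum_(E <- divs b) q ^+ n)).
  rewrite !big_seq; apply: ler_sum => E; rewrite mem_divs // => /andP[Em _].
  rewrite -big_mkcond /=; have [le|lt] := leqP (size E).-1 n; last first.
    by rewrite big_monics_ndvd // ltW // qX_gt0.
  rewrite big_monics_dvd // big_const_seq count_predT iter_addr_0 size_monics.
  by rewrite -(mulr_natl (absR E)) natrX /absR -exprD subnK.
rewrite big_const_seq count_predT iter_addr_0 -(mulr_natr (q ^+ n)).
by rewrite ler_wpM2l ?(ltW (qX_gt0 _)) // -natrX ler_nat size_divs.
Qed.

End CharSums.

(** * Sets of primes and squarefree polynomials *)

Section Subs.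
Variable T : eqType.
Implicit Types (r s : seq T).

Fixpoint subs r : seq (seq T) :=
  if r is x :: r' then subs r' ++ [seq x :: s | s <- subs r'] else [:: [::]].

Lemma mem_subs r s : (s \in subs r) = subseq s r.
Proof.
elim: r s => [|x r IH] s /=; first by rewrite inE; case: s.
rewrite mem_cat IH; case: s => [|y s] /=; first by rewrite sub0seq.
case: eqP => [->|ne].
  apply/orP/idP => [[h|/mapP [t]]|h].
  - by apply: subseq_trans h; exact: subseq_cons.
  - by rewrite IH => ht [->].
  - by right; apply: map_f; rewrite IH.
by rewrite orbC; case: mapP => // -[t _ [e]]; rewrite e in ne.
Qed.

Lemma subs_uniq r : uniq r -> uniq (subs r).
Proof.
elim: r => //= x r IH /andP[xr ur]; rewrite cat_uniq IH // map_inj_uniq ?IH //.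
  rewrite andbT; apply/hasPn => s /mapP [t _ ->] /=; rewrite mem_subs.
  by apply: contra xr => /mem_subseq; apply; rewrite mem_head.
by move=> s t [].
Qed.

Lemma prod_subs (A : comPzRingType) r (g : T -> A) :
  \prod_(x <- r) (1 + g x) = \sum_(s <- subs r) \prod_(x <- s) g x.
Proof.
elim: r => [|x r IH] /=; first by rewrite big_nil big_seq1 big_nil.
rewrite big_cons big_cat big_map /= IH mulrDl mul1r; congr (_ + _).
by rewrite big_distrr; apply: eq_bigr => s _; rewrite big_cons.
Qed.

End Subs.

Section SquareFree.
Variable F : finFieldType.
Implicit Types (P D E e : {poly F}) (n b N : nat) (S : seq {poly F}).

Definition eS S : {poly F} := \prod_(P <- S) P.
Definition pdivs N e : seq {poly F} := [seq P <- prs F N | P %| e].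
Definition sqf e : bool := e == eS (pdivs (size e).-1 e).

Lemma subs_prs N S : S \in subs (prs F N) ->
  uniq S /\ (forall P, P \in S -> P \in prs F N).
Proof.
rewrite mem_subs => h; split; first exact: subseq_uniq h (prs_uniq F N).
by move=> P; exact: mem_subseq.
Qed.

Lemma eS_monic N S : S \in subs (prs F N) -> eS S \is monic.
Proof.
move=> /subs_prs [_ h]; rewrite /eS big_seq; apply: monic_prod => P /h /prs_prime [] //.
Qed.

Lemma val_eS S P : uniq S -> (forall Q, Q \in S -> primeA Q) -> primeA P ->
  valA P (eS S) = (P \in S) :> nat.
Proof.
move=> uS pS Pp; have -> : eS S = \prod_(Q <- S) Q ^+ (fun=> 1%N) Q.
  by apply: eq_bigr => Q _; rewrite expr1.
by rewrite val_prodX //; case: ifP.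
Qed.

Lemma dvd_eS S P : uniq S -> (forall Q, Q \in S -> primeA Q) -> primeA P ->
  (P %| eS S) = (P \in S).
Proof.
move=> uS pS Pp; rewrite val_dvd // ?val_eS //; first by case: (P \in S).
rewrite monic_neq0 // /eS big_seq; apply: monic_prod => Q /pS [] //.
Qed.

Lemma eS_dvd S D : uniq S -> (forall Q, Q \in S -> primeA Q) -> D != 0 ->
  (eS S %| D) = all (fun P => P %| D) S.
Proof.
move=> uS pS D0; apply/idP/allP => [d P PS|h].
  by apply: dvdp_trans d; rewrite dvd_eS //; exact: pS.
apply: dvd_val => //.
  by rewrite /eS big_seq; apply: monic_prod => Q /pS [].
by move=> P Pp; rewrite val_eS //; case: (boolP (P \in S)) => // /h; rewrite val_dvd.
Qed.

Lemma pdivs_eS N S : S \in subs (prs F N) -> pdivs N (eS S) = S.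
Proof.
move=> hS; have [uS pS] := subs_prs hS.
have ss : subseq S (prs F N) by rewrite -mem_subs.
rewrite [RHS](subseq_uniqP (prs_uniq F N) ss).
apply: eq_in_filter => P hP; rewrite dvd_eS //; last exact: prs_prime hP.
by move=> Q /pS /prs_prime.
Qed.

Lemma pdivs_perm N e : e != 0 -> (size e <= N.+1)%N ->
  perm_eq (pdivs N e) (pdivs (size e).-1 e).
Proof.
move=> e0 se; apply: uniq_perm; try exact: filter_uniq (prs_uniq _ _).
move=> P.
rewrite (mem_filter _ _ (prs F N)) (mem_filter _ _ (prs F _)); case dP : (P %| e) => //=; apply/idP/idP => /prs_prime Pp.
  by apply: (prs_dvd Pp e0) dP; rewrite prednK // size_poly_gt0.
exact: (prs_dvd Pp e0) dP.
Qed.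

(** By unique factorization sets of primes correspond to squarefree polynomials; in particular the
    degree [b] part of a product over primes does not depend on the truncation [N >= b]. *)
Lemma subs_sum (A : comPzRingType) (g : {poly F} -> A) N b : (b <= N)%N ->
  \sum_(S <- subs (prs F N) | (size (eS S)).-1 == b) \prod_(P <- S) g P =
  \sum_(e <- monics F b | sqf e) \prod_(P <- pdivs b e) g P.
Proof.
move=> bN; rewrite -big_filter -[RHS]big_filter; apply: esym.
have sz (e : {poly F}) : e \in monics F b -> (size e <= N.+1)%N.
  by move=> h; rewrite (monics_size h).
rewrite (@big_seq_reindex _ _ _ _ _ [seq S <- subs (prs F N) | (size (eS S)).-1 == b] _ (@eS) (pdivs N)).
- rewrite !big_seq; apply: eq_bigr => S; rewrite mem_filter => /andP[/eqP sS hS].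
  have Sm := eS_monic hS; have S0 := monic_neq0 Sm.
  rewrite -[S in RHS](pdivs_eS hS); apply: perm_big; rewrite perm_sym -sS; apply: pdivs_perm => //.
  by apply: sz; rewrite -sS mem_monics_deg.
- by rewrite filter_uniq // subs_uniq // prs_uniq.
- by rewrite filter_uniq // monics_uniq.
- move=> S; rewrite !mem_filter => /andP[/eqP sS hS]; have Sm := eS_monic hS.
  rewrite pdivs_eS //; split=> //; rewrite -{1}sS mem_monics_deg // andbT.
  have S0 := monic_neq0 Sm.
  rewrite /sqf -[X in X == _]/(eS S) -{1}(pdivs_eS hS); apply/eqP; apply: perm_big.
  by apply: pdivs_perm => //; apply: sz; rewrite -sS mem_monics_deg.
- move=> e; rewrite !mem_filter => /andP[/eqP se he]; have em := monics_monic he.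
  have e0 := monic_neq0 em.
  have ee : eS (pdivs N e) = e.
    by rewrite [RHS]se; apply: perm_big; apply: pdivs_perm => //; exact: sz.
  by rewrite ee (monics_deg he) eqxx mem_subs filter_subseq.
Qed.

Lemma count_subs N b :
  (count (fun S => (size (eS S)).-1 == b) (subs (prs F N)) <= #|F| ^ b)%N.
Proof.
rewrite -size_filter -(size_map (@eS)) -size_monics; apply: uniq_leq_size.
  rewrite map_inj_in_uniq ?filter_uniq ?subs_uniq ?prs_uniq // => S S'.
  rewrite !mem_filter => /andP[_ h] /andP[_ h'] e.
  by rewrite -(pdivs_eS h) -(pdivs_eS h') e.
move=> e /mapP [S]; rewrite mem_filter => /andP[/eqP <- hS] ->.
by rewrite mem_monics_deg // (eS_monic hS).
Qed.

End SquareFree.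

(** * Sums of the totient and the coefficients of the Euler product *)

Section Counting.
Variables (R : realType) (F : finFieldType).
Implicit Types (P D E e l : {poly F}) (n b k N : nat) (S : seq {poly F}).
Local Notation q := (#|F|%:R : R).
Local Notation absR := (@absR R F).
Local Notation phi := (@phi R F).
Local Notation phiP := (@phiP R F).

Lemma phiE n D : D != 0 -> (size D <= n.+1)%N ->
  phi D = \prod_(P <- prs F n) phiP P (valA P D).
Proof.
move=> D0 sD; have h P : primeA P -> ~~ (P %| D) -> phiP P (valA P D) = 1.
  by move=> Pp nd; rewrite val_ndvd.
rewrite /(phi _) -(@fsbig_prime_divisors _ _ _ _ n D) // -(@fsbig_prime_divisors _ _ _ _ (size D).-1 D) //.
by rewrite prednK // size_poly_gt0.
Qed.

Lemma phi1 : phi 1 = 1.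
Proof.
rewrite /(phi _) big_seq big1 // => P /prs_prime Pp; by rewrite val1.
Qed.

Lemma phi_mulP P D : primeA P -> D \is monic ->
  phi (P * D) = (if P %| D then absR P else absR P - 1) * phi D.
Proof.
move=> Pp Dm; have D0 := monic_neq0 Dm; have P0 := primeA_neq0 Pp.
have PD0 : P * D != 0 by rewrite mulf_neq0.
pose n := size (P * D).
have sD : (size D <= n.+1)%N.
  by apply: leqW; apply: dvdp_leq => //; exact: dvdp_mull.
have Pn : P \in prs F n.
  by apply/mem_prs; split=> //; apply: leqW; apply: dvdp_leq => //; exact: dvdp_mulr.
rewrite (@phiE n) // (@phiE n D) //.
rewrite (bigD1_seq P) ?prs_uniq //= [in RHS](bigD1_seq P) ?prs_uniq //= mulrA.
congr (_ * _).
  rewrite valM // val_self // val_dvd // add1n; case: (valA P D) => [|v] /=.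
    by rewrite expr0 mul1r mulr1.
  by rewrite exprS mulrA.
rewrite big_seq_cond [RHS]big_seq_cond; apply: eq_bigr => Q /andP[/prs_prime Qp ne].
by rewrite valM // val_prime // (negbTE ne).
Qed.

(** Gauss's identity, by induction on [D = P D']. The divisors of [D] that do not divide [D'] are
    the [P E] with [E | D'] and [P E] not dividing [D']. *)
Lemma sum_divs_phi D : D \is monic -> \sum_(E <- divs D) phi E = absR D.
Proof.
have [m] := ubnP (size D); elim: m D => // m IH D; rewrite ltnS => sm Dm.
have : (0 < size D)%N by rewrite size_poly_gt0 monic_neq0.
rewrite leq_eqVlt => /orP[/eqP e|s1].
  rewrite (monic_size1 Dm (esym e)) /(absR _) size_poly1 expr0.
  have -> : divs (1 : {poly F}) = [:: 1].
    by rewrite /divs size_poly1 /= monics0 /= dvdpp.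
  by rewrite big_seq1 phi1.
have [P Pp dP] := prime_divisor_exists s1.
have [D' Dm' e] := monic_divisor Dm Pp.1 dP.
have P0 := primeA_neq0 Pp; have D0' := monic_neq0 Dm'; have D0 := monic_neq0 Dm.
have Pm := Pp.1; have sP := primeA_size Pp.
have sD : (size D').-1 = ((size D).-1 - (size P).-1)%N.
  by rewrite e size_monicM // addKn.
have lt' : (size D' < m)%N.
  apply: leq_trans sm; have := size_monicM Pm Dm'; rewrite -e; move: sP s1.
  by move: (size P) (size D) (size D') => i j k; lia.
rewrite (bigID (fun E => E %| D')) /=.
have -> : \sum_(E <- divs D | E %| D') phi E = absR D'.
  rewrite -IH // -big_filter; apply: perm_big; apply: uniq_perm.
  - by rewrite filter_uniq // divs_uniq.
  - exact: divs_uniq.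
  move=> E; rewrite mem_filter !mem_divs //; case dE : (E %| D') => //=; last by rewrite andbF.
  by rewrite e (dvdp_mull _ dE).
have -> : \sum_(E <- divs D | ~~ (E %| D')) phi E =
  \sum_(E <- divs D' | ~~ (P * E %| D')) phi (P * E).
  rewrite -big_filter -[RHS]big_filter.
  apply: (@big_seq_reindex _ _ _ _ _ _ _ _ (fun E => E %/ P)).
  - by rewrite filter_uniq // divs_uniq.
  - by rewrite filter_uniq // divs_uniq.
  - move=> E; rewrite mem_filter mem_divs // => /and3P[h Em dE].
    by rewrite mem_filter mem_divs // h mulKp // monicMl // Em e dvdp_mul2l.
  - move=> E; rewrite mem_filter mem_divs // => /and3P[h Em dE].
    have dPE : P %| E.
      apply: contraR h => nP; move: dE; rewrite e Gauss_dvdpr //.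
      by rewrite coprimep_sym primeA_coprime.
    have [G Gm eE] := monic_divisor Em Pm dPE.
    rewrite eE mulKp // -eE; split=> //.
    rewrite mem_filter mem_divs // Gm -eE h /=.
    by move: dE; rewrite eE e dvdp_mul2l.
have -> : absR D = absR P * absR D' by rewrite e absRM.
(* If [P | D'], every [E] that occurs is divisible by [P], otherwise [P E] would divide [D']; so
   [phi (P * E)] is [|P| phi(E)]. If [P] does not divide [D'], it divides no [E], and the factor is
   [|P| - 1]. *)
have [dPD|ndPD] := boolP (P %| D').
  have [D2 Dm2 e2] := monic_divisor Dm' Pm dPD.
  have lt2 : (size D2 < m)%N.
    apply: leq_ltn_trans lt'; apply: dvdp_leq => //; by rewrite e2 dvdp_mull.
  have tot : \sum_(E <- divs D') phi E = absR D' by exact: IH.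
  have D02 := monic_neq0 Dm2.
  have sub : \sum_(E <- divs D' | P * E %| D') phi E = absR D2.
    rewrite -(IH D2) // -big_filter; apply: perm_big; apply: uniq_perm.
    - by rewrite filter_uniq // divs_uniq.
    - exact: divs_uniq.
    move=> E; rewrite mem_filter !mem_divs // e2 dvdp_mul2l //.
    by case dE : (E %| D2) => //=; rewrite ?andbT ?andbF // (dvdp_mull _ dE) andbT.
  have -> : \sum_(E <- divs D' | ~~ (P * E %| D')) phi (P * E) =
    absR P * \sum_(E <- divs D' | ~~ (P * E %| D')) phi E.
    rewrite big_distrr /= big_seq_cond [RHS]big_seq_cond; apply: eq_bigr => E.
    rewrite mem_divs // => /andP[/andP[Em dE] nd]; rewrite phi_mulP //.
    rewrite ifT //; apply: contraR nd => nPE; rewrite Gauss_dvdp ?dPD //.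
    by rewrite primeA_coprime.
  move: tot; rewrite (bigID (fun E => P * E %| D')) /= sub => tot.
  have eD' : absR D' = absR P * absR D2 by rewrite e2 absRM.
  have -> : \sum_(E <- divs D' | ~~ (P * E %| D')) phi E = absR D' - absR D2.
    by rewrite -tot addrAC subrr add0r.
  by rewrite eD'; ring.
have -> : \sum_(E <- divs D' | ~~ (P * E %| D')) phi (P * E) =
  (absR P - 1) * \sum_(E <- divs D') phi E.
  rewrite big_distrr /= big_mkcond /= !big_seq; apply: eq_bigr => E.
  rewrite mem_divs // => /andP[Em dE].
  have nPE : ~~ (P %| E) by apply: contra ndPD => h; exact: dvdp_trans h dE.
  rewrite ifT; first by rewrite phi_mulP // (negbTE nPE).
  by apply: contra ndPD => h; apply: dvdp_trans h; exact: dvdp_mulr.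
by rewrite IH //; ring.
Qed.

Definition tot n : R := \sum_(D <- monics F n) phi D.

Lemma sum_const_monics n (c : R) : \sum_(f <- monics F n) c = q ^+ n * c.
Proof.
by rewrite big_const_seq count_predT iter_addr_0 size_monics -(mulr_natl c) natrX.
Qed.

(** Gauss's identity summed over degree [n] is a convolution of [tot] with powers of [q]; comparing
    consecutive values of [n] inverts it in [totS]. *)
Lemma tot_conv n : \sum_(i < n.+1) tot i * q ^+ (n - i) = q ^+ (2 * n).
Proof.
transitivity (\sum_(D <- monics F n) \sum_(i < n.+1) \sum_(E <- monics F i | E %| D) phi E).
  rewrite exchange_big /=; apply: eq_bigr => i _; under [RHS]eq_bigr do rewrite big_mkcond.
  rewrite exchange_big /= /tot big_distrl /= !big_seq; apply: eq_bigr => E hE.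
  have Em := monics_monic hE; rewrite -big_mkcond /=.
  rewrite (@big_monics_dvd F R 0 +%R n E (fun=> phi E)) // (monics_deg hE) ?sum_const_monics.
    by rewrite mulrC.
  by rewrite -ltnS.
rewrite big_seq (eq_bigr (fun=> q ^+ n)) -?big_seq; last first.
  move=> D hD; have Dm := monics_monic hD; have D0 := monic_neq0 Dm.
  have -> : q ^+ n = absR D by rewrite /(absR _) (monics_deg hD).
  rewrite -sum_divs_phi // /divs (monics_size hD).
  rewrite big_filter big_flatten big_map.
  by rewrite -(big_mkord xpredT (fun i => \sum_(E <- monics F i | E %| D) phi E)) /index_iota subn0.
by rewrite sum_const_monics -exprD addnn mul2n.
Qed.

Lemma tot0 : tot 0 = 1.
Proof. by rewrite /tot monics0 big_seq1 phi1. Qed.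

Lemma totS n : tot n.+1 = q ^+ (2 * n.+1) - q ^+ (2 * n).+1.
Proof.
have := tot_conv n.+1; rewrite big_ord_recr /= subnn expr0 mulr1 => <-.
rewrite (eq_bigr (fun i : 'I_n.+1 => q * (tot i * q ^+ (n - i)))); last first.
  by move=> i _; rewrite subSn ?exprS 1?mulrCA // -ltnS.
by rewrite -big_distrr /= tot_conv exprS; ring.
Qed.

(** Equal to [1/zeta_A(2)]; for positive [n], [tot n] is exactly [q^(2n)] times it. *)
Definition kap : R := 1 - q^-1.

Lemma kap_bound : 0 <= kap <= 1.
Proof.
have q1 := q_ge1 R F; have q0 := q_gt0 R F; rewrite /kap subr_ge0 invf_le1 // q1 /=.
by rewrite gerBl invr_ge0 ltW.
Qed.

Lemma tot_approx n : `|tot n - q ^+ (2 * n) * kap| <= q ^+ n.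
Proof.
have q0 := q_gt0 R F; have q1 := q_ge1 R F; case: n => [|n].
  rewrite tot0 muln0 !expr0 mul1r /kap opprB addrCA subrr addr0.
  have i0 : 0 <= q^-1 by rewrite invr_ge0 ltW.
  by rewrite (ger0_norm i0) invf_le1.
rewrite totS; have -> : q ^+ (2 * n.+1) * kap = q ^+ (2 * n.+1) - q ^+ (2 * n).+1.
  by rewrite /kap mulrBr mulr1 mulnS 2!addSn add0n [q ^+ _.+2]exprSr mulfK // gt_eqF.
by rewrite subrr normr0 ltW // qX_gt0.
Qed.

Definition Phi n e : R := \sum_(D <- monics F n | e %| D) phi D.

(** Put [D = P D1]. The totient is multiplied by [|P| - 1], and by one more if [P | D1]; this extra
    unit is the sum over multiples of [P e] in the lower degree. *)
Lemma Phi_rec n e P : primeA P -> e \is monic -> ~~ (P %| e) ->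
  ((size P).-1 <= n)%N ->
  Phi n (P * e) = Phi (n - (size P).-1) (P * e) + (absR P - 1) * Phi (n - (size P).-1) e.
Proof.
move=> Pp em nd dn; have cP : coprimep P e by rewrite primeA_coprime.
rewrite /Phi; under eq_bigl do rewrite Gauss_dvdp //.
under [X in _ = X + _]eq_bigl do rewrite Gauss_dvdp //.
rewrite big_mkcondr /= (big_monics_dvd _ _ Pp.1) //.
rewrite big_distrr /= [X in _ = _ + X]big_mkcond [X in _ = X + _]big_mkcond -big_split /=.
rewrite !big_seq; apply: eq_bigr => D hD; have Dm := monics_monic hD.
rewrite Gauss_dvdpr; last by rewrite coprimep_sym.
rewrite phi_mulP //; case: (P %| D); case: (e %| D) => /=; ring.
Qed.

Lemma Phi_small n e P : primeA P -> (n < (size P).-1)%N -> Phi n (P * e) = 0.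
Proof.
move=> Pp nP; rewrite /Phi big_seq_cond big1 // => D /andP[hD dD].
have := dvdp_leq (monic_neq0 (monics_monic hD)) (dvdp_trans (dvdp_mulr e (dvdpp P)) dD).
by rewrite (monics_size hD); move: nP; case: (size P) => // k; lia.
Qed.

Definition sig S : R := \prod_(P <- S) (absR P + 1).

Lemma absR_ge1 P : 1 <= absR P.
Proof. by rewrite exprn_ege1 // q_ge1. Qed.

Lemma sig_ge1 S : 1 <= sig S.
Proof.
rewrite /sig; elim: S => [|P S IH]; first by rewrite big_nil.
rewrite big_cons mulr_ege1 //; have := absR_ge1 P; lra.
Qed.

(** The recursion has fixed point [1/(|P| + 1)], and its errors add up to
    [(1 + (|P| - 1)) q^(n-d) = q^n]. So the bound reproduces itself and is uniform in the set of
    primes. *)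
Lemma Phi_approx S n : uniq S -> (forall P, P \in S -> primeA P) ->
  `|Phi n (eS S) - q ^+ (2 * n) * kap / sig S| <= q ^+ n.
Proof.
elim: S n => [|P S IH] n.
  move=> _ _; rewrite /eS /sig !big_nil divr1 /Phi.
  by under eq_bigl do rewrite dvd1p; exact: tot_approx.
move=> /= /andP[PS uS] pr; have Pp : primeA P by apply: pr; rewrite mem_head.
have pr' Q : Q \in S -> primeA Q by move=> h; apply: pr; rewrite inE h orbT.
have em : eS S \is monic by rewrite /eS big_seq; apply: monic_prod => Q /pr' [].
have nd : ~~ (P %| eS S) by rewrite dvd_eS.
have -> : eS (P :: S) = P * eS S by rewrite /eS big_cons.
have -> : sig (P :: S) = (absR P + 1) * sig S by rewrite /sig big_cons.
set p := absR P; have p1 : 1 <= p := absR_ge1 P; have s1 := sig_ge1 S.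
set d := (size P).-1; have dp : (0 < d)%N by rewrite /d; have := primeA_size Pp; case: (size P) => [|[]].
have /andP[k0 k1] := kap_bound.
have [m] := ubnP n; elim: m n => // m IHn n; rewrite ltnS => nm.
have [nd'|dn] := ltnP n d.
  have t0 : 0 < (p + 1) * sig S by nra.
  have X0 := qX_gt0 R F n; have X0' := qX_gt0 R F (2 * n).
  rewrite Phi_small // sub0r normrN ger0_norm; last first.
    by apply: divr_ge0; [apply: mulr_ge0 => //; exact: ltW|exact: ltW].
  have le : q ^+ n <= p by rewrite /p /(absR _) ler_eXn2l ?q_gt1 // ltnW.
  rewrite ler_pdivrMr // mul2n -addnn exprD.
  apply: (@le_trans _ _ (q ^+ n * q ^+ n)); first by nra.
  by rewrite ler_pM2l //; nra.
rewrite (Phi_rec Pp em nd dn) -/d -/p.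
have e2 : q ^+ (2 * n) = q ^+ (2 * (n - d)) * p ^+ 2.
  by rewrite /p /(absR _) -/d -exprM -exprD; congr (_ ^+ _); move: dn; lia.
have e1 : q ^+ n = q ^+ (n - d) * p by rewrite /p /(absR _) -/d -exprD subnK.
have h1 := IHn (n - d)%N (leq_trans (_ : n - d < n)%N nm).
have h2 := IH (n - d)%N uS pr'.
have -> : Phi (n - d) (P * eS S) + (p - 1) * Phi (n - d) (eS S) -
   q ^+ (2 * n) * kap / ((p + 1) * sig S) =
  (Phi (n - d) (P * eS S) - q ^+ (2 * (n - d)) * kap / ((p + 1) * sig S)) +
  (p - 1) * (Phi (n - d) (eS S) - q ^+ (2 * (n - d)) * kap / sig S).
  rewrite e2; move: (Phi _ _) (Phi _ _) (q ^+ _) => A B C; field.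
  by apply/andP; split; rewrite gt_eqF //; lra.
apply: le_trans (ler_normD _ _) _; rewrite normrM (ger0_norm (_ : 0 <= p - 1)); last by lra.
rewrite e1; apply: (@le_trans _ _ (q ^+ (n - d) + (p - 1) * q ^+ (n - d))); last by lra.
apply: lerD; first by apply: h1; move: dp dn; lia.
by rewrite ler_wpM2l // subr_ge0.
Qed.

End Counting.

(** * Coefficients of the Euler product, and averages over squares *)

Section Coefs.
Variables (R : realType) (F : finFieldType).
Implicit Types (P D E e l : {poly F}) (n b k N : nat) (S : seq {poly F}).
Local Notation q := (#|F|%:R : R).
Local Notation absR := (@absR R F).
Local Notation phi := (@phi R F).
Local Notation Phi := (@Phi R F).
Local Notation sig := (@sig R F).
Local Notation kap := (kap R F).

Definition deg_eS S : nat := (size (eS S)).-1.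

Definition pcoef b : R :=
  \sum_(e <- monics F b | sqf e) \prod_(P <- pdivs b e) - (absR P + 1)^-1.

Definition ccoef k : R := \sum_(b < k.+1) pcoef b * q ^+ (k - b).

Definition cnt k S : R := \sum_(l <- monics F k | eS S %| l) 1.

Lemma cntE k N S : S \in subs (prs F N) ->
  cnt k S = if (deg_eS S <= k)%N then q ^+ (k - deg_eS S) else 0.
Proof.
move=> hS; rewrite /cnt; case: leqP => h; last exact: big_monics_ndvd.
by rewrite big_monics_dvd ?(eS_monic hS) // sum_const_monics mulr1.
Qed.

Lemma sum_by_degree (A : nmodType) N k (H : seq {poly F} -> A) :
  (forall S, S \in subs (prs F N) -> (k < deg_eS S)%N -> H S = 0) ->
  \sum_(S <- subs (prs F N)) H S =
  \sum_(b < k.+1) \sum_(S <- subs (prs F N) | deg_eS S == b) H S.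
Proof.
move=> h; under [RHS]eq_bigr do rewrite big_mkcond; rewrite exchange_big /= !big_seq.
apply: eq_bigr => S hS; rewrite -big_mkcond /=.
have [le|lt] := leqP (deg_eS S) k.
  by rewrite (big_pred1 (Ordinal (le : (deg_eS S < k.+1)%N))) // => i; rewrite eq_sym.
rewrite h // big_pred0 // => i; apply/negbTE; rewrite gtn_eqF //.
exact: leq_trans (ltn_ord i) lt.
Qed.

Lemma pcoefE b N : (b <= N)%N ->
  pcoef b = \sum_(S <- subs (prs F N) | deg_eS S == b) \prod_(P <- S) - (absR P + 1)^-1.
Proof. by move=> bN; rewrite subs_sum. Qed.

Lemma prod_opp_inv S : \prod_(P <- S) - (absR P + 1)^-1 = (-1) ^+ size S / sig S.
Proof.
rewrite /(sig _); elim: S => [|P S IH]; first by rewrite !big_nil divr1.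
by rewrite !big_cons IH /= exprS invfM; ring.
Qed.

Lemma absR_eS N S : S \in subs (prs F N) -> \prod_(P <- S) absR P = q ^+ deg_eS S.
Proof.
move=> /subs_prs [_ pS]; rewrite -[RHS]/(absR (eS S)) /eS.
have := @absR_prod R F S (fun=> 1%N) (fun P h => prs_prime (pS P h)).
by under eq_bigr do rewrite expr1; move=> ->; under [RHS]eq_bigr do rewrite expr1.
Qed.

Lemma prod_bool (S : seq {poly F}) (p : pred {poly F}) :
  \prod_(P <- S) ((p P)%:R : R) = (all p S)%:R.
Proof.
elim: S => [|P S IH]; first by rewrite big_nil.
by rewrite big_cons IH /=; case: (p P); rewrite ?mul1r ?mul0r.
Qed.

Definition ib (x : bool) : R := x%:R.

(** Inclusion-exclusion: coprimality is the product over primes of [1] minus the indicator that [P]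
    divides both, expanded over sets of primes. *)
Lemma coprime_prod l D k : l \in monics F k -> D \is monic ->
  ib (coprimep D l) =
  \sum_(S <- subs (prs F k)) (-1) ^+ size S * (ib (eS S %| l) * ib (eS S %| D)).
Proof.
move=> hl Dm; have lm := monics_monic hl; have l0 := monic_neq0 lm; have D0 := monic_neq0 Dm.
transitivity (\prod_(P <- prs F k) (1 + - (ib (P %| l) * ib (P %| D)))).
  have [cD|nc] := boolP (coprimep D l).
    rewrite big_seq big1 // => P /prs_prime Pp.
    case dD : (P %| D); last by rewrite mulr0 oppr0 addr0.
    by rewrite (negbTE (coprime_prime_ndvd Pp cD dD)) mul0r oppr0 addr0.
  have s1 : (1 < size (gcdp D l))%N.
    by rewrite ltn_neqAle size_poly_gt0 gcdp_eq0 negb_and D0 andbT eq_sym.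
  have [P Pp] := prime_divisor_exists s1; rewrite dvdp_gcd => /andP[dD dl].
  have Pk : P \in prs F k by apply: (prs_dvd Pp l0) dl; rewrite (monics_size hl).
  by rewrite (bigD1_seq P) ?prs_uniq //= dD dl /ib mulr1 subrr mul0r.
rewrite prod_subs !big_seq; apply: eq_bigr => S hS; have [uS pS] := subs_prs hS.
have pS' Q : Q \in S -> primeA Q by move=> /pS /prs_prime.
rewrite !eS_dvd // -[X in _ = _ * (X * _)]prod_bool -[X in _ = _ * (_ * X)]prod_bool.
elim: (S) => [|P S' IH]; first by rewrite !big_nil expr0 !mulr1.
by rewrite !big_cons IH /= exprS /ib; ring.
Qed.

Lemma sum_ib (r : seq {poly F}) (p : pred {poly F}) (G : {poly F} -> R) :
  \sum_(x <- r) ib (p x) * G x = \sum_(x <- r | p x) G x.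
Proof.
rewrite [RHS]big_mkcond; apply: eq_bigr => x _; rewrite /ib; case: (p x).
  by rewrite mul1r.
by rewrite mul0r.
Qed.

Lemma cnt_ib k S : cnt k S = \sum_(l <- monics F k) ib (eS S %| l).
Proof.
rewrite /cnt -(sum_ib _ (fun l => eS S %| l) (fun=> 1)).
by apply: eq_bigr => l _; rewrite mulr1.
Qed.

Lemma ccoefE k : ccoef k =
  \sum_(S <- subs (prs F k)) (-1) ^+ size S * (cnt k S / sig S).
Proof.
rewrite (sum_by_degree (k := k)); last first.
  by move=> S hS lt; rewrite (cntE _ hS) leqNgt lt /= mul0r mulr0.
apply: eq_bigr => b _; have bk : (b <= k)%N by rewrite -ltnS.
rewrite (pcoefE bk) big_distrl /= big_seq_cond [RHS]big_seq_cond; apply: eq_bigr => S.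
move=> /andP[hS /eqP e]; rewrite prod_opp_inv (cntE _ hS) e bk; ring.
Qed.

Lemma sum_cnt_le k : \sum_(S <- subs (prs F k)) cnt k S <= k.+1%:R * q ^+ k.
Proof.
rewrite (sum_by_degree (k := k)); last first.
  by move=> S hS lt; rewrite (cntE _ hS) leqNgt lt.
apply: (@le_trans _ _ (\sum_(b < k.+1) q ^+ k)); last first.
  by rewrite sumr_const card_ord mulr_natl.
apply: ler_sum => b _; have bk : (b <= k)%N by rewrite -ltnS.
rewrite big_seq_cond (eq_bigr (fun=> q ^+ (k - b))); last first.
  by move=> S /andP[hS /eqP e]; rewrite (cntE _ hS) e bk.
rewrite -big_seq_cond big_const_seq iter_addr_0 -(mulr_natl (q ^+ _)).
apply: (@le_trans _ _ (q ^+ b * q ^+ (k - b))); last by rewrite -exprD subnKC.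
by rewrite ler_pM2r ?qX_gt0 // -natrX ler_nat count_subs.
Qed.

Section Msum.
Variable xi : F.
Hypothesis char2 : 2%N \in [pchar F].
Hypothesis nxi : ~~ inH xi.
Local Notation Ssum := (@Ssum R F).

Definition Msum n k : R := \sum_(l <- monics F k) Ssum n (l ^+ 2).

Lemma MsumE n k :
  Msum n k = \sum_(S <- subs (prs F k)) (-1) ^+ size S * (cnt k S * Phi n (eS S)).
Proof.
transitivity (\sum_(l <- monics F k) \sum_(D <- monics F n) \sum_(S <- subs (prs F k))
   (-1) ^+ size S * (ib (eS S %| l) * ib (eS S %| D)) * phi D).
  rewrite /Msum !big_seq; apply: eq_bigr => l hl; have lm := monics_monic hl.
  rewrite (Ssum_square R char2 nxi) ?monic_exp ?deriv_sqr2 // -sum_ib !big_seq.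
  apply: eq_bigr => D hD; have Dm := monics_monic hD.
  by rewrite -big_distrl /= -(coprime_prod hl Dm) coprimep_pexpr.
under eq_bigr do rewrite exchange_big; rewrite exchange_big /=; apply: eq_bigr => S _.
rewrite cnt_ib /(Phi _ _) -(sum_ib _ (fun D => eS S %| D) phi) big_distrlr /= big_distrr /=.
apply: eq_bigr => l _; rewrite big_distrr /=; apply: eq_bigr => D _; ring.
Qed.

(** Each set [S] costs [q^n] times the number of [l] that it divides. For each degree [b <= k] there
    are at most [q^b] sets with [q^(k-b)] multiples, whence [(k + 1) q^k]. *)
Lemma Msum_approx n k :
  `|Msum n k - q ^+ (2 * n) * kap * ccoef k| <= k.+1%:R * q ^+ (n + k).
Proof.
rewrite MsumE ccoefE big_distrr /= -sumrB; apply: le_trans (ler_norm_sum _ _ _) _.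
apply: (@le_trans _ _ (\sum_(S <- subs (prs F k)) cnt k S * q ^+ n)); last first.
  rewrite -big_distrl /= addnC exprD mulrA ler_pM2r ?qX_gt0 //; exact: sum_cnt_le.
rewrite !big_seq; apply: ler_sum => S hS; have [uS pS] := subs_prs hS.
have pS' Q : Q \in S -> primeA Q by move=> /pS /prs_prime.
have -> : (-1) ^+ size S * (cnt k S * Phi n (eS S)) -
   q ^+ (2 * n) * kap * ((-1) ^+ size S * (cnt k S / sig S)) =
   (-1) ^+ size S * (cnt k S * (Phi n (eS S) - q ^+ (2 * n) * kap / sig S)) by ring.
have c0 : 0 <= cnt k S by rewrite /cnt sumr_ge0.
rewrite normrM normrX normrN1 expr1n mul1r normrM ger0_norm //.
by rewrite ler_wpM2l // Phi_approx.
Qed.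

Definition Tsum n m : R := \sum_(f <- monics F m) Ssum n f.

Lemma square_monic (f : {poly F}) : f \is monic -> od2 f = 0 -> ev2 f ^+ 2 = f /\ ev2 f \is monic.
Proof.
move=> fm o0; have e : ev2 f ^+ 2 = f.
  by rewrite {2}(ev_od2 char2 f) o0 expr0n mulr0 addr0.
split=> //; have e1 : lead_coef (ev2 f) ^+ 2 = 1 by rewrite -lead_coef_exp e (monicP fm).
have : (lead_coef (ev2 f) - 1) ^+ 2 = 0.
  rewrite (oppr_pchar2 char2) sqrFD // e1 expr1n addrr_pchar2 //.
by move/eqP; rewrite sqrf_eq0 subr_eq0 => /eqP h; rewrite monicE h.
Qed.

Lemma ev2_sqr l : ev2 (l ^+ 2) = l.
Proof.
have e := ev_od2 char2 (l ^+ 2); have d := deriv_od2 char2 (l ^+ 2).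
have o0 : od2 (l ^+ 2) = 0.
  by apply/eqP; rewrite -sqrf_eq0 -d deriv_sqr2.
move: e; rewrite o0 expr0n mulr0 addr0 => e.
apply/eqP; rewrite -subr_eq0 -sqrf_eq0 oppp2 // sqrD2 // -e addpp2 //.
Qed.

Lemma od2_sqr l : od2 (l ^+ 2) = 0.
Proof.
by apply/eqP; rewrite -sqrf_eq0 -(deriv_od2 char2) deriv_sqr2.
Qed.

Lemma sum_squares m (G : {poly F} -> R) :
  \sum_(f <- monics F m | od2 f == 0) G f =
  if odd m then 0 else \sum_(l <- monics F m./2) G (l ^+ 2).
Proof.
case: ifPn => om.
  rewrite big_seq_cond big1 // => f /andP[hf /eqP o0].
  have [e _] := square_monic (monics_monic hf) o0.
  have := monics_deg hf; rewrite -e size_exp => em.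
  by move: om; rewrite -em muln2 odd_double.
have em : (m./2.*2 = m)%N by rewrite -[RHS](odd_double_half m) (negbTE om).
rewrite -big_filter; apply: (@big_seq_reindex _ _ _ _ _ _ _ _ (@ev2 F)).
- exact: monics_uniq.
- by rewrite filter_uniq // monics_uniq.
- move=> l hl; have lm := monics_monic hl; rewrite ev2_sqr; split=> //.
  rewrite mem_filter od2_sqr eqxx /= -em -muln2 -(monics_deg hl) -size_exp.
  by rewrite mem_monics_deg // monic_exp.
- move=> f; rewrite mem_filter => /andP[/eqP o0 hf].
  have [e lm] := square_monic (monics_monic hf) o0; rewrite e; split=> //.
  have := monics_deg hf; rewrite -{1}e size_exp muln2 => <-.
  by rewrite doubleK mem_monics_deg.
Qed.

End Msum.

Definition hcoef b : R := \sum_(i < b.+1) pcoef i.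

(** Expand [1/(|P| + 1) = 1 - |P|/(|P| + 1)] over sets of primes: the factors [|P|] and the
    [q^(b - deg)] multiples of the product combine to the same [q^b] for every set, leaving the
    partial sum of the [pcoef]. The right side shows that it is nonnegative. *)
Lemma hcoefE b :
  q ^+ b * hcoef b = \sum_(e <- monics F b) \prod_(P <- pdivs b e) (absR P + 1)^-1.
Proof.
pose g P : R := - (absR P / (absR P + 1)).
transitivity (\sum_(e <- monics F b) \sum_(S <- subs (prs F b)) ib (eS S %| e) * \prod_(P <- S) g P);
  last first.
  rewrite !big_seq; apply: eq_bigr => e he; have em := monics_monic he.
  transitivity (\prod_(P <- prs F b) (1 + ib (P %| e) * g P)).
    rewrite prod_subs !big_seq; apply: eq_bigr => S hS; have [uS pS] := subs_prs hS.
    have pS' Q : Q \in S -> primeA Q by move=> /pS /prs_prime.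
    by rewrite eS_dvd ?monic_neq0 // big_split /= prod_bool.
  rewrite /pdivs [RHS]big_filter [RHS]big_mkcond; apply: eq_bigr => P _.
  rewrite /ib /g; case: (P %| e); last by rewrite mul0r addr0.
  have p1 := absR_ge1 R P; rewrite mul1r; field; rewrite gt_eqF //; lra.
rewrite exchange_big /= (sum_by_degree (k := b)); last first.
  move=> S hS lt; rewrite -big_distrl /=; have := cntE b hS.
  by rewrite cnt_ib leqNgt lt /= => ->; rewrite mul0r.
rewrite /hcoef big_distrr /=; apply: eq_bigr => i _; have ib' : (i <= b)%N by rewrite -ltnS.
rewrite (pcoefE ib') big_distrr /= big_seq_cond [RHS]big_seq_cond; apply: eq_bigr => S.
move=> /andP[hS /eqP di]; rewrite -big_distrl /=; have := cntE b hS.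
rewrite di ib' cnt_ib => ->; rewrite /g.
have -> : \prod_(P <- S) - (absR P / (absR P + 1)) = q ^+ i * \prod_(P <- S) - (absR P + 1)^-1.
  rewrite -di -(absR_eS hS) -big_split /=; apply: eq_bigr => P _; ring.
by rewrite mulrA -exprD subnK.
Qed.

(** Squares of primes are removed until the cofactor is squarefree; there each factor is at most
    [1/|P|], while the removed primes contribute factors at most 1. *)
Lemma square_part e : e \is monic -> exists c, [/\ c \is monic, c ^+ 2 %| e &
  \prod_(P <- pdivs (size e) e) (absR P + 1)^-1 <= absR c ^+ 2 / absR e].
Proof.
have i0 (P : {poly F}) : 0 <= (absR P + 1)^-1.
  by rewrite invr_ge0; have := absR_ge1 R P; lra.
have i1 (P : {poly F}) : (absR P + 1)^-1 <= 1.
  by rewrite invf_le1; have := absR_ge1 R P; lra.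
have [m] := ubnP (size e); elim: m e => // m IH e; rewrite ltnS => sm em.
have e0 := monic_neq0 em.
have [[P [Pp dP]]|nsq] := pselect (exists P, primeA P /\ P ^+ 2 %| e).
  have Pm := Pp.1; have P0 := primeA_neq0 Pp.
  have [e' em' ee] := monic_divisor em (monic_exp 2 Pm) dP.
  have e0' := monic_neq0 em'.
  have lt : (size e' < m)%N.
    apply: leq_trans sm; rewrite ee size_mul ?expf_neq0 //.
    have : (2 < size (P ^+ 2)%R)%N.
      rewrite -(prednK (n := size _)) ?size_poly_gt0 ?expf_neq0 // size_exp.
      by have := primeA_size Pp; move: (size P) => i; lia.
    case: (size (P ^+ 2)%R) => [|[|[|k]]] // _.
    by rewrite !addSn /= ltnS leqW // leq_addl.
  have [c [cm dc bd]] := IH e' lt em'.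
  exists (P * c); split; first by rewrite monicMl.
    by rewrite exprMn ee dvdp_mul2l // expf_neq0.
  have -> : absR (P * c) ^+ 2 / absR e = absR c ^+ 2 / absR e'.
    rewrite ee (absRM R (monic_exp 2 Pm) em') (absRM R Pm cm).
    have -> : absR (P ^+ 2) = absR P ^+ 2 by rewrite expr2 absRM.
    field; rewrite !gt_eqF ?absR_gt0 //.
  apply: le_trans bd.
  have se : (size e' <= (size e))%N by apply: dvdp_leq => //; rewrite ee dvdp_mull.
  have pe : perm_eq (pdivs (size e') e') (pdivs (size e) e').
    apply: (perm_trans (pdivs_perm e0' (leqnSn _))); rewrite perm_sym.
    by apply: pdivs_perm => //; apply: leqW.
  rewrite [leRHS](perm_big _ pe) /pdivs [leLHS]big_filter [leRHS]big_filter [leLHS]big_mkcond [leRHS]big_mkcond.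
  apply: ler_prod => Q _; case dQ' : (Q %| e').
    by rewrite ee (dvdp_mull _ dQ') lexx i0.
  by case: ifP => _; rewrite ?i0 ?i1 ?ler01 ?lexx.
exists 1; rewrite monic1 expr1n dvd1p; split=> //.
have -> : absR 1 = 1 by rewrite /(absR _) size_poly1 expr0.
rewrite expr1n mul1r.
have ee : e = \prod_(P <- pdivs (size e) e) P.
  have hp Q : Q \in pdivs (size e) e -> primeA Q.
    by rewrite mem_filter => /andP[_ /prs_prime].
  have uq : uniq (pdivs (size e) e) by apply: filter_uniq; exact: prs_uniq.
  apply: eq_val => //; first by rewrite big_seq; apply: monic_prod => Q /hp [].
  move=> P Pp; rewrite -/(eS _) val_eS // mem_filter.
  have le1 : (valA P e <= 1)%N.
    by rewrite leqNgt -valP //; apply/negP => h; apply: nsq; exists P.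
  have [v0|vp] := posnP (valA P e).
    by have -> : (P %| e) = false by rewrite val_dvd // v0.
  have dP : P %| e by rewrite val_dvd.
  rewrite dP /= (prs_dvd Pp e0 (leqnSn _) dP) /=.
  by apply/eqP; rewrite eqn_leq le1.
rewrite {3}ee -[X in absR X]/(eS _).
have hS : pdivs (size e) e \in subs (prs F (size e)) by rewrite mem_subs filter_subseq.
rewrite -[absR _]/(q ^+ deg_eS _) -(absR_eS hS) -prodfV.
apply: ler_prod => P _; rewrite i0 lef_pV2 ?posrE ?absR_gt0 //; have := absR_ge1 R P; lra.
Qed.

Lemma sum_geo (m : nat) : \sum_(j < m.+1) q ^+ j <= 2 * q ^+ m.
Proof.
have q2 : 2 <= q by have := q_gt1 R F; rewrite ltr1n => h; rewrite ler_nat.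
elim: m => [|m IH]; first by rewrite big_ord1 expr0; lra.
rewrite big_ord_recr /=; apply: le_trans (lerD IH (lexx _)) _; rewrite exprS.
by have := qX_gt0 R F m; nra.
Qed.

(** The square part [c] of [e] is not tracked: one sums over all [c] with [c^2 | e]. For [deg c = j]
    the weight [q^(2j - b)] meets [q^(b - 2j)] multiples, so the total is the sum of [q^j] for
    [j <= b/2]. *)
Lemma hcoef_bound b : 0 <= hcoef b <= 2 * q ^+ b./2 / q ^+ b.
Proof.
have qb := qX_gt0 R F b.
have i0 (P : {poly F}) : 0 <= (absR P + 1)^-1.
  by rewrite invr_ge0; have := absR_ge1 R P; lra.
rewrite -(pmulr_rge0 _ qb) ler_pdivlMr // [hcoef b * _]mulrC hcoefE.
rewrite sumr_ge0 /=; last by move=> e _; apply: prodr_ge0.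
apply: le_trans (sum_geo b./2).
apply: (@le_trans _ _ (\sum_(e <- monics F b) \sum_(j < b./2.+1)
   \sum_(c <- monics F j | c ^+ 2 %| e) q ^+ (2 * j) / q ^+ b)).
  rewrite !big_seq; apply: ler_sum => e he; have em := monics_monic he.
  have [c [cm dc bd]] := square_part em; have e0 := monic_neq0 em.
  have pe : perm_eq (pdivs b e) (pdivs (size e) e).
    have := pdivs_perm e0 (leqnSn (size e)); rewrite perm_sym (monics_deg he) //.
  rewrite (perm_big _ pe) /=; apply: le_trans bd _.
  have nn (i : nat) : 0 <= q ^+ i / q ^+ b by rewrite divr_ge0 // ltW // qX_gt0.
  have dj : ((size c).-1 < b./2.+1)%N.
    have := dvdp_leq e0 dc; rewrite (monics_size he).
    rewrite -(prednK (n := size (c ^+ 2))) ?size_poly_gt0 ?expf_neq0 ?monic_neq0 //.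
    by rewrite size_exp; move: (size c).-1 => i; lia.
  rewrite (bigD1 (Ordinal dj)) //= -[leLHS]addr0; apply: lerD; last first.
    by apply: sumr_ge0 => j _; apply: sumr_ge0.
  rewrite -big_filter (bigD1_seq c) /=; last 2 first.
  - by rewrite mem_filter dc mem_monics_deg.
  - by apply: filter_uniq; exact: monics_uniq.
  rewrite -[leLHS]addr0; apply: lerD; last by apply: sumr_ge0.
  by rewrite /(absR c) /(absR e) -exprM mulnC (monics_deg he).
rewrite exchange_big /=; apply: ler_sum => j _.
have jb : (2 * j <= b)%N by have := ltn_ord j; lia.
under eq_bigr do rewrite big_mkcond; rewrite exchange_big /= big_seq.
rewrite (eq_bigr (fun=> 1)); last first.
  move=> c hc; have cm := monics_monic hc; rewrite -big_mkcond /=.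
  have sc : (size (c ^+ 2)).-1 = (2 * j)%N by rewrite size_exp (monics_deg hc) mulnC.
  rewrite big_monics_dvd ?monic_exp ?sc // sum_const_monics.
  by rewrite mulrA -exprD subnK // divff // gt_eqF.
by rewrite -big_seq sum_const_monics mulr1.
Qed.

End Coefs.

(** * Polynomials with odd exponents only *)

Section OddPolynomials.
Variable F : finFieldType.
Implicit Types (p : {poly F}) (s j : nat).

(** This is [T p(T^2)] for [p] of size at most [s]; a nonzero top coefficient becomes
    [size p = s]. *)
Definition godd s p : {poly F} := \sum_(1 <= i < s.+1) (p`_(i - 1))%:P * 'X^(2 * i - 1).

Lemma coef_godd s p j : (godd s p)`_j = if odd j && (j < 2 * s)%N then p`_(j./2) else 0.
Proof.
rewrite /godd coef_sum; case: ifPn => h; last first.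
  rewrite big_nat_cond big1 // => i /andP[/andP[i1 i2] _]; rewrite coefCM coefXn.
  case: eqP => [e|_]; last by rewrite mulr0.
  by move: h; rewrite e; case/negP; apply/andP; split; [rewrite oddB ?mul2n ?odd_double //|]; lia.
rewrite (bigD1_seq (j./2.+1)) ?iota_uniq //=; last first.
  by rewrite mem_index_iota; move: h; lia.
rewrite coefCM coefXn subn1 /= (_ : j == _) ?mulr1; last by apply/eqP; move: h; lia.
rewrite big1_seq ?addr0 // => i /andP[ne]; rewrite mem_index_iota => hi.
rewrite coefCM coefXn; case: eqP => [e|_]; last by rewrite mulr0.
by move: ne; case/eqP; move: h e hi; lia.
Qed.

Lemma size_godd s p : (0 < s)%N -> size p = s -> size (godd s p) = (2 * s)%N.
Proof.
move=> s0 sp; apply/eqP; rewrite eqn_leq; apply/andP; split.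
  by apply/leq_sizeP => j hj; rewrite coef_godd ltnNge hj andbF.
have c0 : (godd s p)`_(2 * s).-1 != 0.
  rewrite coef_godd ifT; last by move: s0; lia.
  have -> : (2 * s).-1./2 = s.-1 by move: s0; lia.
  by rewrite -sp -/(lead_coef p) lead_coef_eq0 -size_poly_gt0 sp.
rewrite -(prednK (n := 2 * s)%N) ?muln_gt0 //.
by rewrite ltnNge; apply: contra c0 => /leq_sizeP /(_ _ (leqnn _)) ->.
Qed.

Lemma godd0 s p : (godd s p)`_0 = 0. Proof. by rewrite coef_godd. Qed.

Lemma godd_inj s p p' : (size p <= s)%N -> (size p' <= s)%N ->
  godd s p = godd s p' -> p = p'.
Proof.
move=> sp sp' e; apply/polyP => i; have [si|is_] := leqP s i.
  by rewrite !nth_default // ?(leq_trans sp) ?(leq_trans sp').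
have := congr1 (fun h : {poly F} => h`_(2 * i + 1)) e; rewrite !coef_godd.
have -> : odd (2 * i + 1) && (2 * i + 1 < 2 * s)%N by move: is_; lia.
by have -> : (2 * i + 1)./2 = i by lia.
Qed.

Definition gpolys s := [seq p : {poly F} <- polys F s | size p == s].

End OddPolynomials.

(** * Coefficients of the L-functions *)

Section LCoefs.
Variables (R : realType) (F : finFieldType) (xi : F).
Hypothesis char2 : 2%N \in [pchar F].
Hypothesis nxi : ~~ inH xi.
Implicit Types (P D E B f p G : {poly F}) (u v : ratfun F) (n m s j : nat).
Local Notation q := (#|F|%:R : R).
Local Notation psi := (@psi R F).
Local Notation chi := (@chi F R).

Definition coefU u m : R := \sum_(f <- monics F m) chi u f.

Lemma sum_nonzero (c : R) : \sum_(x <- enum F | x != 0) c = (q - 1) * c.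
Proof.
rewrite big_enum_cond /= sumr_const -(mulr_natl c); congr (_ * _).
rewrite (_ : #|_| = #|F|.-1); last by rewrite -(cardC1 (0 : F)); apply: eq_card => x; rewrite !inE.
by rewrite -subn1 natrB //; apply/card_gt0P; exists 0.
Qed.

Lemma sum_exact_degree m (G : {poly F} -> R) :
  (forall (c : F) f, c != 0 -> G (c *: f) = G f) ->
  \sum_(f <- polys F m.+1 | size f == m.+1) G f = (q - 1) * \sum_(f <- monics F m) G f.
Proof.
move=> hG; rewrite -big_filter.
pose r := [seq (c, f) | c <- [seq c <- enum F | c != 0], f <- monics F m].
rewrite (@big_seq_reindex _ _ _ _ _ r _ (fun x : F * {poly F} => x.1 *: x.2)
   (fun f => (lead_coef f, (lead_coef f)^-1 *: f))).
- rewrite big_allpairs_dep /= big_filter -sum_nonzero; apply: eq_bigr => c c0.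
  by apply: eq_bigr => f _; rewrite hG.
- apply: allpairs_uniq.
  + by apply: filter_uniq; exact: enum_uniq.
  + exact: monics_uniq.
  + by move=> [? ?] [? ?].
- by rewrite filter_uniq // polys_uniq.
- move=> x /allpairsP [[c f] /= []]; rewrite mem_filter mem_enum => /andP[c0 _] hf -> /=.
  rewrite mem_filter mem_polys size_scale // (monics_size hf) eqxx leqnn; split=> //.
  by rewrite lead_coefZ (monicP (monics_monic hf)) mulr1 scalerA mulVf // scale1r.
- move=> f; rewrite mem_filter => /andP[/eqP sf _].
  have f0 : f != 0 by rewrite -size_poly_gt0 sf.
  have l0 : lead_coef f != 0 by rewrite lead_coef_eq0.
  split; last by rewrite /= scalerA divff // scale1r.
  apply: (allpairs_f pair); first by rewrite mem_filter l0 mem_enum.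
  by rewrite mem_monics monicE lead_coefZ mulVf // eqxx size_scale ?invr_eq0 // sf eqxx.
Qed.

(** For a function invariant under constants, as [theta] is, sums over a space of polynomials become
    partial sums over monic polynomials; the functional equation is thereby about partial sums of
    coefficients. *)
Lemma sum_polys_monics m (G : {poly F} -> R) :
  (forall (c : F) f, c != 0 -> G (c *: f) = G f) -> G 0 = 0 ->
  \sum_(f <- polys F m) G f = (q - 1) * \sum_(j < m) \sum_(f <- monics F j) G f.
Proof.
move=> hG G0; elim: m => [|m IH].
  rewrite big_ord0 mulr0 big_seq big1 // => f; rewrite mem_polys size_poly_leq0.
  by move=> /eqP ->.
rewrite (bigID (fun f => size f == m.+1)) /= sum_exact_degree // big_ord_recr /= mulrDr.
rewrite addrC; congr (_ + _); rewrite -IH -big_filter; apply: perm_big; apply: uniq_perm.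
- by rewrite filter_uniq // polys_uniq.
- exact: polys_uniq.
by move=> f; rewrite mem_filter !mem_polys -[RHS]ltnS ltn_neqAle.
Qed.

Lemma theta_0 D B : (1 < size D)%N -> theta R D B 0 = 0.
Proof.
by move=> sD; rewrite theta0 // coprime0p -size_poly_eq1 gtn_eqF.
Qed.

Definition is_rep n u := exists D B : {poly F},
  [/\ D \in monics F n, simple_poles D B, (size B < size (D ^+ 2)%R)%N &
      u = B%:K / (D ^+ 2)%:K].

Lemma Vseq_is_rep n D u : D \in monics F n -> u \in Vseq (prs F n) D -> is_rep n u.
Proof.
by move=> hD /(Vseq_prs_spec hD) [B [eu sB pB]]; exists D, B.
Qed.

Lemma Fset_is_rep n u : Fset F n u -> is_rep n u.
Proof. by move=> /Fset_Fseq /mem_Fseq [D hD hu]; exact: Vseq_is_rep hD hu. Qed.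

Lemma coefU_theta D B m : D \is monic -> simple_poles D B ->
  (size B < size (D ^+ 2)%R)%N ->
  coefU (B%:K / (D ^+ 2)%:K) m = \sum_(f <- monics F m) theta R D B f.
Proof.
move=> Dm pB sB; rewrite /coefU !big_seq; apply: eq_bigr => f hf.
by rewrite (chi_theta R char2 nxi) // (monics_monic hf).
Qed.

Lemma coefU_FE n u m : (0 < n)%N -> is_rep n u ->
  q ^+ n * \sum_(j < m) coefU u j = q ^+ m * \sum_(j < 2 * n - m) coefU u j.
Proof.
move=> n0 [D [B [hD pB sB ->]]]; have Dm := monics_monic hD.
have sD := monics_deg hD.
have q1 : q - 1 != 0 by rewrite subr_eq0 gt_eqF // q_gt1.
have s1 : (1 < size D)%N by rewrite (monics_size hD).
have hG (c : F) f : c != 0 -> theta R D B (c *: f) = theta R D B f by exact: thetaZ.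
apply: (mulfI q1); rewrite !mulrA ![(q - 1) * _]mulrC -!mulrA.
under eq_bigr do rewrite coefU_theta //; under [in RHS]eq_bigr do rewrite coefU_theta //.
rewrite -!sum_polys_monics //; try exact: theta_0.
by have := functional_equation R char2 nxi Dm pB m; rewrite sD.
Qed.

(** For [k >= 2n] the dual sum in the functional equation is empty, so all these partial sums are
    0. *)
Lemma coefU_vanish n u m : (0 < n)%N -> is_rep n u -> (2 * n <= m)%N -> coefU u m = 0.
Proof.
move=> n0 hu nm.
have z k : (2 * n <= k)%N -> \sum_(j < k) coefU u j = 0.
  move=> hk; have := coefU_FE k n0 hu; rewrite (_ : 2 * n - k = 0)%N; last by move: hk; lia.
  rewrite big_ord0 mulr0 => /eqP; rewrite mulf_eq0 gt_eqF ?qX_gt0 //= => /eqP; exact.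
have := z m.+1 (leqW nm); rewrite big_ord_recr /= z // add0r; exact.
Qed.

Lemma chi_add_poly D B G f : D \is monic -> simple_poles D B -> f \is monic ->
  chi (B%:K / (D ^+ 2)%:K + G%:K) f = chi (B%:K / (D ^+ 2)%:K) f * psi (res (G * f^`()) f).
Proof.
move=> Dm pB fm; have D0 := monic_neq0 Dm; have D20 : D ^+ 2 != 0 by rewrite expf_neq0.
have eG : G%:K = G%:K / 1%:K :> ratfun F by rewrite tofrac1 divr1.
have [cD|cD] := boolP (coprimep D f).
  rewrite (chiD R char2 nxi) //.
  - congr (_ * _); rewrite eG (@chi_res R F xi char2 nxi _ G 1 G f) ?oner_neq0 ?coprime1p //.
    by rewrite mulr1 subrr dvdp0.
  - by exists B, (D ^+ 2); split=> //; rewrite coprimep_expl.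
  - by exists G, 1; split; rewrite ?oner_neq0 ?coprime1p.
(* If [f] meets a pole both sides are 0: adding a multiple of [D^2] to [B] keeps its simple zeros at
   the primes of [D]. *)
rewrite chi_pole // mul0r.
have -> : B%:K / (D ^+ 2)%:K + G%:K = (B + G * D ^+ 2)%:K / (D ^+ 2)%:K :> ratfun F.
  by move: (D ^+ 2) D20 => d d0; rewrite tofracD tofracM mulrDl mulfK // tofrac_neq0.
apply: chi_pole => // P Pp dP; have [d1 n1] := pB P Pp dP.
have d2 : P ^+ 2 %| G * D ^+ 2 by rewrite dvdp_mull // dvdp_exp2r.
split; last by rewrite dvdp_addl.
by rewrite dvdp_add // (dvdp_trans _ d2) // expr2 dvdp_mulr.
Qed.

Lemma res_const_deriv (c : F) f : f \is monic ->
  res (c%:P * f^`()) f = c *+ (size f).-1.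
Proof.
move=> fm; have f0 := monic_neq0 fm; rewrite mul_polyC resZ /res modp_small ?lt_size_deriv //.
have s0 : (0 < size f)%N by rewrite size_poly_gt0.
rewrite coef_deriv; case: (ltngtP (size f) 1) => [|s1|s1].
- by move: s0; case: (size f).
- have -> : (size f).-2.+1 = (size f).-1 by move: s1; case: (size f) => [|[]].
  by rewrite -/(lead_coef f) (monicP fm) mulr_natr.
- by rewrite s1 /= nth_default ?s1 // mul0rn mulr0 mulr0n.
Qed.

Lemma psi_mulrn k : psi (xi *+ k) = (-1) ^+ k.
Proof.
elim: k => [|k IH]; first by rewrite mulr0n psi0 expr0.
by rewrite mulrS psiD // IH (psi_xi R nxi) exprS.
Qed.

(** The residue of [f'/f] is the degree of [f], so the constant [xi] contributes
    [psi (xi *+ m) = (-1)^m]. The inert family at [z] is thus the real family at [-z]. *)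
Lemma coefU_twist D B m : D \is monic -> simple_poles D B ->
  coefU (B%:K / (D ^+ 2)%:K + (xi%:P)%:K) m = (-1) ^+ m * coefU (B%:K / (D ^+ 2)%:K) m.
Proof.
move=> Dm pB; rewrite /coefU big_distrr /= !big_seq; apply: eq_bigr => f hf.
have fm := monics_monic hf.
by rewrite chi_add_poly // res_const_deriv // psi_mulrn (monics_deg hf) mulrC.
Qed.

Lemma coefU_infinity D B s p m : D \is monic -> simple_poles D B ->
  (size B < size (D ^+ 2)%R)%N -> (0 < s)%N -> size p = s ->
  coefU (B%:K / (D ^+ 2)%:K + (godd s p)%:K) m =
  \sum_(f <- monics F m) theta R D B f * theta R 'X^s (Binf s (godd s p)) (revp m f).
Proof.
move=> Dm pB sB s0 sp; rewrite /coefU !big_seq; apply: eq_bigr => f hf.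
have fm := monics_monic hf.
rewrite chi_add_poly // (chi_theta R char2 nxi) //; congr (_ * _).
have := chi_infinity R char2 nxi s0 (size_godd s0 sp) (godd0 s p) fm.
by rewrite (monics_deg hf).
Qed.

(** The character at infinity vanishes on [revp k f] when [deg f < k]. Hence the sum over all
    polynomials sees one degree only, and the functional equation holds for single coefficients. *)
Lemma coefU_infinity_FE D B r s p m : D \in monics F r -> simple_poles D B ->
  (size B < size (D ^+ 2)%R)%N -> (0 < s)%N -> size p = s ->
  let u := B%:K / (D ^+ 2)%:K + (godd s p)%:K in
  q ^+ (r + s) * coefU u m =
  if (m <= 2 * r + 2 * s - 2)%N then q ^+ m.+1 * coefU u (2 * r + 2 * s - 2 - m) else 0.
Proof.
move=> hD pB sB s0 sp u; have Dm := monics_monic hD; have dD := monics_deg hD.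
have q1 : q - 1 != 0 by rewrite subr_eq0 gt_eqF // q_gt1.
set th := theta R D B; set ti := theta R 'X^s (Binf s (godd s p)).
have Xm : ('X^s : {poly F}) \is monic by exact: monicXn.
pose H k f := th f * ti (revp k f).
have hZ k (c : F) f : c != 0 -> H k (c *: f) = H k f.
  by move=> c0; rewrite /H revpZ /th /ti !thetaZ.
have ti0 w : ~~ coprimep w 'X^s -> ti w = 0 by exact: theta0.
have Hz k f : (size f <= k)%N -> H k f = 0.
  move=> sf; rewrite /H ti0 ?mulr0 //; rewrite coprimep_pexpr // coprimepX negbK.
  by rewrite /root horner_coef0 coef_revp leq0n subn0 nth_default.
have ex k : \sum_(f <- polys F k.+1) H k f = (q - 1) * coefU u k.
  rewrite /u coefU_infinity // -sum_exact_degree //; last exact: hZ.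
  rewrite [RHS]big_mkcond /= !big_seq; apply: eq_bigr => f; rewrite mem_polys => sf.
  by case: eqP => // /eqP ne; rewrite Hz // -ltnS ltn_neqAle ne.
have FE := functional_equation_infinity R char2 nxi s0 (size_godd s0 sp) Dm pB m.
rewrite dD in FE.
apply: (mulfI q1); rewrite mulrCA -ex FE; case: leqP => h.
  have -> : (2 * r + 2 * s - 1 - m = (2 * r + 2 * s - 2 - m).+1)%N by move: h s0; lia.
  by rewrite ex mulrCA.
have -> : (2 * r + 2 * s - 1 - m = 0)%N by move: h s0; lia.
rewrite mulr0 big_seq big1 ?mulr0 // => f; rewrite mem_polys => sf.
by apply: (Hz _ f); rewrite (leq_trans sf).
Qed.

End LCoefs.

(** * The ramified family I_n *)

Section Families.
Variables (R : realType) (F : finFieldType) (xi : F).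
Hypothesis char2 : 2%N \in [pchar F].
Hypothesis nxi : ~~ inH xi.
Implicit Types (P D E B f p G : {poly F}) (u v : ratfun F) (n m s j : nat).
Local Notation q := (#|F|%:R : R).
Local Notation psi := (@psi R F).
Local Notation chi := (@chi F R).
Local Notation Ssum := (@Ssum R F).
Local Notation Msum := (@Msum R F).
Local Notation coefU := (@coefU R F).
Local Notation kap := (@kap R F).
Local Notation ccoef := (@ccoef R F).

Lemma succ_le_pow2 k : (k.+1%:R : R) <= 2 ^+ k.
Proof. by rewrite -natrX ler_nat; exact: ltn_expl. Qed.

(** The weight [X] allows for the character sum over polynomial parts; it is constant 1 for the
    families without them. Of the factor 2, one unit bounds the non-squares and one the error of
    [Msum_approx], whose [m./2.+1] is at most [2^(m./2)]. *)
Lemma weighted_approx n m (c : R) (X : {poly F} -> R) :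
  0 <= c -> (forall f, `|X f| <= c) -> (forall f, od2 f = 0 -> X f = c) ->
  `|\sum_(f <- monics F m) Ssum n f * X f
    - c * (if odd m then 0 else q ^+ (2 * n) * kap * ccoef m./2)|
  <= 2 * c * q ^+ (n + m) * 2 ^+ m./2.
Proof.
move=> c0 hX Xc.
have key : `|\sum_(f <- monics F m | od2 f != 0) Ssum n f * X f| <= c * (q ^+ (n + m) * 2 ^+ m./2).
  apply: le_trans (ler_norm_sum _ _ _) _.
  apply: (@le_trans _ _ (\sum_(f <- monics F m) c * (q ^+ n * 2 ^+ m./2))); last first.
    by rewrite sum_const_monics exprD le_eqVlt; apply/orP; left; apply/eqP; ring.
  rewrite big_mkcond !big_seq; apply: ler_sum => f hf; case: ifP => o0; last first.
    by rewrite !mulr_ge0 // ?exprn_ge0 // ltW // q_gt0.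
  rewrite normrM mulrC; apply: ler_pM => //.
  apply: le_trans (Ssum_nonsquare _ char2 nxi n (monics_monic hf) o0) _.
  rewrite ler_pM2l ?qX_gt0 // ler_eXn2l ?ltr1n //.
  by have := size_od2 char2 f; rewrite (monics_size hf); move: (size (od2 f)) => i; lia.
have E0 : 0 <= q ^+ (n + m) * 2 ^+ m./2 by rewrite mulr_ge0 // ?exprn_ge0 // ltW // q_gt0.
rewrite (bigID (fun f => od2 f == 0)) /=.
rewrite (eq_bigr (fun f => c * Ssum n f)); last by move=> f /eqP /Xc ->; rewrite mulrC.
rewrite -big_distrr /= (sum_squares char2).
case: ifP => om.
  rewrite mulr0 add0r subr0; apply: (le_trans key).
  rewrite -mulrA -mulrA [2 * _]mulrC ler_peMr ?mulr_ge0 //.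
  by rewrite ler1n.
rewrite -/(Msum n m./2) addrAC -mulrBr; apply: (le_trans (ler_normD _ _)).
have h := Msum_approx R char2 nxi n m./2.
have -> : 2 * c * q ^+ (n + m) * 2 ^+ m./2 =
    c * (q ^+ (n + m) * 2 ^+ m./2) + c * (q ^+ (n + m) * 2 ^+ m./2) by ring.
apply: lerD => //.
rewrite normrM ger0_norm //; apply: ler_wpM2l => //; apply: (le_trans h).
rewrite mulrC; apply: ler_pM; rewrite ?ler0n ?succ_le_pow2 ?exprn_ge0 ?(ltW (q_gt0 R F)) //.
by rewrite ler_eXn2l ?q_gt1 //; lia.
Qed.

Lemma fsbig_Fset_seq (T : Type) (idx : T) (op : Monoid.com_law idx) n (G : ratfun F -> T) :
  \big[op/idx]_(u \in Fset F n) G u = \big[op/idx]_(u <- Fseq F n) G u.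
Proof. by rewrite fsbig_Fset /Fseq big_flatten big_map. Qed.

Lemma fsbig_Fset' (T : Type) (idx : T) (op : Monoid.com_law idx) n (G : ratfun F -> T) :
  \big[op/idx]_(u \in Fset' xi n) G u =
  \big[op/idx]_(u <- Fseq F n) G (u + (xi%:P)%:K).
Proof.
have -> : Fset' xi n = [set` [seq u + (xi%:P)%:K | u <- Fseq F n]].
  apply/seteqP; split=> u /=; first by move=> [v /Fset_Fseq hv <-]; exact: map_f.
  by move=> /mapP [v hv ->]; exists v => //; apply/Fset_Fseq.
by rewrite -fsbig_seq ?big_map // map_inj_uniq ?Fseq_uniq //; exact: addIr.
Qed.

Definition Gseq s : seq {poly F} :=
  [seq a%:P + godd s p | a <- [:: 0; xi], p <- gpolys F s].

Lemma xi_neq0 : xi != 0.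
Proof. by apply: contraNneq nxi => ->; exact: inH0. Qed.

Lemma mem_gpolys s p : (p \in gpolys F s) = (size p == s).
Proof. by rewrite mem_filter mem_polys; case: eqP => // ->; rewrite leqnn. Qed.

Lemma Gset_Gseq s f : (0 < s)%N -> Gset xi s f <-> f \in Gseq s.
Proof.
move=> s0; split.
  move=> [al [a [hal a0 ->]]].
  pose p := \poly_(i < s) a i.+1.
  have sp : size p = s.
    by rewrite size_poly_eq // prednK.
  apply/allpairsP; exists (al, p); split => /=.
  - by case: hal => ->; rewrite !inE eqxx // orbT.
  - by rewrite mem_gpolys sp.
  - congr (_ + _); rewrite /godd !big_nat; apply: eq_bigr => i /andP[i1 i2].
    by have -> : p`_(i - 1) = a i by rewrite coef_poly subn1 prednK // -ltnS i2.
move=> /allpairsP [[al p] /= [hal]]; rewrite mem_gpolys => /eqP sp ->.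
exists al, (fun i => p`_(i - 1)); split => //.
- by move: hal; rewrite !inE => /orP[] /eqP ->; [left|right].
- by rewrite subn1 -sp -/(lead_coef p) lead_coef_eq0 -size_poly_gt0 sp.
Qed.

Lemma size_Gseq s f : (0 < s)%N -> f \in Gseq s -> size f = (2 * s)%N.
Proof.
move=> s0 /allpairsP [[al p] /= [_]]; rewrite mem_gpolys => /eqP sp ->.
have sg := size_godd s0 sp; rewrite addrC size_polyDl // sg.
by apply: leq_ltn_trans (size_polyC_leq1 _) _; lia.
Qed.

Lemma Gseq_uniq s : uniq (Gseq s).
Proof.
apply: allpairs_uniq.
- by rewrite /= inE eq_sym xi_neq0.
- by rewrite filter_uniq // polys_uniq.
move=> [a p] [b p'] /allpairsP [x [_ hp ex]] /allpairsP [x' [_ hp' ex']] /= e.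
have {x ex}hp : p \in gpolys F s by case: ex => _ ->.
have {x' ex'}hp' : p' \in gpolys F s by case: ex' => _ ->.
have ea : a = b.
  have := congr1 (fun h : {poly F} => h`_0) e.
  by rewrite !coefD !coefC !eqxx !godd0 !addr0.
move: e; rewrite ea => /addrI /godd_inj -> //.
- by move: hp; rewrite mem_gpolys => /eqP ->.
- by move: hp'; rewrite mem_gpolys => /eqP ->.
Qed.

Lemma proper_poly_inj N M v v' f f' : N != 0 -> M != 0 -> proper N v -> proper M v' ->
  v + f%:K = v' + f'%:K -> v = v' /\ f = f'.
Proof.
move=> N0 M0 pv [C sC ev'] e.
have pn : proper M (- v').
  by exists (- C); rewrite ?size_polyN // ev' tofracN mulNr.
have [B sB eB] := properD N0 M0 pv pn.
have NM0 := mulf_neq0 N0 M0.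
have ef : (f' - f)%:K = B%:K / (N * M)%:K.
  rewrite -eB tofracB; move: e => /(congr1 (fun t => t - v' - f%:K)).
  by rewrite addrAC addrK addrAC => ->; ring.
have eB2 : B = (f' - f) * (N * M).
  apply/eqP; rewrite -tofrac_eq tofracM ef divfK // tofrac_neq0 //.
have f0 : f' - f = 0.
  apply/eqP; apply: contraT => f0; move: sB; rewrite eB2 size_mul //.
  by move: f0; rewrite -size_poly_gt0; move: (size _) (size _) => i j; lia.
have ff : f = f' by apply/eqP; rewrite eq_sym -subr_eq0 f0.
by split=> //; move: e; rewrite ff; exact: addIr.
Qed.

Lemma Fseq_proper n u : u \in Fseq F n -> exists2 N : {poly F}, N != 0 & proper N u.
Proof.
move=> /Fset_Fseq /Fset_is_rep [D [B [hD _ sB eu]]]; exists (D ^+ 2).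
  by rewrite expf_neq0 // monic_neq0 // (monics_monic hD).
by exists B.
Qed.

Definition Ipairs n s := [seq (v, f) | v <- Fseq F (n - s), f <- Gseq s].

Definition Iseq n : seq (ratfun F) :=
  [seq x.1 + x.2%:K | s <- iota 1 n, x <- Ipairs n s].

Lemma Iset_Iseq n u : Iset xi n u <-> u \in Iseq n.
Proof.
split.
  move=> [s /= hs [v [f [hv hf ->]]]].
  apply/allpairsPdep; exists s, (v, f); split=> //.
    by rewrite mem_iota; move: hs; lia.
  apply: (allpairs_f pair); first exact/Fset_Fseq.
  by apply/Gset_Gseq => //; case/andP: hs.
move=> /allpairsPdep [s [x []]]; rewrite mem_iota => hs /allpairsP [[v f] /= [hv hf ->]] -> /=.
exists s; first by move: hs => /=; lia.
exists v, f; split=> //; first exact/Fset_Fseq.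
by apply/Gset_Gseq => //; move: hs; lia.
Qed.

Lemma Iseq_uniq n : uniq (Iseq n).
Proof.
apply: (@allpairs_uniq_dep _ _ _ (fun s (x : ratfun F * {poly F}) => x.1 + x.2%:K)).
- exact: iota_uniq.
- move=> s _; apply: allpairs_uniq; [exact: Fseq_uniq|exact: Gseq_uniq|].
  by move=> [? ?] [? ?].
move=> [s x] [t y] /allpairsPdep [s1 [x1 [hs1 hx1 e1]]] /allpairsPdep [t1 [y1 [ht1 hy1 f1]]].
move: e1 f1 => [-> ->] [-> ->] /=.
move: hx1 hy1 => /allpairsP [[v f] /= [hv hf ->]] /allpairsP [[v' f'] /= [hv' hf' ->]] /= e.
have [N N0 pN] := Fseq_proper hv; have [M M0 pM] := Fseq_proper hv'.
have [-> ef] := proper_poly_inj N0 M0 pN pM e.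
rewrite !mem_iota in hs1 ht1.
have := size_Gseq _ hf; have := size_Gseq _ hf'; rewrite ef => h1 h2.
have est : s1 = t1.
  have := h1 _; have := h2 _; move: hs1 ht1 => /andP[s1p _] /andP[t1p _].
  by move=> /(_ s1p) -> /(_ t1p); lia.
by rewrite est.
Qed.

Lemma fsbig_Iset (T : Type) (idx : T) (op : Monoid.com_law idx) n (G : ratfun F -> T) :
  \big[op/idx]_(u \in Iset xi n) G u =
  \big[op/idx]_(s <- iota 1 n) \big[op/idx]_(v <- Fseq F (n - s))
    \big[op/idx]_(a <- [:: 0; xi]) \big[op/idx]_(p <- gpolys F s)
       G (v + (a%:P + godd s p)%:K).
Proof.
have -> : Iset xi n = [set` Iseq n] by apply/seteqP; split=> u /Iset_Iseq.
rewrite -fsbig_seq ?Iseq_uniq // /Iseq big_allpairs_dep; apply: eq_bigr => s _.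
rewrite /Ipairs big_allpairs_dep; apply: eq_bigr => v _.
by rewrite /Gseq big_allpairs_dep.
Qed.

Definition Usum n m : R :=
  \sum_(s <- iota 1 n) \sum_(v <- Fseq F (n - s)) \sum_(p <- gpolys F s)
    coefU (v + (godd s p)%:K) m.

Lemma coefU_add_xi n v s p m : is_rep n v ->
  coefU (v + (xi%:P + godd s p)%:K) m = (-1) ^+ m * coefU (v + (godd s p)%:K) m.
Proof.
move=> [D [B [hD pB sB ->]]]; have Dm := monics_monic hD.
rewrite /(coefU _ _) big_distrr /= !big_seq; apply: eq_bigr => f hf; have fm := monics_monic hf.
rewrite !(chi_add_poly R char2 nxi) // mulrDl resD // psiD // res_const_deriv //.
rewrite (psi_mulrn R char2 nxi) (monics_deg hf); ring.
Qed.

(** Pairing the constants 0 and [xi] kills the odd coefficients and doubles the even ones. *)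
Lemma sum_Iset_coefU n m :
  \sum_(u \in Iset xi n) coefU u m = (1 + (-1) ^+ m) * Usum n m.
Proof.
rewrite fsbig_Iset /Usum big_distrr /=; apply: eq_bigr => s _.
rewrite big_distrr /= !big_seq; apply: eq_bigr => v /Fset_Fseq /Fset_is_rep hv.
rewrite !big_cons big_nil addr0 -big_split big_distrr /=; apply: eq_bigr => p _.
by rewrite polyC0 add0r (coefU_add_xi _ _ _ hv) mulrDl mul1r.
Qed.

(** All members have [r + s = n + 1], so they share one functional equation, from which a factor [q]
    is cancelled. *)
Lemma Usum_FE n m : (m <= 2 * n)%N -> q ^+ n * Usum n.+1 m = q ^+ m * Usum n.+1 (2 * n - m).
Proof.
move=> hm; have q0 : q != 0 by rewrite gt_eqF // q_gt0.
apply: (mulfI q0); rewrite !mulrA -!exprS /Usum.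
have : forall s, s \in iota 1 n.+1 -> (0 < s <= n.+1)%N.
  by move=> s; rewrite mem_iota; lia.
move: (iota 1 n.+1) => r hr; rewrite !big_distrr /= !big_seq.
apply: eq_bigr => s /hr hs; rewrite !big_distrr /= !big_seq.
apply: eq_bigr => v /Fset_Fseq /Fset_is_rep [D [B [hD pB sB ->]]].
rewrite !big_distrr /= !big_seq; apply: eq_bigr => p; rewrite mem_gpolys => /eqP sp.
have s0 : (0 < s)%N by move: hs; lia.
have := coefU_infinity_FE R char2 nxi m hD pB sB s0 sp.
have -> : (n.+1 - s + s = n.+1)%N by move: hs; lia.
have -> : (2 * (n.+1 - s) + 2 * s - 2 = 2 * n)%N by move: hs; lia.
by rewrite hm.
Qed.

Lemma coefI_vanish n u m : Iset xi n.+1 u -> (2 * n < m)%N -> coefU u m = 0.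
Proof.
move=> /Iset_Iseq /allpairsPdep [s [x []]]; rewrite mem_iota => hs.
move=> /allpairsP [[v f] /= [/Fset_Fseq /Fset_is_rep hv hf ->]] -> /= hm.
have s0 : (0 < s)%N by move: hs; lia.
move: hf => /allpairsP [[a p] /= [ha]]; rewrite mem_gpolys => /eqP sp ->.
have z : coefU (v + (godd s p)%:K) m = 0.
  have q0 : q ^+ (n.+1 - s + s) != 0 by rewrite gt_eqF // qX_gt0.
  case: hv => [D [B [hD pB sB ->]]]; apply: (mulfI q0).
  rewrite mulr0 (coefU_infinity_FE R char2 nxi) // ifF //; apply/negbTE; rewrite -ltnNge.
  by move: hs hm; lia.
move: ha; rewrite !inE => /orP[] /eqP ->; first by rewrite polyC0 add0r.
by rewrite (coefU_add_xi _ _ _ hv) z mulr0.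
Qed.

Definition Xsum s f : R := \sum_(p <- gpolys F s) psi (res (godd s p * f^`()) f).

Lemma size_gpolys s : (0 < s)%N -> \sum_(p <- gpolys F s) (1 : R) = (q - 1) * q ^+ s.-1.
Proof.
case: s => // s _; rewrite /gpolys big_filter (@sum_exact_degree R F s (fun=> 1)) //.
by rewrite sum_const_monics mulr1.
Qed.

Lemma Xsum_bound s f : (0 < s)%N -> `|Xsum s f| <= (q - 1) * q ^+ s.-1.
Proof.
move=> s0; rewrite -size_gpolys //; apply: le_trans (ler_norm_sum _ _ _) _.
by apply: ler_sum => p _; rewrite normr_psi.
Qed.

Lemma Xsum_square s f : (0 < s)%N -> od2 f = 0 -> Xsum s f = (q - 1) * q ^+ s.-1.
Proof.
move=> s0 o0; rewrite -size_gpolys //; apply: eq_bigr => p _.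
by rewrite (deriv_od2 char2) o0 expr0n /= mulr0 res0 psi0.
Qed.

Lemma UsumE n m :
  Usum n m = \sum_(s <- iota 1 n) \sum_(f <- monics F m) Ssum (n - s) f * Xsum s f.
Proof.
apply: eq_bigr => s _; rewrite /(coefU _ _).
under eq_bigr do rewrite exchange_big.
rewrite exchange_big /= !big_seq; apply: eq_bigr => f hf; have fm := monics_monic hf.
rewrite /(Ssum _ _) -(fsbig_Fset +%R (n - s) (fun v => chi v f)) fsbig_Fset_seq.
rewrite big_distrl /= !big_seq; apply: eq_bigr => v /Fset_Fseq /Fset_is_rep.
move=> [D [B [hD pB sB ->]]]; have Dm := monics_monic hD.
rewrite /Xsum big_distrr /=; apply: eq_bigr => p _.
by rewrite (chi_add_poly R char2 nxi).
Qed.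

Lemma pcoef_bound b : `|pcoef R F b| <= 2.
Proof.
have hb c : 0 <= hcoef R F c <= 2.
  have /andP[h1 h2] := hcoef_bound R F c; rewrite h1 (le_trans h2) //.
  rewrite -mulrA ler_piMr // ler_pdivrMr ?qX_gt0 // mul1r ler_eXn2l ?q_gt1 //.
  by rewrite -divn2 leq_div.
case: b => [|b].
  have := hb 0%N; rewrite /hcoef big_ord_recr big_ord0 /= add0r => /andP[h1 h2].
  by rewrite ger0_norm.
have e : pcoef R F b.+1 = hcoef R F b.+1 - hcoef R F b.
  by rewrite /hcoef [in RHS]big_ord_recr /= addrAC subrr add0r.
have := hb b; have := hb b.+1; rewrite e => /andP[h1 h2] /andP[h3 h4].
by rewrite ler_norml; apply/andP; split; lra.
Qed.

Lemma ccoef_bound k : `|ccoef k| <= 4 * q ^+ k.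
Proof.
apply: le_trans (ler_norm_sum _ _ _) _.
apply: (@le_trans _ _ (\sum_(b < k.+1) 2 * q ^+ (k - b))).
  apply: ler_sum => b _; rewrite normrM ler_pM //; first exact: pcoef_bound.
  by rewrite ger0_norm // exprn_ge0 // ltW // q_gt0.
rewrite -big_distrr /=.
have -> : \sum_(b < k.+1) q ^+ (k - b) = \sum_(b < k.+1) q ^+ b.
  rewrite (reindex_inj rev_ord_inj) /=; apply: eq_bigr => b _; congr (_ ^+ _).
  by have := ltn_ord b; lia.
have := sum_geo R F k; lra.
Qed.

(** There are [(q - 1) q^(s-1)] odd parts for given [s], and the finite part has main weight
    [q^(2(n-s))]. Besides [q^(2n-1)] the geometric sum leaves [q^(n-1)], which is of the size of the
    error. *)
Lemma sum_qs n : \sum_(s <- iota 1 n) (q - 1) * q ^+ s.-1 * q ^+ (2 * (n - s))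
   = q ^+ n * (q ^+ n - 1) / q.
Proof.
have q0 : q != 0 by rewrite gt_eqF // q_gt0.
have -> : \sum_(s <- iota 1 n) (q - 1) * q ^+ s.-1 * q ^+ (2 * (n - s)) =
          \sum_(j < n) (q - 1) * (q ^+ n / q) * q ^+ j.
  have -> : iota 1 n = index_iota 1 n.+1 by rewrite /index_iota subn1.
  rewrite big_add1 /= big_mkord (reindex_inj rev_ord_inj) /=.
  apply: eq_bigr => j _; have := ltn_ord j => hj.
  have e1 : q ^+ n = q * (q ^+ (n - j.+1) * q ^+ j).
    by rewrite -exprD -exprS; congr (_ ^+ _); move: hj; lia.
  rewrite e1 (_ : (2 * _ = j + j)%N); last by move: hj; lia.
  by rewrite exprD; field.
rewrite -big_distrr /=.
by rewrite subrX1; field.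
Qed.

(** [6 n] covers [2 n + 4]: a 2 from [weighted_approx] for each [s], and 4 from the leftover of
    [sum_qs] times [ccoef_bound]. *)
Lemma Usum_approx n k : (0 < n)%N ->
  `|Usum n (2 * k) - q ^+ (2 * n) / q * kap * ccoef k| <= 6 * n%:R * q ^+ (n + 2 * k) * 2 ^+ k.
Proof.
move=> n0; have q0 : q != 0 by rewrite gt_eqF // q_gt0.
have q1 := q_ge1 R F; have qp := q_gt0 R F.
have k2 : (2 * k)./2 = k by lia.
have o2 : odd (2 * k) = false by rewrite mul2n odd_double.
rewrite UsumE.
have main : \sum_(s <- iota 1 n) (q - 1) * q ^+ s.-1 * (q ^+ (2 * (n - s)) * kap * ccoef k) =
   q ^+ (2 * n) / q * kap * ccoef k - q ^+ n / q * kap * ccoef k.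
  transitivity ((\sum_(s <- iota 1 n) (q - 1) * q ^+ s.-1 * q ^+ (2 * (n - s))) * (kap * ccoef k)).
    by rewrite big_distrl /=; apply: eq_bigr => s _; ring.
  by rewrite sum_qs mul2n -addnn exprD; field.
set A := \sum_(s <- _) _; set B := _ / q * kap * ccoef k.
have -> : A - B = (A - \sum_(s <- iota 1 n) (q - 1) * q ^+ s.-1 * (q ^+ (2 * (n - s)) * kap * ccoef k))
    - q ^+ n / q * kap * ccoef k by rewrite main /B; ring.
apply: le_trans (ler_normB _ _) _.
have h1 : `|q ^+ n / q * kap * ccoef k| <= 4 * q ^+ (n + 2 * k) * 2 ^+ k.
  have /andP[k0 k1] := kap_bound R F.
  rewrite normrM ger0_norm; last by rewrite !mulr_ge0 // ?invr_ge0 ?exprn_ge0 // ltW.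
  apply: (@le_trans _ _ (q ^+ n * (4 * q ^+ k))).
    apply: ler_pM => //; last exact: ccoef_bound.
      by rewrite !mulr_ge0 // ?invr_ge0 ?exprn_ge0 // ltW.
    rewrite -mulrA ler_piMr ?exprn_ge0 ?(ltW qp) //.
    by rewrite mulr_ile1 // ?invr_ge0 ?(ltW qp) // invf_le1.
  rewrite mulrCA -exprD; apply: (@le_trans _ _ (4 * q ^+ (n + 2 * k))).
    by rewrite ler_pM2l // ler_weXn2l //; lia.
  rewrite ler_peMr ?mulr_ge0 ?exprn_ge0 ?(ltW qp) //.
  by rewrite -natrX ler1n expn_gt0.
have h2 : `|A - \sum_(s <- iota 1 n) (q - 1) * q ^+ s.-1 * (q ^+ (2 * (n - s)) * kap * ccoef k)|
   <= 2 * n%:R * q ^+ (n + 2 * k) * 2 ^+ k.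
  rewrite /A -sumrB; apply: le_trans (ler_norm_sum _ _ _) _.
  apply: (@le_trans _ _ (\sum_(s <- iota 1 n) 2 * q ^+ (n + 2 * k) * 2 ^+ k)); last first.
    rewrite big_const_seq count_predT size_iota iter_addr_0 -mulr_natl.
    by rewrite le_eqVlt; apply/orP; left; apply/eqP; ring.
  rewrite !big_seq; apply: ler_sum => s; rewrite mem_iota => hs.
  have s0 : (0 < s)%N by move: hs; lia.
  have c0 : 0 <= (q - 1) * q ^+ s.-1 by rewrite mulr_ge0 ?subr_ge0 ?exprn_ge0 // ltW.
  have := weighted_approx (n - s) (2 * k) c0 (fun f => Xsum_bound f s0)
     (fun f => Xsum_square s0).
  rewrite o2 k2 => h; apply: (le_trans h); rewrite ler_pM2r ?exprn_gt0 //.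
  rewrite -mulrA ler_pM2l // -mulrA -exprD.
  apply: (@le_trans _ _ (q * q ^+ (s.-1 + (n - s + 2 * k)))).
    by rewrite ler_pM2r ?qX_gt0 //; lra.
  by rewrite -exprS ler_weXn2l //; move: hs; lia.
apply: (le_trans (lerD h2 h1)).
have n1 : 1 <= n%:R :> R by rewrite ler1n.
have X0 : 0 <= q ^+ (n + 2 * k) * 2 ^+ k by rewrite mulr_ge0 ?exprn_ge0 // ltW.
rewrite -!mulrA; move: (q ^+ (n + 2 * k) * 2 ^+ k) X0 n1 => X X0; move: (n%:R) => N N1.
by nra.
Qed.

End Families.

(** * Complex power series with geometric bounds *)

Section Modulus.
Variable R : realType.
Implicit Types (x y z : R[i]) (a b c : nat -> R[i]) (C r t : R).

(** The modulus as a real number: the norm of [R[i]] takes values in [R[i]], where the order is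
    partial. *)
Definition cm z : R := Num.sqrt (Re z ^+ 2 + Im z ^+ 2).

Lemma cmE z : `|z| = (cm z)%:C.
Proof. exact: normc_def. Qed.

Lemma cm_ge0 z : 0 <= cm z.
Proof. by rewrite -lecR -cmE normr_ge0. Qed.

Lemma cm_le z t : (`|z| <= t%:C) = (cm z <= t).
Proof. by rewrite cmE lecR. Qed.

Lemma cm0 : cm 0 = 0. Proof. by apply: complexI; rewrite -cmE normr0. Qed.

Lemma cm1 : cm 1 = 1. Proof. by apply: complexI; rewrite -cmE normr1. Qed.

Lemma cmN z : cm (- z) = cm z. Proof. by apply: complexI; rewrite -!cmE normrN. Qed.

Lemma cmBC x y : cm (x - y) = cm (y - x). Proof. by apply: complexI; rewrite -!cmE distrC. Qed.

Lemma cmM x y : cm (x * y) = cm x * cm y.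
Proof. by apply: complexI; rewrite rmorphM /= -!cmE normrM. Qed.

Lemma cmX x n : cm (x ^+ n) = cm x ^+ n.
Proof. by apply: complexI; rewrite rmorphXn /= -!cmE normrX. Qed.

Lemma cmV x : cm x^-1 = (cm x)^-1.
Proof. by apply: complexI; rewrite fmorphV /= -!cmE normfV. Qed.

Lemma cmD x y : cm (x + y) <= cm x + cm y.
Proof. by rewrite -lecR rmorphD /= -!cmE ler_normD. Qed.

Lemma cmB x y : cm (x - y) <= cm x + cm y.
Proof. by rewrite -(cmN y) cmD. Qed.

Lemma cmR t : cm t%:C = `|t|.
Proof. by rewrite /cm /= expr0n /= addr0 sqrtr_sqr. Qed.

Lemma natC n : (n%:R : R[i]) = (n%:R)%:C.
Proof. by rewrite rmorph_nat. Qed.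

Lemma cm_nat n : cm n%:R = n%:R.
Proof. by rewrite natC cmR ger0_norm. Qed.

Lemma cm_eq0 z : (cm z == 0) = (z == 0).
Proof. by rewrite -(inj_eq (@complexI _)) -cmE normr_eq0. Qed.

Lemma cm_gt0 z : (0 < cm z) = (z != 0).
Proof. by rewrite lt_def cm_ge0 andbT cm_eq0. Qed.

Lemma cm_sum (I : Type) (r : seq I) (P : pred I) (f : I -> R[i]) :
  cm (\sum_(i <- r | P i) f i) <= \sum_(i <- r | P i) cm (f i).
Proof.
elim/big_rec2: _ => [|i s t _ h]; first by rewrite cm0.
by apply: le_trans (cmD _ _) _; rewrite lerD2l.
Qed.

Lemma cm_Re z : `|Re z| <= cm z.
Proof. by rewrite -lecR -cmE normc_ge_Re. Qed.

Lemma cm_Im z : `|Im z| <= cm z.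
Proof.
rewrite /cm -sqrtr_sqr ler_wsqrtr // lerDr sqr_ge0 //.
Qed.

Lemma cm_le_ReIm z : cm z <= `|Re z| + `|Im z|.
Proof.
rewrite /cm -(ger0_norm (addr_ge0 (normr_ge0 (Re z)) (normr_ge0 (Im z)))).
rewrite -sqrtr_sqr ler_wsqrtr // sqrrD !real_normK ?num_real //.
have := mulr_ge0 (normr_ge0 (Re z)) (normr_ge0 (Im z)).
by move: (`|_| * _) => u; lra.
Qed.

Lemma Re_sum (f : nat -> R[i]) n : Re (\sum_(i < n) f i) = \sum_(i < n) Re (f i).
Proof. by elim/big_rec2: _ => // i x y _ <-; case: (f i) y => ? ? []. Qed.

Lemma Im_sum (f : nat -> R[i]) n : Im (\sum_(i < n) f i) = \sum_(i < n) Im (f i).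
Proof. by elim/big_rec2: _ => // i x y _ <-; case: (f i) y => ? ? []. Qed.

Lemma sum_geo_nat C t N M : 0 <= C -> 0 <= t < 1 -> (N <= M)%N ->
  \sum_(N <= k < M) C * t ^+ k <= C * t ^+ N / (1 - t).
Proof.
move=> C0 /andP[t0 t1] NM; have d0 : 0 < 1 - t by lra.
have -> : \sum_(N <= k < M) C * t ^+ k = C * (t ^+ N - t ^+ M) / (1 - t).
  elim: M NM => [|M IH].
    by rewrite leqn0 => /eqP ->; rewrite big_geq // subrr mulr0 mul0r.
  rewrite leq_eqVlt => /orP[/eqP ->|NM]; first by rewrite big_geq // subrr mulr0 mul0r.
  by rewrite big_nat_recr //= IH // exprS; field; rewrite gt_eqF.
rewrite ler_pM2r ?invr_gt0 // ler_wpM2l // gerBl exprn_ge0 //.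
Qed.

Lemma real_geo_series (v : nat -> R) C t : 0 <= C -> 0 <= t < 1 ->
  (forall k, `|v k| <= C * t ^+ k) ->
  forall N, `|limn (series v) - \sum_(k < N) v k| <= C * t ^+ N / (1 - t).
Proof.
move=> C0 t01 hv N; have /andP[t0 t1] := t01.
have cv : cvgn (series v).
  apply: normed_cvg; apply: (series_le_cvg (v_ := geometric C t)) => [n|n|n|].
  - exact: normr_ge0.
  - by rewrite /= mulr_ge0 ?exprn_ge0.
  - exact: hv.
  - by apply: is_cvg_geometric_series; rewrite ger0_norm.
set B := _ / _.
have near_b : \forall M \near \oo, `|series v M - \sum_(k < N) v k| <= B.
  near=> M; have NM : (N <= M)%N by near: M; exists N.
  rewrite /series /= -(big_mkord xpredT) (big_cat_nat (n := N)) //= addrAC subrr add0r.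
  apply: le_trans (ler_norm_sum _ _ _) _; apply: le_trans (sum_geo_nat C0 t01 NM).
  by apply: ler_sum => k _; exact: hv.
rewrite ler_distl; apply/andP; split.
  apply: limr_ge => //; near=> M; have : `|series v M - \sum_(k < N) v k| <= B by near: M.
  by rewrite ler_distl => /andP[].
apply: limr_le => //; near=> M; have : `|series v M - \sum_(k < N) v k| <= B by near: M.
by rewrite ler_distl => /andP[].
Unshelve. all: by end_near.
Qed.

(** Real and imaginary parts are summed separately, which reduces convergence to real series; this
    costs the factor 2 in [pser_approx]. *)
Definition pser a x : R[i] :=
  limn (series (fun k => Re (a k * x ^+ k))) +i* limn (series (fun k => Im (a k * x ^+ k))).

Definition gbound a C r := [/\ 0 <= C, 0 <= r & forall k, cm (a k) <= C * r ^+ k].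

Lemma pser_approx a C r x N : gbound a C r -> r * cm x < 1 ->
  cm (pser a x - \sum_(k < N) a k * x ^+ k) <= 2 * C * (r * cm x) ^+ N / (1 - r * cm x).
Proof.
move=> [C0 r0 ha] rx; have rx0 : 0 <= r * cm x by rewrite mulr_ge0 ?cm_ge0.
have hb k : cm (a k * x ^+ k) <= C * (r * cm x) ^+ k.
  rewrite cmM cmX exprMn mulrA; apply: ler_wpM2r => //; first exact: exprn_ge0 (cm_ge0 _).
have hRe := @real_geo_series (fun k => Re (a k * x ^+ k)) C (r * cm x) C0 _
   (fun k => le_trans (cm_Re _) (hb k)) N.
have hIm := @real_geo_series (fun k => Im (a k * x ^+ k)) C (r * cm x) C0 _
   (fun k => le_trans (cm_Im _) (hb k)) N.
apply: le_trans (cm_le_ReIm _) _.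
have -> : Re (pser a x - \sum_(k < N) a k * x ^+ k) =
   limn (series (fun k => Re (a k * x ^+ k))) - \sum_(k < N) Re (a k * x ^+ k).
  by rewrite -(Re_sum (fun k => a k * x ^+ k)) /pser; case: (\sum_(_ < _) _).
have -> : Im (pser a x - \sum_(k < N) a k * x ^+ k) =
   limn (series (fun k => Im (a k * x ^+ k))) - \sum_(k < N) Im (a k * x ^+ k).
  by rewrite -(Im_sum (fun k => a k * x ^+ k)) /pser; case: (\sum_(_ < _) _).
have -> : 2 * C * (r * cm x) ^+ N / (1 - r * cm x) =
   C * (r * cm x) ^+ N / (1 - r * cm x) + C * (r * cm x) ^+ N / (1 - r * cm x) by ring.
by apply: lerD; [apply: hRe|apply: hIm]; rewrite rx0 rx.
Qed.

Lemma geo_small_eq0 C t : 0 <= t < 1 -> forall e : R, 0 < e ->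
  exists N, C * t ^+ N <= e.
Proof.
move=> /andP[t0 t1] e e0; have := @cvg_geometric R C t.
rewrite ger0_norm // => /(_ t1) /cvgrPdist_le /(_ e e0) [N _ /(_ N (leqnn N))] /= h.
by exists N; rewrite (le_trans (ler_norm _)) //; move: h; rewrite sub0r normrN.
Qed.

Lemma geo_eq0 z C t : 0 <= t < 1 -> (forall N, cm z <= C * t ^+ N) -> z = 0.
Proof.
move=> t01 h; apply/eqP; rewrite -cm_eq0 eq_le cm_ge0 andbT.
apply/ler_addgt0Pr => e e0; rewrite add0r.
by have [N hN] := geo_small_eq0 C t01 e0; exact: le_trans (h N) hN.
Qed.

(** The sum of the [a b] with [b > k]; these are the coefficients of the quotient of
    [pser a 1 - pser a x] by [1 - x], see [tail_pser]. *)
Definition tail a k : R[i] := pser a 1 - \sum_(b < k.+1) a b.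

Lemma tail_bound0 a C r N : gbound a C r -> r < 1 ->
  cm (pser a 1 - \sum_(b < N) a b) <= 2 * C / (1 - r) * r ^+ N.
Proof.
move=> ha r1; have h := @pser_approx a C r 1 N ha; rewrite cm1 mulr1 in h.
have := h r1; under eq_bigr do rewrite expr1n mulr1.
by rewrite mulrAC.
Qed.

Lemma tail_gbound a C r : gbound a C r -> r < 1 -> gbound (tail a) (2 * C / (1 - r)) r.
Proof.
move=> ha r1; have [C0 r0 _] := ha.
have c0 : 0 <= 2 * C / (1 - r) by rewrite divr_ge0 ?mulr_ge0 //; lra.
split=> // k; apply: le_trans (tail_bound0 k.+1 ha r1) _.
by rewrite ler_wpM2l // exprS ler_piMl ?exprn_ge0 // ltW.
Qed.

Lemma tail_finite a x N :
  (1 - x) * \sum_(k < N) tail a k * x ^+ k =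
  pser a 1 - \sum_(k < N) a k * x ^+ k - x ^+ N * (pser a 1 - \sum_(b < N) a b).
Proof.
elim: N => [|N IH]; first by rewrite !big_ord0; ring.
rewrite big_ord_recr mulrDr IH /tail [in RHS]big_ord_recr /= big_ord_recr /= exprS.
set s := \sum_(i < N) a i; set t := \sum_(i < N) _; ring.
Qed.

Lemma tail_pser a C r x : gbound a C r -> r < 1 -> r * cm x < 1 ->
  (1 - x) * pser (tail a) x = pser a 1 - pser a x.
Proof.
move=> ha r1 rx; have ht := tail_gbound ha r1; have [C0 r0 _] := ha.
have rx0 : 0 <= r * cm x by rewrite mulr_ge0 ?cm_ge0.
apply/eqP; rewrite -subr_eq0; apply/eqP.
apply: (@geo_eq0 _ (cm (1 - x) * (2 * (2 * C / (1 - r)) / (1 - r * cm x))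
   + 2 * C / (1 - r * cm x) + 2 * C / (1 - r)) (r * cm x)); first by rewrite rx0.
move=> N.
have -> : (1 - x) * pser (tail a) x - (pser a 1 - pser a x) =
  (1 - x) * (pser (tail a) x - \sum_(k < N) tail a k * x ^+ k)
  + (pser a x - \sum_(k < N) a k * x ^+ k) - x ^+ N * (pser a 1 - \sum_(b < N) a b).
  rewrite mulrBr tail_finite; move: (pser _ _) (pser _ _) (pser _ _) => p1 p2 p3.
  by move: (\sum_(_ < _) _) (\sum_(_ < _) _) (x ^+ N) => s1 s2 xN; ring.
apply: le_trans (cmB _ _) _; rewrite [leRHS]mulrDl; apply: lerD; last first.
  rewrite cmM cmX exprMn; have := tail_bound0 N ha r1.
  move=> /(ler_wpM2l (exprn_ge0 N (cm_ge0 x))) h; apply: le_trans h _.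
  by rewrite le_eqVlt; apply/orP; left; apply/eqP; ring.
apply: le_trans (cmD _ _) _; rewrite [leRHS]mulrDl; apply: lerD.
  rewrite cmM; have := pser_approx N ht rx.
  move=> /(ler_wpM2l (cm_ge0 (1 - x))) h; apply: le_trans h _.
  by rewrite le_eqVlt; apply/orP; left; apply/eqP; ring.
apply: le_trans (pser_approx N ha rx) _.
by rewrite mulrAC.
Qed.

Lemma pser_bound a C r x : gbound a C r -> r * cm x < 1 ->
  cm (pser a x) <= 2 * C / (1 - r * cm x).
Proof.
by move=> ha rx; have := pser_approx 0 ha rx; rewrite big_ord0 subr0 expr0 mulr1.
Qed.

(** The difference factors as [x - 1] times the tail series, so only continuity at 1 is obtained,
    the one point where formulas degenerate. *)
Lemma pser_lipschitz a C r x : gbound a C r -> r < 1 -> r * cm x < 1 ->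
  cm (pser a x - pser a 1) <= 4 * C / ((1 - r) * (1 - r * cm x)) * cm (x - 1).
Proof.
move=> ha r1 rx; have ht := tail_gbound ha r1.
have -> : pser a x - pser a 1 = pser (tail a) x * (x - 1).
  by rewrite -[LHS]opprB -(tail_pser ha r1 rx) -mulNr opprB mulrC.
rewrite cmM ler_wpM2r ?cm_ge0 //; apply: le_trans (pser_bound ht rx) _.
rewrite le_eqVlt; apply/orP; left; apply/eqP; move: rx; move: (cm _) => t rt.
by field; rewrite !gt_eqF //=; lra.
Qed.

Lemma pser_scale a (c x : R[i]) : pser (fun k => c ^+ k * a k) x = pser a (c * x).
Proof.
have e : (fun k => c ^+ k * a k * x ^+ k) = (fun k => a k * (c * x) ^+ k).
  by apply: funext => k; rewrite exprMn; ring.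
rewrite /pser; congr (limn (series _) +i* limn (series _)); apply: funext => k.
  by rewrite -[LHS]/(Re ((fun k => c ^+ k * a k * x ^+ k) k)) e.
by rewrite -[LHS]/(Im ((fun k => c ^+ k * a k * x ^+ k) k)) e.
Qed.

(** Kept as a sum and not as a quotient, so that it has the value [N] at [x = 1]. *)
Definition geosum x N : R[i] := \sum_(k < N) x ^+ k.

Lemma geosumE x N : (1 - x) * geosum x N = 1 - x ^+ N.
Proof. by rewrite /geosum -opprB mulNr -subrX1 opprB. Qed.

Lemma geosumS x N : geosum x N.+1 = geosum x N + x ^+ N.
Proof. by rewrite /geosum big_ord_recr. Qed.

Lemma partial_sums_approx a C r x N : gbound a C r -> r < 1 -> r * cm x < 1 ->
  cm (\sum_(k < N) (\sum_(b < k.+1) a b) * x ^+ k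
      - (pser a 1 * geosum x N - pser (tail a) x))
  <= 4 * C / ((1 - r) * (1 - r * cm x)) * (r * cm x) ^+ N.
Proof.
move=> ha r1 rx; have ht := tail_gbound ha r1.
have -> : \sum_(k < N) (\sum_(b < k.+1) a b) * x ^+ k
   = pser a 1 * geosum x N - \sum_(k < N) tail a k * x ^+ k.
  rewrite /geosum big_distrr /= -sumrB; apply: eq_bigr => k _; rewrite /tail; ring.
have -> : pser a 1 * geosum x N - \sum_(k < N) tail a k * x ^+ k
   - (pser a 1 * geosum x N - pser (tail a) x) =
   pser (tail a) x - \sum_(k < N) tail a k * x ^+ k by ring.
apply: le_trans (pser_approx N ht rx) _.
rewrite le_eqVlt; apply/orP; left; apply/eqP; move: rx; move: (cm _) => t rt.
by field; rewrite !gt_eqF //=; lra.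
Qed.

End Modulus.

(** * Splitting by parity, and geometric sums *)

Lemma sum_parity (K : comPzRingType) (f : nat -> K) (t : K) n :
  \sum_(j < n) t ^+ j * f j./2 =
  \sum_(k < uphalf n) f k * (t ^+ 2) ^+ k + t * \sum_(k < n./2) f k * (t ^+ 2) ^+ k.
Proof.
elim: n => [|n IH]; first by rewrite !big_ord0; ring.
rewrite big_ord_recr IH /= uphalf_half.
case: (boolP (odd n)) => on.
  have e : n = (1 + n./2.*2)%N by rewrite -{1}(odd_double_half n) on.
  rewrite add1n !(big_ord_recr n./2) /=.
  have -> : t ^+ n = t * (t ^+ 2) ^+ n./2 by rewrite {1}e exprD expr1 -exprM mul2n.
  by ring.
have e : n = (n./2.*2)%N by rewrite -{1}(odd_double_half n) (negbTE on).
rewrite add0n [in RHS]big_ord_recr /=.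
have -> : t ^+ n = (t ^+ 2) ^+ n./2 by rewrite {1}e -exprM mul2n.
by ring.
Qed.

Lemma sum_even (K : comPzRingType) (f : nat -> K) (t : K) n :
  \sum_(m < n) (if odd m then 0 else f m./2) * t ^+ m =
  \sum_(k < uphalf n) f k * (t ^+ 2) ^+ k.
Proof.
elim: n => [|n IH]; first by rewrite !big_ord0.
rewrite big_ord_recr IH /= uphalf_half.
case: (boolP (odd n)) => on; first by rewrite mul0r addr0 add1n.
rewrite add0n [in RHS]big_ord_recr /=; congr (_ + _ * _).
have e : n = (n./2.*2)%N by rewrite -{1}(odd_double_half n) (negbTE on).
by rewrite {1}e -exprM mul2n.
Qed.

Lemma uphalf_pred g : (0 < g)%N -> uphalf g = (g.-1)./2.+1.
Proof. by case: g. Qed.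

(** [t^2 >= 2] implies [t >= 4/3], and then [t/(t - 1) <= 4]. *)
Lemma geo_le (R : realType) (t : R) N : 0 < t -> 2 <= t ^+ 2 ->
  \sum_(m < N.+1) t ^+ m <= 4 * t ^+ N.
Proof.
move=> t0 t2; have t3 : 4 / 3 <= t by nra.
elim: N => [|N IH]; first by rewrite big_ord_recr big_ord0 /= add0r !expr0; lra.
rewrite big_ord_recr /= exprS; apply: (le_trans (lerD IH (lexx _))).
have : 0 <= t ^+ N by rewrite exprn_ge0 // ltW.
by move: (t ^+ N) => X X0; nra.
Qed.

Lemma geo_le' (R : realType) (t : R) N : 0 < t -> 2 <= t ^+ 2 ->
  \sum_(m < N) t ^+ m <= 4 * t ^+ N.
Proof.
move=> t0 t2; apply: le_trans (geo_le N t0 t2).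
by rewrite big_ord_recr /= lerDl exprn_ge0 // ltW.
Qed.

(** * Main terms *)

Section Functionals.
Variables (R : realType) (q : R).
Implicit Types (T : nat -> R[i]) (z : R[i]).
Local Notation qc := (q%:C : R[i]).

(* [LI] and [LF] are the L-polynomials in [z = q^(-s)], written in terms of the
   coefficients [T m], [m <= g], by means of the functional equations. *)
Definition LI T z g : R[i] :=
  \sum_(m < g.+1) T m * z ^+ m + \sum_(m < g) T m * (qc ^+ (g - m) * z ^+ (2 * g - m)).

Definition LF T z g : R[i] :=
  \sum_(m < g.+1) T m * z ^+ m - z ^+ g.+1 * \sum_(m < g.+1) T m
  + (1 - z) * (qc * z ^+ 2) ^+ g * \sum_(j < g) (qc * z)^-1 ^+ j * \sum_(m < j.+1) T m.

Lemma sum_affine (n : nat) (M : R[i]) (T D h : nat -> R[i]) :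
  \sum_(m < n) (M * T m + D m) * h m = M * (\sum_(m < n) T m * h m) + \sum_(m < n) D m * h m.
Proof.
rewrite big_distrr -big_split /=; apply: eq_bigr => m _.
by rewrite mulrDl mulrA.
Qed.

Lemma sum_affine1 (n : nat) (M : R[i]) (T D : nat -> R[i]) :
  \sum_(m < n) (M * T m + D m) = M * (\sum_(m < n) T m) + \sum_(m < n) D m.
Proof. by rewrite big_distrr -big_split. Qed.

Lemma LI_affine M T D z g :
  LI (fun m => M * T m + D m) z g = M * LI T z g + LI D z g.
Proof.
rewrite /LI (sum_affine _ _ _ _ (fun m => z ^+ m)).
rewrite (sum_affine _ _ _ _ (fun m => qc ^+ (g - m) * z ^+ (2 * g - m))) mulrDr.
by rewrite addrACA.
Qed.

Lemma LF_affine M T D z g :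
  LF (fun m => M * T m + D m) z g = M * LF T z g + LF D z g.
Proof.
rewrite /LF (sum_affine _ _ _ _ (fun m => z ^+ m)) sum_affine1.
have -> : \sum_(j < g) (qc * z)^-1 ^+ j * \sum_(m < j.+1) (M * T m + D m) =
   M * (\sum_(j < g) (qc * z)^-1 ^+ j * \sum_(m < j.+1) T m)
   + \sum_(j < g) (qc * z)^-1 ^+ j * \sum_(m < j.+1) D m.
  rewrite big_distrr -big_split /=; apply: eq_bigr => j _.
  by rewrite sum_affine1 mulrDr mulrCA.
move: (\sum_(_ < _) _) (\sum_(_ < _) _) (\sum_(_ < _) _) (\sum_(_ < _) _).
move: (\sum_(_ < _) _) (\sum_(_ < _) _) ((1 - z) * _) (z ^+ _).
move=> s1 s2 s3 s4 s5 s6 s7 s8; ring.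
Qed.

End Functionals.

Lemma pow_balance (K : fieldType) (q t d : K) m b : t != 0 ->
  (q * t ^+ 2) ^+ (m + b) * (d / t) ^+ m = (q * d) ^+ m * (q ^+ b * t ^+ (m + 2 * b)).
Proof.
move=> t0; rewrite exprD mulrAC -exprMn (_ : q * t ^+ 2 * (d / t) = q * d * t); last by field.
by rewrite (exprMn b q) !(exprMn m) exprD exprM; ring.
Qed.

(** * Effect of coefficient errors on the L-polynomials *)

Section ErrorBounds.
Variables (R : realType) (q rho d : R).
Hypotheses (q2 : (2 : R) <= q) (rho0 : 0 < rho) (rho2 : rho ^+ 2 = q).
Hypotheses (d0 : 0 < d) (d2 : d ^+ 2 = 2).
Implicit Types (T D : nat -> R[i]) (z : R[i]).
Local Notation qc := (q%:C : R[i]).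

Lemma q_pos : 0 < q. Proof. by have := q2; lra. Qed.

Lemma cm_qc : cm qc = q.
Proof. by rewrite cmR gtr0_norm // q_pos. Qed.

Lemma tau_le1 (t : R) : 0 <= t -> t * rho <= 1 -> t <= 1.
Proof. move=> t0 h; have r1 : 1 <= rho by have := rho0; have := rho2; have := q2; nra.
by nra. Qed.

Lemma d_tau (t : R) : 0 < t -> t * rho <= 1 -> 0 < d / t /\ 2 <= (d / t) ^+ 2.
Proof.
move=> t0 h; split; first by rewrite divr_gt0.
rewrite exprMn d2 -ler_pdivrMl // mulVf // exprVn invf_ge1 ?exprn_gt0 //.
have := tau_le1 (ltW t0) h; nra.
Qed.

Lemma qd_ge2 : 0 < q * d /\ 2 <= (q * d) ^+ 2.
Proof.
split; first by rewrite mulr_gt0 ?q_pos.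
by rewrite exprMn d2; have := q2; nra.
Qed.

Variables (D : nat -> R[i]) (E : R).
Hypotheses (E0 : 0 <= E) (hD : forall m, cm (D m) <= E * (q * d) ^+ m).

Lemma first_err z n :
  cm (\sum_(m < n) D m * z ^+ m) <= E * \sum_(m < n) (q * d * cm z) ^+ m.
Proof.
apply: le_trans (cm_sum _ _ _) _; rewrite big_distrr /=; apply: ler_sum => m _.
by rewrite cmM cmX exprMn mulrA ler_wpM2r // exprn_ge0 // cm_ge0.
Qed.

(** With [t = |z|], a reflected term has size [E (q t^2)^g (d/t)^m]. Since [t <= 1] gives
    [(d/t)^2 >= 2], the geometric sum is controlled by [4 (d/t)^g], that is [4 (q d t)^g] in
    total. *)
Lemma LI_err z g : z != 0 -> cm z * rho <= 1 ->
  cm (LI q D z g) <=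
  E * (\sum_(m < g.+1) (q * d * cm z) ^+ m + 4 * (q * d * cm z) ^+ g).
Proof.
move=> z0 hz; have t0 : 0 < cm z by rewrite cm_gt0.
apply: le_trans (cmD _ _) _; rewrite mulrDr; apply: lerD; first exact: first_err.
have [dt0 dt2] := d_tau t0 hz.
apply: le_trans (cm_sum _ _ _) _.
apply: (@le_trans _ _ (E * (q * cm z ^+ 2) ^+ g * \sum_(m < g) (d / cm z) ^+ m)).
  rewrite big_distrr /=; apply: ler_sum => m _; have mg := ltn_ord m.
  have eg : (g = m + (g - m))%N by move: mg; lia.
  have e : E * (q * cm z ^+ 2) ^+ g * (d / cm z) ^+ m
     = E * (q * d) ^+ m * (q ^+ (g - m) * cm z ^+ (2 * g - m)).
    have -> : (2 * g - m = m + 2 * (g - m))%N by move: mg; lia.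
    have tn : cm z != 0 by rewrite gt_eqF.
    have := @pow_balance _ q (cm z) d m (g - m) tn; rewrite -eg => h.
    by rewrite -[LHS]mulrA h [LHS]mulrA.
  rewrite e 2!cmM !cmX cm_qc; apply: ler_wpM2r (hD m).
  by rewrite mulr_ge0 ?exprn_ge0 ?cm_ge0 // ltW // q_pos.
have X0 : 0 <= E * (q * cm z ^+ 2) ^+ g.
  by rewrite mulr_ge0 // exprn_ge0 // mulr_ge0 ?exprn_ge0 ?cm_ge0 // ltW // q_pos.
apply: le_trans (ler_wpM2l X0 (geo_le' g dt0 dt2)) _.
have -> : q * d * cm z = (q * cm z ^+ 2) * (d / cm z) by field; rewrite gt_eqF.
by rewrite [in leRHS]exprMn le_eqVlt; apply/orP; left; apply/eqP; ring.
Qed.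

Lemma sumD_err n : cm (\sum_(m < n.+1) D m) <= 4 * E * (q * d) ^+ n.
Proof.
have [qd0 qd2] := qd_ge2.
apply: le_trans (cm_sum _ _ _) _; apply: (@le_trans _ _ (E * \sum_(m < n.+1) (q * d) ^+ m)).
  by rewrite big_distrr /=; apply: ler_sum => m _; exact: hD.
by rewrite [4 * E]mulrC -mulrA ler_wpM2l // geo_le.
Qed.

(** [36 = 4 + 32]: 4 for the boundary term, and [32 = 2 * 4 * 4] for [|1 - z| <= 2], the partial
    sums and the geometric sum. *)
Lemma LF_err z g : z != 0 -> cm z * rho <= 1 ->
  cm (LF q D z g) <=
  E * (\sum_(m < g.+1) (q * d * cm z) ^+ m + 36 * (q * d * cm z) ^+ g).
Proof.
move=> z0 hz; have t0 : 0 < cm z by rewrite cm_gt0.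
have t1 := tau_le1 (ltW t0) hz; have [dt0 dt2] := d_tau t0 hz.
have q0 := q_pos; have [qd0 _] := qd_ge2.
have X0 : 0 <= (q * d * cm z) ^+ g by rewrite exprn_ge0 // mulr_ge0 ?ltW.
have h2 : cm (z ^+ g.+1 * \sum_(m < g.+1) D m) <= E * (4 * (q * d * cm z) ^+ g).
  rewrite cmM cmX exprS; apply: le_trans (ler_wpM2l _ (sumD_err g)) _.
    by rewrite mulr_ge0 ?exprn_ge0 // ltW.
  have -> : cm z * cm z ^+ g * (4 * E * (q * d) ^+ g) = cm z * (E * (4 * (q * d * cm z) ^+ g)).
    by rewrite [(q * d * cm z) ^+ g]exprMn; ring.
  by rewrite ler_piMl // !mulr_ge0.
have h3 : cm ((1 - z) * (qc * z ^+ 2) ^+ g * \sum_(j < g) (qc * z)^-1 ^+ j * \sum_(m < j.+1) D m)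
   <= E * (32 * (q * d * cm z) ^+ g).
  rewrite !cmM cmX cmM cmX cm_qc.
  have hs : cm (\sum_(j < g) (qc * z)^-1 ^+ j * \sum_(m < j.+1) D m)
      <= 4 * E * (4 * (d / cm z) ^+ g).
    apply: le_trans (cm_sum _ _ _) _.
    apply: (@le_trans _ _ (4 * E * \sum_(j < g) (d / cm z) ^+ j)); last first.
      by rewrite ler_wpM2l ?mulr_ge0 // geo_le'.
    rewrite big_distrr /=; apply: ler_sum => j _; rewrite cmM cmX cmV cmM cm_qc.
    apply: le_trans (ler_wpM2l _ (sumD_err j)) _.
      by rewrite exprn_ge0 // invr_ge0 mulr_ge0 // ltW.
    rewrite mulrCA -exprMn le_eqVlt; apply/orP; left; apply/eqP; congr (_ * _ ^+ _).
    by field; rewrite !gt_eqF.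
  have h1z : cm (1 - z) <= 2 by apply: le_trans (cmB _ _) _; rewrite cm1; lra.
  have Y0 : 0 <= (q * cm z ^+ 2) ^+ g by rewrite exprn_ge0 // mulr_ge0 ?exprn_ge0 ?ltW.
  apply: (@le_trans _ _ (2 * (q * cm z ^+ 2) ^+ g * (4 * E * (4 * (d / cm z) ^+ g)))).
    apply: ler_pM; rewrite ?cm_ge0 ?mulr_ge0 ?cm_ge0 //.
    by rewrite ler_wpM2r.
  rewrite le_eqVlt; apply/orP; left; apply/eqP.
  have -> : q * d * cm z = (q * cm z ^+ 2) * (d / cm z) by field; rewrite gt_eqF.
  by rewrite [in RHS]exprMn; ring.
apply: le_trans (cmD _ _) _; apply: le_trans (lerD (cmB _ _) (lexx _)) _.
apply: le_trans (lerD (lerD (first_err z g.+1) h2) h3) _.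
by rewrite le_eqVlt; apply/orP; left; apply/eqP; ring.
Qed.

End ErrorBounds.

Lemma inv_sq (K : fieldType) (A B : K) : A != 0 -> B != 0 ->
  (A * B ^+ 2)^-1 = A * (A * B)^-1 ^+ 2.
Proof. by move=> A0 B0; field; rewrite A0 B0. Qed.

Lemma sq_div (K : fieldType) (A B : K) : A != 0 -> B != 0 -> A * B ^+ 2 / (A * B) = B.
Proof. by move=> A0 B0; field; rewrite A0 B0. Qed.

Lemma half_cases g : (0 < g)%N ->
  g = (g.-1)./2.+1.*2 \/ (g.-1)./2.+1.*2 = g.+1.
Proof. by move=> g0; lia. Qed.

Lemma leq_uphalf2 g : (g <= 2 * uphalf g)%N. Proof. by lia. Qed.

Lemma leq_half2 g : (g <= (2 * g./2).+1)%N. Proof. by lia. Qed.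

Lemma leq_half2S g : (g <= 2 * g./2.+1)%N. Proof. by lia. Qed.

(** The geometric sums produce the constant [Q/(A - 1)], and the value [Wq] produces its negative.
    Their cancellation rests on the power series vanishing at [q]. *)
Lemma third_algebra (K : fieldType) (z w Y Q A S G1 V Wx Wq wg qk eta : K) :
  A != 0 -> A - 1 != 0 ->
  (1 - w) * S = A^-1 + (1 - A^-1) * G1 - wg * qk ->
  (1 - w) * ((1 + w) * V) = Wq - Wx -> Wq = - Q / (A - 1) -> 1 - z = eta * (1 - w) ->
  (1 - z) * Y * (Q * (A / (A - 1)) * S + (1 + w) * V) =
  eta * (Y * (Q * G1 - Wx)) - Q * (A / (A - 1)) * (Y * wg * (eta * qk)).
Proof.
move=> A0 A1 gp eV eW ->.
transitivity (eta * Y * (Q * (A / (A - 1)) * ((1 - w) * S) + (1 - w) * ((1 + w) * V))).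
  by ring.
by rewrite gp eV eW; field; rewrite A0 A1.
Qed.

Lemma LF_algebra (K : comPzRingType) (s z zg Q qK A i um Y S p1 p2 w V p3 H eta qk : K) :
  (1 - z) * Y * (Q * (A * i) * S + (1 + w) * V) = H - Q * (A * i) * (zg * (eta * qk)) ->
  s - zg * z * (Q * (qK * A * i) + um) + (1 - z) * Y * (Q * (A * i) * S + (p1 + w * p2))
  - (p3 + H - Q * (A * i) * (zg * (qK * z + eta * qk))) =
  s - p3 - zg * z * um + (1 - z) * Y * (p1 - V + w * (p2 - V)).
Proof.
move=> /eqP; rewrite -subr_eq0 => /eqP key.
by apply/eqP; rewrite -subr_eq0; apply/eqP; rewrite -[RHS]key; ring.
Qed.

Section MainTerms.
Variables (R : realType) (q rho C : R) (a : nat -> R[i]).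
Hypotheses (q2 : (2 : R) <= q) (rho0 : 0 < rho) (rho2 : rho ^+ 2 = q).
Hypothesis ha : gbound a C (rho^-1 ^+ 3).
Hypothesis Qq : pser a q%:C = 0.
Implicit Types (x y z w : R[i]) (g k n N : nat).
Local Notation qc := (q%:C : R[i]).
Local Notation Q1 := (pser a 1).
Local Notation W := (pser (tail a)).
Local Notation u := (rho^-1).

(** Away from [x = 1] this is [(Q(x) - Q(1) x^N)/(1 - x)], by [Gm_eq]. *)
Definition Gm x N : R[i] := Q1 * geosum x N - W x.

Definition psum k : R[i] := \sum_(b < k.+1) a b.

(* [mu m] is the main term of the coefficient of degree [m]: [c_k] for [m = 2k]. *)
Definition mu m : R[i] := if odd m then 0 else qc ^+ m./2 * psum m./2.

Lemma u_gt0 : 0 < u. Proof. by rewrite invr_gt0. Qed.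

Lemma u_ge0 : 0 <= u. Proof. exact: ltW u_gt0. Qed.

Lemma rho_ge0 : 0 <= rho. Proof. exact: ltW rho0. Qed.

Lemma u2q : u ^+ 2 * q = 1.
Proof. by rewrite -rho2 exprVn mulVf // expf_neq0 // gt_eqF. Qed.

Lemma u_le34 : u <= 3 / 4.
Proof. by have := u2q; have := u_gt0; have := q2; nra. Qed.

Lemma u3_le : u ^+ 3 <= 1 / 2.
Proof.
have := u2q; have := u_gt0; have := q2; have := u_le34 => h1 h2 h3 h4.
have h5 : u ^+ 2 <= 1 / 2 by nra.
by rewrite exprS; nra.
Qed.

Lemma u3_lt1 : u ^+ 3 < 1. Proof. by have := u3_le; lra. Qed.

Lemma C_ge0 : 0 <= C. Proof. by case: ha. Qed.

(** [u^3 q = u]: the disc [|x| <= q] lies well inside the disc of convergence of radius [q^(3/2)],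
    so the constants below are uniform. *)
Lemma u3_small (t : R) : 0 <= t -> t <= q -> u ^+ 3 * t <= 3 / 4.
Proof.
move=> t0 tq; apply: le_trans u_le34; have e : u ^+ 3 * q = u by rewrite exprSr -mulrA mulrCA mulrC u2q mul1r.
by rewrite -[leRHS]e ler_wpM2l // exprn_ge0 // ltW // u_gt0.
Qed.

(** The two factors of the denominator are at least [1/2] and [1/4], whence [4 * 8 = 32]. *)
Lemma const_bound (t : R) : 0 <= t -> t <= q ->
  4 * C / ((1 - u ^+ 3) * (1 - u ^+ 3 * t)) <= 32 * C.
Proof.
move=> t0 tq; have h1 := u3_le; have h2 := u3_small t0 tq; have c0 := C_ge0.
have p : 1 / 8 <= (1 - u ^+ 3) * (1 - u ^+ 3 * t).
  move: (u ^+ 3) (u ^+ 3 * t) h1 h2 => v1 v2 h1 h2; nra.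
rewrite ler_pdivrMr; last by lra.
by move: p; set v := (1 - u ^+ 3) * _ => p; nra.
Qed.

Lemma psum_approx x N : cm x <= q ->
  cm (\sum_(k < N) psum k * x ^+ k - Gm x N) <= 32 * C * (u ^+ 3 * cm x) ^+ N.
Proof.
move=> xq; have r1 := u3_lt1; have h2 := u3_small (cm_ge0 x) xq.
have rx : u ^+ 3 * cm x < 1 by lra.
apply: le_trans (partial_sums_approx N ha r1 rx) _.
apply: ler_wpM2r; last exact: const_bound (cm_ge0 x) xq.
by rewrite exprn_ge0 // mulr_ge0 ?cm_ge0 // exprn_ge0 // ltW // u_gt0.
Qed.

Lemma W_eq x : cm x <= q -> (1 - x) * W x = Q1 - pser a x.
Proof.
move=> xq; have h2 := u3_small (cm_ge0 x) xq.
by apply: (tail_pser ha u3_lt1); lra.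
Qed.

Lemma Gm_eq x N : cm x <= q -> (1 - x) * Gm x N = pser a x - Q1 * x ^+ N.
Proof.
move=> xq; rewrite /Gm mulrBr W_eq // mulrCA geosumE.
by move: Q1 (pser a x) (x ^+ N) => A B X; ring.
Qed.

Lemma qc_cm : cm qc = q.
Proof. by rewrite cmR gtr0_norm //; have := q2; lra. Qed.

Lemma qc1_neq0 : qc - 1 != 0.
Proof.
rewrite -(rmorph1 (real_complex R)) -rmorphB /=; apply/eqP => /complexI.
by have := q2; lra.
Qed.

Lemma qc_neq0 : qc != 0.
Proof. by apply/eqP => /complexI; have := q2; lra. Qed.

Lemma Wq : W qc = - Q1 / (qc - 1).
Proof.
have := @W_eq qc; rewrite qc_cm lexx => /(_ isT); rewrite Qq subr0 => h.
apply: (mulIf qc1_neq0); rewrite divfK ?qc1_neq0 //.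
by have -> : Q1 = (1 - qc) * W qc := esym h; rewrite -mulNr opprB mulrC.
Qed.

Lemma Q1_bound : cm Q1 <= 4 * C.
Proof.
have := pser_bound (x := 1) ha; rewrite cm1 mulr1 => /(_ u3_lt1) h.
apply: le_trans h _; rewrite ler_pdivrMr; last by have := u3_lt1; lra.
by have := u3_le; have := C_ge0; nra.
Qed.

Lemma psum_bound k : cm (psum k) <= 2 * C.
Proof.
have [C0 u0 h] := ha; apply: le_trans (cm_sum _ _ _) _.
apply: (@le_trans _ _ (\sum_(0 <= b < k.+1) C * (u ^+ 3) ^+ b)).
  by rewrite big_mkord; apply: ler_sum => b _; exact: h.
apply: le_trans (sum_geo_nat C0 _ (leq0n _)) _; first by rewrite u0 u3_lt1.
rewrite expr0 mulr1 ler_pdivrMr; last by have := u3_lt1; lra.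
by have := u3_le; nra.
Qed.

(* The remainder of [\sum_(i <= k) c_i = Q1 q^(k+1)/(q-1) + Um k]: the constant
   term of the partial sums cancels because the power series vanishes at [q]. *)
Definition bm k : R[i] := qc ^+ k * tail a k.
Definition Um : nat -> R[i] := tail bm.

Lemma bm_gbound : gbound bm (4 * C) u.
Proof.
have [C0 _ h] := tail_gbound ha u3_lt1.
split; [by have := C_ge0; lra|exact: ltW u_gt0|] => k.
rewrite /bm cmM cmX qc_cm; have := h k.
have q0 : 0 <= q ^+ k by rewrite exprn_ge0 //; have := q2; lra.
move=> /(ler_wpM2l q0) h1; apply: le_trans h1 _; rewrite mulrCA -exprMn.
have e : q * u ^+ 3 = u by rewrite exprSr mulrA [q * _]mulrC u2q mul1r.
rewrite e ler_wpM2r ?exprn_ge0 ?(ltW u_gt0) //.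
rewrite ler_pdivrMr; last by have := u3_lt1; lra.
by have := u3_le; have := C_ge0; nra.
Qed.

Lemma Um_gbound : gbound Um (32 * C) u.
Proof.
have u1 := u_le34.
have [|C0 u0 h] := tail_gbound bm_gbound; first by lra.
split=> //; first by have := C_ge0; lra.
move=> k; apply: le_trans (h k) _; rewrite ler_wpM2r ?exprn_ge0 //.
rewrite ler_pdivrMr; last by lra.
by have := C_ge0; nra.
Qed.

Lemma pser_bm x : pser bm x = W (qc * x).
Proof. exact: pser_scale. Qed.

Lemma csum_eq k : \sum_(i < k.+1) qc ^+ i * psum i = Q1 * (qc ^+ k.+1 / (qc - 1)) + Um k.
Proof.
have h := qc1_neq0.
have -> : \sum_(i < k.+1) qc ^+ i * psum i = Q1 * geosum qc k.+1 - \sum_(i < k.+1) bm i.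
  rewrite /geosum big_distrr /= -sumrB; apply: eq_bigr => i _; rewrite /bm /tail /psum.
  by move: (\sum_(_ < _) _) Q1 (qc ^+ i) => s A B; ring.
rewrite /Um /tail pser_bm mulr1 Wq.
have -> : geosum qc k.+1 = (qc ^+ k.+1 - 1) / (qc - 1).
  by rewrite -opprB -geosumE -mulNr opprB [(qc - 1) * _]mulrC mulfK.
move: (\sum_(_ < _) _) Q1 (qc ^+ _) (qc - 1) h => s A B D D0; by field.
Qed.

Lemma mu_first z n : \sum_(m < n) mu m * z ^+ m = \sum_(k < uphalf n) psum k * (qc * z ^+ 2) ^+ k.
Proof.
rewrite (sum_even (fun k => qc ^+ k * psum k)); apply: eq_bigr => k _.
by rewrite (exprMn k qc) mulrCA mulrA.
Qed.

Lemma mu_sum n : \sum_(m < n.+1) mu m = Q1 * (qc ^+ n./2.+1 / (qc - 1)) + Um n./2.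
Proof.
rewrite -csum_eq; have := sum_even (fun k => qc ^+ k * psum k) 1 n.+1 => /= h.
transitivity (\sum_(m < n.+1) (if odd m then 0 else qc ^+ m./2 * psum m./2) * 1 ^+ m).
  by apply: eq_bigr => m _; rewrite expr1n mulr1.
by rewrite h; apply: eq_bigr => m _; rewrite !expr1n mulr1.
Qed.

Lemma mu_bound m : cm (mu m) <= 2 * C * rho ^+ m.
Proof.
rewrite /mu; case: ifP => om.
  by rewrite cm0 !mulr_ge0 ?exprn_ge0 ?C_ge0 // ltW.
rewrite cmM cmX qc_cm mulrC; apply: ler_pM; rewrite ?cm_ge0 ?exprn_ge0 ?psum_bound //.
  by have := q2; lra.
rewrite -rho2 -exprM le_eqVlt; apply/orP; left; apply/eqP; congr (_ ^+ _).
by move: om; lia.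
Qed.

Section Point.
Variable z : R[i].
Hypotheses (z0 : z != 0) (hz : cm z * rho <= 1).
Local Notation t := (cm z).
Local Notation y := (qc * z ^+ 2).
Local Notation w := ((qc * z)^-1).
Local Notation x := ((qc * z ^+ 2)^-1).

Lemma t_gt0 : 0 < t. Proof. by rewrite cm_gt0. Qed.

Lemma t_ge0 : 0 <= t. Proof. exact: ltW t_gt0. Qed.

Lemma rho_ge1 : 1 <= rho. Proof. by have := rho0; have := rho2; have := q2; nra. Qed.

Lemma t_le1 : t <= 1. Proof. by have := rho_ge1; have := t_gt0; have := hz; nra. Qed.

Lemma cm_y : cm y = q * t ^+ 2. Proof. by rewrite cmM cmX qc_cm. Qed.

Lemma cm_y_le1 : cm y <= 1.
Proof.
rewrite cm_y -rho2 -exprMn mulrC exprn_ile1 // mulr_ge0 ?t_ge0 ?u_ge0 ?rho_ge0 ?t_gt0 //.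
Qed.

Lemma first_main g :
  cm (\sum_(m < g.+1) mu m * z ^+ m - Gm y g./2.+1) <= 32 * C * t ^+ g.
Proof.
rewrite mu_first /=; have y1 : cm y <= q by have := cm_y_le1; have := q2; lra.
apply: le_trans (psum_approx _ y1) _; rewrite ler_wpM2l ?mulr_ge0 ?C_ge0 //.
have -> : u ^+ 3 * cm y = u * t ^+ 2.
  by rewrite cm_y -[u in RHS]mul1r -u2q; ring.
have u1 := u_le34; have u0 := u_gt0; have t0 := t_gt0; have t1 := t_le1.
apply: (@le_trans _ _ ((t ^+ 2) ^+ g./2.+1)).
  rewrite lerXn2r ?nnegrE ?mulr_ge0 ?exprn_ge0 ?(ltW t0) ?(ltW u0) // ler_piMl ?exprn_ge0 ?(ltW t0) //.
  by lra.
by rewrite -exprM ler_wiXn2l ?t_ge0 // leq_half2S.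
Qed.

Lemma LI_second g : (0 < g)%N ->
  \sum_(m < g) mu m * (qc ^+ (g - m) * z ^+ (2 * g - m)) =
  y ^+ g * \sum_(k < (g.-1)./2.+1) psum k * x ^+ k.
Proof.
move=> g0; have qz : qc * z != 0 by rewrite mulf_neq0 ?qc_neq0.
have e (m : 'I_g) : qc ^+ (g - m) * z ^+ (2 * g - m) = y ^+ g * w ^+ m.
  have mg := ltn_ord m.
  have -> : (2 * g - m = m + 2 * (g - m))%N by move: mg; lia.
  have := @pow_balance _ qc z qc^-1 m (g - m) z0.
  rewrite divff ?qc_neq0 // expr1n mul1r subnKC ?(ltnW mg) // => <-.
  by congr (_ * _ ^+ _); rewrite invfM.
under eq_bigr do rewrite e mulrCA.
rewrite -big_distrr /= (sum_even (fun k => qc ^+ k * psum k)) uphalf_pred //.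
congr (_ * _); apply: eq_bigr => k _; rewrite mulrAC mulrC; congr (_ * _).
rewrite -exprMn; congr (_ ^+ _).
by apply/esym/inv_sq => //; exact: qc_neq0.
Qed.

(** [1 <= q t] keeps [x = 1/y] in [|x| <= q]. With [N = [(g-1)/2] + 1] one has
    [(q t^2)^(2N) (u^3 |x|)^N = u^N t^(2N)]; [g] is [2N] or [2N - 1], and in the second case the
    spare factor is absorbed by [t <= q t^2]. *)
Lemma second_main g : (0 < g)%N -> 1 <= q * t ->
  cm (y ^+ g * \sum_(k < (g.-1)./2.+1) psum k * x ^+ k - y ^+ g * Gm x (g.-1)./2.+1)
  <= 32 * C * t ^+ g.
Proof.
move=> g0 qt; have t0 := t_gt0; have u0 := u_gt0; have u1 := u_le34; have q0 : 0 < q by have := q2; lra.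
have ex : cm x = (q * t ^+ 2)^-1 by rewrite cmV cm_y.
have yp : 0 < q * t ^+ 2 by rewrite mulr_gt0 ?exprn_gt0.
have x1 : cm x <= q.
  by rewrite ex invf_ple ?posrE // -[leLHS]mulr1 ler_pdivrMl //; nra.
rewrite -mulrBr cmM cmX; apply: le_trans (ler_wpM2l _ (psum_approx _ x1)) _.
  by rewrite exprn_ge0 ?cm_ge0.
rewrite mulrCA ler_wpM2l ?mulr_ge0 ?C_ge0 //.
have -> : u ^+ 3 * cm x = u ^+ 5 / t ^+ 2.
  rewrite ex -[u ^+ 3]mul1r -u2q; field.
  by rewrite !gt_eqF.
rewrite cm_y; set N := (g.-1)./2.+1.
have key : (q * t ^+ 2) ^+ N.*2 * (u ^+ 5 / t ^+ 2) ^+ N = u ^+ N * t ^+ N.*2.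
  rewrite -mul2n !exprM -!exprMn; congr (_ ^+ _).
  have -> : (q * t ^+ 2) ^+ 2 * (u ^+ 5 / t ^+ 2) = (u ^+ 2 * q) ^+ 2 * (u * t ^+ 2).
    by move: u => v; field; rewrite gt_eqF.
  by rewrite u2q expr1n mul1r.
have uN : u ^+ N <= 1 by rewrite exprn_ile1 ?t_ge0 ?u_ge0 ?rho_ge0 //; lra.
have [eg|eg] : g = N.*2 \/ N.*2 = g.+1 := half_cases g0.
  by rewrite -eg in key; rewrite key ler_piMl // exprn_ge0 // t_ge0.
rewrite -(ler_pM2l yp) mulrA -exprS -eg key.
apply: (@le_trans _ _ (t ^+ N.*2)); first by rewrite ler_piMl ?exprn_ge0 ?t_ge0 ?u_ge0 ?rho_ge0.
rewrite eg exprS mulrA ler_wpM2r ?exprn_ge0 ?t_ge0 ?u_ge0 ?rho_ge0 //.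
by nra.
Qed.

Lemma LI_main g : (0 < g)%N -> 1 <= q * t ->
  cm (LI q mu z g - (Gm y g./2.+1 + y ^+ g * Gm x (g.-1)./2.+1)) <= 64 * C * t ^+ g.
Proof.
move=> g0 qt; rewrite /LI LI_second //.
move: (first_main g) (second_main g0 qt).
move: (\sum_(_ < _) _) (y ^+ g * _) (Gm _ _) (y ^+ g * _) => s1 s4 s3 s2 h1 h2.
have -> : s1 + s2 - (s3 + s4) = (s1 - s3) + (s2 - s4) by ring.
by apply: le_trans (cmD _ _) _; apply: le_trans (lerD h1 h2) _; lra.
Qed.

(** Since [x = q w^2], the bracket is the sum of [w^j q^[j/2]] over [j < g]. Multiplied by [1 - w]
    it telescopes: odd powers cancel and even ones keep the factor [1 - 1/q]. *)
Lemma geosum_parity g : (0 < g)%N ->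
  (1 - w) * (geosum x (uphalf g) + w * geosum x g./2) =
  qc^-1 + (1 - qc^-1) * geosum x (uphalf g) - w ^+ g * qc ^+ (g.-1)./2.
Proof.
move=> g0; have q0 := qc_neq0; have xw : x = qc * w ^+ 2.
  exact: inv_sq.
have eG := geosumE x g./2.
have w2 N : w ^+ N.*2 * qc ^+ N = x ^+ N by rewrite -mul2n exprM -exprMn mulrC -xw.
have eX : x ^+ g./2 = 1 - (1 - qc * w ^+ 2) * geosum x g./2 by rewrite -xw eG; ring.
have [eg|eg] : g = g./2.*2.+1 \/ g = g./2.*2 by lia.
  have -> : uphalf g = g./2.+1 by lia.
  have -> : (g.-1)./2 = g./2 by lia.
  have ew : w ^+ g = w * w ^+ g./2.*2 by rewrite -exprS -eg.
  rewrite ew -[w * _ * _]mulrA w2 geosumS eX.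
  by move: (geosum _ _) => A; move: w => B; move: qc q0 => D D0; field.
have -> : uphalf g = g./2 by lia.
have -> : w ^+ g * qc ^+ (g.-1)./2 = x ^+ g./2 / qc.
  rewrite -w2 -eg -[in RHS](_ : (g.-1)./2.+1 = g./2); last by lia.
  by rewrite exprSr mulrA mulfK.
rewrite eX; by move: (geosum _ _) => A; move: w => B; move: qc q0 => D D0; field.
Qed.

(** For [z = q^(-s)] this is [zeta_A(2-s)/zeta_A(1+s)], and for [z = -q^(-s)] it is [nu s]. *)
Definition etaf : R[i] := (1 - z) / (1 - w).

Definition betaM g : R[i] :=
  Gm y g./2.+1 + etaf * (y ^+ g * Gm x (g.-1)./2.+1)
  - Q1 * (qc / (qc - 1)) * (z ^+ g * (qc ^+ g./2 * z + etaf * qc ^+ (g.-1)./2)).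

Lemma yw g : y ^+ g * w ^+ g = z ^+ g.
Proof.
by rewrite -exprMn; congr (_ ^+ _); apply: sq_div => //; exact: qc_neq0.
Qed.

Definition Upart N : R[i] := \sum_(k < N) Um k * (w ^+ 2) ^+ k.

Lemma third_sum g :
  \sum_(j < g) w ^+ j * (\sum_(m < j.+1) mu m) =
  Q1 * (qc / (qc - 1)) * (geosum x (uphalf g) + w * geosum x g./2)
  + (Upart (uphalf g) + w * Upart g./2).
Proof.
have q0 := qc_neq0; have xw : x = qc * w ^+ 2.
  exact: inv_sq.
pose f k := Q1 * (qc ^+ k.+1 / (qc - 1)) + Um k.
have e N : \sum_(k < N) f k * (w ^+ 2) ^+ k = Q1 * (qc / (qc - 1)) * geosum x N + Upart N.
  rewrite /geosum /Upart big_distrr -big_split /=; apply: eq_bigr => k _.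
  rewrite /f xw [(qc * _) ^+ k]exprMn exprS.
  by move: (_ ^+ k) (_ ^+ k) (Um k) Q1 (qc - 1)^-1 => A B D G H; ring.
transitivity (\sum_(j < g) w ^+ j * f j./2); first by apply: eq_bigr => j _; rewrite mu_sum.
rewrite sum_parity !e; set A := Q1 * _; ring.
Qed.

Lemma cm_w : cm w = (q * t)^-1. Proof. by rewrite cmV cmM qc_cm. Qed.

Lemma Upart_approx N : 1 < q * t ->
  cm (Upart N - pser Um (w ^+ 2)) <= 256 * C * (cm w ^+ 2) ^+ N.
Proof.
move=> qt; have u0 := u_gt0; have u1 := u_le34; have c0 := C_ge0.
have w1 : cm w ^+ 2 <= 1.
  by rewrite exprn_ile1 ?cm_ge0 // cm_w invf_le1 ?(ltW qt) // (lt_trans _ qt).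
have w0 : 0 <= cm w ^+ 2 by rewrite exprn_ge0 ?cm_ge0.
have uw : u * cm (w ^+ 2) <= 3 / 4 by rewrite cmX; nra.
rewrite cmBC; apply: le_trans (pser_approx N Um_gbound _) _; first by lra.
rewrite cmX exprMn.
have uN : u ^+ N <= 1 by rewrite exprn_ile1 ?t_ge0 ?u_ge0 ?rho_ge0 //; lra.
have W0 : 0 <= (cm w ^+ 2) ^+ N by rewrite exprn_ge0.
have U0 : 0 <= u ^+ N by rewrite exprn_ge0 // ltW.
rewrite cmX in uw; rewrite ler_pdivrMr; last by lra.
apply: (@le_trans _ _ (64 * C * (cm w ^+ 2) ^+ N)).
  move: ((cm w ^+ 2) ^+ N) W0 => X X0.
  have -> : 2 * (32 * C) * (u ^+ N * X) = 64 * C * X * u ^+ N by ring.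
  by rewrite ler_piMr // !mulr_ge0.
move: (u * _) uw ((cm w ^+ 2) ^+ N) W0 => v hv X X0.
have := mulr_ge0 c0 X0; nra.
Qed.

(** The strict inequality gives [|w| < 1], so that [etaf] is defined. The constant rounds up
    [32 + 32 + 1024], the last from [2 * 2 * 256]. *)
Lemma LF_main g : (0 < g)%N -> 1 < q * t ->
  cm (LF q mu z g - betaM g) <= 1200 * C * t ^+ g.
Proof.
move=> g0 qt; have c0 := C_ge0; have t0 := t_gt0; have t1 := t_le1.
have w1 : cm w < 1 by rewrite cm_w invf_lt1 // (lt_trans _ qt).
have w_ge0 := cm_ge0 w.
have nw : 1 - w != 0.
  by rewrite subr_eq0; apply: contraTneq w1 => <-; rewrite cm1 ltxx.
have xw : x = qc * w ^+ 2.
  by apply: inv_sq => //; exact: qc_neq0.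
set V := pser Um (w ^+ 2).
have eV : (1 - w) * ((1 + w) * V) = W qc - W x.
  have uw : u * cm (w ^+ 2) < 1 by rewrite cmX; have := u_le34; have := u_gt0; nra.
  have u1 : u < 1 by have := u_le34; lra.
  have := tail_pser bm_gbound u1 uw; rewrite !pser_bm mulr1 -xw -/Um -/V => <-.
  by rewrite mulrA; congr (_ * _); ring.
pose e1 := Upart (uphalf g) - V; pose e2 := Upart g./2 - V.
have E : LF q mu z g - betaM g =
  (\sum_(m < g.+1) mu m * z ^+ m - Gm y g./2.+1) - z ^+ g.+1 * Um g./2
  + (1 - z) * y ^+ g * (e1 + w * e2).
  rewrite /LF mu_sum third_sum /betaM /e1 /e2 -uphalf_pred //.
  have gp := geosum_parity g0; have eta_eq : 1 - z = etaf * (1 - w) by rewrite /etaf divfK.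
  rewrite [z ^+ g.+1]exprSr [qc ^+ g./2.+1]exprSr; apply: LF_algebra.
  rewrite -[X in _ = _ - _ * (X * _)](yw g).
  exact: (third_algebra _ qc_neq0 qc1_neq0 gp eV Wq eta_eq).
rewrite E; apply: le_trans (cmD _ _) _.
have tg0 : 0 <= t ^+ g by rewrite exprn_ge0 ?t_ge0 ?u_ge0 ?rho_ge0.
have h2 : cm (z ^+ g.+1 * Um g./2) <= 32 * C * t ^+ g.
  rewrite cmM cmX exprS [leRHS]mulrC; apply: ler_pM; rewrite ?mulr_ge0 ?cm_ge0 ?t_ge0 ?u_ge0 ?rho_ge0 //.
    by rewrite ler_piMl.
  have [_ u0 h] := Um_gbound; apply: le_trans (h _) _.
  by rewrite ler_piMr ?mulr_ge0 // exprn_ile1 //; have := u_le34; lra.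
have h3 : cm ((1 - z) * y ^+ g * (e1 + w * e2)) <= 1024 * C * t ^+ g.
  have hz1 : cm (1 - z) <= 2 by apply: le_trans (cmB _ _) _; rewrite cm1; lra.
  have he1 : cm e1 <= 256 * C * cm w ^+ g.
    apply: le_trans (Upart_approx _ qt) _; rewrite ler_wpM2l ?mulr_ge0 //.
    by rewrite -exprM ler_wiXn2l ?(ltW w1) // leq_uphalf2.
  have he2 : cm (w * e2) <= 256 * C * cm w ^+ g.
    rewrite cmM; apply: le_trans (ler_wpM2l w_ge0 (Upart_approx _ qt)) _.
    rewrite mulrCA ler_wpM2l ?mulr_ge0 // -exprM -exprS.
    by rewrite ler_wiXn2l ?(ltW w1) // leq_half2.
  have hs : cm (e1 + w * e2) <= 512 * C * cm w ^+ g.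
    by apply: le_trans (cmD _ _) _; apply: le_trans (lerD he1 he2) _; lra.
  rewrite cmM cmM; apply: (@le_trans _ _ (2 * cm (y ^+ g) * (512 * C * cm w ^+ g))).
    apply: ler_pM => //; rewrite ?mulr_ge0 ?cm_ge0 //.
    by rewrite ler_wpM2r ?cm_ge0.
  have -> : 2 * cm (y ^+ g) * (512 * C * cm w ^+ g) = 1024 * C * (cm (y ^+ g) * cm w ^+ g) by ring.
  by rewrite -cmX -cmM yw cmX.
apply: le_trans (lerD (cmB _ _) (lexx _)) _.
apply: le_trans (lerD (lerD (first_main g) h2) h3) _.
have := mulr_ge0 c0 tg0; move: (t ^+ g) => X; lra.
Qed.

(** * Main terms for real part at least 1 *)

Section Far.
Hypothesis qt : q * t <= 1.

Lemma t_le_u2 : t <= u ^+ 2.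
Proof. by have := u2q; have := u_gt0; have := qt; have := q2; nra. Qed.

Lemma tg_le g : t ^+ g <= u ^+ g.
Proof.
have := t_le_u2; have := u_gt0; have := u_le34 => u1 u0 h; have := t_gt0 => t0.
apply: lerXn2r; rewrite ?nnegrE ?t_ge0 ?u_ge0 //; apply: (le_trans h); nra.
Qed.

Lemma rhot_le g : (rho * t) ^+ g <= u ^+ g.
Proof.
have u0 := u_gt0; have r0 := rho0; have t0 := t_gt0.
rewrite lerXn2r ?nnegrE ?mulr_ge0 ?(ltW t0) ?(ltW r0) ?(ltW u0) //.
have e : rho * u ^+ 2 = u by rewrite expr2 mulrA divff ?mul1r // gt_eqF.
by rewrite -[leRHS]e ler_wpM2l ?t_ge0 ?u_ge0 ?rho_ge0 // t_le_u2.
Qed.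

Lemma cm_1y : 1 / 2 <= cm (1 - y).
Proof.
have h : cm y <= 1 / 2.
  by rewrite cm_y; have := qt; have := t_gt0; have := q2; nra.
have : cm 1 <= cm (1 - y) + cm y by rewrite -{1}(subrK y 1) cmD.
by rewrite cm1; lra.
Qed.

(** Here [|y| <= u^2] and [|1 - y| >= 1/2], so the part of [Gm] that depends on [N] is itself an
    error of size [8 C u^g]. *)
Lemma first_main1 g :
  cm (\sum_(m < g.+1) mu m * z ^+ m - pser a y / (1 - y)) <= 40 * C * u ^+ g.
Proof.
have c0 := C_ge0; have u0 := u_gt0; have y1 := cm_1y; have t0 := t_gt0; have t1 := t_le1.
have y1n : 1 - y != 0 by rewrite -cm_gt0; lra.
have yq : cm y <= q by have := cm_y_le1; have := q2; lra.
have eG : pser a y / (1 - y) = Gm y g./2.+1 + Q1 * y ^+ g./2.+1 / (1 - y).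
  have hG := Gm_eq g./2.+1 yq; apply: (mulIf y1n).
  by rewrite divfK // mulrDl divfK // [Gm _ _ * _]mulrC hG subrK.
have -> : \sum_(m < g.+1) mu m * z ^+ m - pser a y / (1 - y) =
  (\sum_(m < g.+1) mu m * z ^+ m - Gm y g./2.+1) - Q1 * y ^+ g./2.+1 / (1 - y).
  by rewrite eG opprD addrA.
apply: le_trans (cmB _ _) _.
have h1 := le_trans (first_main g) (ler_wpM2l (mulr_ge0 (ler0n R 32) c0) (tg_le g)).
apply: le_trans (lerD h1 (lexx _)) _.
have h2 : cm (Q1 * y ^+ g./2.+1 / (1 - y)) <= 4 * C * u ^+ g * 2.
  rewrite !cmM cmV cmX; apply: ler_pM; rewrite ?mulr_ge0 ?exprn_ge0 ?cm_ge0 ?invr_ge0 ?cm_ge0 //.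
    apply: ler_pM; rewrite ?cm_ge0 ?exprn_ge0 ?cm_ge0 ?Q1_bound //.
    have yu : cm y <= u ^+ 2.
      by rewrite cm_y; have := qt; have := t_le_u2; nra.
    apply: (@le_trans _ _ ((u ^+ 2) ^+ g./2.+1)).
      by rewrite lerXn2r ?nnegrE ?cm_ge0 ?exprn_ge0 ?t_ge0 ?u_ge0 ?rho_ge0.
    rewrite -exprM ler_wiXn2l ?t_ge0 ?u_ge0 ?rho_ge0 //; first by have := u_le34; lra.
    exact: leq_half2S.
  by rewrite invf_ple ?posrE //; [move: y1; rewrite mul1r|lra].
by apply: le_trans (lerD (lexx _) h2) _; lra.
Qed.

(** Each of the [g] reflected terms is at most [2 C (rho t)^(2g - m)], and [rho t <= u]. *)
Lemma LI_main1 g :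
  cm (LI q mu z g - pser a y / (1 - y)) <= (40 + 2 * g%:R) * C * u ^+ g.
Proof.
have c0 := C_ge0; have u0 := u_gt0; have t0 := t_gt0; have r0 := rho0.
rewrite /LI addrAC; apply: le_trans (cmD _ _) _.
apply: le_trans (lerD (first_main1 g) (lexx _)) _.
suff h : cm (\sum_(m < g) mu m * (qc ^+ (g - m) * z ^+ (2 * g - m))) <= g%:R * (2 * C * u ^+ g).
  by apply: le_trans (lerD (lexx _) h) _; lra.
apply: le_trans (cm_sum _ _ _) _.
apply: (@le_trans _ _ (\sum_(m < g) 2 * C * u ^+ g)); last first.
  by rewrite sumr_const card_ord -[leLHS]mulr_natl.
apply: ler_sum => m _; have mg := ltn_ord m; rewrite 2!cmM !cmX qc_cm.
apply: le_trans (ler_wpM2r _ (mu_bound m)) _.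
  by rewrite mulr_ge0 ?exprn_ge0 ?cm_ge0 //; have := q2; lra.
rewrite -[leLHS]mulrA ler_wpM2l ?mulr_ge0 //.
have -> : rho ^+ m * (q ^+ (g - m) * t ^+ (2 * g - m)) = (rho * t) ^+ (2 * g - m).
  rewrite exprMn mulrA -rho2 -exprM -exprD; congr (_ ^+ _ * _); by move: mg; lia.
apply: le_trans (rhot_le _) _; rewrite ler_wiXn2l ?t_ge0 ?u_ge0 ?rho_ge0 //; first by have := u_le34; lra.
by move: mg; lia.
Qed.

(** [112 = 40 + 8 + 64], where [64 = 2 * 8 * 4] comes from [|1 - z|], the partial sums of [mu] and
    the geometric sum of ratio [u/t]. *)
Lemma LF_main1 g :
  cm (LF q mu z g - pser a y / (1 - y)) <= 112 * C * u ^+ g.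
Proof.
have c0 := C_ge0; have u0 := u_gt0; have t0 := t_gt0; have r0 := rho0; have t1 := t_le1.
have rq : 2 <= rho ^+ 2 by rewrite rho2.
have q0 : 0 < q by have := q2; lra.
have hs n : cm (\sum_(m < n.+1) mu m) <= 8 * C * rho ^+ n.
  apply: le_trans (cm_sum _ _ _) _.
  apply: (@le_trans _ _ (2 * C * \sum_(m < n.+1) rho ^+ m)).
    by rewrite big_distrr /=; apply: ler_sum => m _; exact: mu_bound.
  apply: le_trans (ler_wpM2l _ (geo_le n r0 rq)) _; first by rewrite mulr_ge0.
  by rewrite le_eqVlt; apply/orP; left; apply/eqP; ring.
have h2 : cm (z ^+ g.+1 * \sum_(m < g.+1) mu m) <= 8 * C * u ^+ g.
  rewrite cmM cmX; apply: le_trans (ler_wpM2l _ (hs g)) _; first by rewrite exprn_ge0 ?t_ge0 ?u_ge0 ?rho_ge0.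
  rewrite mulrCA ler_wpM2l ?mulr_ge0 // exprS -mulrA -exprMn [t * rho]mulrC.
  by apply: le_trans (rhot_le g); rewrite ler_piMl // exprn_ge0 // mulr_ge0 ?t_ge0 ?u_ge0 ?rho_ge0.
have h3 : cm ((1 - z) * y ^+ g * \sum_(j < g) w ^+ j * \sum_(m < j.+1) mu m) <= 64 * C * u ^+ g.
  have ut : 0 < u / t by rewrite divr_gt0.
  have ut2 : 2 <= (u / t) ^+ 2.
    apply: le_trans rq _; rewrite lerXn2r ?nnegrE ?(ltW r0) ?(ltW ut) //.
    rewrite ler_pdivlMr //; have e : rho * u ^+ 2 = u by rewrite expr2 mulrA divff ?mul1r // gt_eqF.
    by rewrite -[leRHS]e ler_wpM2l ?t_ge0 ?u_ge0 ?rho_ge0 // t_le_u2.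
  have hS : cm (\sum_(j < g) w ^+ j * \sum_(m < j.+1) mu m) <= 8 * C * (4 * (u / t) ^+ g).
    apply: le_trans (cm_sum _ _ _) _.
    apply: (@le_trans _ _ (8 * C * \sum_(j < g) (u / t) ^+ j)); last first.
      by rewrite ler_wpM2l ?mulr_ge0 // geo_le'.
    rewrite big_distrr /=; apply: ler_sum => j _; rewrite cmM cmX cm_w.
    apply: le_trans (ler_wpM2l _ (hs j)) _; first by rewrite exprn_ge0 // invr_ge0 mulr_ge0 ?t_ge0 ?(ltW q0).
    rewrite mulrCA -exprMn le_eqVlt; apply/orP; left; apply/eqP; congr (_ * _ ^+ _).
    by rewrite -rho2; field; rewrite !gt_eqF.
  have hz1 : cm (1 - z) <= 2 by apply: le_trans (cmB _ _) _; rewrite cm1; lra.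
  rewrite 2!cmM; apply: (@le_trans _ _ (2 * cm (y ^+ g) * (8 * C * (4 * (u / t) ^+ g)))).
    apply: ler_pM => //; rewrite ?mulr_ge0 ?cm_ge0 //.
    by rewrite ler_wpM2r ?cm_ge0.
  have -> : 2 * cm (y ^+ g) * (8 * C * (4 * (u / t) ^+ g)) = 64 * C * (cm (y ^+ g) * (u / t) ^+ g) by ring.
  rewrite ler_wpM2l ?mulr_ge0 // cmX cm_y -exprMn.
  have -> : q * t ^+ 2 * (u / t) = rho * t by rewrite -rho2; field; rewrite !gt_eqF.
  exact: rhot_le.
rewrite /LF addrAC [X in cm (X + _)]addrAC; apply: le_trans (cmD _ _) _.
apply: le_trans (lerD (cmB _ _) (lexx _)) _.
apply: le_trans (lerD (lerD (first_main1 g) h2) h3) _; lra.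
Qed.

End Far.

End Point.

End MainTerms.

(** * L-polynomials from the lower half of their coefficients *)

Section FunctionalEquationSums.
Variables (R : realType) (q : R).
Hypothesis q0 : (q%:C : R[i]) != 0.
Implicit Types (T : nat -> R[i]) (z : R[i]) (g : nat).
Local Notation qc := (q%:C : R[i]).

Lemma sum_rev_upper T g : \sum_(g.+1 <= m < (2 * g).+1) T m = \sum_(j < g) T (2 * g - j)%N.
Proof.
rewrite -{1}[g.+1]add0n big_addn (_ : ((2 * g).+1 - g.+1 = g)%N); last by lia.
rewrite big_mkord (reindex_inj rev_ord_inj) /=; apply: eq_bigr => j _; congr T.
by have := ltn_ord j; lia.
Qed.

Lemma FE_LI T z g :
  (forall m, (m <= 2 * g)%N -> qc ^+ g * T m = qc ^+ m * T (2 * g - m)%N) ->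
  \sum_(m < (2 * g).+1) T m * z ^+ m = LI q T z g.
Proof.
move=> FE; rewrite -(big_mkord xpredT (fun m => T m * z ^+ m)).
rewrite (big_cat_nat (n := g.+1)) //=; last by lia.
rewrite big_mkord /LI; congr (_ + _); rewrite (sum_rev_upper (fun m => T m * z ^+ m)).
apply: eq_bigr => j _; have jg := ltn_ord j; rewrite mulrA; congr (_ * _).
have hj : (2 * g - j <= 2 * g)%N by lia.
have := FE _ hj; rewrite (_ : (2 * g - (2 * g - j) = j)%N); last by lia.
have -> : (2 * g - j = g + (g - j))%N by lia.
rewrite exprD -mulrA => /(mulfI (expf_neq0 g q0)) ->.
by rewrite mulrC.
Qed.

Lemma abel_upper T z g M : (g < M)%N ->
  \sum_(g.+1 <= m < M) T m * z ^+ m =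
  z ^+ M * (\sum_(j < M) T j) - z ^+ g.+1 * (\sum_(j < g.+1) T j)
  + (1 - z) * \sum_(g.+1 <= m < M) z ^+ m * \sum_(j < m.+1) T j.
Proof.
elim: M => // M IH; rewrite ltnS leq_eqVlt => /orP[/eqP ->|gM].
  by rewrite !big_geq // subrr mulr0 addr0.
rewrite !(big_nat_recr M) //= (IH gM) !(big_ord_recr M) /= [z ^+ M.+1]exprS.
set s1 := \sum_(_ < M) _; set s2 := \sum_(_ < g.+1) _; set s3 := \sum_(_ <= _ < M) _.
by move: s1 s2 s3 (z ^+ M) (z ^+ g.+1) (T M) => a1 a2 a3 a4 a5 a6; ring.
Qed.

(** Only partial sums are related, so the upper half is first rewritten in terms of them by Abel
    summation. The term at the upper end drops out because the sum of all coefficients is 0, the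
    trivial zero at [z = 1]. *)
Lemma FE_LF T z g : z != 0 ->
  (forall m, qc ^+ g.+1 * \sum_(j < m) T j = qc ^+ m * \sum_(j < 2 * g.+1 - m) T j) ->
  \sum_(m < 2 * g.+1) T m * z ^+ m = LF q T z g.
Proof.
move=> z0 FE; rewrite -(big_mkord xpredT (fun m => T m * z ^+ m)).
rewrite (big_cat_nat (n := g.+1)) //=; last by lia.
rewrite big_mkord /LF -addrA; congr (_ + _).
have S0 : \sum_(j < 2 * g.+1) T j = 0.
  have := FE (2 * g.+1)%N; rewrite subnn big_ord0 mulr0 => /eqP.
  by rewrite mulf_eq0 (negbTE (expf_neq0 _ q0)) => /eqP.
rewrite abel_upper; last by lia.
rewrite S0 mulr0 add0r -mulrA; congr (_ + _ * _).
have e2 : (2 * g.+1 = (2 * g).+2)%N by lia.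
rewrite {1}e2 big_nat_recr /=; last by lia.
rewrite -e2 S0 mulr0 addr0 (sum_rev_upper (fun m => z ^+ m * \sum_(j < m.+1) T j)).
rewrite big_distrr /=; apply: eq_bigr => j _; have jg := ltn_ord j.
have -> : (2 * g - j).+1 = (2 * g.+1 - j.+1)%N by lia.
have := FE (2 * g.+1 - j.+1)%N.
rewrite (_ : (2 * g.+1 - (2 * g.+1 - j.+1) = j.+1)%N); last by lia.
have -> : qc ^+ (2 * g.+1 - j.+1) = qc ^+ g.+1 * qc ^+ (g - j).
  by rewrite -exprD; congr (_ ^+ _); move: jg; clear; lia.
rewrite -mulrA => /(mulfI (expf_neq0 g.+1 q0)) ->.
rewrite [LHS]mulrA [RHS]mulrA; congr (_ * _).
have := @pow_balance _ qc z qc^-1 j (g - j) z0.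
rewrite divff // expr1n mul1r subnKC ?(ltnW jg) // => e.
have -> : (qc * z)^-1 = qc^-1 / z by rewrite invfM.
rewrite e (_ : (2 * g - j = j + 2 * (g - j))%N); last by lia.
by rewrite mulrC.
Qed.

End FunctionalEquationSums.

(** * Complex powers and the Euler product *)

Section Exponential.
Variables (R : realType).
Implicit Types (x y z s : R[i]).

Lemma cexpD x y : cexp (x + y) = cexp x * cexp y.
Proof.
case: x => a b; case: y => c d; rewrite /cexp /= expRD cosD sinD.
by apply/eqP; rewrite eq_complex /=; apply/andP; split; apply/eqP; ring.
Qed.

Lemma cexp0 : cexp (0 : R[i]) = 1.
Proof. by rewrite /cexp /= expR0 cos0 sin0 mulr1 mulr0. Qed.

Lemma cm_cexp z : cm (cexp z) = expR (Re z).
Proof.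
rewrite /cm /cexp /= !exprMn -mulrDr cos2Dsin2 mulr1 sqrtr_sqr ger0_norm.
  by [].
exact: expR_ge0.
Qed.

Lemma cexp_neq0 z : cexp z != 0.
Proof. by rewrite -cm_gt0 cm_cexp expR_gt0. Qed.

Lemma cexpX z n : cexp (n%:R * z) = cexp z ^+ n.
Proof.
elim: n => [|n IH]; first by rewrite mul0r cexp0 expr0.
by rewrite -add1n natrD mulrDl mul1r cexpD IH exprS.
Qed.

Lemma cexpR (t : R) : cexp t%:C = (expR t)%:C.
Proof. by rewrite /cexp /= cos0 sin0 mulr1 mulr0. Qed.

Variable F : finFieldType.
Local Notation q := (#|F|%:R : R).
Local Notation qc := (q%:C : R[i]).
Local Notation qpow := (@qpow R F).

Lemma qpowE z : qpow z = cexp (z * (ln q)%:C). Proof. by []. Qed.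

Lemma qpowD x y : qpow (x + y) = qpow x * qpow y.
Proof. by rewrite !qpowE mulrDl cexpD. Qed.

Lemma qpow0 : qpow 0 = 1. Proof. by rewrite qpowE mul0r cexp0. Qed.

Lemma qpow_neq0 z : qpow z != 0. Proof. exact: cexp_neq0. Qed.

Lemma qpowN z : qpow (- z) = (qpow z)^-1.
Proof.
apply: (mulfI (qpow_neq0 z)); rewrite -qpowD subrr qpow0 divff //.
exact: qpow_neq0.
Qed.

Lemma qpowX z n : qpow (z * n%:R) = qpow z ^+ n.
Proof. by rewrite !qpowE -cexpX mulrCA mulrA. Qed.

Lemma qpow1 : qpow 1 = qc.
Proof. by rewrite qpowE mul1r cexpR lnK // posrE q_gt0. Qed.

Lemma qpow_nat n : qpow n%:R = qc ^+ n.
Proof. by rewrite -(mul1r n%:R) qpowX qpow1. Qed.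

Lemma cm_qpow z : cm (qpow z) = q `^ Re z.
Proof.
rewrite qpowE cm_cexp /powR gt_eqF ?q_gt0 //; congr expR.
by case: z => a b; rewrite /= mulr0 subr0.
Qed.

Lemma cm_qpowN_lt1 s : 0 < Re s -> cm (qpow (- s)) < 1.
Proof.
move=> s0; rewrite cm_qpow /powR gt_eqF ?q_gt0 // expR_lt1.
have l0 : 0 < ln q by rewrite ln_gt0 // q_gt1.
by case: s s0 => a b /= a0; rewrite mulNr oppr_lt0 mulr_gt0.
Qed.

Lemma npow_absA (f : {poly F}) z : npow (absA f) z = qpow z ^+ (size f).-1.
Proof.
rewrite -qpowX qpowE /npow; congr cexp; rewrite /absA natrX lnXn ?q_gt0 //.
by rewrite rmorphMn /= -[_%:C *+ _]mulr_natl mulrA.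
Qed.

(** The index [n.+1] fits truncation by [size P <= n.+1], that is by degree at most [n]. *)
Lemma cvg_geo (v : nat -> R[i]) l (C t : R) : 0 <= t < 1 ->
  (forall n, cm (v n.+1 - l) <= C * t ^+ n) -> limn (v : nat -> R[i]^o) = l.
Proof.
move=> t01 h; apply: cvg_lim; first exact: norm_hausdorff.
apply/cvgrPdist_le => e; rewrite ltcE => /andP[/eqP /= e1 e0].
have ee : e = (Re e)%:C by case: e e1 e0 => x y /= -> _.
have [N hN] := geo_small_eq0 C t01 e0.
exists N.+1 => // -[|n] //= hn; rewrite ee cm_le cmBC.
apply: le_trans (h n) _; apply: le_trans hN.
have C0 : 0 <= C.
  by have := le_trans (cm_ge0 _) (h 0%N); rewrite expr0 mulr1.
by case/andP: t01 => t0 t1; rewrite ler_wpM2l // ler_wiXn2l ?(ltW t1).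
Qed.

Lemma chi_complex (u : ratfun F) (f : {poly F}) : chi R[i] u f = (chi R u f)%:C.
Proof.
rewrite /chi; case: ifP => _; last by rewrite rmorph0.
by rewrite rmorphXn /= rmorphN1.
Qed.

Lemma Lfun_poly s (u : ratfun F) M :
  (forall m, (M <= m)%N -> coefU R u m = 0) ->
  Lfun s u = \sum_(m < M) (coefU R u m)%:C * qpow (- s) ^+ m.
Proof.
move=> hM; rewrite /Lfun.
have e n : \sum_(f \in monic_deg F n) (chi R[i] u f * npow (absA f) (- s)) =
   (coefU R u n)%:C * qpow (- s) ^+ n.
  rewrite fsbig_monics /coefU rmorph_sum /= big_distrl /= !big_seq.
  apply: eq_bigr => f hf; rewrite chi_complex npow_absA.
  by rewrite (monics_deg hf).
apply: (norm_lim_near_cst (V := R[i]^o)); exists M => // n /= hn.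
rewrite /series /=; under eq_bigr do rewrite e.
rewrite (big_cat_nat (n := M)) //= big_mkord.
have -> : \sum_(M <= m < n) (coefU R u m)%:C * qpow (- s) ^+ m = 0.
  by rewrite big_nat big1 // => m /andP[hm _]; rewrite hM // rmorph0 mul0r.
by rewrite addr0.
Qed.

End Exponential.

Section EulerProduct.
Variables (R : realType) (F : finFieldType).
Implicit Types (x z s : R[i]) (P : {poly F}) (S : seq {poly F}) (b N k : nat).
Local Notation q := (#|F|%:R : R).
Local Notation qc := (q%:C : R[i]).
Local Notation qpow := (@qpow R F).
Local Notation pcoef := (@pcoef R F).
Local Notation hcoef := (@hcoef R F).

Definition rho : R := Num.sqrt q.
Local Notation u := (rho^-1).

Lemma q_ge2 : (2 : R) <= q.
Proof. by have := q_gt1 R F; rewrite ltr1n ler_nat. Qed.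

Lemma rho_gt0 : 0 < rho. Proof. by rewrite sqrtr_gt0 q_gt0. Qed.

Lemma rho_sq : rho ^+ 2 = q. Proof. by rewrite sqr_sqrtr // ltW // q_gt0. Qed.

Lemma urho_gt0 : 0 < u. Proof. by rewrite invr_gt0 rho_gt0. Qed.

Lemma urho_lt1 : u < 1.
Proof. by have := u_le34 q_ge2 rho_gt0 rho_sq; lra. Qed.

Lemma rho_gt1 : 1 < rho.
Proof. by have := rho_sq; have := rho_gt0; have := q_ge2; nra. Qed.

Lemma hcoef_decay b : 0 <= hcoef b <= 2 * u ^+ b.
Proof.
have /andP[h0 h1] := hcoef_bound R F b; rewrite h0 (le_trans h1) //.
rewrite -mulrA ler_pM2l // -rho_sq -!exprM exprVn.
rewrite ler_pdivrMr ?exprn_gt0 ?rho_gt0 // mulrC -expfB_cond; last first.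
  by rewrite gt_eqF ?rho_gt0 //=; lia.
by rewrite ler_eXn2l ?rho_gt1 //; lia.
Qed.

Lemma hcoefS b : hcoef b.+1 = hcoef b + pcoef b.+1.
Proof. by rewrite /(hcoef _) [LHS]big_ord_recr. Qed.

Lemma pcoef_decay b : `|pcoef b| <= 2 * rho * u ^+ b.
Proof.
have u0 := urho_gt0; have u1 := urho_lt1; have r1 := rho_gt1.
case: b => [|b].
  have /andP[h0 h1] := hcoef_decay 0; move: h0 h1.
  by rewrite /(hcoef _) big_ord_recr big_ord0 /= add0r !expr0 => h0 h1; rewrite ger0_norm //; lra.
have /andP[h0 h1] := hcoef_decay b; have /andP[h2 h3] := hcoef_decay b.+1.
have -> : 2 * rho * u ^+ b.+1 = 2 * u ^+ b.
  by rewrite exprS mulrA -[2 * rho * u]mulrA divff ?mulr1 // gt_eqF ?rho_gt0.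
have e : u ^+ b.+1 <= u ^+ b by rewrite exprS ler_piMl ?exprn_ge0 ?(ltW u0) ?(ltW u1).
have := hcoefS b => eh; rewrite ler_norml; apply/andP; split; lra.
Qed.

(** Normalized for the variable [x = q^(1-s)]: the points [s = 1] and [s = 0] become [x = 1] and
    [x = q]. *)
Definition acoef b : R[i] := (pcoef b / q ^+ b)%:C.

Lemma acoef_gbound : gbound acoef (2 * rho) (u ^+ 3).
Proof.
have u0 := urho_gt0; have r0 := rho_gt0.
split; rewrite ?mulr_ge0 ?exprn_ge0 ?(ltW r0) ?(ltW u0) // => b.
rewrite /acoef cmR normrM normfV [`|q ^+ b|]ger0_norm ?exprn_ge0 ?ler0n //.
rewrite ler_pdivrMr ?qX_gt0 //; apply: (le_trans (pcoef_decay b)).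
rewrite -rho_sq -[leRHS]mulrA -exprMn.
have -> // : u ^+ 3 * rho ^+ 2 = u by field; rewrite gt_eqF.
Qed.

Local Notation Q := (pser acoef).

Lemma qn0 : q != 0. Proof. by rewrite gt_eqF ?q_gt0. Qed.

Lemma acoef_term b x : acoef b * (qc * x) ^+ b = (pcoef b)%:C * x ^+ b.
Proof.
rewrite exprMn mulrA; congr (_ * _).
have -> : qc ^+ b = (q ^+ b)%:C by rewrite rmorphXn.
by rewrite /acoef -rmorphM /= divfK // expf_neq0 ?qn0.
Qed.

Lemma u3q : u ^+ 3 * q = u.
Proof. by rewrite -rho_sq; field; rewrite gt_eqF ?rho_gt0. Qed.

(** The partial sums of the series at [q] are the [hcoef N], which decay geometrically. *)
Lemma Q_at_q : Q qc = 0.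
Proof.
have u0 := urho_gt0; have u1 := urho_lt1; have r0 := rho_gt0.
have eq : u ^+ 3 * cm qc = u by rewrite qc_cm ?u3q //; exact: q_ge2.
apply: (@geo_eq0 _ _ (2 * (2 * rho) / (1 - u) + 2) u); first by rewrite ltW.
move=> N; have := @pser_approx _ _ _ _ qc N.+1 acoef_gbound; rewrite eq => /(_ u1) h.
have e : \sum_(k < N.+1) acoef k * qc ^+ k = (hcoef N)%:C.
  rewrite /(hcoef _) rmorph_sum; apply: eq_bigr => k _.
  by rewrite -[qc]mulr1 acoef_term expr1n mulr1.
have /andP[h0 h1] := hcoef_decay N.
rewrite -(subrK (hcoef N)%:C (Q qc)) -{1}e; apply: le_trans (cmD _ _) _.
rewrite cmR ger0_norm // mulrDl; apply: lerD => //; apply: le_trans h _.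
rewrite exprS mulrAC ler_wpM2l //; first by rewrite divr_ge0 ?mulr_ge0 // ?(ltW r0) // subr_ge0 ltW.
by rewrite ler_piMl ?exprn_ge0 ?(ltW u0) ?(ltW u1).
Qed.

Lemma hcoef0 : hcoef 0 = 1.
Proof.
have := hcoefE R F 0; rewrite expr0 mul1r monics0 big_seq1 => ->.
rewrite big_seq big1 // => P; rewrite mem_filter => /andP[_ /mem_prs [[_ [sP _]]]].
by rewrite leqNgt sP.
Qed.

(** Summation by parts against the nonnegative [hcoef]; the first of them, equal to 1, already gives
    [1 - 1/q]. This keeps [P(1)] away from 0, as the logarithmic derivative there requires. *)
Lemma partial_Q1 N : 1 - q^-1 <= \sum_(b < N.+2) pcoef b / q ^+ b.
Proof.
have q1 := q_gt1 R F; have q0 := q_gt0 R F.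
have e M : \sum_(b < M.+1) pcoef b / q ^+ b =
    hcoef M / q ^+ M + (1 - q^-1) * \sum_(b < M) hcoef b / q ^+ b.
  elim: M => [|M IH].
    by rewrite big_ord_recr !big_ord0 /= add0r mulr0 addr0 /(hcoef _) big_ord_recr big_ord0 /= add0r.
  rewrite big_ord_recr /= IH [in RHS]big_ord_recr /= hcoefS exprS.
  by field; rewrite qn0 expf_neq0 ?qn0.
rewrite e; have h M : 0 <= hcoef M / q ^+ M.
  by have /andP[h0 _] := hcoef_decay M; rewrite divr_ge0 ?exprn_ge0 ?ler0n.
rewrite big_ord_recl /= hcoef0 expr0 divr1.
have : 0 <= \sum_(i < N) hcoef (bump 0 i) / q ^+ bump 0 i by apply: sumr_ge0 => i _; exact: h.
have := h N.+1; have : 0 <= 1 - q^-1 by rewrite subr_ge0 invf_le1 // ltW.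
move: (\sum_(_ < _) _) (1 - _) (hcoef _ / _) => v1 v2 v3 h1 h2 h3; nra.
Qed.

Lemma Q1_neq0 : Q 1 != 0.
Proof.
apply/eqP => Q10; have u0 := urho_gt0; have r0 := rho_gt0; have q2 := q_ge2.
have u3 : u ^+ 3 < 1 := u3_lt1 q_ge2 rho_gt0 rho_sq.
have h N : 1 / 2 <= 2 * (2 * rho) / (1 - u ^+ 3) * (u ^+ 3) ^+ N.
  have := tail_bound0 N.+2 acoef_gbound u3; rewrite Q10 sub0r cmN.
  have -> : \sum_(b < N.+2) acoef b = (\sum_(b < N.+2) pcoef b / q ^+ b)%:C.
    by rewrite rmorph_sum.
  rewrite cmR => h; have h1 := partial_Q1 N.
  have q1 : q^-1 <= 1 / 2 by rewrite -[1 / 2]invf_div divr1 lef_pV2 ?posrE ?q_gt0.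
  have c0 : 0 <= 2 * (2 * rho) / (1 - u ^+ 3).
    by rewrite divr_ge0 ?mulr_ge0 ?(ltW r0) // subr_ge0 ltW.
  have h2 := ler_norm (\sum_(b < N.+2) pcoef b / q ^+ b).
  have h3 : (u ^+ 3) ^+ N.+2 <= (u ^+ 3) ^+ N.
    by rewrite ler_wiXn2l ?exprn_ge0 ?(ltW u0) ?(ltW u3) //; lia.
  have := ler_wpM2l c0 h3; lra.
have u30 : 0 <= u ^+ 3 < 1 by rewrite exprn_ge0 ?(ltW u0).
have e0 : 0 < 1 / 4 :> R by lra.
have [N hN] := geo_small_eq0 (2 * (2 * rho) / (1 - u ^+ 3)) u30 e0.
by have := h N; lra.
Qed.

Lemma prod_pow_eS (A : comPzRingType) (t : A) N S : S \in subs (prs F N) ->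
  \prod_(P <- S) t ^+ (size P).-1 = t ^+ deg_eS S.
Proof.
move=> /subs_prs [_ pS]; rewrite /deg_eS /eS.
have : forall P, P \in S -> P \is monic by move=> P /pS /prs_prime [].
elim: S {pS} => [|P S IH] h; first by rewrite !big_nil size_poly1 expr0.
have Pm : P \is monic by apply: h; rewrite mem_head.
have h' Q : Q \in S -> Q \is monic by move=> hQ; apply: h; rewrite inE hQ orbT.
have Sm : \prod_(P <- S) P \is monic by rewrite big_seq; apply: monic_prod => Q; exact: h'.
rewrite !big_cons IH // -exprD size_monicM //.
Qed.

Definition vS S : R := \prod_(P <- S) - (absR R P + 1)^-1.

Lemma vS_bound N S : S \in subs (prs F N) -> `|vS S| <= (q ^+ deg_eS S)^-1.
Proof.
move=> hS; rewrite -(absR_eS R hS) -prodfV /vS normr_prod.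
apply: ler_prod => P _; have p1 := absR_ge1 R P.
rewrite normr_ge0 normrN normfV ger0_norm; last by lra.
by rewrite lef_pV2 ?posrE; lra.
Qed.

(** In the product over primes of degree at most [N], the terms of degree [b <= N] give [pcoef b]
    exactly. In each higher degree at most [q^b] sets of primes occur, of weight at most [q^(-b)],
    so the rest is a geometric tail in [|q^(-s)|]. *)
Lemma euler_partial s N : 0 < Re s ->
  cm (\big[*%R/1]_(P \in [set P : {poly F} | primeA P /\ (size P <= N.+1)%N])
        (1 - (npow (absA P) s * ((absA P)%:R + 1))^-1)
      - \sum_(b < N.+1) (pcoef b)%:C * qpow (- s) ^+ b)
  <= cm (qpow (- s)) ^+ N.+1 / (1 - cm (qpow (- s))).
Proof.
move=> s0; set t := qpow (- s).
have t1 : 0 <= cm t < 1 by rewrite cm_ge0 cm_qpowN_lt1.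
have -> : [set P : {poly F} | primeA P /\ (size P <= N.+1)%N] = [set` prs F N].
  by apply/seteqP; split=> P /= /mem_prs.
rewrite -fsbig_seq ?prs_uniq //.
have -> : \prod_(P <- prs F N) (1 - (npow (absA P) s * ((absA P)%:R + 1))^-1) =
   \sum_(S <- subs (prs F N)) t ^+ deg_eS S * (vS S)%:C.
  pose gP P := t ^+ (size P).-1 * (- (absR R P + 1)^-1)%:C.
  transitivity (\prod_(P <- prs F N) (1 + gP P)).
    apply: eq_bigr => P _; congr (_ + _); rewrite npow_absA invfM /gP rmorphN mulrN /=.
    congr (- (_ * _)); first by rewrite /t qpowN exprVn.
    by rewrite fmorphV rmorphD rmorph1 /= /absA /(absR _) natrX rmorphXn /= rmorph_nat.
  rewrite prod_subs !big_seq; apply: eq_bigr => S hS.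
  by rewrite big_split /= (prod_pow_eS _ hS) /vS rmorph_prod.
pose k := (N + \sum_(S <- subs (prs F N)) deg_eS S)%N.
rewrite (sum_by_degree (k := k)); last first.
  move=> S hS; rewrite /k ltnNge => /negP; case.
  by rewrite (big_rem S) //= addnCA leq_addr.
pose e b := \sum_(S <- subs (prs F N) | deg_eS S == b) t ^+ deg_eS S * (vS S)%:C.
have ee b : e b = t ^+ b * (\sum_(S <- subs (prs F N) | deg_eS S == b) vS S)%:C.
  by rewrite rmorph_sum big_distrr /=; apply: eq_bigr => S /eqP ->.
have eb b : cm (e b) <= 1 * cm t ^+ b.
  rewrite ee cmM cmX mulrC ler_wpM2r ?exprn_ge0 ?cm_ge0 // cmR.
  apply: le_trans (ler_norm_sum _ _ _) _.
  apply: (@le_trans _ _ (\sum_(S <- subs (prs F N) | deg_eS S == b) (q ^+ b)^-1)).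
    rewrite big_seq_cond [leRHS]big_seq_cond; apply: ler_sum => S /andP[hS /eqP <-].
    exact: vS_bound hS.
  rewrite big_const_seq iter_addr_0 -[_ *+ _]mulr_natr ler_pdivrMl ?qX_gt0 // mulr1.
  by rewrite -natrX ler_nat; exact: count_subs.
rewrite -(big_mkord xpredT e) (big_cat_nat (n := N.+1)) //=; last by rewrite ltnS leq_addr.
rewrite big_mkord addrAC; have -> : \sum_(b < N.+1) e b = \sum_(b < N.+1) (pcoef b)%:C * t ^+ b.
  apply: eq_bigr => b _; rewrite ee mulrC; congr (_%:C * _).
  by rewrite (pcoefE R F (b := b) (N := N)) // -ltnS.
rewrite subrr add0r; apply: le_trans (cm_sum _ _ _) _.
rewrite -[X in X / _]mul1r; apply: le_trans (sum_geo_nat (M := k.+1) _ t1 _) => //.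
  by apply: ler_sum => b _; exact: eb.
by rewrite ltnS leq_addr.
Qed.

Lemma eulerPE s : 0 < Re s -> eulerP F s = Q (qc * qpow (- s)).
Proof.
move=> s0; set t := qpow (- s).
have t1 : 0 <= cm t < 1 by rewrite cm_ge0 cm_qpowN_lt1.
have /andP[t0 tl1] := t1; have u0 := urho_gt0; have u1 := urho_lt1; have r0 := rho_gt0.
have eqt : u ^+ 3 * cm (qc * t) = u * cm t.
  by rewrite cmM qc_cm ?mulrA ?u3q //; exact: q_ge2.
have ut : u * cm t < 1 by nra.
apply: (@cvg_geo _ _ _ ((1 - cm t)^-1 + 2 * (2 * rho) / (1 - u * cm t)) (cm t) t1) => N.
have h1 := @euler_partial s N s0; rewrite -/t in h1.
have := @pser_approx _ _ _ _ (qc * t) N.+1 acoef_gbound; rewrite eqt => /(_ ut).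
rewrite (eq_bigr (fun b : 'I_N.+1 => (pcoef b)%:C * t ^+ b)); last first.
  by move=> b _; exact: acoef_term.
move=> h2; rewrite cmBC in h2.
set S := \sum_(b < _) _ in h1 h2; rewrite -(subrKA S); apply: le_trans (cmD _ _) _.
rewrite mulrDl; apply: lerD.
  apply: le_trans h1 _; rewrite mulrC ler_wpM2l ?invr_ge0 ?subr_ge0 ?(ltW tl1) //.
  by rewrite exprS ler_piMl ?exprn_ge0 ?(ltW tl1).
apply: le_trans h2 _; rewrite mulrAC ler_wpM2l //.
  by rewrite divr_ge0 ?mulr_ge0 ?(ltW r0) // subr_ge0 ltW.
apply: (@le_trans _ _ (cm t ^+ N.+1)).
  by rewrite exprMn ler_piMl ?exprn_ge0 // exprn_ile1 ?(ltW u0) ?(ltW u1).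
by rewrite exprS ler_piMl ?exprn_ge0 ?(ltW tl1).
Qed.

Lemma mu_ccoef m : mu q acoef m = (if odd m then 0 else ccoef R F m./2)%:C.
Proof.
rewrite /mu; case: ifP => _ //; rewrite /psum /ccoef big_distrr rmorph_sum /=.
apply: eq_bigr => b _; rewrite /acoef -rmorphXn -rmorphM /=; congr _%:C.
rewrite mulrCA; congr (_ * _); have := ltn_ord b; rewrite ltnS => hb.
have -> : q ^+ m./2 = q ^+ (m./2 - b) * q ^+ b by rewrite -exprD subnK.
by rewrite mulfK // expf_neq0 ?qn0.
Qed.

End EulerProduct.

(** * Limits at a punctured point *)

Section PuncturedLimits.
Variable R : realType.
Implicit Types (f h : R[i] -> R[i]) (a l m z v : R[i]).

Definition dlim f a l := forall e : R, 0 < e ->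
  exists2 d : R, 0 < d & forall z, z != a -> cm (z - a) < d -> cm (f z - l) <= e.

Lemma dlim_lim f a l : dlim f a l -> lim ((f z : R[i]^o) @[z --> (a : R[i]^o)^']) = l.
Proof.
move=> H; apply: cvg_lim; first exact: norm_hausdorff.
apply/cvgrPdist_le => e; rewrite ltcE => /andP[/eqP /= e1 e0].
have ee : e = (Re e)%:C by case: e e1 e0 => x y /= -> _.
have [d d0 hd] := H _ e0; rewrite /dnbhs /within /=.
apply/nbhs_ballP; exists d%:C; first by rewrite /= ltcR.
move=> z; rewrite -ball_normE /= cmE ltcR cmBC => hz za.
by rewrite ee cm_le cmBC hd.
Qed.

Lemma dlim_ext f h a l (r : R) : 0 < r ->
  (forall z, z != a -> cm (z - a) < r -> f z = h z) -> dlim h a l -> dlim f a l.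
Proof.
move=> r0 e H x x0; have [d d0 hd] := H x x0; exists (Num.min d r).
  by rewrite lt_min d0.
by move=> z za; rewrite lt_min => /andP[h1 h2]; rewrite e // hd.
Qed.

Lemma dlim_cst a l : dlim (fun=> l) a l.
Proof. by move=> e e0; exists 1 => // z _ _; rewrite subrr cm0 ltW. Qed.

Lemma dlim_id a : dlim id a a.
Proof. by move=> e e0; exists e => // z _ /ltW. Qed.

Lemma dlimD f h a l m : dlim f a l -> dlim h a m -> dlim (fun z => f z + h z) a (l + m).
Proof.
move=> H1 H2 e e0; have e2 : 0 < e / 2 by rewrite divr_gt0.
have [d1 d10 h1] := H1 _ e2; have [d2 d20 h2] := H2 _ e2.
exists (Num.min d1 d2); first by rewrite lt_min d10.
move=> z za; rewrite lt_min => /andP[z1 z2].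
have -> : f z + h z - (l + m) = (f z - l) + (h z - m) by rewrite opprD addrACA.
apply: le_trans (cmD _ _) _; have := h1 z za z1; have := h2 z za z2; lra.
Qed.

Lemma dlimM f h a l m : dlim f a l -> dlim h a m -> dlim (fun z => f z * h z) a (l * m).
Proof.
move=> H1 H2 e e0; pose B := cm l + cm m + 2.
have B0 : 0 < B by have := cm_ge0 l; have := cm_ge0 m; rewrite /B; lra.
pose e' := Num.min 1 (e / B).
have e'0 : 0 < e' by rewrite lt_min ltr01 divr_gt0.
have e'1 : e' <= 1 by rewrite ge_min lexx.
have eB : e' * B <= e by rewrite -ler_pdivlMr // ge_min lexx orbT.
have [d1 d10 h1] := H1 _ e'0; have [d2 d20 h2] := H2 _ e'0.
exists (Num.min d1 d2); first by rewrite lt_min d10.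
move=> z za; rewrite lt_min => /andP[z1 z2].
have {}h1 := h1 z za z1; have {}h2 := h2 z za z2.
have -> : f z * h z - l * m = (f z - l) * (h z - m) + (l * (h z - m) + (f z - l) * m).
  by move: (f z) (h z) => A D; ring.
apply: le_trans (cmD _ _) _; apply: le_trans (lerD (lexx _) (cmD _ _)) _.
rewrite !cmM; have l0 := cm_ge0 l; have m0 := cm_ge0 m.
have f0 := cm_ge0 (f z - l); have h0 := cm_ge0 (h z - m).
by move: eB; rewrite /B; nra.
Qed.

Lemma dlimN f a l : dlim f a l -> dlim (fun z => - f z) a (- l).
Proof.
move=> H e e0; have [d d0 hd] := H e e0; exists d => // z za h.
by rewrite -opprD cmN hd.
Qed.

Lemma dlimB f h a l m : dlim f a l -> dlim h a m -> dlim (fun z => f z - h z) a (l - m).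
Proof. by move=> H1 H2; apply: dlimD => //; exact: dlimN. Qed.

Lemma dlimX f a l n : dlim f a l -> dlim (fun z => f z ^+ n) a (l ^+ n).
Proof.
move=> H; elim: n => [|n IH]; first exact: dlim_cst.
have := dlimM H IH; rewrite -exprS; apply: (dlim_ext (r := 1)) => // z _ _.
by rewrite exprS.
Qed.

Lemma dlimV f a l : l != 0 -> dlim f a l -> dlim (fun z => (f z)^-1) a l^-1.
Proof.
move=> l0 H e e0; have c0 : 0 < cm l by rewrite cm_gt0.
pose e' := Num.min (cm l / 2) (e * (cm l ^+ 2 / 2)).
have c2 : 0 < cm l ^+ 2 by rewrite exprn_gt0.
have e'0 : 0 < e' by rewrite lt_min !divr_gt0 // mulr_gt0 // divr_gt0.
have [d d0 hd] := H _ e'0; exists d => // z za hz.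
have := hd z za hz; rewrite le_min => /andP[h1 h2].
have fl : cm l / 2 <= cm (f z).
  have : cm l <= cm (f z) + cm (f z - l).
    by rewrite -{1}(subKr (f z) l); exact: cmB.
  lra.
have f0 : f z != 0 by rewrite -cm_gt0; lra.
have -> : (f z)^-1 - l^-1 = - ((f z - l) * ((f z)^-1 * l^-1)).
  by move: (f z) f0 => A A0; field; rewrite A0 l0.
rewrite cmN !cmM !cmV; apply: (@le_trans _ _ (e * (cm l ^+ 2 / 2) * ((cm l / 2)^-1 * (cm l)^-1))).
  apply: ler_pM => //; rewrite ?cm_ge0 ?mulr_ge0 ?invr_ge0 ?cm_ge0 //.
  rewrite ler_wpM2r ?invr_ge0 ?cm_ge0 // lef_pV2 ?posrE //; lra.
rewrite le_eqVlt; apply/orP; left; apply/eqP; move: (cm l) c0 => t t0; field.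
by rewrite gt_eqF.
Qed.

Lemma dlim_geosum f a l N : dlim f a l -> dlim (fun z => geosum (f z) N) a (geosum l N).
Proof.
move=> H; elim: N => [|N IH].
  by rewrite /geosum big_ord0; apply: (dlim_ext (r := 1) _ _ (dlim_cst a 0)) => // z _ _; rewrite big_ord0.
rewrite geosumS; apply: (dlim_ext (r := 1) _ _ (dlimD IH (dlimX N H))) => // z _ _.
by rewrite geosumS.
Qed.

Lemma dlim_lipschitz f h a l (K r : R) : 0 < K -> cm l < r ->
  (forall x, cm x <= r -> cm (h x - h l) <= K * cm (x - l)) ->
  dlim f a l -> dlim (fun z => h (f z)) a (h l).
Proof.
move=> K0 lr hK H e e0; pose e' := Num.min (e / K) (r - cm l).
have e'0 : 0 < e' by rewrite lt_min divr_gt0 // subr_gt0.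
have [d d0 hd] := H _ e'0; exists d => // z za hz.
have := hd z za hz; rewrite le_min => /andP[h1 h2].
have fr : cm (f z) <= r.
  by have := cmD (f z - l) l; rewrite subrK; lra.
by apply: le_trans (hK _ fr) _; rewrite mulrC -ler_pdivlMr.
Qed.

Lemma real_derive0 (f : R -> R) (l : R) : is_derive (0 : R) 1 f l ->
  forall e : R, 0 < e -> exists2 d : R, 0 < d &
    forall t : R, `|t| < d -> `|f t - f 0 - l * t| <= e * `|t|.
Proof.
move=> [df dv] e e0.
have : h^-1 *: (f (h *: 1 + 0) - f 0) @[h --> (0 : R)^'] --> l by rewrite -dv; exact: df.
move=> /cvgrPdist_le /(_ e e0); rewrite /dnbhs /within /= => /nbhs_ballP [d /= d0 hd].
exists d => // t td; have [->|t0] := eqVneq t 0.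
  by rewrite !subrr mulr0 subrr normr0 mulr0.
have := hd t; rewrite -ball_normE /= sub0r normrN => /(_ td t0).
rewrite /GRing.scale /= mulr1 addr0 => h.
have -> : f t - f 0 - l * t = - (l - t^-1 * (f t - f 0)) * t by field.
by rewrite normrM normrN ler_wpM2r.
Qed.

Lemma cexp_near0 (e : R) : 0 < e ->
  exists2 d : R, 0 < d & forall v, cm v < d -> cm (cexp v - 1 - v) <= e * cm v.
Proof.
(* The estimates below add up to at most [5 x |v|], whence [e / 5]. *)
move=> e0; pose x := Num.min 1 (e / 5).
have x0 : 0 < x by rewrite lt_min ltr01 divr_gt0.
have x1 : x <= 1 by rewrite ge_min lexx.
have x5 : 5 * x <= e by rewrite mulrC -ler_pdivlMr // ge_min lexx orbT.
have [d1 d10 h1] := real_derive0 (is_derive_expR (0 : R)) x0.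
have [d2 d20 h2] := real_derive0 (is_derive_cos (0 : R)) x0.
have [d3 d30 h3] := real_derive0 (is_derive_sin (0 : R)) x0.
exists (Num.min (Num.min d1 d2) (Num.min d3 (x / 4))).
  by rewrite !lt_min d10 d20 d30 divr_gt0.
move=> [a b]; set v := a +i* b; rewrite !lt_min => /andP[/andP[v1 v2] /andP[v3 v4]].
have ha : `|a| <= cm v := cm_Re v; have hb : `|b| <= cm v := cm_Im v.
have {h1 v1} := h1 a (le_lt_trans ha v1); rewrite expR0 mul1r.
have {h2 v2} := h2 b (le_lt_trans hb v2); rewrite cos0 sin0 oppr0 mul0r subr0.
have {h3 v3} := h3 b (le_lt_trans hb v3); rewrite sin0 cos0 subr0 mul1r.
have hc := cos_max b; rewrite /cexp /=.
move: (expR a) (cos b) (sin b) hc => A B S hc hS hB hA.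
apply: le_trans (cm_le_ReIm _) _; rewrite /=.
have -> : A * B - 1 - a = (A - 1 - a) * B + (1 + a) * (B - 1) by ring.
have -> : A * S - 0 - b = ((A - 1 - a) + a) * ((S - b) + b) + (S - b) by ring.
have a4 : `|a| <= 1 / 4 by apply: (le_trans ha); lra.
have t1 : `|(A - 1 - a) * B + (1 + a) * (B - 1)| <= x * `|a| + 2 * (x * `|b|).
  apply: le_trans (ler_normD _ _) _; rewrite !normrM; apply: lerD.
    by apply: le_trans (ler_wpM2l (normr_ge0 _) hc) _; rewrite mulr1.
  apply: ler_pM => //; apply: le_trans (ler_normD _ _) _; rewrite normr1; lra.
have t2 : `|(A - 1 - a) + a| <= 2 * `|a|.
  by apply: le_trans (ler_normD _ _) _; have := normr_ge0 a; nra.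
have t3 : `|(S - b) + b| <= 2 * `|b|.
  by apply: le_trans (ler_normD _ _) _; have := normr_ge0 b; nra.
have t4 : `|((A - 1 - a) + a) * ((S - b) + b) + (S - b)| <= x * `|b| + x * `|b|.
  apply: le_trans (ler_normD _ _) _; apply: lerD => //; rewrite normrM.
  apply: (@le_trans _ _ ((2 * `|a|) * (2 * `|b|))); first exact: ler_pM.
  have := normr_ge0 b; have : `|a| <= x / 4 by apply: (le_trans ha); lra.
  by move: (`|a|) (`|b|) => p r; nra.
apply: le_trans (lerD t1 t4) _; have := cm_ge0 v; move: (cm v) ha hb => c ha hb c0; nra.
Qed.

Lemma dlim_cexp f a l : dlim f a l -> dlim (fun z => cexp (f z)) a (cexp l).
Proof.
move=> H e e0; have [d1 d10 h1] := @cexp_near0 1 ltr01.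
pose B := 2 * cm (cexp l); have B0 : 0 < B by rewrite mulr_gt0 // cm_gt0 cexp_neq0.
pose e' := Num.min (d1 / 2) (e / B).
have e'0 : 0 < e' by rewrite lt_min !divr_gt0.
have [d d0 hd] := H _ e'0; exists d => // z za hz.
have := hd z za hz; rewrite le_min => /andP[k1 k2].
have -> : cexp (f z) - cexp l = cexp l * (cexp (f z - l) - 1).
  by rewrite mulrBr mulr1 -cexpD [l + _]addrC subrK.
rewrite cmM; have hv : cm (cexp (f z - l) - 1) <= 2 * cm (f z - l).
  have k3 : cm (f z - l) < d1 by lra.
  rewrite -(subrK (f z - l) (cexp (f z - l) - 1)); apply: le_trans (cmD _ _) _.
  by have := h1 _ k3; lra.
apply: le_trans (ler_wpM2l (cm_ge0 _) hv) _.
move: k2; rewrite ler_pdivlMr // /B; lra.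
Qed.

End PuncturedLimits.

(** The factor [1/(1 - y)] of [zeta_A(2s)] is absorbed into the two functions [Gm] at [y] and [1/y],
    which have no pole at [y = 1]. *)
Lemma closed_form_algebra (K : fieldType) (y Qy Qx Q1 Gy Gx yK xK yg eta k : K) :
  y != 0 -> 1 - y != 0 ->
  (1 - y) * Gy = Qy - Q1 * yK -> (1 - y^-1) * Gx = Qx - Q1 * xK ->
  (1 - y)^-1 * k * (Qy - Q1 * yK + eta * (yg * y) * (Q1 * xK - Qx)) =
  k * (Gy + eta * (yg * Gx)).
Proof.
move=> y0 y1 eGy eGx.
have x1 : 1 - y^-1 != 0.
  have -> : 1 - y^-1 = - ((1 - y) / y) by field.
  by rewrite oppr_eq0 mulf_neq0 // invr_eq0.
have -> : Q1 * xK - Qx = - ((1 - y^-1) * Gx) by rewrite eGx opprB.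
by rewrite -eGy; field; rewrite y0 y1.
Qed.

Lemma half_sum g : (0 < g)%N -> (g./2 + (g.-1)./2.+1 = g)%N.
Proof. by move=> g0; lia. Qed.

Lemma half_pred_le g : ((g.-1)./2 <= g)%N. Proof. by lia. Qed.

(** * The closed forms of alpha, beta and gamma *)

Section ClosedForms.
Variables (R : realType) (F : finFieldType).
Implicit Types (x z s : R[i]) (g N : nat).
Local Notation q := (#|F|%:R : R).
Local Notation qc := (q%:C : R[i]).
Local Notation qpow := (@qpow R F).
Local Notation a := (acoef R F).
Local Notation Q := (pser (acoef R F)).
Local Notation W := (pser (tail (acoef R F))).
Local Notation q2 := (q_ge2 R F).
Local Notation r0 := (rho_gt0 R F).
Local Notation r2 := (rho_sq R F).
Local Notation ha := (acoef_gbound R F).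

Definition kc : R[i] := (kap R F)%:C.

Definition ys s : R[i] := qc * qpow (- s) ^+ 2.

(** The pole-free form of [alpha_X], meaningful also where [ys s = 1]. *)
Definition alphaC g s : R[i] :=
  kc * (Gm a (ys s) g./2.+1 + ys s ^+ g * Gm a (ys s)^-1 (g.-1)./2.+1).

(** The sign [e] is 1 for beta and -1 for gamma. *)
Definition betaC (e : R[i]) g s : R[i] := kc * betaM q a (e * qpow (- s)) g.

Lemma qcn0 : qc != 0. Proof. exact: qc_neq0 q2. Qed.

Lemma qcn1 : qc - 1 != 0. Proof. exact: qc1_neq0 q2. Qed.

Lemma kcE : kc = 1 - qc^-1.
Proof. by rewrite /kc /kap rmorphB rmorph1 fmorphV. Qed.

Lemma kc_qc : kc * (qc / (qc - 1)) = 1.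
Proof.
rewrite kcE; have := qcn0; have := qcn1; move: qc => A A1 A0; field.
by rewrite A0 A1.
Qed.

Lemma ysE s : ys s = qpow (1 - 2 * s).
Proof. by rewrite /ys qpowD qpow1 mulrC -mulrN mulrC -[2]/(2%:R) -(mulrC (- s)) qpowX mulrC. Qed.

Lemma ys_neq0 s : ys s != 0. Proof. by rewrite ysE qpow_neq0. Qed.

Lemma inv_zetaA2 : (zetaA F (2 : R[i]))^-1 = kc.
Proof.
rewrite /zetaA invrK kcE (_ : 1 - 2 = -1); last by ring.
by rewrite qpowN qpow1.
Qed.

Lemma cm_t_lt1 s : 0 < Re s -> cm (qpow (- s)) < 1.
Proof. exact: cm_qpowN_lt1. Qed.

Lemma qt_gt1 s : Re s < 1 -> 1 < q * cm (qpow (- s)).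
Proof.
move=> s1; have e : q * cm (qpow (- s)) = (cm (qpow (- (1 - s))))^-1.
  by rewrite -{1}(qc_cm q2) -cmM -qpow1 -qpowD qpowN cmV invrK.
rewrite e invf_gt1.
  by apply: cm_qpowN_lt1; case: s s1 {e} => x y /=; lra.
by rewrite cm_gt0 qpow_neq0.
Qed.

Lemma ys_le s : 0 < Re s -> cm (ys s) <= q.
Proof.
move=> /cm_t_lt1 t1; rewrite /ys cmM cmX (qc_cm q2); have := cm_ge0 (qpow (- s)).
have := q2; move: (cm _) t1 => t t1 q2 t0.
by rewrite ler_piMr ?exprn_ile1 ?(ltW t1) //; lra.
Qed.

Lemma ysV_le s : Re s < 1 -> cm (ys s)^-1 <= q.
Proof.
move=> s1; have h := qt_gt1 s1; have t0 : 0 < cm (qpow (- s)) by rewrite cm_gt0 qpow_neq0.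
rewrite cmV /ys cmM cmX (qc_cm q2); have q0 := q_gt0 R F.
move: (cm _) t0 h => t t0 h.
by rewrite invf_ple ?posrE ?mulr_gt0 ?exprn_gt0 // -[leLHS]mulr1 ler_pdivrMl //; nra.
Qed.

Lemma Re_2 s : Re (2 * s) = 2 * Re s.
Proof. by rewrite !mulr_natl !mulr2n; case: s. Qed.

Lemma eulerP_2s s : 0 < Re s -> eulerP F (2 * s) = Q (ys s).
Proof.
move=> s0; rewrite eulerPE; last by rewrite Re_2; lra.
have -> : - (2 * s) = - s * 2%:R by ring.
by rewrite qpowX.

Qed.

Lemma eulerP_22s s : Re s < 1 -> eulerP F (2 - 2 * s) = Q (ys s)^-1.
Proof.
move=> s1; rewrite eulerPE; last by case: s s1 => x y /= h; rewrite ?mulr0 ?mul0r ?subr0; lra.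
by congr Q; rewrite ysE -qpowN -qpow1 -qpowD; congr (Defs.qpow _ _); ring.
Qed.

Lemma eulerP_1 : eulerP F (1 : R[i]) = Q 1.
Proof.
by rewrite eulerPE; [rewrite qpowN qpow1 divff ?qcn0|exact: ltr01].
Qed.

Lemma zetaA_2s s : zetaA F (2 * s) = (1 - ys s)^-1.
Proof. by rewrite /zetaA -ysE. Qed.

Lemma qpow_ys s n : qpow ((1 - 2 * s) * n%:R) = ys s ^+ n.
Proof. by rewrite qpowX ysE. Qed.

Lemma qpow_ysV s n : qpow ((2 * s - 1) * n%:R) = (ys s)^-1 ^+ n.
Proof. by rewrite qpowX ysE -qpowN opprB. Qed.

Lemma alpha_X_closed g s : 0 < Re s < 1 -> ys s != 1 -> alpha_X F g s = alphaC g s.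
Proof.
move=> /andP[s0 s1] y1; have y1' : 1 - ys s != 0 by rewrite subr_eq0 eq_sym.
have y0 := ys_neq0 s.
rewrite /alpha_X zetaA_2s inv_zetaA2 eulerP_2s // eulerP_22s // eulerP_1 !qpow_ys.
rewrite -natrB ?half_pred_le // qpow_ys /alphaC.
have h1 := Gm_eq q2 r0 r2 ha g./2.+1 (ys_le s0).
have h2 := Gm_eq q2 r0 r2 ha (g.-1)./2.+1 (ysV_le s1).
have := closed_form_algebra (ys s ^+ g) 1 kc y0 y1' h1 h2; rewrite !mul1r => <-.
congr (_ * _); rewrite -exprSr.
have -> : ys s ^+ (g - (g.-1)./2) = ys s ^+ g.+1 * (ys s)^-1 ^+ (g.-1)./2.+1.
  have eg : (g.+1 = (g - (g.-1)./2) + (g.-1)./2.+1)%N by rewrite addnS subnK ?half_pred_le.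
  by rewrite eg exprD exprVn mulfK ?expf_neq0.
move: (ys s ^+ g.+1) (Q _) (Q _) (Q _) (_ ^+ _) (_ ^+ _) => A1 A2 A3 A4 A5 A6; ring.
Qed.

Definition etaX s : R[i] := zetaA F (2 - s) / zetaA F (1 + s).

Lemma w_qpow s : (qc * qpow (- s))^-1 = qpow (s - 1).
Proof. by rewrite -qpow1 -qpowD -qpowN; congr (Defs.qpow _ _); ring. Qed.

Lemma etafE s : etaf q (1 * qpow (- s)) = etaX s.
Proof.
rewrite /etaf mul1r w_qpow /etaX /zetaA invrK mulrC.
by congr ((1 - _)^-1 * (1 - _)); congr (Defs.qpow _ _); ring.
Qed.

Lemma etafN s : etaf q (-1 * qpow (- s)) = nu F s.
Proof. by rewrite /etaf mulN1r opprK mulrN invrN opprK w_qpow. Qed.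

Lemma betaM_closed (e : R[i]) g s : e ^+ 2 = 1 -> 0 < Re s < 1 -> ys s != 1 ->
  betaC e g s =
  zetaA F (2 * s) / zetaA F 2 *
  (Q (ys s) - Q 1 * ys s ^+ g./2.+1
   + etaf q (e * qpow (- s)) * ys s ^+ g.+1
     * (Q 1 * (ys s)^-1 ^+ (g.-1)./2.+1 - Q (ys s)^-1))
  - Q 1 * ((e * qpow (- s)) ^+ g
    * (qc ^+ g./2 * (e * qpow (- s)) + etaf q (e * qpow (- s)) * qc ^+ (g.-1)./2)).
Proof.
move=> e1 /andP[s0 s1] y1; have y1' : 1 - ys s != 0 by rewrite subr_eq0 eq_sym.
have y0 := ys_neq0 s.
have h1 := Gm_eq q2 r0 r2 ha g./2.+1 (ys_le s0).
have h2 := Gm_eq q2 r0 r2 ha (g.-1)./2.+1 (ysV_le s1).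
rewrite zetaA_2s inv_zetaA2 [ys s ^+ g.+1]exprSr.
rewrite (closed_form_algebra (ys s ^+ g) _ kc y0 y1' h1 h2) /betaC /betaM.
have -> : qc * (e * qpow (- s)) ^+ 2 = ys s by rewrite exprMn e1 mul1r.
rewrite mulrBr; congr (_ - _).
by rewrite -[Q 1 * _ * _]mulrA mulrCA [kc * _]mulrA kc_qc mul1r.
Qed.

Lemma beta_X_closed g s : 0 < Re s < 1 -> ys s != 1 -> beta_X F g s = betaC 1 g s.
Proof.
move=> s01 y1; have /andP[s0 s1] := s01; rewrite betaM_closed ?expr1n // etafE.
rewrite /beta_X -/(etaX s) eulerP_2s // eulerP_22s // eulerP_1 !qpow_ys qpow_ysV !mul1r.
have -> : qpow (- (g%:R * s)) = qpow (- s) ^+ g by rewrite -mulrN mulrC qpowX.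
by rewrite qpowD !qpow_nat -[Q 1 * _ * _]mulrA.
Qed.

Lemma gamma_X_closed g s : 0 < Re s < 1 -> ys s != 1 -> gamma_X F g s = betaC (-1) g s.
Proof.
move=> s01 y1; have /andP[s0 s1] := s01; rewrite betaM_closed ?sqrrN ?expr1n // etafN.
rewrite /gamma_X eulerP_2s // eulerP_22s // eulerP_1 !qpow_ys qpow_ysV.
congr (_ + _).
have -> : qpow (- (g%:R * s)) = qpow (- s) ^+ g by rewrite -mulrN mulrC qpowX.
rewrite qpowD !qpow_nat mulN1r [(- qpow _) ^+ g]exprNn.
move: ((-1) ^+ g) (qpow (- s) ^+ g) (qpow _) (qc ^+ _) (qc ^+ _) (nu _ _) (Q 1).
by move=> A1 A2 A3 A4 A5 A6 A7; ring.
Qed.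

Lemma dlim_qpow f p l : dlim f p l -> dlim (fun z => qpow (f z)) p (qpow l).
Proof. by move=> H; apply: dlim_cexp; apply: dlimM => //; exact: dlim_cst. Qed.

Lemma dlim_t s : dlim (fun z => qpow (- z)) s (qpow (- s)).
Proof. by apply: dlim_qpow; apply: dlimN; exact: dlim_id. Qed.

Lemma dlim_ys s : dlim ys s (ys s).
Proof. by apply: dlimM; [exact: dlim_cst|apply: dlimX; exact: dlim_t]. Qed.

Lemma W_lipschitz : exists2 K : R, 0 < K &
  forall x, cm x <= q -> cm (W x - W 1) <= K * cm (x - 1).
Proof.
have hr := u3_lt1 q2 r0 r2; have ht := tail_gbound ha hr.
set C := (X in gbound _ X _) in ht; exists (32 * C + 1).
  by case: ht => C0 _ _; lra.
move=> x xq; have h := u3_small q2 r0 r2 (cm_ge0 x) xq.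
have rx : (rho R F)^-1 ^+ 3 * cm x < 1 by lra.
apply: le_trans (pser_lipschitz ht hr rx) _; rewrite ler_wpM2r ?cm_ge0 //.
apply: le_trans (const_bound q2 r0 r2 ht (cm_ge0 x) xq) _; lra.
Qed.

Lemma dlim_W f p : dlim f p 1 -> dlim (fun z => W (f z)) p (W 1).
Proof.
have [K K0 hK] := W_lipschitz; apply: (dlim_lipschitz K0 _ hK).
by rewrite cm1 q_gt1.
Qed.

Lemma dlim_Gm f p N : dlim f p 1 -> dlim (fun z => Gm a (f z) N) p (Gm a 1 N).
Proof.
move=> H; apply: dlimB; last exact: dlim_W.
by apply: dlimM; [exact: dlim_cst|exact: dlim_geosum].
Qed.

Lemma dlim_alphaC g s : ys s = 1 -> dlim (alphaC g) s (alphaC g s).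
Proof.
move=> y1; have hy := dlim_ys s; rewrite /alphaC.
have hy1 : dlim ys s 1 by rewrite -y1.
have hx1 : dlim (fun z => (ys z)^-1) s 1.
  by have := dlimV (ys_neq0 s) hy; rewrite y1 invr1.
apply: dlimM; first exact: dlim_cst.
rewrite y1 invr1; apply: dlimD; first exact: dlim_Gm.
by apply: dlimM; [apply: dlimX|exact: dlim_Gm].
Qed.

Lemma dlim_betaC e g s : e ^+ 2 = 1 -> 0 < Re s < 1 -> ys s = 1 ->
  dlim (betaC e g) s (betaC e g s).
Proof.
move=> e1 /andP[s0 s1] y1; have hy := dlim_ys s.
have hy1 : dlim ys s 1 by rewrite -y1.
have hx1 : dlim (fun z => (ys z)^-1) s 1.
  by have := dlimV (ys_neq0 s) hy; rewrite y1 invr1.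
have et z : qc * (e * qpow (- z)) ^+ 2 = ys z by rewrite exprMn e1 mul1r.
have e0 : e != 0 by apply: contra_eq_neq e1 => ->; rewrite expr0n eq_sym oner_neq0.
have ht : dlim (fun z => e * qpow (- z)) s (e * qpow (- s)).
  by apply: dlimM; [exact: dlim_cst|exact: dlim_t].
have hqt : qc * (e * qpow (- s)) != 0 by rewrite !mulf_neq0 ?qcn0 ?qpow_neq0.
have w1 : 1 - (qc * (e * qpow (- s)))^-1 != 0.
  rewrite subr_eq0 eq_sym; apply/eqP => h.
  have : cm (qc * (e * qpow (- s))) = 1 by rewrite -[cm _]invrK -cmV h cm1 invr1.
  have ce : cm e = 1.
    apply/eqP; rewrite -(@eqrXn2 _ 2) ?cm_ge0 // -cmX e1 cm1 expr1n //.
  rewrite !cmM ce mul1r (qc_cm q2) => h2; have := qt_gt1 s1; lra.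
have heta : dlim (fun z => etaf q (e * qpow (- z))) s (etaf q (e * qpow (- s))).
  apply: dlimM; first by apply: dlimB => //; exact: dlim_cst.
  apply: dlimV => //; apply: dlimB; first exact: dlim_cst.
  by apply: dlimV => //; apply: dlimM => //; exact: dlim_cst.
have e2 : betaC e g s = kc * (Gm a 1 g./2.+1
   + etaf q (e * qpow (- s)) * (ys s ^+ g * Gm a 1 (g.-1)./2.+1)
   - Q 1 * (qc / (qc - 1)) * ((e * qpow (- s)) ^+ g * (qc ^+ g./2 * (e * qpow (- s))
      + etaf q (e * qpow (- s)) * qc ^+ (g.-1)./2))).
  by rewrite /betaC /betaM et y1 invr1.
have H := dlimM (dlim_cst s kc) (dlimB (dlimD (dlim_Gm g./2.+1 hy1)
  (dlimM heta (dlimM (dlimX g hy) (dlim_Gm (g.-1)./2.+1 hx1))))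
  (dlimM (dlim_cst s (Q 1 * (qc / (qc - 1)))) (dlimM (dlimX g ht)
     (dlimD (dlimM (dlim_cst s (qc ^+ g./2)) ht)
            (dlimM heta (dlim_cst s (qc ^+ (g.-1)./2))))))).
by rewrite e2; apply: (dlim_ext ltr01 _ H) => z _ _; rewrite /betaC /betaM et.
Qed.

Lemma lnq_gt0 : 0 < ln q. Proof. by rewrite ln_gt0 // q_gt1. Qed.

(** Near 0 the exponential satisfies [|cexp v - 1 - v| <= |v|/2], so [cexp v = 1] forces [v = 0]:
    the zeros of [1 - ys] are isolated. *)
Lemma ys_neq1_near s : ys s = 1 ->
  exists2 r : R, 0 < r & forall z, z != s -> cm (z - s) < r -> ys z != 1.
Proof.
move=> y1; have l0 := lnq_gt0; have h2 : 0 < 1 / 2 :> R by lra.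
have [d d0 hd] := @cexp_near0 R _ h2.
exists (d / (2 * ln q)); first by rewrite divr_gt0 // mulr_gt0.
move=> z zs hz; apply/eqP => yz.
pose v := - (2 * (z - s)) * (ln q)%:C.
have ev : cexp v = 1.
  have e : ys z = ys s * qpow (- (2 * (z - s))).
    by rewrite !ysE -qpowD; congr (Defs.qpow _ _); ring.
  by move: e; rewrite yz y1 mul1r => /esym.
have cv : cm v = 2 * cm (z - s) * ln q.
  by rewrite /v !cmM cmN cmM cmR gtr0_norm // -[2 : R[i]]/(2%:R) cm_nat.
have vd : cm v < d.
  by rewrite cv -mulrA mulrCA mulrC; move: hz; rewrite ltr_pdivlMr ?mulr_gt0 //; lra.
have := hd v vd; rewrite ev subrr sub0r cmN => h.
have : 0 < cm v by rewrite cv !mulr_gt0 // cm_gt0 subr_eq0.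
lra.
Qed.

(** At a removable point the closed form agrees with [f] on a punctured neighbourhood inside the
    strip, so the limit is its value by continuity. *)
Lemma meroval_closed (f h : R[i] -> R[i]) s : 0 < Re s < 1 ->
  (forall z, 0 < Re z < 1 -> ys z != 1 -> f z = h z) ->
  (ys s = 1 -> dlim h s (h s)) -> meroval F f s = h s.
Proof.
move=> /andP[s0 s1] fh hd; rewrite /meroval -ysE; case: eqP => [y1|/eqP y1]; last first.
  by rewrite fh // s0.
apply: dlim_lim; have [r rp hr] := ys_neq1_near y1.
pose r' := Num.min r (Num.min (Re s) (1 - Re s)).
apply: (dlim_ext (r := r')) (hd y1); first by rewrite !lt_min rp s0 subr_gt0.
move=> z zs; rewrite !lt_min => /andP[z1 /andP[z2 z3]]; apply: fh; last exact: hr.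
have := cm_Re (z - s); rewrite ler_norml; case: z s s0 s1 z2 z3 {hd y1 hr zs z1} r' => [x y] [x' y'] /=.
by move=> s0 s1 z2 z3 _ /andP[h1 h2]; apply/andP; split; lra.
Qed.

Lemma Re_half : Re (half R) = 1 / 2.
Proof.
by rewrite /half -[2 : R[i]]/(2%:R) natC -fmorphV /= mul1r.
Qed.

Lemma half_compl : 1 - half R = half R.
Proof. by have := splitr (1 : R[i]); rewrite !mul1r => h; rewrite {1}h addrK. Qed.

Lemma ys_half : ys (half R) = 1.
Proof.
by rewrite ysE /half mulfV ?subrr ?qpow0.
Qed.

(** [P(1 + h) = Q(q^(-h))], so the difference quotient is [(q^(-h) - 1)/h] times [W(q^(-h))]; the
    first factor tends to [- log q], the second to [W 1]. *)
Lemma dlog_value : dlog_eulerP1 R F = - logq R F * W 1 / Q 1.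
Proof.
rewrite /dlog_eulerP1 eulerP_1; congr (_ / _).
pose L : R[i] := (ln q)%:C.
apply: (@dlim_lim R (fun h => h^-1 * (eulerP F (h + 1) - eulerP F 1)) 0).
apply: (dlim_ext (r := 1) (h := fun h => (h^-1 * (qpow (- h) - 1)) * W (qpow (- h)))) => //.
  move=> h h0; rewrite subr0 => h1; have hR : -1 < Re h.
    by have := cm_Re h; rewrite ler_norml => /andP[h2 _]; lra.
  rewrite eulerP_1 eulerPE; last by case: h hR {h0 h1} => x y /=; lra.
  have -> : qc * qpow (- (h + 1)) = qpow (- h).
    by rewrite -qpow1 -qpowD; congr (Defs.qpow _ _); ring.
  have xq : cm (qpow (- h)) <= q.
    have e1 : qpow 1 = qpow (1 + h) * qpow (- h).
      by rewrite -qpowD; congr (Defs.qpow _ _); ring.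
    rewrite -[leRHS](qc_cm q2) -qpow1 e1 cmM ler_peMl ?cm_ge0 //.
    have := @cm_qpowN_lt1 R F (1 + h); rewrite qpowN cmV => k.
    have k1 : 0 < Re (1 + h) by case: h hR {h0 h1 k e1} => x y /=; lra.
    have := k k1; rewrite invf_lt1 ?cm_gt0 ?qpow_neq0 //; exact: ltW.
  have := W_eq q2 r0 r2 ha xq; rewrite -mulrA -[qpow (- h) - 1]opprB mulNr => ->.
  by rewrite opprB.
apply: dlimM; last first.
  apply: dlim_W; have := dlim_t 0; rewrite oppr0 qpow0; exact.
move=> e e0; have l0 := lnq_gt0.
have [d d0 hd] := @cexp_near0 R (e / ln q) (divr_gt0 e0 l0).
exists (d / ln q); first exact: divr_gt0.
move=> h h0; rewrite subr0 => hh.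
pose v := - h * L; have cv : cm v = cm h * ln q by rewrite /v cmM cmN cmR gtr0_norm.
have vd : cm v < d by rewrite cv; move: hh; rewrite ltr_pdivlMr.
have -> : h^-1 * (qpow (- h) - 1) - - logq R F = h^-1 * (cexp v - 1 - v).
  rewrite qpowE -/L -/v; have -> : logq R F = L by [].
  by move: (cexp v) => E; rewrite /v; field.
rewrite cmM cmV ler_pdivrMl ?cm_gt0 //; apply: le_trans (hd v vd) _; rewrite cv.
by rewrite mulrCA mulfVK ?gt_eqF // mulrC.
Qed.

Lemma logq_neq0 : logq R F != 0.
Proof. by rewrite /logq -cm_gt0 cmR normr_gt0 gt_eqF // lnq_gt0. Qed.

Lemma geosum1 N : geosum (1 : R[i]) N = N%:R.
Proof. by rewrite /geosum; under eq_bigr do rewrite expr1n; rewrite sumr_const card_ord. Qed.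

(** At [x = 1] each [Gm] is its length times [Q 1], minus [W 1]. The lengths add up to [g + 1], and
    [- 2 W 1] is the term with the logarithmic derivative. *)
Lemma Gm_halves g : (0 < g)%N ->
  Gm a 1 g./2.+1 + Gm a 1 (g.-1)./2.+1 = Q 1 * (g.+1%:R + 2 / logq R F * dlog_eulerP1 R F).
Proof.
move=> g0; rewrite /Gm !geosum1 dlog_value.
have -> : g.+1%:R = g./2.+1%:R + (g.-1)./2.+1%:R :> R[i].
  by rewrite -natrD addSn half_sum.
have := Q1_neq0 R F; have := logq_neq0.
move: (Q 1) (W 1) (logq R F) (_%:R) (_%:R) => A B D E G D0 A0; field.
by rewrite A0 D0.
Qed.

Lemma alphag_X g s : (0 < g)%N -> 1 / 2 <= Re s < 1 -> alphag F g s = alphaC g s.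
Proof.
move=> g0 /andP[s0 s1]; rewrite /alphag; case: eqP => [->|_].
  by rewrite /alphaC ys_half invr1 expr1n mul1r Gm_halves // inv_zetaA2 eulerP_1 mulrAC mulrC.
rewrite leNgt s1 /=; apply: meroval_closed; first by rewrite s1; lra.
  exact: alpha_X_closed.
exact: dlim_alphaC.
Qed.

Lemma t_half : qpow (- half R) ^+ 2 * qc = 1.
Proof. by rewrite mulrC -/(ys _) ys_half. Qed.

Lemma cm_t_half : cm (qpow (- half R)) < 1.
Proof. by apply: cm_qpowN_lt1; rewrite Re_half; lra. Qed.

(** The parity of [g] only exchanges the two products, so their sum, which is all that matters at
    [s = 1/2], is always [t + t^2]. *)
Lemma pow_halves (t A : R[i]) g : t ^+ 2 * A = 1 -> A != 0 -> (0 < g)%N ->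
  (t ^+ g * (A ^+ g./2 * t) = t /\ t ^+ g * A ^+ (g.-1)./2 = t ^+ 2) \/
  (t ^+ g * (A ^+ g./2 * t) = t ^+ 2 /\ t ^+ g * A ^+ (g.-1)./2 = t).
Proof.
move=> e A0 g0.
have eN N : t ^+ N.*2 * A ^+ N = 1 by rewrite -mul2n exprM -exprMn e expr1n.
have [eg|eg] : g = g./2.*2 \/ g = g./2.*2.+1 by lia.
  left; have ep : g./2 = (g.-1)./2.+1 by lia.
  have h := eN g./2; rewrite -eg in h; split; first by rewrite mulrA h mul1r.
  apply: (mulIf A0); rewrite e -mulrA -exprSr -ep.
  exact: h.
right; have ep : (g.-1)./2 = g./2 by lia.
have h : t ^+ g * A ^+ g./2 = t.
  have -> : t ^+ g = t * t ^+ g./2.*2 by rewrite -exprS -eg.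
  by rewrite -mulrA eN mulr1.
by rewrite ep mulrA h.
Qed.

Lemma betaC_half e g : e ^+ 2 = 1 -> (0 < g)%N ->
  betaC e g (half R) = kc * (Q 1 * (g.+1%:R + 2 / logq R F * dlog_eulerP1 R F))
    - Q 1 * (e * qpow (- half R) + (e * qpow (- half R)) ^+ 2).
Proof.
move=> e1 g0; set t := e * _.
have tq : t ^+ 2 * qc = 1 by rewrite /t exprMn e1 mul1r t_half.
have tn0 : t != 0.
  by apply: contra_eq_neq tq => ->; rewrite expr0n mul0r eq_sym oner_neq0.
have w : (qc * t)^-1 = t.
  have qtt : qc * t * t = 1 by rewrite -mulrA -expr2 mulrC.
  by rewrite -[RHS]mul1r -(mulVf (mulf_neq0 qcn0 tn0)) -mulrA qtt mulr1.
have ce : cm e = 1.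
  by apply/eqP; rewrite -(@eqrXn2 _ 2) ?cm_ge0 // -cmX e1 cm1 expr1n.
have t1 : 1 - t != 0.
  rewrite subr_eq0 eq_sym; apply/eqP => h.
  have : cm t = 1 by rewrite h cm1.
  by rewrite /t cmM ce mul1r => h2; have := cm_t_half; lra.
have eta1 : etaf q t = 1 by rewrite /etaf w divff.
rewrite /betaC /betaM -/t (_ : qc * t ^+ 2 = 1) ?invr1 ?expr1n ?eta1 ?mul1r; last by rewrite mulrC.
rewrite Gm_halves // mulrBr; congr (_ - _).
rewrite -[Q 1 * _ * _]mulrA mulrCA [kc * _]mulrA kc_qc mul1r; congr (_ * _); rewrite mulrDr.
by case: (pow_halves tq qcn0 g0) => -[-> ->] //; rewrite addrC.
Qed.

Lemma betag_X g s : (0 < g)%N -> 1 / 2 <= Re s < 1 -> betag F g s = betaC 1 g s.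
Proof.
move=> g0 /andP[s0 s1]; rewrite /betag; case: eqP => [->|_].
  rewrite betaC_half ?expr1n // eulerP_1 inv_zetaA2 mul1r.
  (* With [t = q^(-1/2)] one has [kc = 1 - t^2] and [zeta_A(1/2) = - t/(1 - t)]. *)
  have e : kc * zetaA F (half R) = - (qpow (- half R) + qpow (- half R) ^+ 2).
    rewrite /zetaA kcE; rewrite half_compl.
    have := t_half; have -> : qpow (half R) = (qpow (- half R))^-1 by rewrite qpowN invrK.
    have := cm_t_half; have := qpow_neq0 F (- half R); have := qcn0.
    move: (qpow _) qc => t A A0 t0 t1 tA.
    have tn1 : 1 - t^-1 != 0.
      rewrite subr_eq0 eq_sym; apply/eqP => h; move: t1.
      by rewrite -[t]invrK h invr1 cm1 ltxx.
    have -> : A^-1 = t ^+ 2 by apply: (mulIf A0); rewrite mulVf.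
    apply: (mulIf tn1); rewrite mulfVK //; field; exact: t0.
  transitivity (kc * (Q 1 * (g.+1%:R + 2 / logq R F * dlog_eulerP1 R F)) + Q 1 * (kc * zetaA F (half R))).
    move: (2 / _ * _) (zetaA _ _) => A B; ring.
  by rewrite e mulrN.
rewrite leNgt s1 /=; apply: meroval_closed; first by rewrite s1; lra.
  exact: beta_X_closed.
by apply: dlim_betaC; rewrite ?expr1n // s1; lra.
Qed.

Lemma gammag_X g s : (0 < g)%N -> 1 / 2 <= Re s < 1 -> gammag F g s = betaC (-1) g s.
Proof.
move=> g0 /andP[s0 s1]; rewrite /gammag; case: eqP => [->|_].
  rewrite betaC_half ?sqrrN ?expr1n // eulerP_1 inv_zetaA2 mulN1r sqrrN.
  have e : kc * (zetaA F 0 / zetaA F (half R)) = - (- qpow (- half R) + qpow (- half R) ^+ 2).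
    rewrite /zetaA kcE invrK subr0 qpow1.
    rewrite half_compl.
    have := t_half; have -> : qpow (half R) = (qpow (- half R))^-1 by rewrite qpowN invrK.
    have := qpow_neq0 F (- half R); have := qcn0; have := qcn1.
    move: (qpow _) qc => t A A1 A0 t0 tA.
    have A1' : 1 - A != 0 by rewrite -opprB oppr_eq0.
    have eA : A^-1 = t ^+ 2 by apply: (mulIf A0); rewrite mulVf.
    have -> : 1 - A^-1 = - (1 - A) * A^-1 by field.
    rewrite mulNr [(1 - A) * _]mulrC mulNr -!mulrA [(1 - A) * _]mulrA divff // mul1r eA.
    by field; exact: t0.
  transitivity (kc * (Q 1 * (g.+1%:R + 2 / logq R F * dlog_eulerP1 R F)) + Q 1 * (kc * (zetaA F 0 / zetaA F (half R)))).
    move: (2 / _ * _) (_ / zetaA _ _) => A B; ring.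
  by rewrite e mulrN.
rewrite leNgt s1 /=; apply: meroval_closed; first by rewrite s1; lra.
  exact: gamma_X_closed.
by apply: dlim_betaC; rewrite ?sqrrN ?expr1n // s1; lra.
Qed.

Definition farC s : R[i] := kc * (Q (ys s) / (1 - ys s)).

Lemma far_value s : 1 <= Re s -> zetaA F (2 * s) / zetaA F 2 * eulerP F (2 * s) = farC s.
Proof.
move=> s1; rewrite zetaA_2s inv_zetaA2 eulerP_2s; last by lra.
by rewrite /farC [_^-1 * kc]mulrC -mulrA [_^-1 * Q _]mulrC.
Qed.

Lemma not_half s : 1 <= Re s -> (s == half R) = false.
Proof. by move=> s1; apply/eqP => e; move: s1; rewrite e Re_half; lra. Qed.

Lemma alphag_far g s : 1 <= Re s -> alphag F g s = farC s.
Proof. by move=> s1; rewrite /alphag not_half // s1 far_value. Qed.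

Lemma betag_far g s : 1 <= Re s -> betag F g s = farC s.
Proof. by move=> s1; rewrite /betag not_half // s1 far_value. Qed.

Lemma gammag_far g s : 1 <= Re s -> gammag F g s = farC s.
Proof. by move=> s1; rewrite /gammag not_half // s1 far_value. Qed.

End ClosedForms.

(** * The two regimes of the error term *)

Section ErrorUnits.
Variables (R : realType) (q rho d t : R) (g : nat).
Hypotheses (q2 : (2 : R) <= q) (rho0 : 0 < rho) (rho2 : rho ^+ 2 = q).
Hypotheses (d0 : 0 < d) (d2 : d ^+ 2 = 2) (t0 : 0 < t).

(** For [t = q^(-Re s)] and [d^2 = 2] the test [1 < d rho t] is [Re s < s1], see [s1_test]; the two
    values are the powers in the stated errors. *)
Definition Yerr : R :=
  if 1 < d * rho * t then d ^+ g * (q ^+ 2 * t) ^+ g else (q * rho) ^+ g.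

Lemma Yerr_q0 : 0 < q. Proof. by have := q2; lra. Qed.

Lemma Yerr_ge0 : 0 <= Yerr.
Proof.
have q0 := Yerr_q0; rewrite /Yerr; case: ifP => _.
  by rewrite mulr_ge0 ?exprn_ge0 ?(ltW d0) ?mulr_ge0 ?exprn_ge0 ?(ltW t0) ?(ltW q0).
by rewrite exprn_ge0 // mulr_ge0 ?(ltW q0) ?(ltW rho0).
Qed.

Lemma Yerr_last : q ^+ g * (q * d * t) ^+ g <= Yerr.
Proof.
have q0 := Yerr_q0; rewrite -exprMn /Yerr; case: (ltP 1 (d * rho * t)) => h.
  by rewrite -exprMn le_eqVlt; apply/orP; left; apply/eqP; congr (_ ^+ _); ring.
rewrite lerXn2r ?nnegrE ?mulr_ge0 ?(ltW q0) ?(ltW d0) ?(ltW t0) ?(ltW rho0) //.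
rewrite ler_pM2l // -{1}rho2 -[leRHS]mulr1 expr2 -!mulrA ler_pM2l //.
by move: h; rewrite [d * rho]mulrC -mulrA.
Qed.

Lemma d_ge1 : 1 <= d. Proof. by have := d0; have := d2; nra. Qed.

Lemma Yerr_main : q ^+ (2 * g) * t ^+ g <= Yerr.
Proof.
have q0 := Yerr_q0; apply: le_trans Yerr_last; have d1 := d_ge1.
rewrite exprM -!exprMn lerXn2r ?nnegrE ?mulr_ge0 ?exprn_ge0 ?(ltW q0) ?(ltW d0) ?(ltW t0) //.
have -> : q * (q * d * t) = d * (q ^+ 2 * t) by ring.
by rewrite ler_peMl // mulr_ge0 ?exprn_ge0 ?(ltW q0) ?(ltW t0).
Qed.

(** The ratio [q d t] equals [rho (d rho t)]. Above the threshold it exceeds [rho] and the last term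
    dominates; below it the sum is compared with the geometric sum of ratio [rho]. *)
Lemma Yerr_sum : q ^+ g * \sum_(m < g.+1) (q * d * t) ^+ m <= 4 * Yerr.
Proof.
have q0 := Yerr_q0; have qg0 : 0 <= q ^+ g by rewrite exprn_ge0 ?(ltW q0).
have e : q * d * t = rho * (d * rho * t) by rewrite -rho2; ring.
have th0 : 0 < q * d * t by rewrite !mulr_gt0.
case: (ltP 1 (d * rho * t)) => h.
  have th2 : 2 <= (q * d * t) ^+ 2.
    rewrite e exprMn rho2 (le_trans q2) // ler_peMr ?(ltW q0) //.
    by rewrite exprn_ege1 // ltW.
  apply: le_trans (ler_wpM2l qg0 (geo_le g th0 th2)) _.
  by rewrite mulrCA ler_pM2l // Yerr_last.
have r2 : 2 <= rho ^+ 2 by rewrite rho2.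
apply: (@le_trans _ _ (q ^+ g * \sum_(m < g.+1) rho ^+ m)).
  apply: ler_wpM2l => //; apply: ler_sum => m _.
  rewrite lerXn2r ?nnegrE ?(ltW th0) ?(ltW rho0) // e -[leRHS]mulr1.
  by rewrite ler_pM2l.
apply: le_trans (ler_wpM2l qg0 (geo_le g rho0 r2)) _.
by rewrite mulrCA ler_pM2l // /Yerr ltNge h /= exprMn.
Qed.

(** [d <= rho] because [2 <= q], so [q t <= 1] lies below the threshold; there [q^(2g) rho^(-g)] is
    exactly [(q rho)^g]. *)
Lemma Yerr_far : q * t <= 1 -> q ^+ (2 * g) * rho^-1 ^+ g <= Yerr.
Proof.
move=> qt; have q0 := Yerr_q0.
have dr : d <= rho by have := d0; have := d2; have := rho0; have := rho2; have := q2; nra.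
have h : d * rho * t <= 1.
  apply: le_trans qt; rewrite ler_pM2r // -rho2 expr2 ler_pM2r //.
rewrite /Yerr ltNge h /= exprM -exprMn le_eqVlt; apply/orP; left; apply/eqP; congr (_ ^+ _).
by rewrite expr2 -mulrA -{2}rho2 expr2 mulfK // gt_eqF.
Qed.

End ErrorUnits.

(** * Error terms *)

Section Final.
Variables (R : realType) (F : finFieldType) (xi : F).
Hypothesis char2 : 2%N \in [pchar F].
Hypothesis nxi : ~~ inH xi.
Implicit Types (z s : R[i]) (g n m : nat).
Local Notation q := (#|F|%:R : R).
Local Notation qc := (q%:C : R[i]).
Local Notation qpow := (@qpow R F).
Local Notation a := (acoef R F).
Local Notation rho := (rho R F).
Local Notation q2 := (q_ge2 R F).
Local Notation r0 := (rho_gt0 R F).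
Local Notation r2 := (rho_sq R F).
Local Notation ha := (acoef_gbound R F).
Local Notation kc := (kc R F).
Local Notation Tsum := (@Tsum R F).
Local Notation Usum := (@Usum R F).
Local Notation coefU := (@coefU R F).

Lemma realCM (x y : R) : (x * y)%:C = x%:C * y%:C :> R[i].
Proof. exact: rmorphM. Qed.

Lemma realCB (x y : R) : (x - y)%:C = x%:C - y%:C :> R[i].
Proof. exact: rmorphB. Qed.

Definition dd : R := Num.sqrt 2.

Lemma dd_gt0 : 0 < dd. Proof. by rewrite sqrtr_gt0. Qed.

Lemma dd_sq : dd ^+ 2 = 2. Proof. by rewrite sqr_sqrtr. Qed.

Local Notation Y g t := (Yerr q rho dd t g).

Lemma TsumE n m : Tsum n m = \sum_(u <- Fseq F n) coefU u m.
Proof.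
rewrite /(coefU _ _) exchange_big; apply: eq_bigr => f _.
by rewrite /(Ssum _ _) -(fsbig_Fset +%R n (fun u => chi R u f)) fsbig_Fset_seq.
Qed.

Lemma Tsum_FE g m :
  q ^+ g.+1 * \sum_(j < m) Tsum g.+1 j = q ^+ m * \sum_(j < 2 * g.+1 - m) Tsum g.+1 j.
Proof.
have e k : \sum_(j < k) Tsum g.+1 j = \sum_(u <- Fseq F g.+1) \sum_(j < k) coefU u j.
  by rewrite exchange_big; apply: eq_bigr => j _; exact: TsumE.
rewrite !e !big_distrr /= !big_seq; apply: eq_bigr => u /Fset_Fseq /Fset_is_rep hu.
exact: (coefU_FE R char2 nxi).
Qed.

Lemma pow2_half m : 2 ^+ m./2 <= dd ^+ m.
Proof.
rewrite -dd_sq -exprM; have := d_ge1 dd_gt0 dd_sq => d1.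
by rewrite ler_weXn2l //; lia.
Qed.

Lemma Tsum_err n m :
  cm ((Tsum n m)%:C - (q ^+ (2 * n))%:C * kc * mu q a m) <= 2 * q ^+ n * (q * dd) ^+ m.
Proof.
have := @weighted_approx R F xi char2 nxi n m 1 (fun=> 1) ler01 _ _.
rewrite mu_ccoef /kc -!rmorphM -rmorphB /= cmR => h.
have {h} := h (fun=> _) (fun _ _ => erefl); rewrite normr1 lexx => /(_ isT).
rewrite (eq_bigr (fun f => Ssum R n f)); last by move=> f _; rewrite mulr1.
rewrite -/(Tsum n m) mul1r mulr1 => h.
have e : q ^+ (2 * n) * kap R F * (if odd m then 0 else ccoef R F m./2) =
  (if odd m then 0 else q ^+ (2 * n) * kap R F * ccoef R F m./2) by case: ifP; rewrite ?mulr0.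
rewrite e; apply: (le_trans h); rewrite exprD exprMn -!mulrA ler_pM2l // ler_pM2l ?qX_gt0 //.
by rewrite ler_pM2l ?qX_gt0 // pow2_half.
Qed.

Definition Lam n z : R[i] := \sum_(m < 2 * n) (Tsum n m)%:C * z ^+ m.

Lemma cm_main n : cm ((q ^+ (2 * n))%:C * kc) <= q ^+ (2 * n).
Proof.
have /andP[k0 k1] := kap_bound R F.
rewrite /kc -rmorphM cmR ger0_norm ?mulr_ge0 ?exprn_ge0 ?ler0n //.
by rewrite ler_piMr ?exprn_ge0 ?ler0n.
Qed.

(** [LF] is linear in the coefficients: it is applied to the main terms [mu] and to the differences
    [D] separately. The constant is [80 q = 2 q (4 + 36)], from [Yerr_sum] and [LF_err]. *)
Lemma Lam_split g z (M0 : R[i]) (B : R) : (0 < g)%N -> z != 0 -> cm z * rho <= 1 ->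
  0 <= B ->
  cm (LF q (mu q a) z g - M0) <= B ->
  cm (Lam g.+1 z - (q ^+ (2 * g.+1))%:C * kc * M0)
  <= q ^+ 2 * (q ^+ (2 * g) * B) + 80 * q * Y g (cm z).
Proof.
move=> g0 z0 hz B0 hB; have t0 : 0 < cm z by rewrite cm_gt0.
have q0 := q_gt0 R F.
set M := (q ^+ (2 * g.+1))%:C * kc.
pose T m := (Tsum g.+1 m)%:C; pose D m := T m - M * mu q a m.
have eT : Lam g.+1 z = M * LF q (mu q a) z g + LF q D z g.
  rewrite -LF_affine -[RHS]FE_LF ?qcn0 //.
    by apply: eq_bigr => m _; rewrite /D [M * _ + _]addrC subrK.
  move=> m; have e k : \sum_(j < k) (M * mu q a j + D j) = (\sum_(j < k) Tsum g.+1 j)%:C.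
    by rewrite rmorph_sum; apply: eq_bigr => j _; rewrite /D [M * _ + _]addrC subrK.
  have eq k : qc ^+ k = (q ^+ k)%:C by rewrite rmorphXn.
  by rewrite (e m) (e (2 * g.+1 - m)%N) !eq -!rmorphM /= Tsum_FE.
have E0 : 0 <= 2 * q ^+ g.+1 by rewrite mulr_ge0 ?exprn_ge0 ?(ltW q0).
have hD := LF_err q2 r0 r2 dd_gt0 dd_sq E0 (Tsum_err g.+1) g z0 hz.
have -> : Lam g.+1 z - M * M0 = M * (LF q (mu q a) z g - M0) + LF q D z g.
  by rewrite eT mulrBr addrAC.
apply: le_trans (cmD _ _) _; apply: lerD.
  rewrite cmM mulrA -exprD; apply: ler_pM => //; rewrite ?cm_ge0 //.
  by rewrite (_ : (2 + 2 * g = 2 * g.+1)%N) ?cm_main //; lia.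
apply: le_trans hD _.
have h1 := @Yerr_sum R q rho dd (cm z) g q2 r0 r2 dd_gt0 t0.
have h2 := @Yerr_last R q rho dd (cm z) g q2 r0 r2 dd_gt0 t0.
rewrite exprS; move: (\sum_(_ < _) _) (_ ^+ g) (q ^+ g) (Y _ _) h1 h2 => S1 S2 S3 S4 h1 h2.
have -> : 2 * (q * S3) * (S1 + 36 * S2) = 2 * q * (S3 * S1 + 36 * (S3 * S2)) by ring.
have -> : 80 * q * S4 = 2 * q * (4 * S4 + 36 * S4) by ring.
by apply: ler_wpM2l; [rewrite mulr_ge0 ?(ltW q0)|lra].
Qed.

Lemma rho2_ge0 : 0 <= 2 * rho.
Proof. exact: mulr_ge0 (ler0n R 2) (ltW r0). Qed.

Lemma sq_q_ge0 : 0 <= q ^+ 2. Proof. exact: exprn_ge0 (ler0n R #|F|). Qed.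

(** [2 * rho] is the constant of [acoef_gbound], [q ^+ 2] the quotient of [q^(2(g+1))] by [q^(2g)];
    1200 comes from [LF_main] and covers the 112 of [LF_main1]. *)
Definition CF : R := 1200 * (2 * rho) * q ^+ 2 + 80 * q.

Lemma Lam_near g z : (0 < g)%N -> z != 0 -> cm z * rho <= 1 -> 1 < q * cm z ->
  cm (Lam g.+1 z - (q ^+ (2 * g.+1))%:C * kc * betaM q a z g) <= CF * Y g (cm z).
Proof.
move=> g0 z0 hz qt; have t0 : 0 < cm z by rewrite cm_gt0.
have rr := rho2_ge0; have hB := LF_main q2 r0 r2 ha (Q_at_q R F) z0 hz g0 qt.
apply: le_trans (Lam_split g0 z0 hz _ hB) _.
  exact: mulr_ge0 (mulr_ge0 (ler0n R 1200) rr) (exprn_ge0 g (cm_ge0 z)).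
have h := @Yerr_main R q rho dd (cm z) g q2 r0 r2 dd_gt0 dd_sq t0.
rewrite /CF [leRHS]mulrDl lerD2r.
have -> : q ^+ 2 * (q ^+ (2 * g) * (1200 * (2 * rho) * cm z ^+ g)) =
   1200 * (2 * rho) * q ^+ 2 * (q ^+ (2 * g) * cm z ^+ g) by ring.
apply: ler_wpM2l; last exact: h.
exact: mulr_ge0 (mulr_ge0 (ler0n R 1200) rr) sq_q_ge0.
Qed.

Lemma Lam_far g z : (0 < g)%N -> z != 0 -> cm z * rho <= 1 -> q * cm z <= 1 ->
  cm (Lam g.+1 z - (q ^+ (2 * g.+1))%:C * kc * (pser a (qc * z ^+ 2) / (1 - qc * z ^+ 2)))
  <= CF * Y g (cm z).
Proof.
move=> g0 z0 hz qt; have t0 : 0 < cm z by rewrite cm_gt0.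
have rr := rho2_ge0; have hB := LF_main1 q2 r0 r2 ha z0 hz qt g.
have u0 : 0 <= rho^-1 by rewrite invr_ge0; exact: ltW r0.
apply: le_trans (Lam_split g0 z0 hz _ hB) _.
  exact: mulr_ge0 (mulr_ge0 (ler0n R 112) rr) (exprn_ge0 g u0).
have h := @Yerr_far R q rho dd (cm z) g q2 r0 r2 dd_gt0 dd_sq t0 qt.
rewrite /CF [leRHS]mulrDl lerD2r.
have -> : q ^+ 2 * (q ^+ (2 * g) * (112 * (2 * rho) * rho^-1 ^+ g)) =
   112 * (2 * rho) * q ^+ 2 * (q ^+ (2 * g) * rho^-1 ^+ g) by ring.
apply: ler_pM h.
- exact: mulr_ge0 (mulr_ge0 (ler0n R 112) rr) sq_q_ge0.
- exact: mulr_ge0 (exprn_ge0 _ (ler0n R #|F|)) (exprn_ge0 g u0).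
apply: ler_wpM2r; first exact: sq_q_ge0.
apply: ler_wpM2r; first exact: rr.
by rewrite ler_nat.
Qed.

Lemma sum_Fset_Lfun s g : \sum_(u \in Fset F g.+1) Lfun s u = Lam g.+1 (qpow (- s)).
Proof.
rewrite fsbig_Fset_seq.
rewrite (eq_big_seq (fun u => \sum_(m < 2 * g.+1) (coefU u m)%:C * qpow (- s) ^+ m)); last first.
  move=> u /Fset_Fseq /Fset_is_rep hu; apply: Lfun_poly => m hm.
  exact: (coefU_vanish R char2 nxi _ hu hm).
rewrite exchange_big; apply: eq_bigr => m _.
by rewrite -big_distrl TsumE rmorph_sum.
Qed.

Lemma sum_Fset'_Lfun s g :
  \sum_(u \in Fset' xi g.+1) Lfun s u = Lam g.+1 (-1 * qpow (- s)).
Proof.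
rewrite fsbig_Fset'.
rewrite (eq_big_seq (fun u => \sum_(m < 2 * g.+1) (coefU u m)%:C * (-1 * qpow (- s)) ^+ m)); last first.
  move=> u /Fset_Fseq /Fset_is_rep hu; have hu' := hu.
  case: hu' => D [B [hD pB sB eu]].
  have tw m : coefU (u + (xi%:P)%:K) m = (-1) ^+ m * coefU u m.
    by rewrite eu (coefU_twist R char2 nxi) // (monics_monic hD).
  rewrite (@Lfun_poly _ _ s _ (2 * g.+1)); last first.
    by move=> m hm; rewrite tw (coefU_vanish R char2 nxi _ hu hm) // mulr0.
  apply: eq_bigr => m _; rewrite tw rmorphM rmorphXn rmorphN1 /= exprMn.
  by rewrite [_ * (coefU _ _)%:C]mulrC mulrA.
rewrite exchange_big; apply: eq_bigr => m _.
by rewrite -big_distrl TsumE rmorph_sum.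
Qed.

Definition Tin n m : R := (1 + (-1) ^+ m) * Usum n m.

Definition LamI g z : R[i] := \sum_(m < (2 * g).+1) (Tin g.+1 m)%:C * z ^+ m.

Lemma Tin_err n m : (0 < n)%N ->
  cm ((Tin n m)%:C - (2 * (q ^+ (2 * n) / q))%:C * kc * mu q a m)
  <= 12 * n%:R * q ^+ n * (q * dd) ^+ m.
Proof.
move=> n0; have q0 := q_gt0 R F; have d0 := dd_gt0.
rewrite mu_ccoef /kc.
have -> : (Tin n m)%:C - (2 * (q ^+ (2 * n) / q))%:C * (kap R F)%:C
    * (if odd m then 0 else ccoef R F m./2)%:C =
  (Tin n m - 2 * (q ^+ (2 * n) / q) * kap R F
    * (if odd m then 0 else ccoef R F m./2))%:C by rewrite realCB !realCM.
rewrite cmR /Tin -signr_odd.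
case: (boolP (odd m)) => om.
  rewrite expr1 subrr mul0r mulr0 subrr normr0.
  by rewrite !mulr_ge0 ?exprn_ge0 ?mulr_ge0 ?ler0n ?(ltW d0).
rewrite expr0; have em : m = (2 * m./2)%N by rewrite -{1}(odd_double_half m) (negbTE om) mul2n.
have := Usum_approx R char2 nxi m./2 n0; rewrite -em => h.
have -> : (1 + 1) * Usum n m - 2 * (q ^+ (2 * n) / q) * kap R F * ccoef R F m./2 =
   2 * (Usum n m - q ^+ (2 * n) / q * kap R F * ccoef R F m./2) by ring.
rewrite normrM ger0_norm //; have p := pow2_half m.
have X0 : 0 <= 12 * n%:R * q ^+ n * q ^+ m by rewrite !mulr_ge0 ?exprn_ge0 ?ler0n.
have := ler_wpM2l X0 p; rewrite exprMn => h1.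
have := ler_wpM2l (ler0n R 2) h; rewrite exprD => h2.
apply: le_trans h2 _; apply: le_trans (le_trans _ h1) _.
  by rewrite le_eqVlt; apply/orP; left; apply/eqP; ring.
by rewrite [leRHS]mulrA.
Qed.

Lemma LamI_split g z (M0 : R[i]) (B : R) : (0 < g)%N -> z != 0 -> cm z * rho <= 1 ->
  0 <= B ->
  cm (LI q (mu q a) z g - M0) <= B ->
  cm (LamI g z - (2 * (q ^+ (2 * g.+1) / q))%:C * kc * M0)
  <= 2 * q ^+ 2 * (q ^+ (2 * g) * B) + 192 * q * (g%:R * Y g (cm z)).
Proof.
move=> g0 z0 hz B0 hB; have t0 : 0 < cm z by rewrite cm_gt0.
have q0 := q_gt0 R F; have q1 := q_ge1 R F.
set M := (2 * (q ^+ (2 * g.+1) / q))%:C * kc.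
pose T m := (Tin g.+1 m)%:C; pose D m := T m - M * mu q a m.
have eT : LamI g z = M * LI q (mu q a) z g + LI q D z g.
  rewrite -LI_affine -[RHS]FE_LI ?qcn0 //.
    by apply: eq_bigr => m _; rewrite /D [M * _ + _]addrC subrK.
  move=> m hm; have e k : M * mu q a k + D k = (Tin g.+1 k)%:C by rewrite /D addrC subrK.
  have eq k : qc ^+ k = (q ^+ k)%:C by rewrite rmorphXn.
  rewrite (e m) (e (2 * g - m)%N) !eq -!rmorphM /=; congr _%:C.
  rewrite /Tin mulrCA (Usum_FE R char2 nxi hm) [RHS]mulrCA; congr ((1 + _) * _).
  by rewrite -[RHS]signr_odd oddB // mul2n odd_double /= signr_odd.
have E0 : 0 <= 12 * g.+1%:R * q ^+ g.+1 by rewrite !mulr_ge0 ?exprn_ge0 ?ler0n.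
have hD := LI_err q2 r0 r2 dd_gt0 dd_sq E0 (fun m => Tin_err m (ltn0Sn g)) g z0 hz.
have -> : LamI g z - M * M0 = M * (LI q (mu q a) z g - M0) + LI q D z g.
  by rewrite eT mulrBr addrAC.
apply: le_trans (cmD _ _) _; apply: lerD.
  rewrite cmM mulrA; apply: ler_pM => //; rewrite ?cm_ge0 //.
  have -> : M = (2 / q)%:C * ((q ^+ (2 * g.+1))%:C * kc).
    rewrite /M (_ : 2 * (q ^+ (2 * g.+1) / q) = 2 / q * q ^+ (2 * g.+1)); last by ring.
    by rewrite realCM mulrA.
  have q2' : 0 <= 2 / q by rewrite divr_ge0 ?(ltW q0).
  rewrite cmM cmR ger0_norm //; apply: le_trans (ler_wpM2l q2' (cm_main g.+1)) _.
  rewrite -[2 * q ^+ 2 * _]mulrA -exprD (_ : (2 + 2 * g = 2 * g.+1)%N); last by lia.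
  rewrite -mulrA ler_pM2l // ler_pdivrMl // ler_peMl // exprn_ge0 ?(ltW q0) //.
apply: le_trans hD _.
have h1 := @Yerr_sum R q rho dd (cm z) g q2 r0 r2 dd_gt0 t0.
have h2 := @Yerr_last R q rho dd (cm z) g q2 r0 r2 dd_gt0 t0.
have y0 := @Yerr_ge0 R q rho dd (cm z) g q2 r0 dd_gt0 t0.
have g1 : g.+1%:R <= 2 * g%:R :> R by rewrite -natrM ler_nat; move: g0; clear; lia.
rewrite exprS; move: (\sum_(_ < _) _) (_ ^+ g) (q ^+ g) (Y _ _) h1 h2 y0 => S1 S2 S3 S4 h1 h2 y0.
have -> : 12 * g.+1%:R * (q * S3) * (S1 + 4 * S2) = g.+1%:R * (12 * q * (S3 * S1 + 4 * (S3 * S2))) by ring.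
apply: (@le_trans _ _ (g.+1%:R * (12 * q * (8 * S4)))).
  apply: ler_wpM2l; first exact: ler0n.
  by apply: ler_wpM2l; [rewrite mulr_ge0 ?(ltW q0)|lra].
have Z0 : 0 <= 12 * q * (8 * S4) by rewrite !mulr_ge0 ?(ltW q0).
by apply: le_trans (ler_wpM2r Z0 g1) _; rewrite le_eqVlt; apply/orP; left; apply/eqP; ring.
Qed.

(** [128 = 2 * 64] from [LI_main] covers the 84 of the far case; [192 = 12 * 2 * (4 + 4)] from
    [Tin_err], [g + 1 <= 2g], [Yerr_sum] and [LI_err]. *)
Definition CI : R := 128 * (2 * rho) * q ^+ 2 + 192 * q.

Lemma LamI_near g z : (0 < g)%N -> z != 0 -> cm z * rho <= 1 -> 1 < q * cm z ->
  cm (LamI g z - (2 * (q ^+ (2 * g.+1) / q))%:C * kc *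
    (Gm a (qc * z ^+ 2) g./2.+1 + (qc * z ^+ 2) ^+ g * Gm a (qc * z ^+ 2)^-1 (g.-1)./2.+1))
  <= CI * (g%:R * Y g (cm z)).
Proof.
move=> g0 z0 hz qt; have t0 : 0 < cm z by rewrite cm_gt0.
have rr := rho2_ge0; have hB := LI_main q2 r0 r2 ha z0 hz g0 (ltW qt).
apply: le_trans (LamI_split g0 z0 hz _ hB) _.
  exact: mulr_ge0 (mulr_ge0 (ler0n R 64) rr) (exprn_ge0 g (cm_ge0 z)).
have h := @Yerr_main R q rho dd (cm z) g q2 r0 r2 dd_gt0 dd_sq t0.
have y0 := @Yerr_ge0 R q rho dd (cm z) g q2 r0 dd_gt0 t0.
have g1 : 1 <= g%:R :> R by rewrite ler1n.
rewrite /CI [leRHS]mulrDl lerD2r.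
have -> : 2 * q ^+ 2 * (q ^+ (2 * g) * (64 * (2 * rho) * cm z ^+ g)) =
   128 * (2 * rho) * q ^+ 2 * (q ^+ (2 * g) * cm z ^+ g) by ring.
apply: ler_wpM2l; first exact: mulr_ge0 (mulr_ge0 (ler0n R 128) rr) sq_q_ge0.
by apply: (le_trans h); rewrite ler_peMl.
Qed.

Lemma LamI_far g z : (0 < g)%N -> z != 0 -> cm z * rho <= 1 -> q * cm z <= 1 ->
  cm (LamI g z - (2 * (q ^+ (2 * g.+1) / q))%:C * kc *
    (pser a (qc * z ^+ 2) / (1 - qc * z ^+ 2)))
  <= CI * (g%:R * Y g (cm z)).
Proof.
move=> g0 z0 hz qt; have t0 : 0 < cm z by rewrite cm_gt0.
have rr := rho2_ge0; have hB := LI_main1 q2 r0 r2 ha z0 hz qt g.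
have u0 : 0 <= rho^-1 by rewrite invr_ge0; exact: ltW r0.
have g1 : 1 <= g%:R :> R by rewrite ler1n.
have v0 : 0 <= 2 * rho * rho^-1 ^+ g := mulr_ge0 rr (exprn_ge0 g u0).
have {hB} hB := le_trans hB (_ : _ <= 42 * g%:R * (2 * rho * rho^-1 ^+ g)).
apply: le_trans (LamI_split g0 z0 hz _ (hB _)) _.
- exact: mulr_ge0 (mulr_ge0 (ler0n R 42) (ler0n R g)) v0.
- by rewrite -[leLHS]mulrA; apply: ler_wpM2r; [exact: v0|lra].
have h := @Yerr_far R q rho dd (cm z) g q2 r0 r2 dd_gt0 dd_sq t0 qt.
rewrite /CI [leRHS]mulrDl lerD2r.
have -> : 2 * q ^+ 2 * (q ^+ (2 * g) * (42 * g%:R * (2 * rho * rho^-1 ^+ g))) =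
   84 * (2 * rho) * q ^+ 2 * (g%:R * (q ^+ (2 * g) * rho^-1 ^+ g)) by ring.
apply: ler_pM; last by apply: ler_wpM2l; [exact: ler0n|exact: h].
- exact: mulr_ge0 (mulr_ge0 (ler0n R 84) rr) sq_q_ge0.
- exact: mulr_ge0 (ler0n R g) (mulr_ge0 (exprn_ge0 _ (ler0n R #|F|)) (exprn_ge0 g u0)).
apply: ler_wpM2r; first exact: sq_q_ge0.
apply: ler_wpM2r; first exact: rr.
by rewrite ler_nat.
Qed.

Lemma sum_Iset_Lfun s g : \sum_(u \in Iset xi g.+1) Lfun s u = LamI g (qpow (- s)).
Proof.
have eI : Iset xi g.+1 = [set` Iseq xi g.+1].
  by apply/seteqP; split=> u /(Iset_Iseq char2 nxi).
rewrite eI -fsbig_seq ?(Iseq_uniq char2 nxi) //.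
rewrite (eq_big_seq (fun u => \sum_(m < (2 * g).+1) (coefU u m)%:C * qpow (- s) ^+ m)); last first.
  move=> u /(Iset_Iseq char2 nxi) hu; apply: Lfun_poly => m hm.
  exact: (coefI_vanish R char2 nxi hu hm).
rewrite exchange_big; apply: eq_bigr => m _.
rewrite -big_distrl; congr (_ * _); rewrite /Tin -(sum_Iset_coefU R char2 nxi) eI.
by rewrite -fsbig_seq ?(Iseq_uniq char2 nxi) // rmorph_sum.
Qed.

Lemma cm_t s : cm (qpow (- s)) = q `^ (- Re s).
Proof. by rewrite cm_qpow; case: s. Qed.

Lemma rho_pow : rho = q `^ 2^-1.
Proof. by rewrite powR12_sqrt // ler0n. Qed.

Lemma t_rho_le1 s : 1 / 2 <= Re s -> cm (qpow (- s)) * rho <= 1.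
Proof.
move=> hs; rewrite cm_t rho_pow -powRD ?qn0 ?implybT //.
by rewrite -[leRHS](powRr0 q) ler_powR ?q_ge1 //; lra.
Qed.

Lemma qt_le1 s : 1 <= Re s -> q * cm (qpow (- s)) <= 1.
Proof.
move=> hs; rewrite cm_t -{1}(powRr1 (ler0n R #|F|)) -powRD ?qn0 ?implybT //.
by rewrite -[leRHS](powRr0 q) ler_powR ?q_ge1 //; lra.
Qed.

(** Squaring gives [1 < 2 q q^(-2 Re s)], and the logarithm to base [q] turns this into the
    definition of [s1]. *)
Lemma s1_test s : (Re s < s1 R F) = (1 < dd * rho * cm (qpow (- s))).
Proof.
have l0 := lnq_gt0 R F; have q0 := q_gt0 R F; have rr := r0; have d0 := dd_gt0.
have t0 : 0 < cm (qpow (- s)) by rewrite cm_gt0 qpow_neq0.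
set X := dd * rho * _; have X0 : 0 < X by rewrite !mulr_gt0.
have -> : (1 < X) = (1 < X ^+ 2) by rewrite -[X in _ = (X < _)](expr1n R 2) ltr_pXn2r ?nnegrE ?(ltW X0).
have -> : X ^+ 2 = 2 * q * (q `^ (- Re s)) ^+ 2 by rewrite /X -cm_t !exprMn dd_sq r2.
have p0 : 0 < q `^ (- Re s) by rewrite powR_gt0.
rewrite -(ltr_ln (x := 1)) ?posrE ?mulr_gt0 ?exprn_gt0 // ln1.
rewrite (lnM (x := 2 * q)) ?posrE ?mulr_gt0 ?exprn_gt0 // (lnM (x := 2)) ?posrE // lnXn // ln_powR /s1.
apply/idP/idP => h.
  have : 0 < (s1 R F - Re s) * (2 * ln q) by rewrite mulr_gt0 ?subr_gt0 ?mulr_gt0.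
  rewrite /s1; have -> : ((1 + ln 2 / ln q) / 2 - Re s) * (2 * ln q) = ln 2 + ln q + - Re s * ln q *+ 2.
    by field; rewrite gt_eqF.
  by [].
have e : (1 + ln 2 / ln q) / 2 - Re s = (ln 2 + ln q + - Re s * ln q *+ 2) / (2 * ln q).
  by field; rewrite gt_eqF.
by rewrite -subr_gt0 e divr_gt0 ?mulr_gt0.
Qed.

Lemma pow_near s g :
  2 `^ (g%:R / 2) * q `^ ((2 - Re s) * g%:R) = dd ^+ g * (q ^+ 2 * cm (qpow (- s))) ^+ g.
Proof.
have q0 := q_gt0 R F; congr (_ * _).
  by rewrite mulrC powRrM powR12_sqrt // powR_mulrn ?sqrtr_ge0.
rewrite powRrM powR_mulrn ?powR_ge0 //; congr (_ ^+ _).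
by rewrite powRD ?qn0 ?implybT // powR_mulrn ?ler0n // cm_t.
Qed.

Lemma pow_far g : q `^ (3 * g%:R / 2) = (q * rho) ^+ g.
Proof.
have -> : 3 * g%:R / 2 = (1 + 2^-1) * g%:R :> R by field.
rewrite powRrM powR_mulrn ?powR_ge0 //; congr (_ ^+ _).
by rewrite powRD ?qn0 ?implybT // powRr1 ?ler0n // rho_pow.
Qed.

Lemma errI_E s g :
  (if Re s < s1 R F then g%:R * 2 `^ (g%:R / 2) * q `^ ((2 - Re s) * g%:R)
   else g%:R * q `^ (3 * g%:R / 2)) = g%:R * Y g (cm (qpow (- s))).
Proof.
rewrite s1_test /Yerr; case: ifP => _; last by rewrite pow_far.
by rewrite -mulrA pow_near.
Qed.

Lemma errF_ge s g : (0 < g)%N -> Y g (cm (qpow (- s))) <=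
  (if Re s < s1 R F then 2 `^ (g%:R / 2) * q `^ ((2 - Re s) * g%:R)
   else g%:R * q `^ (3 * g%:R / 2)).
Proof.
move=> g0; rewrite s1_test /Yerr; case: ifP => _; first by rewrite pow_near.
rewrite pow_far ler_peMl ?ler1n // exprn_ge0 // mulr_ge0 ?ler0n ?(ltW r0) //.
Qed.

Lemma Xbar_cases (eps : R) s : Xbar eps s -> 1 / 2 <= Re s < 1 \/ 1 <= Re s.
Proof.
case=> [[->|[h _]]|h]; [left|left|by right].
  by rewrite Re_half; lra.
by rewrite mul1r.
Qed.

Lemma natqC n : (#|F|%:R : R[i]) ^+ n = (q ^+ n)%:C.
Proof. by rewrite natC rmorphXn. Qed.

Lemma CF_ge0 : 0 <= CF.
Proof.
exact: addr_ge0 (mulr_ge0 (mulr_ge0 (ler0n R 1200) rho2_ge0) sq_q_ge0)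
  (mulr_ge0 (ler0n R 80) (ler0n R #|F|)).
Qed.

Lemma estimate_I g s : (0 < g)%N -> 1 / 2 <= Re s < 1 \/ 1 <= Re s ->
  `|\sum_(u \in Iset xi g.+1) Lfun s u - 2 * alphag F g s * #|F|%:R ^+ (2 * g + 1)|
  <= (CI * (if Re s < s1 R F
            then g%:R * 2 `^ (g%:R / 2) * q `^ ((2 - Re s) * g%:R)
            else g%:R * q `^ (3 * g%:R / 2)))%:C.
Proof.
move=> g0 hs; rewrite errI_E cm_le sum_Iset_Lfun natqC.
have z0 := qpow_neq0 F (- s).
have e (A : R[i]) : 2 * (kc * A) * (q ^+ (2 * g + 1))%:C
    = (2 * (q ^+ (2 * g.+1) / q))%:C * kc * A.
  have -> : q ^+ (2 * g.+1) / q = q ^+ (2 * g + 1).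
    have -> : (2 * g.+1 = (2 * g + 1).+1)%N by lia.
    by rewrite exprSr mulfK ?qn0.
  rewrite rmorphM rmorph_nat /=; move: (q ^+ _)%:C kc => X k; ring.
case: hs => [hs|hs].
  rewrite alphag_X // /alphaC e; case/andP: hs => h1 h2.
  by apply: LamI_near => //; [exact: t_rho_le1|exact: qt_gt1].
rewrite alphag_far // /farC e; apply: LamI_far => //; last exact: qt_le1.
by apply: t_rho_le1; lra.
Qed.

(** Covers both the real and the inert family: the sign [e] enters only through [z = e q^(-s)],
    whose modulus and square do not depend on it. *)
Lemma estimate_F (e : R[i]) g s (S B : R[i]) : (0 < g)%N ->
  1 / 2 <= Re s < 1 \/ 1 <= Re s -> e ^+ 2 = 1 ->
  S = Lam g.+1 (e * qpow (- s)) ->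
  (1 / 2 <= Re s < 1 -> B = betaC F e g s) -> (1 <= Re s -> B = farC F s) ->
  `|S - B * #|F|%:R ^+ (2 * g + 2)|
  <= (CF * (if Re s < s1 R F
            then 2 `^ (g%:R / 2) * q `^ ((2 - Re s) * g%:R)
            else g%:R * q `^ (3 * g%:R / 2)))%:C.
Proof.
move=> g0 hs e1 -> hB1 hB2; rewrite cm_le natqC.
apply: le_trans (ler_wpM2l CF_ge0 (errF_ge s g0)).
have ce : cm e = 1.
  by apply/eqP; rewrite -(@eqrXn2 _ 2) ?cm_ge0 // -cmX e1 cm1 expr1n.
have ct : cm (e * qpow (- s)) = cm (qpow (- s)) by rewrite cmM ce mul1r.
have z0 : e * qpow (- s) != 0 by rewrite -cm_gt0 ct cm_gt0 qpow_neq0.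
have eA (A : R[i]) : kc * A * (q ^+ (2 * g + 2))%:C = (q ^+ (2 * g.+1))%:C * kc * A.
  by rewrite mulrC mulrA (_ : (2 * g + 2 = 2 * g.+1)%N) //; lia.
have ey : qc * (e * qpow (- s)) ^+ 2 = ys F s by rewrite exprMn e1 mul1r.
case: hs => [hs|hs].
  rewrite hB1 // /betaC eA -ct; case/andP: hs => h1 h2.
  by apply: Lam_near; rewrite ?ct //; [exact: t_rho_le1|exact: qt_gt1].
rewrite hB2 // /farC eA -ct -ey; apply: Lam_far; rewrite ?ct //; last exact: qt_le1.
by apply: t_rho_le1; lra.
Qed.

End Final.

Theorem theorem2p4 (R : realType) (F : finFieldType) (xi : F)
    (char2 : 2%N \in [pchar F])
    (xi_notin : forall x : F, xi <> x ^+ 2 + x) :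
  [/\
   forall eps : R, 0 < eps ->
   exists C : R, \forall g \near \oo, forall s : R[i], Xbar eps s ->
     `|\sum_(u \in Iset xi g.+1) Lfun s u
       - 2 * alphag F g s * #|F|%:R ^+ (2 * g + 1)|
     <= (C * (if Re s < s1 R F
              then g%:R * 2 `^ (g%:R / 2) * #|F|%:R `^ ((2 - Re s) * g%:R)
              else g%:R * #|F|%:R `^ (3 * g%:R / 2)))%:C,

   forall eps delta : R, 0 < eps -> 0 < delta ->
   exists C : R, \forall g \near \oo, forall s : R[i], Xbar eps s ->
     delta%:C < `|s - 1| \/ s = 1 ->
     `|\sum_(u \in Fset F g.+1) Lfun s u
       - betag F g s * #|F|%:R ^+ (2 * g + 2)|
     <= (C * (if Re s < s1 R F
              then 2 `^ (g%:R / 2) * #|F|%:R `^ ((2 - Re s) * g%:R)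
              else g%:R * #|F|%:R `^ (3 * g%:R / 2)))%:C
 & forall eps : R, 0 < eps ->
   exists C : R, \forall g \near \oo, forall s : R[i], Xbar eps s ->
     `|\sum_(u \in Fset' xi g.+1) Lfun s u
       - gammag F g s * #|F|%:R ^+ (2 * g + 2)|
     <= (C * (if Re s < s1 R F
              then 2 `^ (g%:R / 2) * #|F|%:R `^ ((2 - Re s) * g%:R)
              else g%:R * #|F|%:R `^ (3 * g%:R / 2)))%:C].
Proof.
have nxi : ~~ inH xi by apply/inHP => -[x]; exact: xi_notin.
(* The threshold is [g = 1], from where on [g.-1./2] is the integer part of [(g-1)/2]. *)
split=> [eps _|eps delta _ _|eps _]; [exists (CI R F)|exists (CF R F)|exists (CF R F)];
  exists 1%N => // g /= g0 s /Xbar_cases hs.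
- exact: (estimate_I char2 nxi g0 hs).
- move=> _; apply: (estimate_F char2 nxi (e := 1) g0 hs).
  + exact: expr1n.
  + by rewrite mul1r; exact: (sum_Fset_Lfun char2 nxi).
  + exact: betag_X.
  + exact: betag_far.
- apply: (estimate_F char2 nxi (e := -1) g0 hs).
  + by rewrite sqrrN expr1n.
  + exact: (sum_Fset'_Lfun char2 nxi).
  + exact: gammag_X.
  + exact: gammag_far.
Qed.
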